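(* The currents $B^\pm_1$ and $B^\pm_{i,j}$, for $i\in\{2,\dots,k\}$, $j\in\{1,\dots,J_i\}$, are basic for the unstable, respectively stable, foliations $\mathcal F^\pm$ on $M\setminus\Sigma$ (that is, $B^+_1$, $B^+_{i,j}$ are basic for the unstable foliation $\mathcal F^+$ and $B^-_1$, $B^-_{i,j}$ are basic for the stable foliation $\mathcal F^-$).
   Context: Setting. $M$ is a compact orientable surface, $\Sigma\subset M$ is a finite set, and $A:M\to M$ is an orientation-preserving pseudo-Anosov diffeomorphism of class $C^r$ with $r>1$, whose singularities are the points of $\Sigma$, all fixed by $A$. $A$ need not be linear nor volume-preserving, but it is assumed topologically conjugate to a linear pseudo-Anosov diffeomorphism (linear with respect to a translation structure on $M$). Anosov diffeomorphisms of the torus are included. $\mathcal F^+$ and $\mathcal F^-$ are the unstable and stable foliations of $A$, $h_{top}(A)$ is the topological entropy and $\lambda=e^{h_{top}(A)}$. Currents. $\Omega^1(M)$ is the space of $1$-forms of class $C^1$ on $M$, $\Omega^1(M)^*$ its dual, and $\mathcal Z^{-1}(M)\subset\Omega^1(M)^*$ the subspace of closed currents (of degree and dimension $1$). The action on currents is $(A_*B)(\alpha)=B(A^*\alpha)$. A current $B$ is called basic for a foliation $\mathcal F$ on a smooth manifold if, for all vector fields $Y$ tangent to $\mathcal F$, $\mathcal L_YB=\imath_YB=0$ (Lie derivative and contraction). For a current of dimension $1$ on a surface this is equivalent to $dB=\imath_YB=0$ for all such $Y$; here $(\imath_YB)(w)=B(\imath_Yw)$, up to sign, for $2$-forms $w$.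 Cohomology. $A^\#:H^1(M,\mathbb C)\to H^1(M,\mathbb C)$ is the linear map induced by $A$, with the convention $A^\#[\gamma]=[A_*\gamma]$ for classes of closed $1$-currents. $E^+$ and $E^-$ are its unstable and stable subspaces (sums of generalized eigenspaces for eigenvalues of modulus $>1$, respectively $<1$). The expanding eigenvalues are listed, one for each Jordan block, as $\mu_1=\lambda>|\mu_2|\ge\dots\ge|\mu_k|>1$; $J_i$ is the size of the $i$-th Jordan block, with $J_1=1$. By symmetry $A^\#|E^-$ has Jordan blocks of the same sizes $J_i$ for the eigenvalues $\mu_i^{-1}$. $\{\mathcal C^\pm_{i,j}\,|\,1\le i\le k,\ 1\le j\le J_i\}$ are Jordan bases of $E^\pm$. The currents. $\mathcal B^\pm:E^\pm\to\mathcal Z^{-1}(M)$ are the injective linear maps with $[\mathcal B^\pm(C)]=C$ and $A_*\circ\mathcal B^\pm=\mathcal B^\pm\circ A^\#$ on $E^\pm$ constructed as follows: fix a linear map $\alpha$ assigning to each class in $H^1(M,\mathbb C)$ a closed $1$-form representing it, and set $\mathcal B^+(C)=\lim_{n\to+\infty}A_*^n\,\alpha((A^\#)^{-n}C)$ for $C\in E^+$ and $\mathcal B^-(C)=\lim_{n\to+\infty}A_*^{-n}\,\alpha((A^\#)^{n}C)$ for $C\in E^-$ (limits in $\Omega^1(M)^*$, $1$-forms being viewed as currents). Put $B^\pm_{i,j}:=\mathcal B^\pm(\mathcal C^\pm_{i,j})$ and $B^\pm_1:=\mathcal B^\pm(\mathcal C^\pm_{1,1})$. *)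

(* Defs.v *)
From HB Require Import structures.
From mathcomp Require Import all_boot all_order all_algebra.
From mathcomp Require Import all_classical all_reals all_analysis.
From mathcomp Require Import complex.

Set Implicit Arguments.
Unset Strict Implicit.
Unset Printing Implicit Defensive.

Import Order.TTheory GRing.Theory Num.Theory.
Import numFieldNormedType.Exports.

Local Open Scope classical_set_scope.
Local Open Scope ring_scope.
Local Open Scope complex_scope.

(* The real and imaginary parts as elements of R. *)
Notation cRe := complex.Re.
Notation cIm := complex.Im.

(** * Calculus on open subsets of the plane *)

Section Plane.
Variable R : realType.
Implicit Types (U : set (R * R)) (f : R * R -> R) (F : R * R -> R * R).

Definition px f (p : R * R) : R := 'D_((1, 0) : R * R) f p.
Definition py f (p : R * R) : R := 'D_((0, 1) : R * R) f p.

Definition loc_holder (th : R) U f :=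
  forall p, U p -> exists (V : set (R * R)) (C : R), nbhs p V /\
    forall x y, V x -> U x -> V y -> U y -> `|f x - f y| <= C * `|x - y| `^ th.

(* f is of class C^k on the open set U and its partial derivatives of order k
   are locally th-Hoelder there; for th = 0 the Hoelder condition is void,
   continuous functions being locally bounded. *)
Fixpoint class_holder (k : nat) (th : R) U f : Prop :=
  match k with
  | 0%N => (forall p, U p -> {for p, continuous f}) /\ loc_holder th U f
  | k'.+1 =>
      [/\ forall p, U p -> {for p, continuous f},
          forall p, U p -> derivable f p ((1, 0) : R * R) /\
                           derivable f p ((0, 1) : R * R),
          class_holder k' th U (px f) &
          class_holder k' th U (py f)]
  end.

Definition class_nat (k : nat) U f := class_holder k 0 U f.

(* Class C^r for a real r >= 0: integer part plus Hoelder exponent. *)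
Definition class_real (r : R) U f :=
  class_holder (Num.truncn r) (r - (Num.truncn r)%:R) U f.

Definition class2_nat k U F :=
  class_nat k U (fun p => (F p).1) /\ class_nat k U (fun p => (F p).2).
Definition class2_real r U F :=
  class_real r U (fun p => (F p).1) /\ class_real r U (fun p => (F p).2).
Definition classC_nat k U (f : R * R -> R[i]) :=
  class_nat k U (fun p => cRe (f p)) /\ class_nat k U (fun p => cIm (f p)).

Definition cpx (f : R * R -> R[i]) p : R[i] :=
  px (fun q => cRe (f q)) p +i* px (fun q => cIm (f q)) p.
Definition cpy (f : R * R -> R[i]) p : R[i] :=
  py (fun q => cRe (f q)) p +i* py (fun q => cIm (f q)) p.

Definition jac11 F := px (fun p => (F p).1).
Definition jac12 F := py (fun p => (F p).1).
Definition jac21 F := px (fun p => (F p).2).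
Definition jac22 F := py (fun p => (F p).2).
Definition jdet F p : R := jac11 F p * jac22 F p - jac12 F p * jac21 F p.

(* [(a, b)] stands for the covector a du + b dv at F p, (u, v) = F. *)
Definition covec_pull F p (a : R[i] * R[i]) : R[i] * R[i] :=
  (a.1 * (jac11 F p)%:C + a.2 * (jac21 F p)%:C,
   a.1 * (jac12 F p)%:C + a.2 * (jac22 F p)%:C).
Definition vec_push F p (v : R * R) : R * R :=
  (jac11 F p * v.1 + jac12 F p * v.2, jac21 F p * v.1 + jac22 F p * v.2).

(* z |-> z ^ k on the plane identified with the complex numbers. *)
Definition plane_pow (k : nat) (p : R * R) : R * R :=
  let z := (p.1 +i* p.2) ^+ k in (cRe z, cIm z).

Definition leb2 := (@lebesgue_measure R \x @lebesgue_measure R)%E.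

(* Limit of a complex sequence, taken componentwise. *)
Definition limC (u : nat -> R[i]) : R[i] :=
  lim ((fun n => cRe (u n)) @ \oo) +i* lim ((fun n => cIm (u n)) @ \oo).

End Plane.

(** * Compact oriented surfaces *)

(* A smooth structure on a compact surface is given by a finite oriented atlas.
   Charts are total functions, meaningful on [dom i] only; [inv i] is the local
   inverse of [chart i].  There is no boundary: chart images are open in the
   plane. *)
Record surface (R : realType) := Surface {
  pt :> topologicalType;
  nch : nat;
  dom : 'I_nch -> set pt;
  chart : 'I_nch -> pt -> R * R;
  inv : 'I_nch -> R * R -> pt;
  surface_compact : compact [set: pt];
  surface_hausdorff : hausdorff_space pt;
  surface_connected : connected [set: pt];
  dom_open : forall i, open (dom i);
  dom_cover : forall m, exists i, dom i m;
  chart_open : forall i, open (chart i @` dom i);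
  chart_cont : forall i m, dom i m -> {for m, continuous (chart i)};
  inv_cont : forall i p, (chart i @` dom i) p -> {for p, continuous (inv i)};
  chartK : forall i m, dom i m -> inv i (chart i m) = m;
  trans_smooth : forall i j k,
    class2_nat k (chart i @` (dom i `&` dom j)) (chart j \o inv i);
  trans_oriented : forall i j m, dom i m -> dom j m ->
    0 < jdet (chart j \o inv i) (chart i m) }.

Section Forms.
Variables (R : realType) (M : surface R).
Local Notation C := R[i].

Definition trans (i j : 'I_(nch M)) : R * R -> R * R := chart j \o inv i.
Definition img (i : 'I_(nch M)) (S : set M) : set (R * R) :=
  chart i @` (dom i `&` S).

(* [a i m] are the coefficients (of dx, dy), resp. the coefficient (of dx/\dy),
   of the complex differential form at the point m, in the chart i. *)
Definition form1 := 'I_(nch M) -> M -> C * C.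
Definition form2 := 'I_(nch M) -> M -> C.
Definition vfield := 'I_(nch M) -> M -> R * R.

(* The vanishing outside [dom i] only makes the representation unique. *)
Definition is_form1 (a : form1) :=
  (forall i m, ~ dom i m -> a i m = (0, 0)) /\
  (forall i j m, dom i m -> dom j m ->
     a i m = covec_pull (trans i j) (chart i m) (a j m)).
Definition is_form2 (w : form2) :=
  (forall i m, ~ dom i m -> w i m = 0) /\
  (forall i j m, dom i m -> dom j m ->
     w i m = (jdet (trans i j) (chart i m))%:C * w j m).

Definition class_fun (k : nat) (f : M -> C) :=
  forall i, classC_nat k (img i setT) (f \o inv i).
Definition form1_class (k : nat) (a : form1) :=
  is_form1 a /\ forall i,
    classC_nat k (img i setT) (fun p => (a i (inv i p)).1) /\
    classC_nat k (img i setT) (fun p => (a i (inv i p)).2).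
Definition form2_class (k : nat) (w : form2) :=
  is_form2 w /\ forall i, classC_nat k (img i setT) (fun p => w i (inv i p)).
Definition is_vfield_on (k : nat) (S : set M) (Y : vfield) :=
  (forall i j m, S m -> dom i m -> dom j m ->
     Y j m = vec_push (trans i j) (chart i m) (Y i m)) /\
  (forall i, class2_nat k (img i S) (fun p => Y i (inv i p))).

Definition d0 (f : M -> C) : form1 := fun i m =>
  if `[< dom i m >] then
    (cpx (f \o inv i) (chart i m), cpy (f \o inv i) (chart i m))
  else (0, 0).
Definition d1 (a : form1) : form2 := fun i m =>
  if `[< dom i m >] then
    cpx (fun p => (a i (inv i p)).2) (chart i m)
    - cpy (fun p => (a i (inv i p)).1) (chart i m)
  else 0.

Definition add1 (a b : form1) : form1 := fun i m =>
  ((a i m).1 + (b i m).1, (a i m).2 + (b i m).2).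
Definition scale1 (c : C) (a : form1) : form1 := fun i m =>
  (c * (a i m).1, c * (a i m).2).
Definition wedge (a b : form1) : form2 := fun i m =>
  (a i m).1 * (b i m).2 - (a i m).2 * (b i m).1.

(* Contractions by a vector field defined on S, of forms supported in S. *)
Definition contract1 (S : set M) (Y : vfield) (a : form1) (m : M) : C :=
  if [pick i | `[< S m /\ dom i m >]] is Some i then
    (a i m).1 * ((Y i m).1)%:C + (a i m).2 * ((Y i m).2)%:C
  else 0.
Definition contract2 (S : set M) (Y : vfield) (w : form2) : form1 := fun i m =>
  if `[< S m >] then
    (- (w i m * ((Y i m).2)%:C), w i m * ((Y i m).1)%:C)
  else (0, 0).
(* Cartan's formula. *)
Definition lie1 (S : set M) (Y : vfield) (a : form1) : form1 :=
  add1 (d0 (contract1 S Y a)) (contract2 S Y (d1 a)).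

Definition cpt_supported (S : set M) (P : M -> Prop) :=
  exists K : set M, [/\ compact K, K `<=` S & forall m, ~ K m -> P m].

(* The integral of a 2-form: M is cut into the disjoint Borel pieces
   [dom i] minus the previous [dom j]. *)
Definition piece (i : 'I_(nch M)) : set (R * R) :=
  img i (~` \bigcup_(j in [set j : 'I_(nch M) | (j < i)%N]) dom j).
Definition integral2 (w : form2) : C :=
  \sum_(i < nch M)
    ((\int[@leb2 R]_(p in piece i) cRe (w i (inv i p)))
     +i* (\int[@leb2 R]_(p in piece i) cIm (w i (inv i p)))).

(* The pull-back of forms by a map M -> M, computed at m in any chart around
   [A m]; it is meaningful wherever A is differentiable. *)
Definition pull1 (A : M -> M) (a : form1) : form1 := fun i m =>
  if `[< dom i m >] then
    if [pick j | `[< dom j (A m) >]] is Some j then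
      covec_pull (chart j \o A \o inv i) (chart i m) (a j (A m))
    else (0, 0)
  else (0, 0).

(** * Currents of degree and dimension 1 *)

(* Currents are functionals on forms of class C^1.  They
   are total functions since the current of a form, and hence the limits of such
   currents below, are also evaluated on forms less regular than C^1, such as
   pull-backs and Lie derivatives. *)
Definition current := form1 -> C.

Definition current_of (a : form1) : current := fun b => integral2 (wedge a b).

Definition push (A : M -> M) (B : current) : current := fun b => B (pull1 A b).

(* B = dS for a current S of dimension 2. *)
Definition exact_current (B : current) :=
  exists S : form2 -> C,
    (forall c w w', S (fun i m => c * w i m + w' i m) = c * S w + S w') /\
    (forall b, form1_class 1 b -> B b = S (d1 b)).

Definition closed_form (a : form1) :=
  form1_class 1 a /\ forall i m, d1 a i m = 0.

End Forms.

(** * Cohomology *)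

(* H^1(M, C): closed 1-forms modulo exact ones.  It is given as a vector space
   with a linear surjection from closed forms whose kernel is the space of
   exact forms, which characterizes it up to a unique isomorphism. *)
Record deRham (R : realType) (M : surface R) := DeRham {
  H1 :> vectType R[i];
  cls : form1 M -> H1;
  cls_linear : forall c a b, closed_form a -> closed_form b ->
    cls (add1 (scale1 c a) b) = c *: cls a + cls b;
  cls_surj : forall x : H1, exists a, closed_form a /\ cls a = x;
  cls_ker : forall a, closed_form a ->
    (cls a = 0 <-> exists f, class_fun 2 f /\ a = d0 f) }.

Section Cohomology.
Variables (R : realType) (M : surface R) (H : deRham M).

Definition current_class (B : current M) (x : H) :=
  exists a, [/\ closed_form a, cls H a = x &
    exact_current (fun b => B b - current_of a b)].

(* A^# is the automorphism of H^1 such that A^#[a] = [A_* a]. *)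
Definition cohomology_action (A : M -> M) (As : 'End(H)) :=
  lker As = 0%VS /\
  forall a, closed_form a -> current_class (push A (current_of a)) (As (cls H a)).

(* A linear choice of closed representatives. *)
Definition linear_section (al : H -> form1 M) :=
  [/\ forall c x y, al (c *: x + y) = add1 (scale1 c (al x)) (al y),
      forall x, closed_form (al x) &
      forall x, cls H (al x) = x].

(* lim_n g_*^n al (f^n x), pointwise on test forms. *)
Definition current_limit (g : M -> M) (f : 'End(H)) (al : H -> form1 M) (x : H) :
    current M :=
  fun b => limC (fun n => iter n (push g) (current_of (al (iter n f x))) b).

(* Membership in the sum of the generalized eigenspaces of f for the
   eigenvalues satisfying P. *)
Definition in_spectral (P : R[i] -> Prop) (f : 'End(H)) (x : H) :=
  exists (s : seq R[i]) (w : R[i] -> H), x = \sum_(c <- s) w c /\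
    forall c, c \in s -> P c /\
      exists n : nat, iter n (fun y : H => f y - c *: y) (w c) = 0.

(* Indices start from 1: blocks i in {1, .., k}, positions j in {1, .., J i}. *)
Definition jordan_basis (P : R[i] -> Prop) (f : 'End(H)) (k : nat)
    (mu : nat -> R[i]) (J : nat -> nat) (c : nat -> nat -> H) :=
  let fam := [seq c i j | i <- iota 1 k, j <- iota 1 (J i)] in
  [/\ forall i j, (1 <= i <= k)%N -> (1 <= j <= J i)%N ->
        f (c i j) = mu i *: c i j + (if j == 1%N then 0 else c i j.-1),
      free fam &
      forall x, (x \in <<fam>>%VS) <-> in_spectral P f x].

End Cohomology.

(** * Topological entropy *)

Section Entropy.
Variables (R : realType) (T : topologicalType) (f : T -> T).

Definition open_cover (U : set (set T)) :=
  (forall V, U V -> open V) /\ forall x, exists2 V, U V & V x.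

(* The join of U, f^-1 U, .., f^-(n-1) U has a subcover by k elements. *)
Definition has_subcover (U : set (set T)) (n k : nat) :=
  exists s : 'I_k -> 'I_n -> set T,
    (forall a i, U (s a i)) /\ forall x, exists a, forall i, s a i (iter i f x).

Definition subcover_number U n : R :=
  inf [set k%:R | k in [set k | has_subcover U n k]].

Definition topological_entropy : \bar R :=
  ereal_sup [set (lim ((fun n => ln (subcover_number U n) / n%:R) @ \oo))%:E
            | U in open_cover].

End Entropy.

(** * Translation structures and pseudo-Anosov maps *)

Definition homeo (T T' : topologicalType) (f : T -> T') (g : T' -> T) :=
  [/\ cancel f g, cancel g f, continuous f & continuous g].

Definition embedding_on (T T' : topologicalType) (U : set T) (f : T -> T') :=
  [/\ open U,
      forall x, U x -> {for x, continuous f},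
      {in U &, injective f} &
      forall V, open V -> V `<=` U -> open (f @` V)].

(* An atlas outside [sing] with transition maps that are locally translations;
   near p in [sing], flat coordinates are branches of z ^ (k+1) (up to
   translation), z being a coordinate on a neighbourhood of p: p is a cone point
   of angle 2 (k+1) pi, and k = 0 is that of a marked regular point. *)
Record translation_structure (R : realType) (T : topologicalType) :=
  TranslationStructure {
  sing : set T;
  tidx : Type;
  tdom : tidx -> set T;
  tchart : tidx -> T -> R * R;
  sing_finite : finite_set sing;
  tdom_cover : \bigcup_(k in setT) tdom k = ~` sing;
  tchart_emb : forall k, embedding_on (tdom k) (tchart k);
  ttrans : forall k l m, tdom k m -> tdom l m ->
    exists v, \forall m' \near m, tchart l m' = tchart k m' + v;
  tcone : forall p, sing p ->
    exists (k : nat) (U : set T) (z : T -> R * R),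
      [/\ embedding_on U z, U `&` sing = [set p], z p = (0, 0) &
          forall l m, U m -> tdom l m ->
            exists v, \forall m' \near m,
              tchart l m' = plane_pow k.+1 (z m') + v] }.

(* In flat coordinates, (x, y) |-> (nu x, nu^-1 y) up to translation. *)
Definition linear_pA (R : realType) (T : topologicalType)
    (X : translation_structure R T) (L L' : T -> T) :=
  [/\ homeo L L', L @` sing X = sing X &
      exists nu : R, 1 < `|nu| /\
        forall k l m, tdom (t:=X) k m -> tdom (t:=X) l (L m) ->
          exists v : R * R, \forall m' \near m,
            tchart (t:=X) l (L m') =
              (nu * (tchart (t:=X) k m').1, nu^-1 * (tchart (t:=X) k m').2) + v].

(* The number lambda = e^(h_top). *)
Definition dilatation (R : realType) (T : topologicalType) (f : T -> T) : R :=
  expR (fine (topological_entropy R f)).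

Section PseudoAnosov.
Variables (R : realType) (M : surface R).

(* A linear pseudo-Anosov map is not differentiable at its singularities, where
   it is merely Lipschitz.  So, for a homeomorphism, class C^r is required
   outside the finite set Sig and boundedness of the derivative near it, which
   holds in particular if A is a C^r diffeomorphism of M. *)
Definition class_off (r : R) (Sig : set M) (A : M -> M) :=
  (forall i j, class2_real r (img i (A @^-1` dom j `\` Sig))
                 (chart j \o A \o inv i)) /\
  (forall i j p, Sig p -> dom i p -> dom j (A p) ->
     exists c : R, \forall m \near p, ~ Sig m ->
       let F := chart j \o A \o inv i in let q := chart i m in
       [/\ `|jac11 F q| <= c, `|jac12 F q| <= c,
           `|jac21 F q| <= c & `|jac22 F q| <= c]).

Definition orientation_preserving_off (Sig : set M) (A : M -> M) :=
  forall i j m, ~ Sig m -> dom i m -> dom j (A m) ->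
    0 < jdet (chart j \o A \o inv i) (chart i m).

(* Pseudo-Anosov diffeomorphisms of class C^r with singularities Sig, with a
   topological conjugacy to a linear pseudo-Anosov one. *)
Record pA_diffeo (r : R) (Sig : set M) := PADiffeo {
  pA_map :> M -> M;
  pA_inv : M -> M;
  pA_flat : translation_structure R M;
  pA_lin : M -> M;
  pA_lin_inv : M -> M;
  pA_conj : M -> M;
  pA_conj_inv : M -> M;
  pA_homeo : homeo pA_map pA_inv;
  pA_fix : forall p, Sig p -> pA_map p = p;
  pA_class : class_off r Sig pA_map;
  pA_inv_class : class_off r Sig pA_inv;
  pA_orient : orientation_preserving_off Sig pA_map;
  pA_lin_pA : linear_pA pA_flat pA_lin pA_lin_inv;
  pA_conj_homeo : homeo pA_conj pA_conj_inv;
  pA_conj_sing : pA_conj @` Sig = sing pA_flat;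
  pA_conjE : forall m, pA_conj (pA_map m) = pA_lin (pA_conj m) }.

(* A foliation of an open subset of M by curves, whose plaques are the level
   sets of the functions [fproj]. *)
Record foliation := Foliation {
  fidx : Type;
  fdom : fidx -> set M;
  fproj : fidx -> M -> R }.

(* The leaves of the unstable (stable) foliation correspond under the conjugacy
   to the lines y = const (x = const), which the linear map expands
   (contracts). *)
Definition unstable_foliation r Sig (A : pA_diffeo r Sig) : foliation :=
  @Foliation (tidx (pA_flat A)) (fun k => pA_conj A @^-1` tdom k)
    (fun k m => (tchart k (pA_conj A m)).2).
Definition stable_foliation r Sig (A : pA_diffeo r Sig) : foliation :=
  @Foliation (tidx (pA_flat A)) (fun k => pA_conj A @^-1` tdom k)
    (fun k m => (tchart k (pA_conj A m)).1).

(* Y m is the velocity at m of a curve contained in the plaque of m. *)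
Definition tangent_to (F : foliation) (S : set M) (Y : vfield M) :=
  forall m, S m -> exists (k : fidx F) (c : R -> M) (e : R),
    [/\ 0 < e, c 0 = m,
        forall t, `|t| < e -> [/\ {for t, continuous c}, fdom k (c t) &
                                 fproj k (c t) = fproj k m] &
        forall i, dom i m -> is_derive (0 : R) (1 : R) (chart i \o c) (Y i m)].

(* B is basic for F on the open set S: L_Y B = i_Y B = 0, tested with vector
   fields of class C^1 (the foliations need not be smoother) and forms with
   compact support in S.  When Y is only C^1, L_Y b is in general only
   continuous, and B has to be given on such forms too.  The closedness of B, to
   which L_Y B = 0 is equivalent when i_Y B = 0, is included: it does not
   involve the regularity of Y. *)
Definition basic_current (F : foliation) (S : set M) (B : current M) :=
  (forall f, class_fun 2 f -> cpt_supported S (fun m => f m = 0) ->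
     B (d0 f) = 0) /\
  (forall Y, is_vfield_on 1 S Y -> tangent_to F S Y ->
    (forall w, form2_class 1 w ->
       cpt_supported S (fun m => forall i, w i m = 0) ->
       B (contract2 S Y w) = 0) /\
    (forall b, form1_class 2 b ->
       cpt_supported S (fun m => forall i, b i m = (0, 0)) ->
       B (lie1 S Y b) = 0)).

End PseudoAnosov.

(** * The invariant currents *)

Section InvariantCurrents.
Variables (R : realType) (M : surface R) (r : R) (Sig : set M).
Variables (A : pA_diffeo r Sig) (H : deRham M).

(* On an automorphism As of H, [As^-1]%VF is its inverse. *)
Definition current_plus (As : 'End(H)) (al : H -> form1 M) : H -> current M :=
  current_limit A (As^-1)%VF al.
Definition current_minus (As : 'End(H)) (al : H -> form1 M) : H -> current M :=
  current_limit (pA_inv A) As al.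

Definition modulus_gt1 (c : R[i]) : Prop := 1 < `|c|.
Definition modulus_lt1 (c : R[i]) : Prop := `|c| < 1.

(* The expanding eigenvalues, one for each of the k Jordan blocks. *)
Definition expanding_data (k : nat) (mu : nat -> R[i]) (J : nat -> nat) :=
  [/\ (0 < k)%N /\ mu 1%N = (dilatation R A)%:C,
      J 1%N = 1%N,
      (1 < k)%N -> `|mu 2%N| < (dilatation R A)%:C,
      forall i, (1 <= i < k)%N -> `|mu i.+1| <= `|mu i| &
      forall i, (1 <= i <= k)%N -> 1 < `|mu i| /\ (0 < J i)%N].

End InvariantCurrents.

(* Main.v *)
(* Let S = A and f = As^-1 for the unstable foliation, S = A^-1 and f = As for the stable one.
   The value of the current of x on a test form b is the limit of u_n (f^n x), where u_n (x) is the integral of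
   al x /\ (S^n)^* b and f^n x decays geometrically along a Jordan chain.  So it is enough that, for
   each closed form a, the integrals of a /\ (S^n)^* b stay bounded as n grows: the limit is then 0.
   For b = dF they vanish, by Stokes' theorem.

   For b = i_Y w, with Y tangent to the foliation, they are the integrals of a_n /\ i_Y w, where
   a_n = (S^-n)^* a.  Locally a_n = dG_n, and they become the integrals of w (Y . grad G_n) in a
   chart.  As S^-n shrinks the leaves, the oscillation of G_n along the plaques is at most a constant
   K independent of n: if Q_n is the function, constant along the plaques, that agrees with G_n on a
   transversal, then |G_n - Q_n| <= K.  The foliation is only continuous, and so is Q_n, but Y is
   C^1 and Q_n is constant along curves with velocity Y, so that the integral of Q_n div (w Y) is 0.
   Therefore the integral of w (Y . grad G_n) is that of (Q_n - G_n) div (w Y), which is at most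
   K times the integral of |div (w Y)|. *)

Require Import Defs.
From HB Require Import structures.
From mathcomp Require Import all_boot all_order all_algebra.
From mathcomp Require Import all_classical all_reals all_analysis.
From mathcomp Require Import measurable_realfun complex ring lra.

Set Implicit Arguments.
Unset Strict Implicit.
Unset Printing Implicit Defensive.

Import Order.TTheory GRing.Theory Num.Theory.
Import numFieldNormedType.Exports.

Local Open Scope classical_set_scope.
Local Open Scope ring_scope.
Local Open Scope complex_scope.

(** Regularity shapes the proof. The iterates are only C^1 off the singularities, so a_n is merely
    continuous there; it is closed only in the sense of having local primitives, and G_n is glued
    from these. No flow of Y is used: the integral of Q_n div (w Y) is shown to vanish by means of
    C^1 functions uniformly close to Q_n whose derivative along Y is uniformly small. The constant K
    must survive leaf segments that are pushed arbitrarily close to a singularity. There the flat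
    coordinate is a power of a topological coordinate, which confines a short segment starting near
    the point to a small neighbourhood; since the form is closed on all of M, this neighbourhood
    carries a bounded primitive. Compactness then yields one admissible length and one bound.
    Segments fall below that length only for large n; the finitely many other n are bounded
    separately. The integral over M is defined by cutting along charts. Its invariance rests on a
    change of variables inequality, proved by bisection and applied to a map and to its inverse.
    Finally, the decay along Jordan chains is uniform in the index of the functional, so that both
    indices may be set equal. *)

Local Notation inv := Defs.inv.

(** * Calculus in the plane *)

Section PlaneCalculus.
Variable R : realType.
Implicit Types (f g : R * R -> R) (p q : R * R) (t s e : R).

Lemma near_normP (V : normedModType R) (p : V) (P : V -> Prop) :
  (\forall q \near p, P q) <-> exists2 d : R, 0 < d & forall q : V, `|q - p| < d -> P q.
Proof.
split=> [/nbhs_normP [d /= d0 H]|[d d0 H]].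
  by exists d => // q qp; apply: H; rewrite /ball_ /= distrC.
by apply/nbhs_normP; exists d => // q; rewrite /ball_ /= distrC => /H.
Qed.

Lemma continuousP_eps (V W : normedModType R) (f : V -> W) (p : V) :
  {for p, continuous f} <->
  forall e : R, 0 < e -> exists2 d : R, 0 < d & forall q : V, `|q - p| < d -> `|f q - f p| < e.
Proof.
split=> [/cvgrPdist_lt H e e0|H].
  have /near_normP[d d0 {}H] := H e e0.
  by exists d => // q /H; rewrite distrC.
apply/cvgrPdist_lt => e /H [d d0 {}H]; apply/near_normP; exists d => // q /H.
by rewrite distrC.
Qed.

(** Multiplying the difference quotient by h removes the punctured neighbourhood: at h = 0 the
    inequality is trivial. *)
Lemma directional_derivativeP (V : normedModType R) (f : V -> R) (p v : V) (l : R) :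
  is_derive p v f l <->
  forall e, 0 < e -> exists2 d : R, 0 < d & forall h : R, `|h| < d ->
    `|f (h *: v + p) - f p - h * l| <= e * `|h|.
Proof.
have key h : h != 0 -> `|f (h *: v + p) - f p - h * l| =
    `|h| * `|l - h^-1 * (f (h *: v + p) - f p)|.
  by move=> h0; rewrite -normrM distrC; congr `|_|; field.
split=> [[dv dl] e e0|H].
  have /cvgrPdist_le /(_ e e0) : (fun h => h^-1 *: (f (h *: v + p) - f p)) @ 0^' --> l.
    by rewrite -dl.
  rewrite near_withinE => /near_normP[d d0 H]; exists d => // h hd.
  have [->|h0] := eqVneq h 0.
    by rewrite scale0r add0r subrr mul0r subrr normr0 mulr0.
  rewrite key // mulrC ler_wpM2r //; apply: H => //; by rewrite subr0.
have C : (fun h => h^-1 *: (f (h *: v + p) - f p)) @ 0^' --> l.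
  apply/cvgrPdist_le => e e0; rewrite near_withinE; apply: (near_normP (0 : R) _).2.
  have [d d0 {}H] := H e e0; exists d => // h; rewrite subr0 => hd h0.
  have := H h hd; rewrite key // mulrC ler_pM2r ?normr_gt0 //.
split; last exact: cvg_lim C.
by apply/cvg_ex; exists l.
Qed.

Lemma is_deriveP (c : R -> R) t v :
  is_derive t 1 c v <->
  forall e, 0 < e -> exists2 d : R, 0 < d & forall s, `|s - t| < d ->
    `|c s - c t - v * (s - t)| <= e * `|s - t|.
Proof.
rewrite directional_derivativeP; split=> H e /H [d d0 {}H]; exists d => // s sd.
  by have := H _ sd; rewrite /GRing.scale/= mulr1 subrK [v * _]mulrC.
by have := H (s + t); rewrite addrK /GRing.scale/= mulr1 => /(_ sd); rewrite [v * _]mulrC.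
Qed.

Lemma is_derive1_continuous (c : R -> R) t v : is_derive t 1 c v -> {for t, continuous c}.
Proof. by move=> [h _]; apply/differentiable_continuous/derivable1_diffP. Qed.

(** Total differentiability with gradient (a, b), for the sup norm of the product. The partial
    derivatives [px] and [py] are directional and obey no chain rule by themselves. *)
Definition dif f p (a b : R) := forall e, 0 < e -> exists2 d : R, 0 < d &
  forall q, `|q - p| < d -> `|f q - f p - (a * (q.1 - p.1) + b * (q.2 - p.2))| <= e * `|q - p|.

Lemma norm_pairE (p : R * R) : `|p| = Num.max `|p.1| `|p.2|.
Proof. by []. Qed.

Lemma norm_fst_le (p : R * R) : `|p.1| <= `|p|.
Proof. by rewrite norm_pairE le_max lexx. Qed.

Lemma norm_snd_le (p : R * R) : `|p.2| <= `|p|.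
Proof. by rewrite norm_pairE le_max lexx orbT. Qed.

Lemma norm_pair_le (p : R * R) (d : R) : `|p.1| <= d -> `|p.2| <= d -> `|p| <= d.
Proof. by move=> a b; rewrite norm_pairE ge_max a b. Qed.

Lemma norm_pair_lt (p : R * R) (d : R) : `|p.1| < d -> `|p.2| < d -> `|p| < d.
Proof. by move=> a b; rewrite norm_pairE gt_max a b. Qed.

Lemma dif_lipschitz f p a b : dif f p a b -> exists2 d : R, 0 < d &
  forall q, `|q - p| < d -> `|f q - f p| <= (1 + `|a| + `|b|) * `|q - p|.
Proof.
move=> /(_ 1 ltr01)[d d0 H]; exists d => // q /H {}H.
rewrite -[f q - f p](subrK (a * (q.1 - p.1) + b * (q.2 - p.2))) -[1 + _ + _]addrA mulrDl.
apply: (le_trans (ler_normD _ _)); rewrite lerD //.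
rewrite mulrDl; apply: (le_trans (ler_normD _ _)); rewrite !normrM lerD // ler_wpM2l //.
  exact: (norm_fst_le (q - p)).
exact: (norm_snd_le (q - p)).
Qed.

Lemma dif_continuous f p a b : dif f p a b -> {for p, continuous f}.
Proof.
move=> /dif_lipschitz [d d0 H]; apply/continuousP_eps => e e0.
set K := 1 + `|a| + `|b| in H.
have K0 : 0 < K by rewrite /K -addrA ltr_pwDl // addr_ge0.
exists (Num.min d (e / K)); first by rewrite lt_min d0 divr_gt0.
move=> q; rewrite lt_min => /andP[/H h1 h2]; apply: le_lt_trans h1 _.
by rewrite mulrC -ltr_pdivlMr.
Qed.

Lemma dif_directional f p a b v : dif f p a b -> is_derive p v f (a * v.1 + b * v.2).
Proof.
move=> H; apply/directional_derivativeP => e e0.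
have v0 : 0 < 1 + `|v| by rewrite ltr_pwDl.
have [d d0 {}H] := H (e / (1 + `|v|)) (divr_gt0 e0 v0).
exists (d / (1 + `|v|)); first exact: divr_gt0.
move=> h; rewrite ltr_pdivlMr // => hd.
have E : h *: v + p - p = h *: v by rewrite addrK.
have N : `|h *: v| <= `|h| * (1 + `|v|) by rewrite normrZ ler_wpM2l // lerDr.
have := H (h *: v + p); rewrite E => /(_ (le_lt_trans N hd)) {}H.
have -> : h * (a * v.1 + b * v.2) =
  a * ((h *: v + p).1 - p.1) + b * ((h *: v + p).2 - p.2).
  by rewrite /= /GRing.scale /=; ring.
apply: (le_trans H); apply: (@le_trans _ _ (e / (1 + `|v|) * (`|h| * (1 + `|v|)))).
  by rewrite ler_wpM2l // divr_ge0 ?(ltW e0) ?(ltW v0).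
by rewrite le_eqVlt; apply/orP; left; apply/eqP; field; rewrite gt_eqF.
Qed.

Lemma dif_px f p a b : dif f p a b -> derivable f p (1, 0) /\ px f p = a.
Proof.
move=> H; have /= := dif_directional (1, 0) H; rewrite mulr1 mulr0 addr0 => -[H1 H2].
by split.
Qed.

Lemma dif_py f p a b : dif f p a b -> derivable f p (0, 1) /\ py f p = b.
Proof.
move=> H; have /= := dif_directional (0, 1) H; rewrite mulr1 mulr0 add0r => -[H1 H2].
by split.
Qed.

Lemma dif_eq f p a b a' b' : dif f p a b -> a = a' -> b = b' -> dif f p a' b'.
Proof. by move=> H <- <-. Qed.

Lemma dif_near f g p a b : (\forall q \near p, f q = g q) -> dif f p a b -> dif g p a b.
Proof.
move=> /near_normP[d1 d10 E] H e /H [d2 d20 {}H]; exists (Num.min d1 d2).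
  by rewrite lt_min d10.
move=> q; rewrite lt_min => /andP[q1 q2]; rewrite -(E q) // -(E p) ?subrr ?normr0 //.
exact: H.
Qed.

Lemma dif_cst (c : R) p : dif (fun=> c) p 0 0.
Proof.
by move=> e e0; exists 1 => // q _; rewrite !mul0r subrr addr0 subrr normr0 mulr_ge0 // ltW.
Qed.

Lemma dif_fst p : dif fst p 1 0.
Proof.
move=> e e0; exists 1 => // q _.
by rewrite mul0r addr0 mul1r subrr normr0 mulr_ge0 // ltW.
Qed.

Lemma dif_snd p : dif snd p 0 1.
Proof.
move=> e e0; exists 1 => // q _.
by rewrite mul0r add0r mul1r subrr normr0 mulr_ge0 // ltW.
Qed.

Lemma dif_comp f (F1 F2 : R * R -> R) p u v a b c d :
  dif f (F1 p, F2 p) u v -> dif F1 p a b -> dif F2 p c d ->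
  dif (fun q => f (F1 q, F2 q)) p (u * a + v * c) (u * b + v * d).
Proof.
move=> Hf H1 H2 e e0.
have [d1 d10 L1] := dif_lipschitz H1; have [d2 d20 L2] := dif_lipschitz H2.
set K1 := _ + `|b| in L1; set K2 := _ + `|d| in L2.
have K10 : 0 < K1 by rewrite /K1 -addrA ltr_pwDl // addr_ge0.
have K20 : 0 < K2 by rewrite /K2 -addrA ltr_pwDl // addr_ge0.
have K0 : 0 < K1 + K2 by rewrite addr_gt0.
(* One third for the remainder of [f], and one for [u], [v] times the remainders of [F1], [F2]. The
   denominators 1 + |u| and 1 + |v| avoid a case distinction at 0. *)
pose e1 := e / 3.
have e10 : 0 < e1 by rewrite divr_gt0.
have [df df0 {}Hf] := Hf (e1 / (K1 + K2)) (divr_gt0 e10 K0).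
have U0 : 0 < 1 + `|u| by rewrite ltr_pwDl.
have V0 : 0 < 1 + `|v| by rewrite ltr_pwDl.
have [d3 d30 {}H1] := H1 (e1 / (1 + `|u|)) (divr_gt0 e10 U0).
have [d4 d40 {}H2] := H2 (e1 / (1 + `|v|)) (divr_gt0 e10 V0).
exists (Num.min (Num.min d1 d2) (Num.min (Num.min d3 d4) (df / (K1 + K2)))).
  by rewrite !lt_min d10 d20 d30 d40 divr_gt0.
move=> q; rewrite !lt_min => /andP[/andP[q1 q2] /andP[/andP[q3 q4] q5]].
have {L1}l1 := L1 _ q1; have {L2}l2 := L2 _ q2.
have {H1}h1 := H1 _ q3; have {H2}h2 := H2 _ q4.
set N := `|q - p| in l1 l2 h1 h2 q5 *.
have N0 : 0 <= N by exact: normr_ge0.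
have B : `|(F1 q, F2 q) - (F1 p, F2 p)| <= (K1 + K2) * N.
  apply: norm_pair_le => /=; rewrite mulrDl.
    by apply: (le_trans l1); rewrite lerDl mulr_ge0 // ltW.
  by apply: (le_trans l2); rewrite lerDr mulr_ge0 // ltW.
have {Hf} hf := Hf (F1 q, F2 q) _.
have {hf} hf := hf (le_lt_trans B _).
have {hf} hf : `|f (F1 q, F2 q) - f (F1 p, F2 p) -
    (u * (F1 q - F1 p) + v * (F2 q - F2 p))| <= e1 * N.
  apply: (le_trans (hf _)); first by rewrite mulrC -ltr_pdivlMr.
  apply: (@le_trans _ _ (e1 / (K1 + K2) * ((K1 + K2) * N))).
    by rewrite ler_wpM2l // divr_ge0 // ltW.
  by rewrite mulrA divfK // gt_eqF.
have k1 : `|u * (F1 q - F1 p - (a * (q.1 - p.1) + b * (q.2 - p.2)))| <= e1 * N.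
  rewrite normrM; apply: (@le_trans _ _ ((1 + `|u|) * (e1 / (1 + `|u|) * N))).
    by apply: ler_pM => //; rewrite lerDr.
  by rewrite mulrA [_ * (e1 / _)]mulrC divfK // gt_eqF.
have k2 : `|v * (F2 q - F2 p - (c * (q.1 - p.1) + d * (q.2 - p.2)))| <= e1 * N.
  rewrite normrM; apply: (@le_trans _ _ ((1 + `|v|) * (e1 / (1 + `|v|) * N))).
    by apply: ler_pM => //; rewrite lerDr.
  by rewrite mulrA [_ * (e1 / _)]mulrC divfK // gt_eqF.
have -> : e * N = e1 * N + e1 * N + e1 * N by rewrite /e1; field.
move: hf k1 k2; set x := (X in `|X| <= _ -> _); set y := (X in _ -> `|X| <= _ -> _).
set z := (X in _ -> _ -> `|X| <= _ -> _) => hx hy hz.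
have -> : f (F1 q, F2 q) - f (F1 p, F2 p) -
  ((u * a + v * c) * (q.1 - p.1) + (u * b + v * d) * (q.2 - p.2)) = x + y + z.
  by rewrite /x /y /z; ring.
apply: (le_trans (ler_normD _ _)); rewrite lerD //.
by apply: (le_trans (ler_normD _ _)); rewrite lerD.
Qed.

Lemma dif_compT f (F : R * R -> R * R) p u v a b c d :
  dif f (F p) u v -> dif (fun q => (F q).1) p a b -> dif (fun q => (F q).2) p c d ->
  dif (f \o F) p (u * a + v * c) (u * b + v * d).
Proof.
move=> Hf H1 H2; have -> : f \o F = fun q => f ((F q).1, (F q).2).
  by apply/funext => q /=; rewrite -surjective_pairing.
by apply: dif_comp => //; rewrite -surjective_pairing.
Qed.

Lemma dif_add_plane p : dif (fun q => q.1 + q.2) p 1 1.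
Proof.
move=> e e0; exists 1 => // q _.
have -> : q.1 + q.2 - (p.1 + p.2) - (1 * (q.1 - p.1) + 1 * (q.2 - p.2)) = 0 by ring.
by rewrite normr0 mulr_ge0 // ltW.
Qed.

Lemma dif_mul_plane p : dif (fun q => q.1 * q.2) p p.2 p.1.
Proof.
(* The remainder is the product of the two increments, hence quadratic in |q - p|. *)
move=> e e0; exists e => // q qp.
have -> : q.1 * q.2 - p.1 * p.2 - (p.2 * (q.1 - p.1) + p.1 * (q.2 - p.2)) =
  (q.1 - p.1) * (q.2 - p.2) by ring.
rewrite normrM; apply: ler_pM => //; last exact: (norm_snd_le (q - p)).
exact: (le_trans (norm_fst_le (q - p)) (ltW qp)).
Qed.

Lemma difD f g p a b c d : dif f p a b -> dif g p c d ->
  dif (fun q => f q + g q) p (a + c) (b + d).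
Proof.
move=> H1 H2; have := dif_comp (dif_add_plane (f p, g p)) H1 H2.
by rewrite !mul1r.
Qed.

Lemma difM f g p a b c d : dif f p a b -> dif g p c d ->
  dif (fun q => f q * g q) p (a * g p + f p * c) (b * g p + f p * d).
Proof.
move=> H1 H2; have /= := dif_comp (dif_mul_plane (f p, g p)) H1 H2.
by rewrite [_ * a]mulrC [_ * b]mulrC.
Qed.

Lemma difZ (k : R) f p a b : dif f p a b -> dif (fun q => k * f q) p (k * a) (k * b).
Proof. by move=> H; apply: dif_eq (difM (dif_cst k p) H) _ _; ring. Qed.

Lemma difN f p a b : dif f p a b -> dif (fun q => - f q) p (- a) (- b).
Proof.
move=> /(difZ (-1)); rewrite !mulN1r.
by have -> : (fun q => -1 * f q) = (fun q => - f q) by apply/funext => q; rewrite mulN1r.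
Qed.

Lemma difB f g p a b c d : dif f p a b -> dif g p c d ->
  dif (fun q => f q - g q) p (a - c) (b - d).
Proof. by move=> H /difN; exact: difD. Qed.

Lemma dif_of_derive (c : R -> R) p v : is_derive p.1 1 c v -> dif (fun q => c q.1) p v 0.
Proof.
move=> /is_deriveP H e e0; have [d d0 {}H] := H e e0; exists d => // q qp.
have N := norm_fst_le (q - p); rewrite /= in N.
rewrite mul0r addr0; apply: (le_trans (H _ (le_lt_trans N qp))).
by rewrite ler_wpM2l // ltW.
Qed.

Lemma derive_of_dif (c : R -> R) t (y v w : R) :
  dif (fun q => c q.1) (t, y) v w -> is_derive t 1 c v.
Proof.
move=> H; apply/is_deriveP => e e0; have [d d0 {}H] := H e e0; exists d => // s sd.
have N : `|(s, y) - (t, y)| = `|s - t|.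
  by rewrite norm_pairE /= subrr normr0; apply/max_idPl.
by have := H (s, y); rewrite N /= subrr mulr0 addr0 => /(_ sd).
Qed.

Lemma derive_along (f : R * R -> R) (c1 c2 : R -> R) t u v a b :
  dif f (c1 t, c2 t) u v -> is_derive t 1 c1 a -> is_derive t 1 c2 b ->
  is_derive t 1 (fun s => f (c1 s, c2 s)) (u * a + v * b).
Proof.
move=> Hf H1 H2.
have H1' : dif (fun q : R * R => c1 q.1) (t, 0) a 0 by exact: dif_of_derive.
have H2' : dif (fun q : R * R => c2 q.1) (t, 0) b 0 by exact: dif_of_derive.
exact: (derive_of_dif (dif_comp (p := (t, 0)) Hf H1' H2')).
Qed.

Lemma slice_x_derive f (x y v : R) : derivable f (x, y) (1, 0) -> px f (x, y) = v ->
  is_derive x 1 (fun s => f (s, y)) v.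
Proof.
move=> H1 H2; have /directional_derivativeP H : is_derive ((x, y) : R * R) ((1, 0) : R * R) f v by [].
apply/directional_derivativeP => e /H [d d0 {}H]; exists d => // h /H.
suff -> : h *: ((1, 0) : R * R) + (x, y) = (h *: 1 + x, y) by [].
by congr (_, _); rewrite /= /GRing.scale/= mulr0 add0r.
Qed.

Lemma slice_y_derive f (x y v : R) : derivable f (x, y) (0, 1) -> py f (x, y) = v ->
  is_derive y 1 (fun s => f (x, s)) v.
Proof.
move=> H1 H2; have /directional_derivativeP H : is_derive ((x, y) : R * R) ((0, 1) : R * R) f v by [].
apply/directional_derivativeP => e /H [d d0 {}H]; exists d => // h /H.
suff -> : h *: ((0, 1) : R * R) + (x, y) = (x, h *: 1 + y) by [].
by congr (_, _); rewrite /= /GRing.scale/= mulr0 add0r.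
Qed.

(** The mean value theorem in the form used throughout: an approximate slope [v] is kept, and min
    and max allow the endpoints in either order. *)
Lemma mvt_le (c c' : R -> R) (a b v e : R) :
  (forall s, Num.min a b <= s <= Num.max a b -> is_derive s 1 c (c' s)) ->
  (forall s, Num.min a b <= s <= Num.max a b -> `|c' s - v| <= e) ->
  `|c b - c a - v * (b - a)| <= e * `|b - a|.
Proof.
wlog ab : a b / a <= b => [W|] D B.
  have [/W|/ltW/W] := leP a b; first exact.
  rewrite minC maxC => /(_ D B); rewrite (distrC b) => H.
  by rewrite -[X in X <= _]normrN; have -> : - (c b - c a - v * (b - a)) = c a - c b - v * (a - b) by ring.
move: D B; rewrite (min_idPl ab) (max_idPr ab) => D B.
have [||x xab ->] := @MVT_segment _ c c' a b ab.
- by move=> x; rewrite in_itv/= => /andP[/ltW ax /ltW xb]; apply: D; rewrite ax.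
- by apply: derivable_within_continuous => x; rewrite in_itv/= => /D [].
by move: xab; rewrite in_itv/= => /B H; rewrite -mulrBl normrM ler_wpM2r.
Qed.

(** Total differentiability is part of the definition, so that products and compositions follow from
    the rules for [dif]; [C1on_partials] is the bridge from continuous partial derivatives. *)
Definition C1on (U : set (R * R)) f := forall p, U p ->
  [/\ dif f p (px f p) (py f p), {for p, continuous (px f)} & {for p, continuous (py f)}].

Lemma btw_dist (a b s : R) : Num.min a b <= s <= Num.max a b -> `|s - a| <= `|b - a|.
Proof.
have [ab|/ltW ab] := leP a b => /andP[h1 h2].
  by rewrite !ger0_norm ?subr_ge0 // lerD2r.
by rewrite !ler0_norm ?subr_le0 // lerN2 lerD2r.
Qed.

Lemma partials_dif f p :
  (\forall q \near p, derivable f q (1, 0) /\ derivable f q (0, 1)) ->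
  {for p, continuous (px f)} -> {for p, continuous (py f)} ->
  dif f p (px f p) (py f p).
Proof.
move=> /near_normP[d0 d00 D] /continuousP_eps Cx /continuousP_eps Cy e e0.
have e20 : 0 < e / 2 by rewrite divr_gt0.
have [d1 d10 {}Cx] := Cx _ e20; have [d2 d20 {}Cy] := Cy _ e20.
exists (Num.min d0 (Num.min d1 d2)); first by rewrite !lt_min d00 d10.
move=> q; rewrite !lt_min => /and3P[q0 q1 q2].
have N1 := norm_fst_le (q - p); have N2 := norm_snd_le (q - p).
case: p q => [p1 p2] [q1' q2'] /= in D Cx Cy q0 q1 q2 N1 N2 *.
set N := `|(q1', q2') - (p1, p2)| in q0 q1 q2 N1 N2 *.
(* The increment is split at the corner (p1, q2'), and each half is a one-variable mean value
   estimate. *)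
have A1 : `|f (q1', q2') - f (p1, q2') - px f (p1, p2) * (q1' - p1)| <= e / 2 * `|q1' - p1|.
  have B s : Num.min p1 q1' <= s <= Num.max p1 q1' -> `|(s, q2') - (p1, p2)| <= N.
    by move=> /btw_dist b; apply: norm_pair_le => //=; exact: le_trans b N1.
  apply: (@mvt_le (fun s => f (s, q2')) (fun s => px f (s, q2'))) => s /B b.
    by apply: slice_x_derive => //; apply: (D _ (le_lt_trans b q0)).1.
  exact: ltW (Cx _ (le_lt_trans b q1)).
have A2 : `|f (p1, q2') - f (p1, p2) - py f (p1, p2) * (q2' - p2)| <= e / 2 * `|q2' - p2|.
  have B s : Num.min p2 q2' <= s <= Num.max p2 q2' -> `|(p1, s) - (p1, p2)| <= N.
    move=> /btw_dist b; apply: norm_pair_le => //=; last exact: le_trans b N2.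
    by rewrite subrr normr0 normr_ge0.
  apply: (@mvt_le (fun s => f (p1, s)) (fun s => py f (p1, s))) => s /B b.
    by apply: slice_y_derive => //; apply: (D _ (le_lt_trans b q0)).2.
  exact: ltW (Cy _ (le_lt_trans b q2)).
move: A1 A2; set x := (X in `|X| <= _ -> _); set y := (X in _ -> `|X| <= _ -> _) => A1 A2.
have -> : f (q1', q2') - f (p1, p2) - (px f (p1, p2) * (q1' - p1) + py f (p1, p2) * (q2' - p2))
  = x + y by rewrite /x /y; ring.
apply: (le_trans (ler_normD _ _)).
have -> : e * N = e / 2 * N + e / 2 * N by field.
by apply: lerD; [apply: (le_trans A1)|apply: (le_trans A2)]; rewrite ler_wpM2l // ltW.
Qed.

Lemma C1on_partials U f : open U ->
  (forall p, U p -> derivable f p (1, 0) /\ derivable f p (0, 1)) ->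
  (forall p, U p -> {for p, continuous (px f)}) ->
  (forall p, U p -> {for p, continuous (py f)}) -> C1on U f.
Proof.
move=> oU D Cx Cy p Up; split; [|exact: Cx|exact: Cy].
apply: partials_dif; [|exact: Cx|exact: Cy].
by apply: filterS (open_nbhs_nbhs (conj oU Up)) => q /D.
Qed.

Lemma class_nat1_C1on U f : open U -> class_nat 1 U f -> C1on U f.
Proof. by move=> oU [_ D [Cx _] [Cy _]]; exact: C1on_partials. Qed.

Lemma near_continuous (V W : normedModType R) (f g : V -> W) (p : V) :
  (\forall q \near p, f q = g q) -> {for p, continuous f} -> {for p, continuous g}.
Proof.
move=> /near_normP[d1 d10 E] /continuousP_eps H; apply/continuousP_eps => e /H [d2 d20 {}H].
exists (Num.min d1 d2); first by rewrite lt_min d10.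
move=> q; rewrite lt_min => /andP[q1 q2].
by rewrite -(E q) // -(E p) ?subrr ?normr0 //; exact: H.
Qed.

(** Any continuous gradient produced by the rules of calculus will do: it agrees with [px f] and
    [py f] on the open set. *)
Lemma C1on_dif U f (a b : R * R -> R) : open U ->
  (forall p, U p -> dif f p (a p) (b p)) ->
  (forall p, U p -> {for p, continuous a}) -> (forall p, U p -> {for p, continuous b}) ->
  C1on U f.
Proof.
move=> oU D Ca Cb p Up.
have nU := open_nbhs_nbhs (conj oU Up).
split; first by have [_ ->] := dif_px (D _ Up); have [_ ->] := dif_py (D _ Up); exact: D.
  by apply: near_continuous (Ca _ Up); apply: filterS nU => q /D /dif_px[_ ->].
by apply: near_continuous (Cb _ Up); apply: filterS nU => q /D /dif_py[_ ->].
Qed.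

Lemma continuous_add (f g : R * R -> R) p : {for p, continuous f} ->
  {for p, continuous g} -> {for p, continuous (fun q => f q + g q)}.
Proof. by move=> *; exact: continuousD. Qed.

Lemma continuous_mul (f g : R * R -> R) p : {for p, continuous f} ->
  {for p, continuous g} -> {for p, continuous (fun q => f q * g q)}.
Proof. by move=> *; exact: continuousM. Qed.

Lemma continuous_at_comp (F : R * R -> R * R) (f : R * R -> R) p :
  {for p, continuous F} -> {for F p, continuous f} -> {for p, continuous (fun q => f (F q))}.
Proof. by move=> cF cf; exact: (@continuous_comp _ _ _ F f p cF cf). Qed.

Lemma C1on_continuous U f p : C1on U f -> U p -> {for p, continuous f}.
Proof. by move=> H /H [/dif_continuous]. Qed.

Lemma C1onD U f g : open U -> C1on U f -> C1on U g -> C1on U (fun q => f q + g q).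
Proof.
move=> oU Hf Hg; apply: (C1on_dif (a := fun q => px f q + px g q)
  (b := fun q => py f q + py g q)) => // p Up; have [f1 f2 f3] := Hf p Up;
  have [g1 g2 g3] := Hg p Up; [exact: difD|exact: continuous_add|exact: continuous_add].
Qed.

Lemma C1onM U f g : open U -> C1on U f -> C1on U g -> C1on U (fun q => f q * g q).
Proof.
move=> oU Hf Hg; apply: (C1on_dif (a := fun q => px f q * g q + f q * px g q)
  (b := fun q => py f q * g q + f q * py g q)) => // p Up; have [f1 f2 f3] := Hf p Up;
  have [g1 g2 g3] := Hg p Up; first exact: difM;
  by apply: continuous_add; apply: continuous_mul => //;
    [exact: dif_continuous g1|exact: dif_continuous f1].
Qed.

Lemma C1on_cst U (c : R) : open U -> C1on U (fun=> c).
Proof.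
move=> oU; apply: (C1on_dif (a := fun=> 0) (b := fun=> 0)) => // p _;
  [exact: dif_cst|exact: cst_continuous|exact: cst_continuous].
Qed.

Lemma C1onN U f : open U -> C1on U f -> C1on U (fun q => - f q).
Proof.
move=> oU Hf; have := C1onM oU (C1on_cst (-1) oU) Hf.
by under [fun q => -1 * _]eq_fun do rewrite mulN1r.
Qed.

Lemma C1on_sub U V f : V `<=` U -> C1on U f -> C1on V f.
Proof. by move=> VU H p /VU /H. Qed.

Lemma continuous_pair (F : R * R -> R * R) p : {for p, continuous (fun q => (F q).1)} ->
  {for p, continuous (fun q => (F q).2)} -> {for p, continuous F}.
Proof.
move=> /continuousP_eps H1 /continuousP_eps H2; apply/continuousP_eps => e e0.
have [d1 d10 {}H1] := H1 e e0; have [d2 d20 {}H2] := H2 e e0.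
exists (Num.min d1 d2); first by rewrite lt_min d10.
move=> q; rewrite lt_min => /andP[/H1 h1 /H2 h2].
exact: norm_pair_lt.
Qed.

Definition C1map U (F : R * R -> R * R) :=
  C1on U (fun q => (F q).1) /\ C1on U (fun q => (F q).2).

Lemma C1map_continuous U F p : C1map U F -> U p -> {for p, continuous F}.
Proof.
move=> [H1 H2] Up; apply: continuous_pair; first exact: C1on_continuous H1 Up.
exact: C1on_continuous H2 Up.
Qed.

Lemma dif_mapcomp (f : R * R -> R) (F : R * R -> R * R) U p a b : C1map U F -> U p ->
  dif f (F p) a b ->
  dif (f \o F) p (a * jac11 F p + b * jac21 F p) (a * jac12 F p + b * jac22 F p).
Proof.
by move=> [F1 F2] Up df; have [? _ _] := F1 _ Up; have [? _ _] := F2 _ Up; exact: dif_compT.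
Qed.

Lemma C1on_comp U V f F : open U -> C1map U F -> (forall p, U p -> V (F p)) -> C1on V f ->
  C1on U (f \o F).
Proof.
move=> oU HF UV Hf; have [F1 F2] := HF.
apply: (C1on_dif (a := fun p => px f (F p) * jac11 F p + py f (F p) * jac21 F p)
  (b := fun p => px f (F p) * jac12 F p + py f (F p) * jac22 F p)) => // p Up;
  have [f1 f2 f3] := Hf _ (UV _ Up); have cF := C1map_continuous HF Up;
  have [_ c11 c12] := F1 _ Up; have [_ c21 c22] := F2 _ Up.
- exact: (dif_mapcomp HF Up f1).
- exact: (continuous_add (continuous_mul (continuous_at_comp cF f2) c11)
    (continuous_mul (continuous_at_comp cF f3) c21)).
- exact: (continuous_add (continuous_mul (continuous_at_comp cF f2) c12)
    (continuous_mul (continuous_at_comp cF f3) c22)).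
Qed.

Lemma C1on_near U f g : open U -> (forall p, U p -> f p = g p) -> C1on U f -> C1on U g.
Proof.
move=> oU E Hf; apply: (C1on_dif (a := px f) (b := py f)) => // p Up;
  have [f1 f2 f3] := Hf p Up => //.
apply: dif_near f1; apply: filterS (open_nbhs_nbhs (conj oU Up)) => q; exact: E.
Qed.

End PlaneCalculus.

(** * Primitives with parameters and functions with a prescribed mixed derivative *)

Section Primitives.
Variable R : realType.

Lemma mvt_cst (c d : R -> R) (v : R -> R) (a b : R) :
  (forall s, Num.min a b <= s <= Num.max a b -> is_derive s 1 c (v s)) ->
  (forall s, Num.min a b <= s <= Num.max a b -> is_derive s 1 d (v s)) ->
  c b - c a = d b - d a.
Proof.
move=> Hc Hd; have := @mvt_le R (c - d) (fun s => v s - v s) a b 0 0.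
rewrite mul0r mul0r subr0 => H; apply/eqP; rewrite -subr_eq0 -normr_le0.
have -> : c b - c a - (d b - d a) = (c - d) b - (c - d) a.
  by rewrite !fctE; ring.
apply: H => s ab; last by rewrite subrr subr0 normr0.
by apply: is_deriveB; [exact: Hc|exact: Hd].
Qed.

Lemma primitive_exists (c : R -> R) : continuous c ->
  exists C : R -> R, (forall t : R, is_derive t 1 C (c t)) /\ C 0 = 0.
Proof.
move=> cc; pose I (a t : R) := \int[@lebesgue_measure R]_(x in [set` `[a, t]]) c x.
have dI (a t : R) : a < t -> is_derive t 1 (I a) (c t).
  move=> at_.
  have tu : t < t + 1 by rewrite ltrDl.
  have ci : (@lebesgue_measure R).-integrable `[a, t + 1] (EFin \o c).
    apply: continuous_compact_integrable; first exact: segment_compact.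
    by apply: continuous_subspaceT => x; exact: cc.
  have [d1] := @continuous_FTC1_closed R c a t (t + 1) tu ci at_ (cc t).
  by rewrite derive1E => d2; exact: (@DeriveDef _ _ _ _ _ _ _ d1 d2).
(* Integration from a base point is a primitive only to the right of it. The base point moves with t
   so as to stay below both t and 0; by [CE] the value does not depend on it. *)
pose n (t : R) := - (`|t| + 1).
have nt (t s : R) : `|s| <= `|t| -> n t < s.
  move=> st; rewrite /n ltrNl; have := ler_norm (- s); rewrite normrN => h.
  by rewrite (le_lt_trans h) // (le_lt_trans st) // ltrDl.
pose C (t : R) := I (n t) t - I (n t) 0.
have CE (a t : R) : a < t -> a < 0 -> C t = I a t - I a 0.
  move=> at_ a0; rewrite /C; apply: (@mvt_cst _ _ c) => s /andP[h1 _]; apply: dI.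
    by apply: lt_le_trans h1; rewrite lt_min nt ?normr0 // nt.
  by apply: lt_le_trans h1; rewrite lt_min a0.
exists C; split; last by rewrite /C subrr.
move=> t; pose a := - (`|t| + 2).
have at1 : a + 1 <= t.
  by rewrite /a; have := ler_norm (- t); rewrite normrN; lra.
have a1 : a + 1 <= 0 by rewrite /a; have := normr_ge0 t; lra.
have H : is_derive t 1 (fun s => I a s - I a 0) (c t).
  have -> : c t = c t - 0 by rewrite subr0.
  by apply: is_deriveB; apply: dI; lra.
move/is_deriveP: H => H; apply/is_deriveP => e e0; have [d d0 {}H] := H e e0.
exists (Num.min d 1); first by rewrite lt_min d0 ltr01.
move=> s; rewrite lt_min => /andP[sd s1].
by rewrite (CE a s) ?(CE a t) ?H //; move: s1; rewrite ltr_norml => /andP[]; lra.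
Qed.

(** The tube lemma: continuity at the points of {x} x K alone gives closeness uniform over the
    compact set K. *)
Lemma compact_tube (T : topologicalType) (f : R -> T -> R) (x : R) (K : set T) :
  compact K ->
  (forall y, K y -> {for (x, y), continuous (fun q => f q.1 q.2)}) ->
  forall e : R, 0 < e -> exists2 d : R, 0 < d &
    forall x' y, `|x' - x| < d -> K y -> `|f x' y - f x y| <= e.
Proof.
move=> /compact_near_coveringP cK cf e e0.
have [|d d0 H] := (near_normP x (fun x' => K `<=` (fun y => `|f x' y - f x y| <= e))).1.
  apply: (cK R (nbhs x) (fun x' y => is_true (`|f x' y - f x y| <= e)) _) => y Ky.
  have e20 : 0 < e / 2 by rewrite divr_gt0.
  have /cvgrPdist_lt /(_ _ e20) [[A B] [/= nA nB] AB] := cf y Ky.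
  exists (B, A); first by split.
  move=> [y' x'] [/= By' Ax'].
  have h1 := AB (x', y') (conj Ax' By').
  have h2 := AB (x, y') (conj (nbhs_singleton nA) By').
  rewrite /= in h1 h2.
  have -> : f x' y' - f x y' = (f x y - f x y') - (f x y - f x' y') by ring.
  apply: (le_trans (ler_normB _ _)).
  by rewrite [e]splitr lerD // ltW.
by exists d => // x' y xd; exact: H.
Qed.

Lemma btw_compact (a b : R) : compact [set s | Num.min a b <= s <= Num.max a b].
Proof.
suff -> : [set s | Num.min a b <= s <= Num.max a b] = [set` `[Num.min a b, Num.max a b]].
  exact: segment_compact.
by apply/seteqP; split=> s; rewrite /= in_itv.
Qed.

(** Differentiation under the integral sign, the integrals being replaced by primitives in s that
    vanish at y0. The s-derivative of the remainder [D] is a remainder of f in x, which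
    [compact_tube] makes uniformly small. *)
Lemma derive_under_primitive (f f1 F F1 : R -> R -> R) (x y0 y e0 : R) : 0 < e0 ->
  let K := [set s | Num.min y0 y <= s <= Num.max y0 y] in
  (forall x' s, `|x' - x| < e0 -> K s -> is_derive x' 1 (fun z => f z s) (f1 x' s)) ->
  (forall s, K s -> {for (x, s), continuous (fun q => f1 q.1 q.2)}) ->
  (forall x' s, `|x' - x| < e0 -> K s -> is_derive s 1 (F x') (f x' s)) ->
  (forall x', `|x' - x| < e0 -> F x' y0 = 0) ->
  (forall s, K s -> is_derive s 1 (F1 x) (f1 x s)) -> F1 x y0 = 0 ->
  is_derive x 1 (fun z => F z y) (F1 x y).
Proof.
move=> e00 K df cf1 dF F0 dF1 F10; apply/is_deriveP => e eg0.
have L0 : 0 < `|y - y0| + 1 by rewrite ltr_wpDl.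
have [d d0 T] := compact_tube (@btw_compact y0 y) cf1 (divr_gt0 eg0 L0).
exists (Num.min d e0); first by rewrite lt_min d0.
move=> x'; rewrite lt_min => /andP[xd xe].
pose D s := F x' s - F x s - F1 x s * (x' - x).
have B : `|D y - D y0 - 0 * (y - y0)| <= (e / (`|y - y0| + 1) * `|x' - x|) * `|y - y0|.
  apply: (@mvt_le R D (fun s => f x' s - f x s - f1 x s * (x' - x))) => s Ks.
    apply: is_deriveB; first by apply: is_deriveB; apply: dF => //; rewrite subrr normr0.
    have -> : (fun s => F1 x s * (x' - x)) = (x' - x) \*: F1 x.
      by apply/funext => z; rewrite /= mulrC.
    rewrite mulrC; apply: is_deriveZ; exact: dF1.
  rewrite subr0; apply: (@mvt_le _ (fun z => f z s) (fun z => f1 z s)) => z zx.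
    by apply: df => //; apply: le_lt_trans (btw_dist zx) xe.
  by apply: T => //; exact: le_lt_trans (btw_dist zx) xd.
move: B; rewrite /D mul0r subr0 /= (F0 _ xe) (F0 x) ?subrr ?normr0 // F10 mul0r !subr0.
move=> /le_trans; apply.
rewrite -mulrA [X in _ * X]mulrC mulrA ler_wpM2r // mulrAC ler_pdivrMr // ler_wpM2l ?ltW //.
by rewrite ltrDl.
Qed.

Lemma mvt_upper (c c' : R -> R) (a b B : R) : a <= b ->
  (forall s, a <= s <= b -> is_derive s 1 c (c' s)) ->
  (forall s, a <= s <= b -> c' s <= B) -> c b - c a <= B * (b - a).
Proof.
move=> ab D Bd; have [||x xab ->] := @MVT_segment _ c c' a b ab.
- by move=> x; rewrite in_itv/= => /andP[/ltW ax /ltW xb]; apply: D; rewrite ax.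
- by apply: derivable_within_continuous => x; rewrite in_itv/= => /D [].
by move: xab; rewrite in_itv/= => /Bd H; rewrite ler_wpM2r // subr_ge0.
Qed.

Lemma continuous_parametric_primitive (g G : R -> R -> R) :
  continuous (fun q : R * R => g q.1 q.2) ->
  (forall x y : R, is_derive y 1 (G x) (g x y)) -> (forall x, G x 0 = 0) ->
  continuous (fun q : R * R => G q.1 q.2).
Proof.
move=> cg dG G0 [x y]; apply/continuousP_eps => e e0.
have y1 : 0 < `|y| + 1 by rewrite ltr_wpDl.
have e40 : 0 < e / 4 by rewrite divr_gt0.
have [d1 d10 T] := @compact_tube R g x _ (@btw_compact 0 y)
  (fun z _ => cg (x, z)) _ (divr_gt0 e40 y1).
have /continuousP_eps /(_ 1 ltr01) [d2 d20 B] := cg (x, y).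
pose M := `|g x y| + 1.
have M0 : 0 < M by rewrite /M ltr_wpDl.
exists (Num.min (Num.min d1 d2) (e / 4 / M)); first by rewrite !lt_min d10 d20 divr_gt0.
move=> [x' y']; rewrite !lt_min => /andP[/andP[q1 q2] q3] /=.
have h1 := norm_fst_le ((x', y') - (x, y)); have h2 := norm_snd_le ((x', y') - (x, y)).
rewrite /= in h1 h2.
have E1 : `|G x' y - G x y| <= e / 4.
  pose D s := G x' s - G x s.
  have : `|D y - D 0 - 0 * (y - 0)| <= (e / 4 / (`|y| + 1)) * `|y - 0|.
    apply: (@mvt_le R D (fun s => g x' s - g x s)) => s Ks.
    by rewrite subr0; apply: T => //; exact: le_lt_trans h1 q1.
  rewrite /D !G0 mul0r !subr0 => /le_trans; apply.
  by rewrite mulrAC ler_pdivrMr // ler_wpM2l ?lerDl // ltW.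
have E2 : `|G x' y' - G x' y| <= e / 4.
  have : `|G x' y' - G x' y - 0 * (y' - y)| <= M * `|y' - y|.
    apply: (@mvt_le R _ (fun s => g x' s)) => s /btw_dist Ks.
    rewrite subr0 /M addrC -lerBlDr; apply: (le_trans (lerB_dist _ _)); apply: ltW.
    apply: (B (x', s)); apply: le_lt_trans q2; apply: norm_pair_le => //=.
    exact: le_trans Ks h2.
  rewrite mul0r subr0 => /le_trans; apply.
  by rewrite mulrC -ler_pdivlMr //; exact: le_trans h2 (ltW q3).
have -> : G x' y' - G x y = (G x' y' - G x' y) + (G x' y - G x y) by ring.
by apply: (le_lt_trans (ler_normD _ _)); move: E1 E2; lra.
Qed.

(** The mixed derivative of W is g, in the order y then x. Averages of g over squares become
    differences of W, and no double integral is needed to mollify. *)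
Definition double_primitive (W g : R * R -> R) := exists X : R -> R -> R,
  (forall x y : R, is_derive y 1 (fun s => W (x, s)) (X x y)) /\
  (forall x y : R, is_derive x 1 (fun s => X s y) (g (x, y))).

Lemma double_primitive_exists (g : R * R -> R) : continuous g ->
  exists W, double_primitive W g /\ C1on setT W.
Proof.
move=> cg.
have cgx (y : R) : continuous (fun x : R => g (x, y)).
  move=> x; apply/continuousP_eps => e e0; have /continuousP_eps /(_ e e0)[d d0 H] := cg (x, y).
  exists d => // x' xd; apply: H; apply: norm_pair_lt => //=; by rewrite subrr normr0.
have cgy (x : R) : continuous (fun y : R => g (x, y)).
  move=> y; apply/continuousP_eps => e e0; have /continuousP_eps /(_ e e0)[d d0 H] := cg (x, y).
  exists d => // y' yd; apply: H; apply: norm_pair_lt => //=; by rewrite subrr normr0.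
have [X' HX] := choice (fun y => primitive_exists (cgx y)).
have [Y HY] := choice (fun x => primitive_exists (cgy x)).
pose X x y := X' y x.
have cg' : continuous (fun q : R * R => g (q.1, q.2)).
  by have -> : (fun q : R * R => g (q.1, q.2)) = g by apply/funext => -[].
have cX : continuous (fun q : R * R => X q.1 q.2).
  have H : continuous (fun q : R * R => X' q.1 q.2).
    apply: (@continuous_parametric_primitive (fun y x => g (x, y))).
    - move=> q; apply: continuous_at_comp (cg _).
      by apply: continuous_pair; [exact: cvg_snd|exact: cvg_fst].
    - by move=> x y; exact: (HX x).1.
    - by move=> x; exact: (HX x).2.
  move=> q; apply: (continuous_at_comp (f := fun q : R * R => X' q.1 q.2)
    (F := fun q : R * R => (q.2, q.1))) (H _).
  by apply: continuous_pair; [exact: cvg_snd|exact: cvg_fst].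
have cY : continuous (fun q : R * R => Y q.1 q.2).
  apply: (@continuous_parametric_primitive (fun x y => g (x, y))) => //.
  - by move=> x y; exact: (HY x).1.
  - by move=> x; exact: (HY x).2.
have cXx (x : R) : continuous (X x).
  move=> y; apply/continuousP_eps => e e0; have /continuousP_eps /(_ e e0)[d d0 H] := cX (x, y).
  by exists d => // y' yd; apply: (H (x, y')); apply: norm_pair_lt => //=; rewrite subrr normr0.
(* W integrates X in y. Its other partial derivative is Y, the primitive of g in y, by
   differentiation under the primitive; both partials are continuous, so W is C^1. *)
have [W HW] := choice (fun x => primitive_exists (cXx x)).
have dWy (x y : R) : is_derive y 1 (W x) (X x y) by exact: (HW x).1.
have dXx (x y : R) : is_derive x 1 (fun s => X s y) (g (x, y)) by exact: (HX y).1.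
have dWx (x y : R) : is_derive x 1 (fun s => W s y) (Y x y).
  have H := @derive_under_primitive X (fun x y => g (x, y)) W Y x 0 y 1 ltr01; apply: H => //.
  - by move=> s _; exact: cg'.
  - by move=> x' _; exact: (HW x').2.
  - by move=> s _; exact: (HY x).1.
  - exact: (HY x).2.
exists (fun q => W q.1 q.2); split; first by exists X.
have eX (q : R * R) : is_derive q ((1, 0) : R * R) (fun q => W q.1 q.2) (Y q.1 q.2).
  case: q => x y; have /is_deriveP H := dWx x y; apply/directional_derivativeP => e /H [d d0 {}H].
  exists d => // h hd; have := H (h + x); rewrite addrK => /(_ hd).
  by rewrite /= /GRing.scale /= mulr1 mulr0 add0r [h * _]mulrC.
have eY (q : R * R) : is_derive q ((0, 1) : R * R) (fun q => W q.1 q.2) (X q.1 q.2).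
  case: q => x y; have /is_deriveP H := dWy x y; apply/directional_derivativeP => e /H [d d0 {}H].
  exists d => // h hd; have := H (h + y); rewrite addrK => /(_ hd).
  by rewrite /= /GRing.scale /= mulr1 mulr0 add0r [h * _]mulrC.
apply: C1on_partials; first exact: openT.
- by move=> p _; split; [case: (eX p)|case: (eY p)].
- move=> p _; have -> : px (fun q => W q.1 q.2) = (fun q => Y q.1 q.2).
    by apply/funext => q; case: (eX q).
  exact: cY.
- move=> p _; have -> : py (fun q => W q.1 q.2) = (fun q => X q.1 q.2).
    by apply/funext => q; case: (eY q).
  exact: cX.
Qed.

(** For a double primitive W of g this is the integral of g over the square of side h with lower
    left corner p. *)
Definition second_difference (W : R * R -> R) (h : R) (p : R * R) : R :=
  W (p.1 + h, p.2 + h) - W (p.1, p.2 + h) - (W (p.1 + h, p.2) - W (p.1, p.2)).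

Lemma second_difference_le (W g : R * R -> R) (h B : R) p : double_primitive W g -> 0 <= h ->
  (forall q, `|q - p| <= h -> g q <= B) -> second_difference W h p <= B * h * h.
Proof.
move=> [X [dW dX]] h0 gB; case: p gB => x y gB /=.
pose D s := W (x + h, s) - W (x, s).
have := @mvt_upper D (fun s => X (x + h) s - X x s) y (y + h) (B * h).
rewrite /D /second_difference /= [y + h - y]addrC addKr.
apply; first by rewrite lerDl.
move=> s ys; have := @mvt_upper (fun z => X z s) (fun z => g (z, s)) x (x + h) B.
rewrite [x + h - x]addrC addKr; apply; first by rewrite lerDl.
move=> z xz; apply: gB; apply: norm_pair_le => /=; rewrite ger0_norm; lra.
Qed.

Lemma double_primitiveB W1 W2 g1 g2 : double_primitive W1 g1 -> double_primitive W2 g2 ->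
  double_primitive (fun q => W1 q - W2 q) (fun q => g1 q - g2 q).
Proof.
move=> [X1 [a1 b1]] [X2 [a2 b2]]; exists (fun x y => X1 x y - X2 x y).
by split=> x y; apply: is_deriveB.
Qed.

Lemma double_primitive_shift W g (v : R * R) : double_primitive W g ->
  double_primitive (fun q => W (q + v)) (fun q => g (q + v)).
Proof.
have sh (c : R -> R) (t a l : R) : is_derive (t + a) 1 c l -> is_derive t 1 (fun s => c (s + a)) l.
  move=> /is_deriveP H; apply/is_deriveP => e /H [d d0 {}H]; exists d => // s sd.
  by have := H (s + a); rewrite opprD addrACA subrr addr0 => /(_ sd).
move=> [X [a b]]; exists (fun x y => X (x + v.1) (y + v.2)); split=> x y.
  exact: (sh (fun s => W (x + v.1, s))).
exact: (sh (fun s => X s (y + v.2))).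
Qed.

End Primitives.

(** * Integration in the plane *)

Section PlaneIntegral.
Variable R : realType.
Notation leb := (@lebesgue_measure R).
Local Notation plane := (measurableTypeR R * measurableTypeR R)%type.
Local Notation meas A := (measurable (A : set plane)).
Local Notation mfun A f := (measurable_fun (A : set plane) (f : plane -> R)).

(** Measurability refers to the product sigma-algebra, so U is exhausted by the countably many boxes
    with rational corners that it contains. *)
Lemma open_prod_measurable (U : set (R * R)) : open U -> meas U.
Proof.
move=> oU.
pose box (r : (rat * rat) * (rat * rat)) : set (R * R) :=
  [set` `]ratr r.1.1, ratr r.1.2[] `*` [set` `]ratr r.2.1, ratr r.2.2[].
pose F n := if unpickle n is Some r then
  if `[< box r `<=` U >] then box r else set0 else set0.
have -> : U = \bigcup_n F n.
  apply/seteqP; split=> [p Up|p [n _]]; last first.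
    by rewrite /F; case: unpickle => // r; case: asboolP => // + /[dup] _ => /[apply].
  have /near_normP[d d0 H] := open_nbhs_nbhs (conj oU Up).
  have l (x : R) : x - d < x by rewrite ltrBlDr ltrDl.
  have r (x : R) : x < x + d by rewrite ltrDl.
  have [a] := rat_in_itvoo (l p.1); have [b] := rat_in_itvoo (r p.1).
  have [a'] := rat_in_itvoo (l p.2); have [b'] := rat_in_itvoo (r p.2).
  rewrite !in_itv /= => /andP[b1 b2] /andP[a1 a2] /andP[b3 b4] /andP[a3 a4].
  exists (pickle ((a, b), (a', b'))); first by [].
  rewrite /F pickleK; case: asboolP => [_|[]].
    by split; rewrite /= in_itv /= ?a4 ?b3 ?a2 ?b1.
  move=> q [/=]; rewrite !in_itv /= => /andP[q1 q2] /andP[q3 q4].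
  by apply: H; apply: norm_pair_lt; rewrite /= ltr_norml; lra.
apply: bigcupT_measurable => n; rewrite /F; case: unpickle => [r|]; last exact: measurable0.
case: asboolP => _; last exact: measurable0.
by apply: measurableX; exact: measurable_itv.
Qed.

Lemma open_measurable_prod_fun (U : set (R * R)) (f : R * R -> R) : open U ->
  (forall p, U p -> {for p, continuous f}) -> mfun U f.
Proof.
move=> oU cf; apply: (measurability _ (RGenOpens.measurableE R)).
move=> _ [_ [a [b ->] <-]]; apply: open_prod_measurable.
rewrite openE => p [Up fp]; apply: filterI; first exact: open_nbhs_nbhs.
by apply: (cf p Up); apply: open_nbhs_nbhs; split => //; exact: interval_open.
Qed.

Lemma continuous_measurable_prod_fun (f : R * R -> R) : continuous f -> mfun setT f.
Proof. by move=> cf; exact: (open_measurable_prod_fun (@openT _) (fun p _ => cf p)). Qed.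

Definition cbox (N : R) : set (R * R) := [set p | `|p| <= N].

Lemma cboxE N : cbox N = [set` `[- N, N]] `*` [set` `[- N, N]].
Proof.
apply/seteqP; split=> p /=; rewrite /cbox /= norm_pairE ge_max !in_itv /= -!ler_norml.
  by move=> /andP.
by case=> -> ->.
Qed.

Lemma cbox_compact N : compact (cbox N).
Proof. by rewrite cboxE; apply: compact_setX; exact: segment_compact. Qed.

Lemma cbox_measurable N : meas (cbox N).
Proof. by rewrite cboxE; apply: measurableX; exact: measurable_itv. Qed.

Lemma leb_itvN (N : R) : 0 <= N -> leb [set` `[- N, N]] = (N *+ 2)%:E.
Proof.
move=> N0; rewrite lebesgue_measure_itv /= lte_fin; case: ifPn.
  by move=> _; rewrite -EFinD opprK -mulr2n.
rewrite -leNgt => N1; have -> : N = 0 by apply/eqP; rewrite eq_le N0 andbT; lra.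
by rewrite mul0rn.
Qed.

Lemma cbox_leb N : 0 <= N -> leb2 (cbox N) = (N *+ 2 * N *+ 2)%:E.
Proof.
move=> N0; rewrite cboxE /leb2 product_measure1E; [|exact: measurable_itv|exact: measurable_itv].
by have E := leb_itvN N0; rewrite [X in (X * _)%E]E [X in (_ * X)%E]E -EFinM mulrnAr.
Qed.

Definition cc (f : R * R -> R) (N : R) :=
  [/\ 0 <= N, continuous f & forall p, N < `|p| -> f p = 0].

Lemma compact_bounded_fun (T : topologicalType) (K : set T) (f : T -> R) : compact K ->
  (forall p, K p -> {for p, continuous f}) -> exists2 B : R, 0 <= B & forall p, K p -> `|f p| <= B.
Proof.
move=> /compact_near_coveringP cK cf.
have [B [_ HB]] : \forall B \near +oo, K `<=` (fun p => is_true (`|f p| <= B)).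
  apply: (cK R (+oo) (fun B p => is_true (`|f p| <= B)) _) => p Kp.
  have /cvgrPdist_lt /(_ 1 ltr01) nA := cf p Kp.
  exists ([set q | `|f p - f q| < 1], [set B | `|f p| + 1 < B]).
    by split => //=; exists (`|f p| + 1); split=> //; rewrite num_real.
  move=> [q B] /= [h1 h2]; apply: ltW; apply: le_lt_trans h2.
  rewrite -(subKr (f p) (f q)); apply: (le_trans (ler_normB _ _)).
  by rewrite lerD2l ltW.
exists (`|B| + 1); first by rewrite addr_ge0.
by apply: HB; rewrite (le_lt_trans (ler_norm B)) // ltrDl.
Qed.

Lemma cc_bounded f N : cc f N -> exists2 B : R, 0 <= B & forall p, `|f p| <= B.
Proof.
move=> [N0 cf f0]; have [B B0 H] := compact_bounded_fun (cbox_compact (N := N)) (fun p _ => cf p).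
exists B => // p; have [pN|pN] := leP `|p| N; first exact: H.
by rewrite f0 // normr0.
Qed.

Lemma cc_measurable f N : cc f N -> mfun setT f.
Proof. by move=> [_ cf _]; exact: continuous_measurable_prod_fun. Qed.

Lemma bounded_support_integrable (f : R * R -> R) (A : set (R * R)) (N B : R) : meas A ->
  mfun A f -> 0 <= N -> (forall p, A p -> N < `|p| -> f p = 0) ->
  (forall p, A p -> `|f p| <= B) -> (@leb2 R).-integrable A (EFin \o f).
Proof.
move=> mA mf N0 f0 fB.
have mB := cbox_measurable N.
have fin : (leb2 (cbox N) < +oo)%E by rewrite cbox_leb // ltry.
have iB : (@leb2 R).-integrable (cbox N) (EFin \o cst B).
  apply: measurable_bounded_integrable => //.
  by exists `|B|; split; rewrite ?num_real // => M /ltW BM p _ /=.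
have iB' := (integrable_mkcond _ mB).1 iB.
apply: (@le_integrable _ _ _ _ _ mA _ ((EFin \o cst B) \_ (cbox N))).
- exact/measurable_EFinP.
- move=> p Ap; rewrite patchE; case: ifPn => [_|pN].
    by rewrite /= lee_fin; apply: (le_trans (fB _ Ap)); exact: ler_norm.
  rewrite /= f0 ?normr0 // ltNge; apply: contra pN => pN; by rewrite inE.
exact: (@integrableS _ _ _ _ setT).
Qed.

Lemma cc_integrable f N : cc f N -> (@leb2 R).-integrable setT (EFin \o f).
Proof.
move=> Hf; have [B B0 fB] := cc_bounded Hf; have [N0 _ f0] := Hf.
apply: (bounded_support_integrable (N := N) (B := B)) => //.
- exact: cc_measurable Hf.
- by move=> p _; exact: f0.
Qed.

Definition I2 (f : R * R -> R) : R := \int[@leb2 R]_p f p.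

Lemma ccD f g N : cc f N -> cc g N -> cc (fun p => f p + g p) N.
Proof.
move=> [N0 cf f0] [_ cg g0]; split=> // [p|p pN]; first exact: continuous_add (cf p) (cg p).
by rewrite f0 // g0 // addr0.
Qed.

Lemma ccM (f g : R * R -> R) N : cc f N -> continuous g -> cc (fun p => f p * g p) N.
Proof.
move=> [N0 cf f0] cg; split=> // [p|p pN]; first exact: continuous_mul (cf p) (cg p).
by rewrite f0 // mul0r.
Qed.

Lemma ccZ (k : R) f N : cc f N -> cc (fun p => k * f p) N.
Proof.
move=> [N0 cf f0]; split=> // [p|p pN]; last by rewrite f0 // mulr0.
by apply: continuous_mul (cf p); exact: cst_continuous.
Qed.

Lemma I2D f g N : cc f N -> cc g N -> I2 (fun p => f p + g p) = I2 f + I2 g.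
Proof. by move=> Hf Hg; apply: RintegralD => //; [exact: cc_integrable Hf|exact: cc_integrable Hg]. Qed.

Lemma I2Z (k : R) f N : cc f N -> I2 (fun p => k * f p) = k * I2 f.
Proof. by move=> Hf; apply: RintegralZl => //; exact: (cc_integrable Hf). Qed.

Lemma I2B f g N : cc f N -> cc g N -> I2 (fun p => f p - g p) = I2 f - I2 g.
Proof. by move=> Hf Hg; apply: RintegralB => //; [exact: cc_integrable Hf|exact: cc_integrable Hg]. Qed.

Lemma I2_le f g N : cc f N -> cc g N -> (forall p, f p <= g p) -> I2 f <= I2 g.
Proof.
move=> Hf Hg fg; apply: le_Rintegral => //; [exact: (cc_integrable Hf)|exact: (cc_integrable Hg)].
Qed.

Lemma cc_norm f N : cc f N -> cc (fun p => `|f p|) N.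
Proof.
move=> [N0 cf f0]; split=> // [p|p pN]; last by rewrite f0 // normr0.
exact: (continuous_comp (cf p) (@norm_continuous _ _ (f p))).
Qed.

Lemma I2_norm f N : cc f N -> `|I2 f| <= I2 (fun p => `|f p|).
Proof. by move=> Hf; apply: le_normr_Rintegral => //; exact: (cc_integrable Hf). Qed.

Lemma I2_bound f N (B : R) : cc f N -> (forall p, `|f p| <= B) -> `|I2 f| <= B * (N *+ 2 * N *+ 2).
Proof.
move=> Hf fB; apply: (le_trans (I2_norm Hf)).
have [N0 cf f0] := Hf.
have E : I2 (fun p => `|f p|) = \int[@leb2 R]_(p in cbox N) `|f p|.
  rewrite [RHS]Rintegral_mkcond; apply: eq_Rintegral => p _; rewrite patchE.
  case: ifPn => // pN; rewrite f0 ?normr0 // ltNge; apply: contra pN => pN.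
  by rewrite inE.
have B0 : 0 <= B by exact: le_trans (fB (0, 0)).
have fin : (leb2 (cbox N) < +oo)%E by rewrite cbox_leb // ltry.
rewrite E; have -> : B * (N *+ 2 * N *+ 2) = \int[@leb2 R]_(p in cbox N) (cst B) p.
  rewrite Rintegral_cst; last exact: cbox_measurable.
  exact: (f_equal (fun z => B * fine z) (esym (cbox_leb N0))).
apply: le_Rintegral => //.
- exact: cbox_measurable.
- apply: (@integrableS _ _ _ _ setT) => //; first exact: cbox_measurable.
  exact: (cc_integrable (cc_norm Hf)).
- apply: measurable_bounded_integrable => //; first exact: cbox_measurable.
  by exists B; split; rewrite ?num_real // => M /ltW BM p _ /=; rewrite ger0_norm.
Qed.

Lemma I2_iterx f N : cc f N ->
  (forall y : R, (\int[leb]_x (f (x, y))%:E)%E = 0%E) -> I2 f = 0.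
Proof.
move=> Hf f0; rewrite /I2 /Rintegral.
have <- := @integral21_prod_meas1 _ _ _ _ _ leb leb (EFin \o f) (cc_integrable Hf).
by rewrite (eq_integral (cst 0%E)) ?integral0 // => y _; exact: f0.
Qed.

Lemma I2_itery f N : cc f N ->
  (forall x : R, (\int[leb]_y (f (x, y))%:E)%E = 0%E) -> I2 f = 0.
Proof.
move=> Hf f0; rewrite /I2 /Rintegral.
have <- := @integral12_prod_meas1 _ _ _ _ _ leb leb (EFin \o f) (cc_integrable Hf).
by rewrite (eq_integral (cst 0%E)) ?integral0 // => y _; exact: f0.
Qed.

Lemma integral_derivative0 (c c' : R -> R) (N : R) : 0 < N -> continuous c' ->
  (forall t : R, is_derive t 1 c (c' t)) -> (forall t, N <= `|t| -> c t = 0) ->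
  (forall t, N < `|t| -> c' t = 0) -> (\int[leb]_t (c' t)%:E)%E = 0%E.
Proof.
move=> N0 cc' dc c0 c'0.
pose J : set R := [set` `[- N, N]].
have -> : (\int[leb]_t (c' t)%:E)%E = (\int[leb]_(t in J) (c' t)%:E)%E.
  rewrite [RHS]integral_mkcond; apply: eq_integral => t _; rewrite patchE.
  case: ifPn => // tN; rewrite c'0 // ltNge; apply: contra tN => tN.
  by rewrite /J inE /= in_itv /= -ler_norml.
rewrite (@continuous_FTC2 R c' c (- N) N).
- by rewrite !c0 ?subee // ?normrN ger0_norm // ltW.
- by rewrite gtrN.
- by apply: continuous_subspaceT => x; exact: cc'.
- split; first by move=> x _; case: (dc x).
  + by apply: cvg_at_right_filter; exact: is_derive1_continuous (dc _).
  + by apply: cvg_at_left_filter; exact: is_derive1_continuous (dc _).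
- by move=> x _; rewrite derive1E; case: (dc x).
Qed.

Lemma slice_cont1 (f : R * R -> R) (y : R) : continuous f -> continuous (fun x : R => f (x, y)).
Proof.
move=> cf x; apply/continuousP_eps => e e0; have /continuousP_eps /(_ e e0)[d d0 H] := cf (x, y).
by exists d => // x' xd; apply: H; apply: norm_pair_lt => //=; rewrite subrr normr0.
Qed.

Lemma slice_cont2 (f : R * R -> R) (x : R) : continuous f -> continuous (fun y : R => f (x, y)).
Proof.
move=> cf y; apply/continuousP_eps => e e0; have /continuousP_eps /(_ e e0)[d d0 H] := cf (x, y).
by exists d => // x' xd; apply: H; apply: norm_pair_lt => //=; rewrite subrr normr0.
Qed.

(** Vanishing already on the boundary of the box, unlike in [cc], makes the endpoint terms of the
    fundamental theorem of calculus zero on every slice. *)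
Definition C1cc (f : R * R -> R) (N : R) := C1on setT f /\ 0 < N /\ forall p, N <= `|p| -> f p = 0.

Lemma C1cc_cc f N : C1cc f N -> cc f N.
Proof.
move=> [H [N0 f0]]; split; [exact: ltW|by move=> p; exact: C1on_continuous H I|].
by move=> p /ltW; exact: f0.
Qed.

Lemma near_norm_gt (p : R * R) (N : R) : N < `|p| -> \forall q \near p, N < `|q|.
Proof.
move=> pN; apply/near_normP; exists (`|p| - N); first by rewrite subr_gt0.
move=> q; rewrite distrC => qp; have := lerB_dist p q; lra.
Qed.

Lemma C1cc_grad f N : C1cc f N -> cc (px f) N /\ cc (py f) N.
Proof.
move=> [H [N0 f0]]; have Z p : N < `|p| -> px f p = 0 /\ py f p = 0.
  move=> pN; have E : \forall q \near p, (fun=> 0) q = f q.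
    by apply: filterS (near_norm_gt pN) => q /ltW /f0 ->.
  have D := dif_near E (dif_cst 0 p).
  by have [_ ->] := dif_px D; have [_ ->] := dif_py D.
split.
  by split; [exact: ltW|move=> p; have [_ h _] := H p I; exact: h|move=> p /Z [h _]; exact: h].
by split; [exact: ltW|move=> p; have [_ _ h] := H p I; exact: h|move=> p /Z [_ h]; exact: h].
Qed.

Lemma I2_px f N : C1cc f N -> I2 (px f) = 0.
Proof.
move=> Hf; have [cx _] := C1cc_grad Hf; have [H [N0 f0]] := Hf; have [_ c1 c2] := cx.
apply: I2_iterx cx _ => y.
have pN (t : R) : `|t| <= `|(t, y)| by exact: (norm_fst_le (t, y)).
apply: (@integral_derivative0 (fun t => f (t, y)) (fun t => px f (t, y)) N N0).
- exact: slice_cont1 c1.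
- by move=> t; have [d _ _] := H (t, y) I; apply: slice_x_derive => //; case: (dif_px d).
- by move=> t tN; apply: f0; exact: le_trans tN (pN t).
- by move=> t tN; apply: c2; exact: lt_le_trans tN (pN t).
Qed.

Lemma I2_py f N : C1cc f N -> I2 (py f) = 0.
Proof.
move=> Hf; have [_ cy] := C1cc_grad Hf; have [H [N0 f0]] := Hf; have [_ c1 c2] := cy.
apply: I2_itery cy _ => x.
have pN (t : R) : `|t| <= `|(x, t)| by exact: (norm_snd_le (x, t)).
apply: (@integral_derivative0 (fun t => f (x, t)) (fun t => py f (x, t)) N N0).
- exact: slice_cont2 c1.
- by move=> t; have [d _ _] := H (x, t) I; apply: slice_y_derive => //; case: (dif_py d).
- by move=> t tN; apply: f0; exact: le_trans tN (pN t).
- by move=> t tN; apply: c2; exact: lt_le_trans tN (pN t).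
Qed.

End PlaneIntegral.

(** * Functions constant along the curves of a vector field *)

Section Transport.
Variable R : realType.
Implicit Types (p q m : R * R).

Definition cball p0 (r : R) : set (R * R) := [set q | `|q - p0| <= r].

Lemma cball_compact p0 r : compact (cball p0 r).
Proof.
have -> : cball p0 r = [set` `[p0.1 - r, p0.1 + r]] `*` [set` `[p0.2 - r, p0.2 + r]].
  apply/seteqP; split=> q /=; rewrite /cball /= norm_pairE ge_max !in_itv /=.
    by move=> /andP[]; rewrite !ler_distl => -> ->.
  by move=> [h1 h2]; rewrite !ler_distl h1 h2.
by apply: compact_setX; exact: segment_compact.
Qed.

Lemma heine (V : normedModType R) (K : set V) (f : V -> R) : compact K ->
  (forall p : V, K p -> {for p, continuous f}) ->
  forall e : R, 0 < e -> exists2 d : R, 0 < d &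
    forall p q : V, K p -> K q -> `|q - p| < d -> `|f q - f p| < e.
Proof.
move=> /compact_near_coveringP cK cf e e0.
have e20 : 0 < e / 2 by rewrite divr_gt0.
have [d /= d0 H] : \forall d \near 0^'+,
    K `<=` (fun p : V => forall q : V, K q -> `|q - p| < d -> `|f q - f p| < e).
  apply: (cK R 0^'+ (fun d (p : V) => forall q : V, K q -> `|q - p| < d -> `|f q - f p| < e) _) => p Kp.
  have /continuousP_eps /(_ _ e20)[d d0 C] := cf p Kp.
  have d20 : 0 < d / 2 by rewrite divr_gt0.
  exists ([set q | `|q - p| < d / 2], [set s | s < d / 2]).
    split => /=; first by apply/near_normP; exists (d / 2).
    exact: nbhs_right_lt.
  move=> [p' s] /= [p'd sd] q Kq qs.
  have -> : f q - f p' = (f q - f p) - (f p' - f p) by ring.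
  apply: (le_lt_trans (ler_normB _ _)); rewrite [e]splitr; apply: ltrD; apply: C.
    have -> : q - p = (q - p') + (p' - p) by rewrite addrA subrK.
    by apply: (le_lt_trans (ler_normD _ _)); rewrite [d]splitr ltrD // (lt_trans qs).
  by apply: (lt_trans p'd); rewrite ltr_pdivrMr // ltr_pMr // ltr1n.
exists (d / 2); first by rewrite divr_gt0.
move=> p q Kp Kq pq; apply: (H (d / 2)) => //=; last by rewrite divr_gt0.
by rewrite sub0r normrN ger0_norm ?ltW ?divr_gt0 // ltr_pdivrMr // ltr_pMr // ltr1n.
Qed.

Lemma local_min_derivative (f : R -> R) (l e : R) : 0 < e -> is_derive (0 : R) (1 : R) f l ->
  (forall t, `|t| < e -> f 0 <= f t) -> l = 0.
Proof.
move=> e0 /is_deriveP H fm; apply/eqP; apply: contraT => l0.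
have l20 : 0 < `|l| / 2 by rewrite divr_gt0 // normr_gt0.
have [d d0 {}H] := H _ l20.
pose s := Num.min d e / 2.
have s0 : 0 < s by rewrite divr_gt0 // lt_min d0.
have m0 : 0 < Num.min d e by rewrite lt_min d0.
have : s < Num.min d e by rewrite /s ltr_pdivrMr //; lra.
rewrite lt_min => /andP[sd se].
have n : `|- Num.sg l * s| = s by rewrite normrM normrN normr_sg l0 mul1r gtr0_norm.
have h1 := fm (- Num.sg l * s); rewrite n in h1; have {}h1 := h1 se.
have h2 := H (- Num.sg l * s); rewrite subr0 n in h2; have {}h2 := h2 sd.
have E : l * (- Num.sg l * s) = - (`|l| * s).
  by rewrite {1}(numEsg l) mulNr mulrN mulrACA -expr2 sqr_sg l0 mul1r.
have ls : 0 < `|l| * s by rewrite mulr_gt0 // normr_gt0.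
rewrite E opprK in h2; have h3 := le_trans (ler_norm _) h2.
have : `|l| / 2 * s = `|l| * s / 2 by rewrite mulrAC.
by move=> E2; rewrite E2 in h3; exfalso; lra.
Qed.

(** A one-sided estimate valid for both signs of t bounds the absolute value of the derivative; the
    quadratic term disappears in the limit. *)
Lemma derive_le_of_upper (f : R -> R) (l b C e0 : R) : 0 < e0 -> is_derive (0 : R) (1 : R) f l ->
  (forall t, `|t| < e0 -> f t - f 0 <= `|t| * b + t ^+ 2 * C) -> `|l| <= b.
Proof.
move=> e00 /is_deriveP H fu; apply/ler_addgt0Pr => e eg0.
have e20 : 0 < e / 2 by rewrite divr_gt0.
have [d d0 {}H] := H _ e20.
have C0 : 0 < `|C| + 1 by rewrite ltr_wpDl.
pose s := Num.min (Num.min d e0) (e / 2 / (`|C| + 1)) / 2.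
have m0 : 0 < Num.min (Num.min d e0) (e / 2 / (`|C| + 1)) by rewrite !lt_min d0 e00 divr_gt0.
have s0 : 0 < s by rewrite divr_gt0.
have sm : s < Num.min (Num.min d e0) (e / 2 / (`|C| + 1)) by rewrite /s ltr_pdivrMr //; lra.
move: sm; rewrite !lt_min => /andP[/andP[sd se] sC].
have sgP (x : R) : `|x| = s -> `|l| * s = l * x -> `|l| <= b + e.
  move=> n lx; have h1 := fu x; rewrite n in h1; have {}h1 := h1 se.
  have h2 := H x; rewrite subr0 n in h2; have {}h2 := h2 sd.
  have xx : x ^+ 2 = s ^+ 2 by rewrite -[x ^+ 2]real_normK ?num_real // n.
  have h3 : s * C <= e / 2.
    have : s * C <= s * (`|C| + 1) by rewrite ler_wpM2l ?(ltW s0) // (le_trans (ler_norm C)) // lerDl.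
    by move=> /le_trans; apply; rewrite -ler_pdivlMr // ltW.
  have h4 : l * x <= s * b + s * (s * C) + e / 2 * s.
    move: h2; rewrite ler_norml => /andP[h2 _]; rewrite xx in h1.
    have -> : s * (s * C) = s ^+ 2 * C by rewrite mulrA.
    lra.
  rewrite -(ler_pM2r s0) lx; apply: (le_trans h4).
  have : s * (s * C) <= s * (e / 2) by rewrite ler_wpM2l // ltW.
  by lra.
have [l0|l0] := leP 0 l; [apply: (sgP s)|apply: (sgP (- s))].
- by rewrite gtr0_norm.
- by rewrite ger0_norm.
- by rewrite normrN gtr0_norm.
- by rewrite ltr0_norm // mulNr mulrN.
Qed.

Definition dotp p q : R := p.1 * q.1 + p.2 * q.2.

Lemma dotp_norm p q : `|dotp p q| <= 2 * (`|p| * `|q|).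
Proof.
rewrite /dotp; apply: (le_trans (ler_normD _ _)); rewrite !normrM.
have -> : 2 * (`|p| * `|q|) = `|p| * `|q| + `|p| * `|q| by ring.
by rewrite lerD // ler_pM // ?norm_fst_le ?norm_snd_le.
Qed.

Lemma dotp_ge_norm p : `|p| ^+ 2 <= dotp p p.
Proof.
rewrite norm_pairE /dotp -!expr2 -[p.1 ^+ 2]real_normK ?num_real // -[p.2 ^+ 2]real_normK ?num_real //.
by rewrite /Num.max; case: ifP => _; rewrite ?lerDl ?lerDr exprn_ge0.
Qed.

Lemma dotp_sqD p q : dotp (p + q) (p + q) = dotp p p + 2 * dotp q p + dotp q q.
Proof. by rewrite /dotp /=; ring. Qed.

(* The Moreau envelope g of Q. If Q is constant along the curves of Y, a minimizer s m satisfies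
   Y (s m) . (m - s m) = 0, so that g is almost constant in the direction of Y. *)
Section MoreauEnvelope.
Variables (p0 : R * R) (r1 : R) (Q : R * R -> R) (e : R).
Hypotheses (r10 : 0 < r1) (e0 : 0 < e).
Hypothesis cQ : forall p, cball p0 r1 p -> {for p, continuous Q}.

Let Phi m q := Q q + dotp (m - q) (m - q) / (2 * e).

Lemma moreau_minimizer : exists s : R * R -> R * R, forall m, cball p0 r1 (s m) /\
  forall q, cball p0 r1 q -> Phi m (s m) <= Phi m q.
Proof.
suff H m : exists c, cball p0 r1 c /\ forall q, cball p0 r1 q -> Phi m c <= Phi m q.
  by have [s Hs] := choice H; exists s.
have [||c /set_mem cb H] := @compact_EVT_min _ R (Phi m) (cball p0 r1) _ (@cball_compact p0 r1).
- by exists p0; rewrite /cball /= subrr normr0 ltW.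
- apply: continuous_in_subspaceT => q /set_mem qb; rewrite /Phi.
  apply: continuous_add; first exact: cQ.
  apply: continuous_mul; last exact: cst_continuous.
  have c1 : {for q, continuous (fun q => (m - q).1)}.
    apply: (@continuous_add R (fun=> m.1) (fun q => - q.1)); first exact: cst_continuous.
    by apply: continuousN; exact: cvg_fst.
  have c2 : {for q, continuous (fun q => (m - q).2)}.
    apply: (@continuous_add R (fun=> m.2) (fun q => - q.2)); first exact: cst_continuous.
    by apply: continuousN; exact: cvg_snd.
  exact: continuous_add (continuous_mul c1 c1) (continuous_mul c2 c2).
exists c; split=> // q qb; apply: H; exact: mem_set.
Qed.

Variable s : R * R -> R * R.
Hypothesis Hs : forall m, cball p0 r1 (s m) /\
  forall q, cball p0 r1 q -> Phi m (s m) <= Phi m q.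
Let g m := Phi m (s m).

(** The old minimizer [s m] is a competitor at m + h. This semiconcavity replaces a derivative of g,
    which need not exist. *)
Lemma moreau_upper m h : g (m + h) <= g m + dotp h (m - s m) / e + dotp h h / (2 * e).
Proof.
have [sb _] := Hs m; have [_ /(_ _ sb) H] := Hs (m + h).
apply: (le_trans H); rewrite /g /Phi.
have -> : m + h - s m = (m - s m) + h by rewrite addrAC.
rewrite dotp_sqD le_eqVlt; apply/orP; left; apply/eqP; field.
by rewrite gt_eqF.
Qed.

Lemma moreau_ge m q : cball p0 r1 q -> g m <= Phi m q.
Proof. by have [_] := Hs m; exact. Qed.

(** Competitor q = m: the displacement of the minimizer is controlled by the oscillation of Q. *)
Lemma moreau_le m : cball p0 r1 m -> dotp (m - s m) (m - s m) / (2 * e) <= Q m - Q (s m).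
Proof.
move=> mb; have := moreau_ge m mb; rewrite /g /Phi subrr /dotp /= !mulr0 addr0 mul0r addr0.
by rewrite lerBrDl.
Qed.

(** Along the curve through [s m] the term Q is constant, so the squared distance to m has a local
    minimum at time 0 and its derivative vanishes. *)
Lemma moreau_tangent m c1 c2 (v : R * R) (d : R) : 0 < d ->
  is_derive (0 : R) (1 : R) c1 v.1 -> is_derive (0 : R) (1 : R) c2 v.2 -> (c1 0, c2 0) = s m ->
  (forall t, `|t| < d -> cball p0 r1 (c1 t, c2 t) /\ Q (c1 t, c2 t) = Q (s m)) ->
  dotp v (m - s m) = 0.
Proof.
move=> d0 d1 d2 c0 cQs; set w := m - s m.
pose F (q : R * R) := (m.1 - q.1) * (m.1 - q.1) + (m.2 - q.2) * (m.2 - q.2).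
have D1 : dif (fun q => m.1 - q.1) (s m) (0 - 1) (0 - 0) by apply: difB; [exact: dif_cst|exact: dif_fst].
have D2 : dif (fun q => m.2 - q.2) (s m) (0 - 0) (0 - 1) by apply: difB; [exact: dif_cst|exact: dif_snd].
have DF := difD (difM D1 D1) (difM D2 D2).
rewrite -c0 in DF.
have H := derive_along DF d1 d2.
have := local_min_derivative d0 H; rewrite /= -[c1 0]/((c1 0, c2 0).1) -[c2 0]/((c1 0, c2 0).2) c0 => {}H.
suff /H : forall t, `|t| < d -> F (s m) <= F (c1 t, c2 t).
  move=> E; apply: (@mulfI _ (-2)); first by rewrite oppr_eq0 pnatr_eq0.
  by rewrite mulr0 -E /dotp /w /=; ring.
move=> t td; have [cb cQt] := cQs t td; have := moreau_ge m cb.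
rewrite /g /Phi cQt lerD2l ler_pM2r ?invr_gt0 ?mulr_gt0 //.
Qed.

(** [moreau_upper], used from m and from a nearby point, gives a local Lipschitz bound. *)
Lemma moreau_continuous : continuous g.
Proof.
move=> m.
pose C := (2 * (`|m - p0| + 1 + r1) + 2) / e.
have C0 : 0 < C by rewrite /C divr_gt0 // ltr_wpDl // mulr_ge0 // addr_ge0 ?addr_ge0 // ltW.
have L m' h : `|m' - p0| <= `|m - p0| + 1 -> `|h| <= 1 -> g (m' + h) - g m' <= C * `|h|.
  move=> m'b h1; rewrite lerBlDl; apply: (le_trans (moreau_upper m' h)); rewrite -addrA lerD2l.
  have B : `|m' - s m'| <= `|m - p0| + 1 + r1.
    have -> : m' - s m' = (m' - p0) - (s m' - p0) by rewrite opprB addrA subrK.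
    by apply: (le_trans (ler_normB _ _)); rewrite lerD //; case: (Hs m').
  have E1 : dotp h (m' - s m') <= 2 * (`|m - p0| + 1 + r1) * `|h|.
    apply: (le_trans (ler_norm _)); apply: (le_trans (dotp_norm _ _)).
    by rewrite -mulrA ler_wpM2l // mulrC ler_wpM2r.
  have E2 : dotp h h / 2 <= 2 * `|h|.
    have : dotp h h <= 2 * (`|h| * `|h|) by exact: le_trans (ler_norm _) (dotp_norm _ _).
    have : `|h| * `|h| <= `|h| by rewrite ler_piMl.
    by have := normr_ge0 h; lra.
  have -> : dotp h h / (2 * e) = dotp h h / 2 / e by field; rewrite gt_eqF.
  by rewrite -mulrDl /C mulrAC ler_pM2r ?invr_gt0 // [X in _ <= X]mulrDl lerD.
apply/continuousP_eps => k k0; exists (Num.min 1 (k / C)); first by rewrite lt_min ltr01 divr_gt0.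
move=> q; rewrite lt_min => /andP[q1 qk].
have Em : m + (q - m) = q by rewrite addrC subrK.
have Eq : q + (m - q) = m by rewrite addrC subrK.
have a1 := L m (q - m) _ (ltW q1); rewrite Em in a1.
have a2 := L q (m - q) _ _; rewrite Eq in a2.
have {}a1 : g q - g m <= C * `|q - m| by apply: a1; rewrite lerDl.
have {}a2 : g m - g q <= C * `|q - m|.
  rewrite (distrC q); apply: a2; last by rewrite distrC ltW.
  by apply: (le_trans (ler_distD m _ _)); rewrite addrC lerD2l ltW.
have a3 : C * `|q - m| < k by rewrite mulrC -ltr_pdivlMr.
by rewrite ltr_norml; apply/andP; split; lra.
Qed.

End MoreauEnvelope.

Lemma ball_support_cc (f : R * R -> R) p0 (r r1 : R) : 0 <= r -> r < r1 ->
  (forall p, `|p - p0| < r1 -> {for p, continuous f}) ->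
  (forall p, r < `|p - p0| -> f p = 0) -> cc f (`|p0| + r).
Proof.
move=> r0 rr cf f0; split; first by rewrite addr_ge0.
  move=> p; have [pr|pr] := ltP `|p - p0| r1; first exact: cf.
  have E : \forall q \near p, (fun=> 0) q = f q.
    have : r < `|p - p0| by exact: lt_le_trans rr pr.
    move=> rp; apply/near_normP; exists (`|p - p0| - r); first by rewrite subr_gt0.
    move=> q qp; rewrite f0 //.
    by have := ler_distD q p p0; rewrite (distrC p q); move: qp; lra.
  by apply: near_continuous E _; exact: cst_continuous.
move=> p pN; apply: f0; rewrite -(ltrD2l `|p0|); apply: (lt_le_trans pN).
by rewrite -{1}(subrK p0 p) addrC; exact: ler_normD.
Qed.

Lemma ball_open_norm p (d : R) : open [set q | `|q - p| < d].
Proof.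
rewrite openE => q /= qd; apply: (near_normP q _).2; exists (d - `|q - p|); first by rewrite subr_gt0.
by move=> q' q'd; apply: (le_lt_trans (ler_distD q _ _)); move: q'd; lra.
Qed.

Lemma ball_support_C1cc (f : R * R -> R) p0 (r r1 : R) : 0 < r -> r < r1 ->
  C1on [set p | `|p - p0| < r1] f ->
  (forall p, r <= `|p - p0| -> f p = 0) -> C1cc f (`|p0| + r).
Proof.
move=> r0 rr cf f0; split; last split.
- move=> p _; have [pr|pr] := ltP `|p - p0| r1; first exact: cf.
  have E : \forall q \near p, (fun=> 0) q = f q.
    have rp : r < `|p - p0| by exact: lt_le_trans rr pr.
    apply/near_normP; exists (`|p - p0| - r); first by rewrite subr_gt0.
    move=> q qp; rewrite f0 //.
    by have := ler_distD q p p0; rewrite (distrC p q); move: qp; lra.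
  have /near_normP[d d0 N] := E.
  have C : C1on [set q | `|q - p| < d] (fun=> 0 : R).
    by apply: C1on_cst; exact: (@ball_open_norm p d).
  have := C1on_near (@ball_open_norm p d) N C.
  by apply; rewrite /= subrr normr0.
- by rewrite ltr_wpDl.
move=> p pN; apply: f0; rewrite -(lerD2l `|p0|); apply: (le_trans pN).
by rewrite -{1}(subrK p0 p) addrC; exact: ler_normD.
Qed.

Lemma C1onB (U : set (R * R)) (f g : R * R -> R) : open U -> C1on U f -> C1on U g ->
  C1on U (fun q => f q - g q).
Proof. by move=> oU Hf Hg; exact: C1onD oU Hf (C1onN oU Hg). Qed.

Lemma C1on_shift (W : R * R -> R) (a b : R) : C1on setT W ->
  C1on setT (fun p => W (p.1 + a, p.2 + b)).
Proof.
move=> H; have sc p : {for p, continuous (fun p : R * R => (p.1 + a, p.2 + b))}.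
  by apply: continuous_pair; apply: continuous_add;
    [exact: cvg_fst|exact: cst_continuous|exact: cvg_snd|exact: cst_continuous].
apply: (C1on_dif (a := fun p => px W (p.1 + a, p.2 + b)) (b := fun p => py W (p.1 + a, p.2 + b)));
  first exact: openT; move=> p _; have [h1 h2 h3] := H (p.1 + a, p.2 + b) I.
- have d1 := difD (dif_fst p) (dif_cst a p); have d2 := difD (dif_snd p) (dif_cst b p).
  by apply: dif_eq (dif_comp h1 d1 d2) _ _; ring.
- exact: continuous_at_comp (sc p) h2.
- exact: continuous_at_comp (sc p) h3.
Qed.

Lemma double_primitive0 : double_primitive (fun=> 0 : R) (fun=> 0).
Proof. by exists (fun _ _ => 0); split=> x y; exact: is_derive_cst. Qed.

Lemma second_difference_shift (W : R * R -> R) (h : R) (v p : R * R) :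
  second_difference (fun q => W (q + v)) h p = second_difference W h (p + v).
Proof.
rewrite /second_difference /=; congr (W _ - W _ - (W _ - W _)); congr (_, _) => /=;
  by rewrite ?[_ + h + _]addrAC.
Qed.

Lemma C1on_second_difference (W : R * R -> R) (h : R) : C1on setT W ->
  C1on setT (second_difference W h).
Proof.
move=> CW; have -> : second_difference W h = fun p =>
    W (p.1 + h, p.2 + h) - W (p.1 + 0, p.2 + h) - (W (p.1 + h, p.2 + 0) - W (p.1 + 0, p.2 + 0)).
  by apply/funext => p; rewrite /second_difference !addr0.
have S a b := C1on_shift a b CW.
by apply: C1onB (@openT _) _ _; apply: C1onB (@openT _) (S _ _) (S _ _).
Qed.

(** * Integration by parts against a continuous first integral *)

Section TransportTheorem.
Variables (p0 : R * R) (r r1 L M : R) (Y : R * R -> R * R) (rho Q : R * R -> R).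
Hypotheses (r0 : 0 < r) (rr : r < r1) (L0 : 0 <= L).
Hypothesis LY : forall p q, cball p0 r1 p -> cball p0 r1 q -> `|Y p - Y q| <= L * `|p - q|.
Hypothesis cQ : forall p, cball p0 r1 p -> {for p, continuous Q}.
Hypothesis curves : forall q, `|q - p0| < r1 -> exists c1 c2 : R -> R, exists d : R,
  [/\ 0 < d, is_derive (0 : R) (1 : R) c1 (Y q).1, is_derive (0 : R) (1 : R) c2 (Y q).2,
      (c1 0, c2 0) = q &
      forall t, `|t| < d -> cball p0 r1 (c1 t, c2 t) -> Q (c1 t, c2 t) = Q q].
Hypothesis rhoM : forall p, `|rho p| <= M.
Hypothesis rho0 : forall p, r <= `|p - p0| -> rho p = 0.
Let V1 p := rho p * (Y p).1.
Let V2 p := rho p * (Y p).2.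
Hypotheses (CV1 : C1on [set p | `|p - p0| < r1] V1) (CV2 : C1on [set p | `|p - p0| < r1] V2).
Let D p := px V1 p + py V2 p.

(** h is the average, over a tiny square, of the Moreau envelope of Q. The envelope makes the
    function almost constant along Y, the average makes it C^1. *)
Lemma approximate_first_integral (k : R) : 0 < k -> exists h : R * R -> R, [/\ C1on setT h,
  forall m, cball p0 r m -> `|h m - Q m| <= 2 * k &
  forall m, cball p0 r m -> `|px h m * (Y m).1 + py h m * (Y m).2| <= 12 * (L + 1) * k].
Proof.
move=> k0; have r0' := r0; have rr' := rr; have L0' := L0; have r10 : 0 < r1 by exact: lt_trans rr.
have [d1 d10 uQ] := heine (@cball_compact p0 r1) cQ k0.
have [S S0 bQ] := compact_bounded_fun (@cball_compact p0 r1) cQ.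
pose r2 := (r + r1) / 2.
have rr2 : r < r2 by rewrite /r2 ltr_pdivlMr //; lra.
have r2r : r2 < r1 by rewrite /r2 ltr_pdivrMr //; lra.
(* Displacements below d keep Q within k and keep the minimizers of points of the ball of radius r2
   in the open ball of radius r1, where curves of Y are available. *)
pose d := Num.min d1 (r1 - r2).
have d0 : 0 < d by rewrite lt_min d10 subr_gt0.
(* With |Q| <= S, the squared displacement of a minimizer is at most 4 e S, which this choice makes
   smaller than d^2. *)
pose e := d ^+ 2 / (8 * (S + 1)).
have S1 : 0 < 8 * (S + 1) by rewrite mulr_gt0 // ltr_wpDl.
have e0 : 0 < e by rewrite divr_gt0 // exprn_gt0.
have [s Hs] := moreau_minimizer e r10 cQ.
pose g m := Q (s m) + dotp (m - s m) (m - s m) / (2 * e).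
have gc : continuous g by exact: (moreau_continuous r10 e0 Hs).
have e20 : 0 < 2 * e by rewrite mulr_gt0.
have near_s m : cball p0 r1 m -> `|m - s m| < d.
  move=> mb; have H1 := moreau_le Hs mb; rewrite ler_pdivrMr // in H1.
  have Qb : Q m - Q (s m) <= 2 * S.
    have := bQ _ mb; have := bQ _ (Hs m).1; rewrite !ler_norml => /andP[a _] /andP[_ b]; lra.
  have H2 : `|m - s m| ^+ 2 <= 2 * S * (2 * e).
    apply: (le_trans (dotp_ge_norm _)); apply: (le_trans H1).
    by rewrite ler_wpM2r // ltW.
  rewrite -(ltr_pXn2r (n := 2)) ?nnegrE ?(ltW d0) //; apply: (le_lt_trans H2).
  have -> : 2 * S * (2 * e) = d ^+ 2 * (S / (2 * (S + 1))).
    by rewrite /e; field; rewrite gt_eqF // ltr_wpDl.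
  rewrite gtr_pMr ?exprn_gt0 // ltr_pdivrMr ?mul1r ?mulr_gt0 ?ltr_wpDl //; lra.
(* Now that the displacement is below the modulus of continuity, the crude bound 2 S improves to k
   and the squared displacement to 2 e k. *)
have osc m : cball p0 r1 m -> Q m - Q (s m) < k /\ `|m - s m| ^+ 2 <= 2 * e * k.
  move=> mb; have H := near_s _ mb.
  have a : Q m - Q (s m) < k.
    apply: (le_lt_trans (ler_norm _)); apply: (uQ (s m) m) => //; first exact: (Hs m).1.
    by apply: lt_le_trans H _; rewrite ge_min lexx.
  split=> //; apply: (le_trans (dotp_ge_norm _)).
  have H1 := moreau_le Hs mb; rewrite ler_pdivrMr // in H1; apply: (le_trans H1).
  by rewrite mulrC ler_wpM2l // ltW.
have gQ m : cball p0 r1 m -> Q m - k <= g m <= Q m.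
  move=> mb; have [a _] := osc _ mb; apply/andP; split.
    have : 0 <= dotp (m - s m) (m - s m) / (2 * e).
      by rewrite divr_ge0 ?(ltW e20) // (le_trans _ (dotp_ge_norm _)) // exprn_ge0.
    by rewrite /g; lra.
  have := moreau_ge Hs m mb; rewrite subrr /dotp /= !mulr0 addr0 mul0r addr0.
  by [].
have inner m : cball p0 r2 m -> cball p0 r1 m by move=> h; apply: le_trans h _; exact: ltW.
(* Exact orthogonality holds at [s m]. Replacing Y (s m) by Y m costs L times the squared
   displacement; the resulting factor e compensates the 1 / e of [moreau_upper]. *)
have tang m : cball p0 r2 m -> `|dotp (Y m) (m - s m)| <= 4 * L * e * k.
  move=> mb; have m1 := inner _ mb.
  have sb : `|s m - p0| < r1.
    apply: (le_lt_trans (ler_distD m _ _)); rewrite (distrC (s m)); have := near_s _ m1; rewrite lt_min => /andP[_ h].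
    by rewrite /cball /= in mb; lra.
  have [c1 [c2 [dd [dd0 dc1 dc2 c0 cc]]]] := curves sb.
  have cnt1 := is_derive1_continuous dc1; have cnt2 := is_derive1_continuous dc2.
  have g0 : 0 < r1 - `|s m - p0| by rewrite subr_gt0.
  have /continuousP_eps /(_ _ g0) [x1 x10 X1] := cnt1.
  have /continuousP_eps /(_ _ g0) [x2 x20 X2] := cnt2.
  have T : dotp (Y (s m)) (m - s m) = 0.
    apply: (moreau_tangent e0 Hs (d := Num.min dd (Num.min x1 x2)) _ dc1 dc2 c0).
      by rewrite !lt_min dd0 x10.
    move=> t; rewrite !lt_min => /and3P[t1 t2 t3].
    have cb : cball p0 r1 (c1 t, c2 t).
      have -> : (c1 t, c2 t) = ((c1 t - c1 0, c2 t - c2 0) : R * R) + s m.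
        by rewrite -c0; congr (_, _); rewrite /= subrK.
      rewrite /cball /= -addrA; apply: (le_trans (ler_normD _ _)).
      rewrite -lerBrDr; apply: norm_pair_le; apply: ltW; [apply: X1|apply: X2]; by rewrite subr0.
    by split=> //; exact: cc.
  have -> : dotp (Y m) (m - s m) = dotp (Y m - Y (s m)) (m - s m).
    by rewrite -[LHS]subr0 -T /dotp /=; ring.
  apply: (le_trans (dotp_norm _ _)).
  have := LY m1 (Hs m).1; have [_] := osc _ m1; set N := `|m - s m| => o1 o2.
  have N0 : 0 <= N by exact: normr_ge0.
  have : `|Y m - Y (s m)| * N <= L * N * N by rewrite ler_wpM2r.
  have : L * N * N <= L * (2 * e * k) by rewrite -mulrA ler_wpM2l // -expr2.
  by lra.
(* The three bounds keep Q within k on the square, keep the square in the ball of radius r2, and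
   make the variation of Y over it times the displacement at most L e k. *)
pose eta := Num.min (Num.min (d1 / 2) (r2 - r)) (e * k / d).
have eta0 : 0 < eta by rewrite !lt_min subr_gt0 rr2 !divr_gt0 // mulr_gt0.
have [W [dW CW]] := double_primitive_exists gc.
pose h m := eta ^- 2 * second_difference W eta m.
have i20 : 0 < eta ^- 2 by rewrite invr_gt0 exprn_gt0.
have near_eta m q : cball p0 r m -> `|q - m| <= eta ->
    [/\ cball p0 r2 q, `|q - m| < d1 & `|q - m| * d <= e * k].
  rewrite /cball /= => mb; rewrite !le_min => /andP[/andP[h1 h2] h3]; split.
  - by have := ler_distD m q p0; lra.
  - by lra.
  - by rewrite -ler_pdivlMr.
have outer m : cball p0 r m -> cball p0 r1 m by move=> h'; apply: le_trans h' _; exact: ltW.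
have E2 (x : R) : eta ^- 2 * (x * eta * eta) = x.
  by field; rewrite gt_eqF.
have Ch0 : C1on setT h.
  by apply: C1onM (@openT _) (C1on_cst _ (@openT _)) _; exact: C1on_second_difference.
exists h; split.
- exact: Ch0.
- move=> m mb.
  have Qm q : `|q - m| <= eta -> `|Q q - Q m| < k /\ Q q - k <= g q <= Q q.
    move=> /(near_eta _ _ mb)[q1 q2 _]; split; last exact: gQ (inner _ q1).
    exact: uQ (outer _ mb) (inner _ q1) q2.
  have U := @second_difference_le _ W g eta (Q m + k) m dW (ltW eta0) _.
  have {}U : second_difference W eta m <= (Q m + k) * eta * eta.
    by apply: U => q /Qm []; rewrite ltr_norml => /andP[a b] /andP[a' b']; lra.
  (* The comparison lemma bounds only from above; the lower bound is the upper bound for 0 - W, a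
     double primitive of - g. *)
  have Lw := @second_difference_le _ _ _ eta (2 * k - Q m) m
    (double_primitiveB (double_primitive0) dW) (ltW eta0) _.
  have {}Lw : - second_difference W eta m <= (2 * k - Q m) * eta * eta.
    have -> : - second_difference W eta m = second_difference (fun q => 0 - W q) eta m.
      by rewrite /second_difference; ring.
    by apply: Lw => q /Qm []; rewrite ltr_norml => /andP[a b] /andP[a' b']; lra.
  have U' : h m <= Q m + k by rewrite -(E2 (Q m + k)) /h ler_pM2l.
  have L' : - h m <= 2 * k - Q m by rewrite -(E2 (2 * k - Q m)) /h -mulrN ler_pM2l.
  by rewrite ler_norml; apply/andP; split; lra.
move=> m mb.
have Ch : dif h m (px h m) (py h m).
  by have [] := Ch0 m I.
pose v := Y m.
have sc (a x : R) : is_derive (0 : R) (1 : R) (fun t => a + t * x) x.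
  apply/is_deriveP => z z0; exists 1 => // t _.
  have -> : a + t * x - (a + 0 * x) - x * (t - 0) = 0 by ring.
  by rewrite normr0 mulr_ge0 // ltW.
have E0 : (m.1 + 0 * v.1, m.2 + 0 * v.2) = m by rewrite !mul0r !addr0 -surjective_pairing.
have Df : is_derive (0 : R) (1 : R) (fun t => h (m.1 + t * v.1, m.2 + t * v.2))
    (px h m * v.1 + py h m * v.2).
  by apply: derive_along (sc _ _) (sc _ _); rewrite E0.
apply: (@derive_le_of_upper _ _ _ (dotp v v / (2 * e)) 1 ltr01 Df) => t _.
rewrite E0; pose B := `|t| * (12 * (L + 1) * k) + t ^+ 2 * (dotp v v / (2 * e)).
have -> : (m.1 + t * v.1, m.2 + t * v.2) = m + t *: v by [].
(* The increment of h in the direction v is the average of the increments of the envelope, to each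
   of which [moreau_upper] applies. *)
have dWv := double_primitiveB (double_primitive_shift (t *: v) dW) dW.
have S' := @second_difference_le _ _ _ eta B m dWv (ltW eta0) _.
have {}S' : second_difference W eta (m + t *: v) - second_difference W eta m <= B * eta * eta.
  rewrite -second_difference_shift; move: S'; rewrite /second_difference => S'.
  have -> : forall a1 a2 a3 a4 b1 b2 b3 b4 : R,
    a1 - a2 - (a3 - a4) - (b1 - b2 - (b3 - b4)) = a1 - b1 - (a2 - b2) - (a3 - b3 - (a4 - b4)).
    by move=> *; ring.
  apply: S' => q qm; have [q1 q2 q3] := near_eta _ _ mb qm.
  rewrite lerBlDl; apply: (le_trans (moreau_upper e0 Hs q (t *: v))).
  rewrite -/(g q) -addrA lerD2l /B; apply: lerD; last first.
    by rewrite /dotp /= /GRing.scale /= le_eqVlt; apply/orP; left; apply/eqP; ring.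
  have -> : dotp (t *: v) (q - s q) = t * dotp v (q - s q).
    by rewrite /dotp /= /GRing.scale /=; ring.
  rewrite ler_pdivrMr // -[X in _ <= X]mulrA; apply: (le_trans (ler_norm _)).
  rewrite normrM ler_wpM2l //.
  have -> : dotp v (q - s q) = dotp (Y q) (q - s q) + dotp (v - Y q) (q - s q).
    by rewrite /dotp /=; ring.
  apply: (le_trans (ler_normD _ _)).
  have T1 := tang _ q1.
  have T2 : `|dotp (v - Y q) (q - s q)| <= 2 * (L * (e * k)).
    apply: (le_trans (dotp_norm _ _)); rewrite ler_wpM2l //.
    apply: (@le_trans _ _ (L * `|q - m| * d)); last by rewrite -mulrA ler_wpM2l.
    apply: ler_pM => //; last by apply: ltW; exact: near_s (inner _ q1).
    by rewrite (distrC q); exact: LY (outer _ mb) (inner _ q1).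
  have ek : 0 <= e * k by rewrite mulr_ge0 // ltW.
  have Lek : 0 <= L * (e * k) by rewrite mulr_ge0.
  apply: (le_trans (lerD T1 T2)).
  have -> : 4 * L * e * k + 2 * (L * (e * k)) = 6 * (L * (e * k)) by ring.
  have -> : 12 * (L + 1) * k * e = 12 * (L * (e * k)) + 12 * (e * k) by ring.
  lra.
rewrite -/B -(E2 B) /h -mulrBr ler_pM2l //.
Qed.

(* Integrating by parts against the C^1 approximations h of Q. *)
Lemma transport_zero : I2 (fun p => Q p * D p) = 0.
Proof.
have r0' := r0; have rr' := rr; have L0' := L0.
have z1 p : r <= `|p - p0| -> V1 p = 0 by move=> /rho0; rewrite /V1 => ->; rewrite mul0r.
have z2 p : r <= `|p - p0| -> V2 p = 0 by move=> /rho0; rewrite /V2 => ->; rewrite mul0r.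
have C1 := ball_support_C1cc r0 rr CV1 z1; have C2 := ball_support_C1cc r0 rr CV2 z2.
have M0 : 0 <= M by exact: le_trans (normr_ge0 _) (rhoM (0, 0)).
set N := `|p0| + r in C1 C2.
have N0 : 0 < N by rewrite /N ltr_wpDl.
have [X1 _] := C1cc_grad C1; have [_ X2] := C1cc_grad C2.
have CD : cc D N by exact: ccD X1 X2.
have D0 p : r < `|p - p0| -> D p = 0.
  move=> pr; have E : \forall q \near p, r <= `|q - p0|.
    apply/near_normP; exists (`|p - p0| - r); first by rewrite subr_gt0.
    by move=> q qp; have := ler_distD q p p0; rewrite (distrC p q); move: qp; lra.
  have e1 : \forall q \near p, (fun=> 0) q = V1 q by apply: filterS E => q /z1 ->.
  have e2 : \forall q \near p, (fun=> 0) q = V2 q by apply: filterS E => q /z2 ->.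
  have [_ a1] := dif_px (dif_near e1 (dif_cst 0 p)).
  have [_ a2] := dif_py (dif_near e2 (dif_cst 0 p)).
  by rewrite /D a1 a2 addr0.
have CQD : cc (fun p => Q p * D p) N.
  apply: (ball_support_cc (r1 := r1)); [exact: ltW|exact: rr| |].
    move=> p pr; apply: continuous_mul; first by apply: cQ; exact: ltW.
    by have [_ h _] := CD; exact: h.
  by move=> p /D0 ->; rewrite mulr0.
have [DB DB0 HD] := cc_bounded CD.
pose A := N *+ 2 * N *+ 2.
have A0 : 0 <= A by rewrite /A mulrn_wge0 // mulr_ge0 ?mulrn_wge0 // ltW.
(* Per unit of k: replacing Q by h costs 2 DB pointwise, and the derivative of h along Y costs 12 (L
   + 1) times the bound M of rho; A is the area of the box. *)
pose K := (2 * DB + M * (12 * (L + 1))) * A.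
have K0 : 0 <= K by rewrite mulr_ge0 // addr_ge0 ?mulr_ge0 // addr_ge0.
apply/eqP; rewrite -normr_le0; apply/ler_addgt0Pr => x x0; rewrite add0r.
have k0 : 0 < x / (K + 1) by rewrite divr_gt0 // ltr_wpDl.
have [h [Ch hQ hY]] := approximate_first_integral k0.
set k := x / (K + 1) in k0 hQ hY.
have ch : continuous h by move=> p; exact: C1on_continuous Ch I.
have ChD : cc (fun p => D p * h p) N by exact: ccM CD ch.
have B1 : `|I2 (fun p => Q p * D p - D p * h p)| <= 2 * k * DB * A.
  apply: I2_bound.
    have [a b c] := CQD; have [_ b' c'] := ChD; split=> //.
      by move=> p; exact: (continuous_add (b p) (continuousN (b' p))).
    by move=> p pN; rewrite c // c' // subrr.
  move=> p; have [pr|pr] := leP `|p - p0| r; last first.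
    by rewrite D0 // mulr0 mul0r subrr normr0; do 2![apply: mulr_ge0 => //]; exact: ltW.
  have -> : Q p * D p - D p * h p = - ((h p - Q p) * D p) by ring.
  by rewrite normrN normrM ler_pM // hQ.
have G1 : C1cc (fun p => V1 p * h p) N.
  by have [a [b c]] := C1; split; [exact: (C1onM (@openT _))|split=> // p /c ->; rewrite mul0r].
have G2 : C1cc (fun p => V2 p * h p) N.
  by have [a [b c]] := C2; split; [exact: (C1onM (@openT _))|split=> // p /c ->; rewrite mul0r].
have P1 : I2 (px (fun p => V1 p * h p)) = 0 by exact: I2_px G1.
have P2 : I2 (py (fun p => V2 p * h p)) = 0 by exact: I2_py G2.
have cpxh : continuous (px h) by move=> p; have [_ a _] := Ch p I; exact: a.
have cpyh : continuous (py h) by move=> p; have [_ _ a] := Ch p I; exact: a.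
have CVh : cc (fun p => V1 p * px h p + V2 p * py h p) N.
  by apply: ccD; apply: ccM => //; [exact: C1cc_cc C1|exact: C1cc_cc C2].
have E : I2 (fun p => D p * h p) = - I2 (fun p => V1 p * px h p + V2 p * py h p).
  apply/eqP; rewrite -addr_eq0 -(I2D ChD CVh); apply/eqP.
  have [g1 _] := C1cc_grad G1; have [_ g2] := C1cc_grad G2.
  rewrite -[RHS](addr0 0) -{1}P1 -P2 -(I2D g1 g2); congr I2; apply/funext => p.
  have [h1 _ _] := Ch p I; have [v1 _ _] := C1.1 p I; have [v2 _ _] := C2.1 p I.
  have [_ ->] := dif_px (difM v1 h1); have [_ ->] := dif_py (difM v2 h1).
  by rewrite /D; ring.
have B2 : `|I2 (fun p => D p * h p)| <= M * (12 * (L + 1) * k) * A.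
  rewrite E normrN; apply: I2_bound CVh _ => p.
  have [pr|pr] := leP `|p - p0| r; last first.
    rewrite z1 ?z2 ?(ltW pr) // !mul0r addr0 normr0; apply: mulr_ge0 => //.
    by apply: mulr_ge0; [apply: mulr_ge0 => //; apply: addr_ge0|exact: ltW].
  have -> : V1 p * px h p + V2 p * py h p = rho p * (px h p * (Y p).1 + py h p * (Y p).2).
    by rewrite /V1 /V2; ring.
  by rewrite normrM ler_pM // hY.
have -> : I2 (fun p => Q p * D p) = I2 (fun p => Q p * D p - D p * h p) + I2 (fun p => D p * h p).
  by rewrite (I2B CQD ChD) subrK.
apply: (le_trans (ler_normD _ _)); apply: (le_trans (lerD B1 B2)).
have -> : 2 * k * DB * A + M * (12 * (L + 1) * k) * A = K * k by rewrite /K; ring.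
rewrite /k mulrCA ger_pMr // ler_pdivrMr ?ltr_wpDl // mul1r lerDl ler01 //.
Qed.

(** Integration by parts leaves the integral of (Q - G) D by [transport_zero]. Closeness is required
    only on the ball of radius r, outside of which D vanishes. *)
Lemma transport_bound (G : R * R -> R) (K : R) : C1on [set p | `|p - p0| < r1] G ->
  (forall p, cball p0 r p -> `|G p - Q p| <= K) ->
  `|I2 (fun p => V1 p * px G p + V2 p * py G p)| <= K * I2 (fun p => `|D p|).
Proof.
move=> CG GQ.
have r0' := r0; have rr' := rr; have r10 : 0 < r1 by exact: lt_trans rr'.
have oB := @ball_open_norm p0 r1.
have z1 p : r <= `|p - p0| -> V1 p = 0 by move=> /rho0; rewrite /V1 => ->; rewrite mul0r.
have z2 p : r <= `|p - p0| -> V2 p = 0 by move=> /rho0; rewrite /V2 => ->; rewrite mul0r.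
have C1 := ball_support_C1cc r0 rr CV1 z1; have C2 := ball_support_C1cc r0 rr CV2 z2.
have G1 : C1cc (fun p => V1 p * G p) (`|p0| + r).
  by apply: (ball_support_C1cc r0 rr); [exact: C1onM|move=> p /z1 ->; rewrite mul0r].
have G2 : C1cc (fun p => V2 p * G p) (`|p0| + r).
  by apply: (ball_support_C1cc r0 rr); [exact: C1onM|move=> p /z2 ->; rewrite mul0r].
set N := `|p0| + r in C1 C2 G1 G2.
have [X1 _] := C1cc_grad C1; have [_ X2] := C1cc_grad C2.
have CD : cc D N by exact: ccD X1 X2.
have cD : continuous D by case: CD.
have D0 p : r < `|p - p0| -> D p = 0.
  move=> pr; have E : \forall q \near p, r <= `|q - p0|.
    apply/near_normP; exists (`|p - p0| - r); first by rewrite subr_gt0.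
    by move=> q qp; have := ler_distD q p p0; rewrite (distrC p q); move: qp; lra.
  have e1 : \forall q \near p, (fun=> 0) q = V1 q by apply: filterS E => q /z1 ->.
  have e2 : \forall q \near p, (fun=> 0) q = V2 q by apply: filterS E => q /z2 ->.
  have [_ a1] := dif_px (dif_near e1 (dif_cst 0 p)).
  have [_ a2] := dif_py (dif_near e2 (dif_cst 0 p)).
  by rewrite /D a1 a2 addr0.
have CQD : cc (fun p => Q p * D p) N.
  apply: (ball_support_cc (r1 := r1)); [exact: ltW|exact: rr'| |].
    by move=> p pr; apply: continuous_mul (cD p); apply: cQ; exact: ltW.
  by move=> p /D0 ->; rewrite mulr0.
have CGD : cc (fun p => G p * D p) N.
  apply: (ball_support_cc (r1 := r1)); [exact: ltW|exact: rr'| |].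
    by move=> p pr; apply: continuous_mul (cD p); exact: C1on_continuous CG pr.
  by move=> p /D0 ->; rewrite mulr0.
have CVG : cc (fun p => V1 p * px G p + V2 p * py G p) N.
  apply: (ball_support_cc (r1 := r1)); [exact: ltW|exact: rr'| |].
    move=> p pr; have [_ gx gy] := CG p pr.
    apply: continuous_add; apply: continuous_mul => //.
      exact: C1on_continuous CV1 pr.
    exact: C1on_continuous CV2 pr.
  by move=> p /ltW pr; rewrite z1 // z2 // !mul0r addr0.
have [g1 _] := C1cc_grad G1; have [_ g2] := C1cc_grad G2.
have E : I2 (fun p => V1 p * px G p + V2 p * py G p) + I2 (fun p => G p * D p) = 0.
  rewrite -(I2D CVG CGD) -[RHS](addr0 0) -{1}(I2_px G1) -(I2_py G2) -(I2D g1 g2).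
  congr I2; apply/funext => p; have [pr|pr] := leP `|p - p0| r.
    have pr1 : `|p - p0| < r1 by exact: le_lt_trans pr rr'.
    have [h1 _ _] := CG p pr1; have [v1 _ _] := CV1 pr1; have [v2 _ _] := CV2 pr1.
    have [_ ->] := dif_px (difM v1 h1); have [_ ->] := dif_py (difM v2 h1).
    by rewrite /D; ring.
  have E : \forall q \near p, r <= `|q - p0|.
    apply/near_normP; exists (`|p - p0| - r); first by rewrite subr_gt0.
    by move=> q qp; have := ler_distD q p p0; rewrite (distrC p q); move: qp; lra.
  have e1 : \forall q \near p, (fun=> 0) q = V1 q * G q.
    by apply: filterS E => q /z1 ->; rewrite mul0r.
  have e2 : \forall q \near p, (fun=> 0) q = V2 q * G q.
    by apply: filterS E => q /z2 ->; rewrite mul0r.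
  have [_ ->] := dif_px (dif_near e1 (dif_cst 0 p)).
  have [_ ->] := dif_py (dif_near e2 (dif_cst 0 p)).
  by rewrite z1 ?z2 ?(ltW pr) // D0 //; ring.
have -> : I2 (fun p => V1 p * px G p + V2 p * py G p) = I2 (fun p => Q p * D p - G p * D p).
  by rewrite (I2B CQD CGD) transport_zero sub0r; apply/eqP; rewrite -addr_eq0 E.
have CQG : cc (fun p => Q p * D p - G p * D p) N.
  have [a b c] := CQD; have [_ b' c'] := CGD; split=> //.
    by move=> p; exact: (continuous_add (b p) (continuousN (b' p))).
  by move=> p pN; rewrite c // c' // subrr.
apply: (le_trans (I2_norm CQG)); rewrite -(I2Z K (cc_norm CD)).
apply: I2_le (cc_norm CQG) (ccZ K (cc_norm CD)) _ => p.
have [pr|pr] := leP `|p - p0| r; last by rewrite D0 // !mulr0 subrr normr0 mulr0.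
by rewrite -mulrBl normrM ler_wpM2r // distrC; exact: GQ.
Qed.

End TransportTheorem.

End Transport.

(** * Change of variables *)

Section AffineMaps.
Variable R : realType.
Notation leb := (@lebesgue_measure R).
Local Notation plane := (measurableTypeR R * measurableTypeR R)%type.
Local Notation meas A := (measurable (A : set plane)).
Local Notation mfun A f := (measurable_fun (A : set plane) (f : plane -> R)).

Lemma continuous_affine1 (a b : R) : continuous (fun x : R => a * x + b).
Proof.
move=> x; apply: continuousD; last exact: cst_continuous.
by apply: continuousM; [exact: cst_continuous|exact: cvg_id].
Qed.

Lemma leb_affine_itv (a b x y : R) : a != 0 -> x <= y ->
  leb [set t | a * t + b \in `]x, y]] = (`|a|^-1 * (y - x))%:E.
Proof.
move=> a0 xy; have [ap|an] := ltP 0 a.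
  have -> : [set t | a * t + b \in `]x, y]] = [set` `](x - b) / a, (y - b) / a]].
    by apply/seteqP; split=> t /=; rewrite !in_itv /= ltr_pdivrMr // ler_pdivlMr //
      [t * a]mulrC ltrBlDr lerBrDr.
  rewrite lebesgue_measure_itv /= lte_fin ltr_pM2r ?invr_gt0 // ltrD2r gtr0_norm //.
  case: ltgtP xy => // [xy _|-> _]; last by rewrite subrr mulr0.
  by rewrite -EFinD; congr EFin; field.
have {an}an : a < 0 by rewrite lt_neqAle a0 an.
have -> : [set t | a * t + b \in `]x, y]] = [set` `[(y - b) / a, (x - b) / a[].
  by apply/seteqP; split=> t /=; rewrite !in_itv /= ltr_ndivlMr // ler_ndivrMr //
    [t * a]mulrC ltrBlDr lerBrDr andbC.
rewrite lebesgue_measure_itv /= lte_fin ltr_nM2r ?invr_lt0 // ltrD2r ltr0_norm //.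
case: ltgtP xy => // [xy _|-> _]; last by rewrite subrr mulr0.
by rewrite -EFinD; congr EFin; field.
Qed.

(** The image of Lebesgue measure rescaled by |a| agrees with it on half-open intervals, and such a
    measure is unique. *)
Lemma leb_affine (a b : R) (A : set (measurableTypeR R)) : a != 0 -> measurable A ->
  leb [set t | A (a * t + b)] = (`|a|^-1%:E * leb A)%E.
Proof.
move=> a0 mA.
have an : 0 < `|a| by rewrite normr_gt0.
pose T : measurableTypeR R -> measurableTypeR R := fun t => a * t + b.
have mT : measurable_fun setT T by apply: continuous_measurable_fun; exact: continuous_affine1.
pose m : {measure set (measurableTypeR R) -> \bar R} := mscale (NngNum (ltW an)) (pushforward leb T).
have E (X : set R) : m mT X = (`|a|%:E * leb [set t | X (a * t + b)%R])%E by [].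
have H : leb A = m mT A.
  apply: lebesgue_measure_unique mA => _ [[x y] _ <-]; rewrite E /=.
  have [xy|yx] := leP x y.
    have -> := leb_affine_itv b a0 xy; rewrite lebesgue_measure_itv /= lte_fin -EFinM.
    rewrite mulrA divff ?gt_eqF // mul1r; case: ltgtP xy => // -> _; by rewrite subrr.
  have -> : [set t | a * t + b \in `]x, y]] = set0.
    by apply/seteqP; split=> t //=; rewrite in_itv /= => /andP[h1 h2]; move: yx; lra.
  by rewrite set_itv_ge ?measure0 ?mule0 // -leNgt bnd_simp ltW.
by rewrite H E muleA -EFinM mulVf ?gt_eqF // mul1e.
Qed.

Lemma leb2_ysection (A : set (R * R)) : meas A -> leb2 A = (\int[leb]_y leb (ysection A y))%E.
Proof. by move=> mA; apply: (@product_measure_unique _ _ _ _ _ leb leb (leb \x^ leb)%E) => // *; exact: product_measure2E. Qed.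

Definition shear_x (a b c : R) (p : R * R) : R * R := (a * p.1 + b * p.2 + c, p.2).
Definition shear_y (a b c : R) (p : R * R) : R * R := (p.1, a * p.2 + b * p.1 + c).

Lemma continuous_preimage_meas (F : R * R -> R * R) (B : set (R * R)) :
  continuous (fun p => (F p).1) -> continuous (fun p => (F p).2) -> meas B -> meas (F @^-1` B).
Proof.
move=> c1 c2 mB.
have mF : measurable_fun (setT : set plane) (F : plane -> plane).
  apply/measurable_fun_pairP; split; exact: continuous_measurable_prod_fun.
by rewrite -[X in measurable X]setTI; exact: mF.
Qed.

Lemma continuous_affine (a b c : R) : continuous (fun p : R * R => a * p.1 + b * p.2 + c).
Proof.
move=> p; apply: continuous_add; last exact: cst_continuous.
by apply: continuous_add; apply: continuous_mul;
  [exact: cst_continuous|exact: cvg_fst|exact: cst_continuous|exact: cvg_snd].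
Qed.

Lemma leb2_shear_x (a b c : R) (B : set (R * R)) : a != 0 -> meas B ->
  leb2 (shear_x a b c @^-1` B) = (`|a|^-1%:E * leb2 B)%E.
Proof.
move=> a0 mB.
have mB' : meas (shear_x a b c @^-1` B).
  by apply: continuous_preimage_meas mB; [exact: continuous_affine|move=> p; exact: cvg_snd].
rewrite (leb2_ysection mB') (leb2_ysection mB).
rewrite -(@ge0_integralZl _ _ _ leb) //; first last.
- exact: (measurable_fun_ysection leb mB).
apply: eq_integral => y _.
have <- := @leb_affine a (b * y + c) _ a0 (measurable_ysection y mB).
congr (leb _); apply/seteqP; split=> t; rewrite /ysection /= !inE /= /shear_x /= addrA //.
Qed.

Lemma leb2_shear_y (a b c : R) (B : set (R * R)) : a != 0 -> meas B ->
  leb2 (shear_y a b c @^-1` B) = (`|a|^-1%:E * leb2 B)%E.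
Proof.
move=> a0 mB.
have cF : continuous (fun p : R * R => a * p.2 + b * p.1 + c).
  have -> : (fun p : R * R => a * p.2 + b * p.1 + c) = (fun p => b * p.1 + a * p.2 + c).
    by apply/funext => p; rewrite [a * _ + _]addrC.
  exact: continuous_affine.
have mB' : meas (shear_y a b c @^-1` B).
  by apply: continuous_preimage_meas mB; [move=> p; exact: cvg_fst|exact: cF].
rewrite /leb2 /product_measure1.
rewrite -(@ge0_integralZl _ _ _ leb) //; first last.
- exact: (measurable_fun_xsection leb mB).
apply: eq_integral => x _ /=.
have <- := @leb_affine a (b * x + c) _ a0 (measurable_xsection x mB).
congr (leb _); apply/seteqP; split=> t; rewrite /xsection /= !inE /= /shear_y /= addrA //.
Qed.

Definition affine_map (a b c d e f : R) (p : R * R) : R * R :=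
  (a * p.1 + b * p.2 + e, c * p.1 + d * p.2 + f).

(** For d nonzero the map is a composition of a horizontal and a vertical shear, each handled on
    slices by the one-dimensional case. *)
Lemma leb2_affine_d (a b c d e f : R) (B : set (R * R)) : a * d - b * c != 0 -> d != 0 -> meas B ->
  leb2 (affine_map a b c d e f @^-1` B) = (`|a * d - b * c|^-1%:E * leb2 B)%E.
Proof.
move=> D0 d0 mB.
have E : affine_map a b c d e f =
    shear_x ((a * d - b * c) / d) (b / d) (e - b * f / d) \o shear_y d c f.
  apply/funext => p; rewrite /affine_map /shear_x /shear_y /=; congr (_, _); last by ring.
  by field.
have a0 : (a * d - b * c) / d != 0 by rewrite mulf_neq0 // invr_neq0.
rewrite E comp_preimage leb2_shear_y //; last first.
  by apply: continuous_preimage_meas mB; [exact: continuous_affine|move=> p; exact: cvg_snd].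
rewrite leb2_shear_x // muleA -EFinM; congr (_%:E * _)%E.
by rewrite normrM normfV; field; rewrite !normr_eq0 D0.
Qed.

(** If d = 0, composing with the area-preserving shear (x + y, y) turns the last coefficient into c
    + d = c, which is then nonzero. *)
Lemma leb2_affine (a b c d e f : R) (B : set (R * R)) : a * d - b * c != 0 -> meas B ->
  leb2 (affine_map a b c d e f @^-1` B) = (`|a * d - b * c|^-1%:E * leb2 B)%E.
Proof.
move=> D0 mB; have [d0|d0] := eqVneq d 0; last exact: leb2_affine_d.
have c0 : c != 0 by apply: contra D0 => /eqP ->; rewrite d0 !mulr0 subrr.
have mA : meas (affine_map a b c d e f @^-1` B).
  by apply: continuous_preimage_meas mB; exact: continuous_affine.
have := leb2_shear_x 1 0 (oner_neq0 R) mA; rewrite normr1 invr1 mul1e => <-.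
rewrite -comp_preimage.
have -> : affine_map a b c d e f \o shear_x 1 1 0 = affine_map a (a + b) c (c + d) e f.
  by apply/funext => p; rewrite /affine_map /shear_x /=; congr (_, _); ring.
have E : a * (c + d) - (a + b) * c = a * d - b * c by ring.
by rewrite leb2_affine_d ?E // d0 addr0.
Qed.

End AffineMaps.

(** * An induction principle for rectangles *)

Section Bisection.
Variable R : realType.
Implicit Types (a b c d : R).

(* Quartering keeps the ratio of the sides. *)
Lemma rectangle_bisection (P : R -> R -> R -> R -> Prop) (a b c d : R) :
  (forall a m b c d, a <= m <= b -> c <= d -> P a m c d -> P m b c d -> P a b c d) ->
  (forall a b c m d, a <= b -> c <= m <= d -> P a b c m -> P a b m d -> P a b c d) ->
  (forall p : R * R, a <= p.1 <= b -> c <= p.2 <= d -> exists2 e : R, 0 < e &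
     forall a' b' c' d', a <= a' -> b' <= b -> c <= c' -> d' <= d ->
       a' <= p.1 <= b' -> c' <= p.2 <= d' -> b' - a' < e -> d' - c' < e ->
       (b' - a') * (d - c) = (d' - c') * (b - a) -> P a' b' c' d') ->
  a <= b -> c <= d -> P a b c d.
Proof.
move=> Px Py loc ab cd; apply: contrapT => nP.
(* By contradiction: a rectangle failing P has a quarter failing P. The nested quarters shrink to a
   point p, and the local hypothesis at p contradicts the failure of a small one. *)
pose good (r : (R * R) * (R * R)) := r.1.1 <= r.1.2 /\ r.2.1 <= r.2.2 /\ ~ P r.1.1 r.1.2 r.2.1 r.2.2.
pose half (r s : (R * R) * (R * R)) := [/\ r.1.1 <= s.1.1, s.1.2 <= r.1.2, r.2.1 <= s.2.1, s.2.2 <= r.2.2 &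
  s.1.2 - s.1.1 = (r.1.2 - r.1.1) / 2 /\ s.2.2 - s.2.1 = (r.2.2 - r.2.1) / 2].
have step (r : {r | good r}) : exists s : {r | good r}, half (projT1 r) (projT1 s).
  case: r => -[[x y] [z w]] /= [/= xy [/= zw nQ]].
  pose m := (x + y) / 2; pose n := (z + w) / 2.
  have xm : x <= m <= y by rewrite /m; apply/andP; split; lra.
  have zn : z <= n <= w by rewrite /n; apply/andP; split; lra.
  have [/andP[xm1 xm2] /andP[zn1 zn2]] := (xm, zn).
  have mk (s : (R * R) * (R * R)) : good s -> half ((x, y), (z, w)) s ->
      exists s : {r | good r}, half ((x, y), (z, w)) (projT1 s).
    by move=> gs hs; exists (exist _ s gs).
  have [P1|nP1] := pselect (P x m z n); last first.
    by apply: (mk ((x, m), (z, n))); [split|split => //=; split; rewrite /m /n; lra].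
  have [P2|nP2] := pselect (P m y z n); last first.
    by apply: (mk ((m, y), (z, n))); [split|split => //=; split; rewrite /m /n; lra].
  have [P3|nP3] := pselect (P x m n w); last first.
    by apply: (mk ((x, m), (n, w))); [split|split => //=; split; rewrite /m /n; lra].
  have [P4|nP4] := pselect (P m y n w); last first.
    by apply: (mk ((m, y), (n, w))); [split|split => //=; split; rewrite /m /n; lra].
  case: nQ; apply: (Py _ _ _ n) => //; exact: (Px _ m).
have [nx Hnx] := choice step.
have g0 : good ((a, b), (c, d)) by split.
pose r n := projT1 (iter n nx (exist _ _ g0)).
have gr n : good (r n) by exact: projT2.
have hr n : half (r n) (r n.+1) by exact: Hnx.
have mono n k : [/\ (r n).1.1 <= (r (n + k)%N).1.1, (r (n + k)%N).1.2 <= (r n).1.2,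
    (r n).2.1 <= (r (n + k)%N).2.1 & (r (n + k)%N).2.2 <= (r n).2.2].
  elim: k => [|k [h1 h2 h3 h4]]; first by rewrite addn0.
  rewrite addnS; have [k1 k2 k3 k4 _] := hr (n + k)%N.
  by split; [exact: le_trans h1 k1|exact: le_trans k2 h2|exact: le_trans h3 k3|exact: le_trans k4 h4].
have cross n k : (r n).1.1 <= (r k).1.2 /\ (r n).2.1 <= (r k).2.2.
  have [a1 [a2 _]] := gr (n + k)%N.
  have [h1 _ h3 _] := mono n k; have [_ h2 _ h4] := mono k n; rewrite addnC in h2 h4.
  by split; [exact: le_trans h1 (le_trans a1 h2)|exact: le_trans h3 (le_trans a2 h4)].
have size n : (r n).1.2 - (r n).1.1 = (b - a) / 2 ^+ n /\ (r n).2.2 - (r n).2.1 = (d - c) / 2 ^+ n.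
  elim: n => [|n [h1 h2]]; first by rewrite expr0 !divr1.
  have [_ _ _ _ [k1 k2]] := hr n; rewrite k1 k2 h1 h2 exprSr.
  by split; field; rewrite expf_neq0.
pose p := (sup (range (fun n => (r n).1.1)), sup (range (fun n => (r n).2.1))).
have hp n : (r n).1.1 <= p.1 <= (r n).1.2 /\ (r n).2.1 <= p.2 <= (r n).2.2.
  split; apply/andP; split.
  - apply: ub_le_sup; last by exists n.
    by exists (r n).1.2 => _ [k _ <-]; case: (cross k n).
  - apply: ge_sup; first by exists (r n).1.1; exists n.
    by move=> _ [k _ <-]; case: (cross k n).
  - apply: ub_le_sup; last by exists n.
    by exists (r n).2.2 => _ [k _ <-]; case: (cross k n).
  - apply: ge_sup; first by exists (r n).2.1; exists n.
    by move=> _ [k _ <-]; case: (cross k n).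
have [p1 p2] := hp 0%N.
have [e e0 H] := loc p p1 p2.
have w0 : 0 <= (b - a) + (d - c) by rewrite addr_ge0 // subr_ge0.
have [n ne] : exists n, ((b - a) + (d - c)) / e < 2 ^+ n.
  exists (Num.truncn (((b - a) + (d - c)) / e)).+1.
  apply: (lt_trans (truncnS_gt _)); rewrite -natrX ltr_nat.
  exact: ltn_expl.
have t0 : 0 < 2 ^+ n :> R by rewrite exprn_gt0.
have se : ((b - a) + (d - c)) / 2 ^+ n < e by rewrite ltr_pdivrMr // mulrC -ltr_pdivrMr.
have [g1 [g2 ng]] := gr n; apply: ng.
have [s1 s2] := size n; have [h1 h2 h3 h4] := mono 0%N n; have [q1 q2] := hp n.
have x0 : 0 <= (b - a) / 2 ^+ n by rewrite divr_ge0 ?subr_ge0 // ltW.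
have y0 : 0 <= (d - c) / 2 ^+ n by rewrite divr_ge0 ?subr_ge0 // ltW.
rewrite mulrDl in se.
apply: H => //; rewrite ?s1 ?s2; [by lra|by lra|].
by rewrite mulrAC [in RHS]mulrAC [_ * (d - c)]mulrC.
Qed.

End Bisection.

(** * Change of variables for continuous functions with compact support *)

Section ChangeOfVariables.
Variable R : realType.
Notation leb := (@lebesgue_measure R).
Local Notation plane := (measurableTypeR R * measurableTypeR R)%type.
Local Notation meas A := (measurable (A : set plane)).
Local Notation mfun A f := (measurable_fun (A : set plane) (f : plane -> R)).
Implicit Types (U V : set (R * R)) (phi psi : R * R -> R * R).

Definition diffeo2 U V phi psi :=
  [/\ open U, open V, (forall p, U p -> V (phi p) /\ psi (phi p) = p),
      (forall q, V q -> U (psi q) /\ phi (psi q) = q) &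
      [/\ C1map U phi, C1map V psi & forall p, U p -> 0 < jdet phi p]].

Lemma diffeo2_jac U V phi psi p : diffeo2 U V phi psi -> U p ->
  jdet psi (phi p) * jdet phi p = 1.
Proof.
move=> [oU oV UV VU [Cphi [Cpsi1 Cpsi2] _]] Up; have [Vp pp] := UV _ Up.
have nU := open_nbhs_nbhs (conj oU Up).
have [d1 _ _] := Cpsi1 _ Vp; have [d2 _ _] := Cpsi2 _ Vp.
have e1 : \forall q \near p, ((fun q => (psi q).1) \o phi) q = fst q.
  by apply: filterS nU => q /UV [_ /= ->].
have e2 : \forall q \near p, ((fun q => (psi q).2) \o phi) q = snd q.
  by apply: filterS nU => q /UV [_ /= ->].
have D1 := dif_near e1 (dif_mapcomp Cphi Up d1).
have D2 := dif_near e2 (dif_mapcomp Cphi Up d2).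
have [_ a1] := dif_px D1; have [_ a2] := dif_py D1.
have [_ b1] := dif_px (dif_fst p); have [_ b2] := dif_py (dif_fst p).
have [_ a3] := dif_px D2; have [_ a4] := dif_py D2.
have [_ b3] := dif_px (dif_snd p); have [_ b4] := dif_py (dif_snd p).
rewrite /jdet; move: a1 a2 a3 a4; rewrite b1 b2 b3 b4.
rewrite -/(jac11 psi (phi p)) -/(jac12 psi (phi p)) -/(jac21 psi (phi p)) -/(jac22 psi (phi p)).
move: (jac11 psi (phi p)) (jac12 psi (phi p)) (jac21 psi (phi p)) (jac22 psi (phi p)).
move: (jac11 phi p) (jac12 phi p) (jac21 phi p) (jac22 phi p) => x1 x2 x3 x4 y1 y2 y3 y4.
move=> a1 a2 a3 a4.
transitivity ((y1 * x1 + y2 * x3) * (y3 * x2 + y4 * x4) - (y1 * x2 + y2 * x4) * (y3 * x1 + y4 * x3));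
  first by ring.
by rewrite -a1 -a2 -a3 -a4; ring.
Qed.

Lemma diffeo2_sym U V phi psi : diffeo2 U V phi psi -> diffeo2 V U psi phi.
Proof.
move=> H; have [oU oV UV VU [Cphi Cpsi J]] := H; split=> //; split=> // q Vq.
have [Uq qq] := VU _ Vq; have := diffeo2_jac H Uq; rewrite qq => E.
have H1 : (0 : R) < 1 by exact: ltr01.
by rewrite -E pmulr_lgt0 // in H1; exact: J.
Qed.

Lemma jdet_continuous U phi p : C1map U phi -> U p -> {for p, continuous (jdet phi)}.
Proof.
move=> [C1 C2] Up; have [_ a b] := C1 _ Up; have [_ c d] := C2 _ Up.
apply: continuous_add; first exact: continuous_mul a d.
apply: continuousN; exact: continuous_mul b c.
Qed.

(** Pulls back f as a density. The extension by zero is continuous when f has compact support in the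
    image. *)
Definition density_pull phi U (f : R * R -> R) (p : R * R) : R :=
  if `[< U p >] then f (phi p) * jdet phi p else 0.

Definition compactly_in (K V : set (R * R)) (f : R * R -> R) :=
  [/\ compact K, K `<=` V, continuous f & forall p, ~ K p -> f p = 0].

Lemma compact_bounded_plane (K : set (R * R)) : compact K ->
  exists2 N : R, 0 <= N & forall p, K p -> `|p| <= N.
Proof.
move=> cK; have [N N0 H] := @compact_bounded_fun R _ K (fun p => `|p|) cK (fun p _ => @norm_continuous _ _ p).
by exists N => // p /H; rewrite normr_id.
Qed.

Lemma compact_closed_plane (K : set (R * R)) : compact K -> closed K.
Proof. by apply: compact_closed; exact: norm_hausdorff. Qed.

Lemma off_compact_near (K : set (R * R)) p : compact K -> ~ K p -> \forall q \near p, ~ K q.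
Proof.
move=> /compact_closed_plane/closed_openC oK nK.
exact: (open_nbhs_nbhs (conj oK nK)).
Qed.

Lemma compactly_in_cc K V f : compactly_in K V f -> exists N, cc f N.
Proof.
move=> [cK _ cf f0]; have [N N0 H] := compact_bounded_plane cK; exists N; split=> // p pN.
by apply: f0 => /H; rewrite leNgt pN.
Qed.

Lemma density_pull_compactly U V phi psi K f : diffeo2 U V phi psi -> compactly_in K V f ->
  compactly_in (psi @` K) U (density_pull phi U f).
Proof.
move=> [oU oV UV VU [Cphi Cpsi J]] [cK KV cf f0]; split.
- apply: continuous_compact cK; apply: continuous_in_subspaceT => q /set_mem /KV.
  exact: C1map_continuous.
- by move=> _ [q /KV/VU [Uq _] <-].
- have cKi : compact (psi @` K).
    apply: continuous_compact cK; apply: continuous_in_subspaceT => q /set_mem /KV.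
    exact: C1map_continuous.
  move=> p; have [Up|nUp] := pselect (U p).
    apply: (@near_continuous _ _ _ (fun p => f (phi p) * jdet phi p)).
      apply: filterS (open_nbhs_nbhs (conj oU Up)) => q Uq; rewrite /density_pull.
      by case: asboolP.
    apply: continuous_mul (jdet_continuous Cphi Up).
    exact: continuous_at_comp (C1map_continuous Cphi Up) (cf _).
  have nK : ~ (psi @` K) p by move=> [q /KV/VU [Uq _] qp]; apply: nUp; rewrite -qp.
  apply: (@near_continuous _ _ _ (fun=> 0)); last exact: cst_continuous.
  apply: filterS (off_compact_near cKi nK) => q nKq; rewrite /density_pull.
  case: asboolP => // Uq; rewrite f0 ?mul0r // => Kq; apply: nKq; exists (phi q) => //.
  by have [] := UV _ Uq.
- move=> p nK; rewrite /density_pull; case: asboolP => // Up; rewrite f0 ?mul0r // => Kp.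
  by apply: nK; exists (phi p) => //; have [] := UV _ Up.
Qed.

Definition rect (a b c d : R) : set (R * R) := [set` `]a, b]] `*` [set` `]c, d]].

Lemma rectP a b c d p : rect a b c d p <-> (a < p.1 <= b) /\ (c < p.2 <= d).
Proof. by rewrite /rect /= !in_itv /=. Qed.

Lemma rect_meas a b c d : meas (rect a b c d).
Proof. by apply: measurableX; exact: measurable_itv. Qed.

Lemma rect_leb a b c d : a <= b -> c <= d -> leb2 (rect a b c d) = ((b - a) * (d - c))%:E.
Proof.
have I x y : x <= y -> leb [set` `]x, y]] = (y - x)%:E.
  move=> xy; rewrite lebesgue_measure_itv /= lte_fin.
  by case: ltgtP xy => // -> _; rewrite subrr.
move=> ab cd; rewrite /rect /leb2 product_measure1E; [|exact: measurable_itv|exact: measurable_itv].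
by have E1 := I _ _ ab; have E2 := I _ _ cd; rewrite [X in (X * _)%E]E1 [X in (_ * X)%E]E2 -EFinM.
Qed.

Lemma open_map_preimage_meas U phi (B : set (R * R)) a b c d : open U -> C1map U phi ->
  meas (U `&` phi @^-1` rect a b c d).
Proof.
move=> oU C.
have m1 : mfun U (fun p => (phi p).1).
  exact: (open_measurable_prod_fun oU (fun p Up => C1on_continuous C.1 Up)).
have m2 : mfun U (fun p => (phi p).2).
  exact: (open_measurable_prod_fun oU (fun p Up => C1on_continuous C.2 Up)).
have mU := open_prod_measurable oU.
have -> : U `&` phi @^-1` rect a b c d =
    (U `&` (fun p => (phi p).1) @^-1` [set` `]a, b]]) `&`
    (U `&` (fun p => (phi p).2) @^-1` [set` `]c, d]]).
  apply/seteqP; split=> p; first by move=> [Up [h1 h2]]; split; split.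
  by move=> [[Up h1] [_ h2]].
by apply: measurableI; [apply: m1|apply: m2] => //; exact: measurable_itv.
Qed.

Lemma cc_integrable_on f N (A : set (R * R)) : cc f N -> meas A ->
  (@leb2 R).-integrable A (EFin \o f).
Proof. by move=> Hf mA; apply: (@integrableS _ _ _ _ setT) => //; exact: cc_integrable Hf. Qed.

Definition I2on (A : set (R * R)) (f : R * R -> R) : R := \int[@leb2 R]_(p in A) f p.

Lemma I2on_setU f N (A B : set (R * R)) : cc f N -> meas A -> meas B -> A `&` B = set0 ->
  I2on (A `|` B) f = I2on A f + I2on B f.
Proof.
move=> Hf mA mB AB; apply: Rintegral_setU => //.
  by apply: (cc_integrable_on Hf); exact: measurableU.
by apply/disj_set2P.
Qed.

Lemma I2on_ge0 (A : set (R * R)) f : (forall p, A p -> 0 <= f p) -> 0 <= I2on A f.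
Proof. by move=> f0; apply: Rintegral_ge0. Qed.

Lemma I2on_sub f N (A B : set (R * R)) : cc f N -> (forall p, 0 <= f p) -> meas A -> meas B ->
  A `<=` B -> I2on A f <= I2on B f.
Proof.
move=> Hf f0 mA mB AB; rewrite -(setDUK AB) (I2on_setU Hf mA (measurableD mB mA)) ?setDIK //.
by rewrite lerDl; exact: I2on_ge0.
Qed.

Lemma I2on_lower f N (A : set (R * R)) (v m : R) : cc f N -> meas A -> leb2 A = m%:E ->
  (forall p, A p -> v <= f p) -> v * m <= I2on A f.
Proof.
move=> Hf mA Am fv; have fin : (leb2 A < +oo)%E by rewrite Am ltry.
have -> : v * m = \int[@leb2 R]_(p in A) (cst v) p.
  by rewrite Rintegral_cst //; exact: (f_equal (fun z => v * fine z) (esym Am)).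
apply: le_Rintegral => //; last exact: (cc_integrable_on Hf).
apply: measurable_bounded_integrable => //.
by exists `|v|; split; rewrite ?num_real // => M /ltW BM p _ /=.
Qed.

Lemma I2on_upper f N (A : set (R * R)) (v m : R) : cc f N -> meas A -> leb2 A = m%:E ->
  (forall p, A p -> f p <= v) -> I2on A f <= v * m.
Proof.
move=> Hf mA Am fv; have fin : (leb2 A < +oo)%E by rewrite Am ltry.
have -> : v * m = \int[@leb2 R]_(p in A) (cst v) p.
  by rewrite Rintegral_cst //; exact: (f_equal (fun z => v * fine z) (esym Am)).
apply: le_Rintegral => //; first exact: (cc_integrable_on Hf).
apply: measurable_bounded_integrable => //.
by exists `|v|; split; rewrite ?num_real // => M /ltW BM p _ /=.
Qed.

(* The preimage of a small square contains the preimage of a slightly smaller square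
   under the tangent affine map. *)
Lemma affine_inside U phi q (tau e0 : R) : open U -> C1map U phi -> U q -> 0 < jdet phi q ->
  0 < tau -> tau < 1 / 4 -> 0 < e0 -> exists2 e : R, 0 < e & forall a c s, 0 <= s -> s < e ->
    a <= (phi q).1 <= a + s -> c <= (phi q).2 <= c + s ->
    exists E : set (R * R), [/\ meas E,
      leb2 E = (((1 - 2 * tau) * s) ^+ 2 / jdet phi q)%:E &
      forall p, E p -> [/\ U p, rect a (a + s) c (c + s) (phi p) & `|p - q| < e0]].
Proof.
move=> oU [C1 C2] Uq J0 t0 t4 e00.
have [D1 _ _] := C1 _ Uq; have [D2 _ _] := C2 _ Uq.
rewrite -/(jac11 phi q) -/(jac12 phi q) in D1.
rewrite -/(jac21 phi q) -/(jac22 phi q) in D2.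
have JE : jdet phi q = jac11 phi q * jac22 phi q - jac12 phi q * jac21 phi q by [].
move: D1 D2 JE J0; move: (jac11 phi q) (jac12 phi q) (jac21 phi q) (jac22 phi q) (jdet phi q).
move=> j1 j2 j3 j4 J D1 D2 JE J0.
(* An upper bound for the norm of the inverse of the Jacobian matrix: it bounds |p - q| by C s for p
   in the tangent preimage of a square of side s. *)
pose C := (`|j1| + `|j2| + `|j3| + `|j4|) / J.
have C0 : 0 <= C by rewrite divr_ge0 ?(ltW J0) // !addr_ge0.
have C1p : 0 < C + 1 by rewrite ltr_wpDl.
have /near_normP[du du0 HU] := open_nbhs_nbhs (conj oU Uq).
have tC : 0 < tau / (C + 1) by rewrite divr_gt0.
have [d1 d10 {}D1] := D1 _ tC; have [d2 d20 {}D2] := D2 _ tC.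
pose dm := Num.min (Num.min du e0) (Num.min d1 d2).
have dm0 : 0 < dm by rewrite !lt_min du0 e00 d10.
exists (dm / (C + 1)); first by rewrite divr_gt0.
move=> a c s s0 se pa pc.
pose T := affine_map j1 j2 j3 j4 ((phi q).1 - j1 * q.1 - j2 * q.2) ((phi q).2 - j3 * q.1 - j4 * q.2).
pose B := rect (a + tau * s) (a + s - tau * s) (c + tau * s) (c + s - tau * s).
have ts : tau * s <= 1 / 4 * s by rewrite ler_wpM2r // ltW.
have D0 : j1 * j4 - j2 * j3 != 0 by rewrite -JE gt_eqF.
exists (T @^-1` B); split.
- by apply: continuous_preimage_meas; [exact: continuous_affine|exact: continuous_affine|exact: rect_meas].
- rewrite (leb2_affine _ _ D0) ?rect_leb; [|lra|lra|exact: rect_meas].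
  rewrite -JE gtr0_norm // -EFinM; congr EFin; field; by rewrite gt_eqF.
move=> p /rectP [/andP[h1 h2] /andP[h3 h4]].
set z1 := (T p).1 - (phi q).1; set z2 := (T p).2 - (phi q).2.
have ez1 : z1 = j1 * (p.1 - q.1) + j2 * (p.2 - q.2) by rewrite /z1 /T /=; ring.
have ez2 : z2 = j3 * (p.1 - q.1) + j4 * (p.2 - q.2) by rewrite /z2 /T /=; ring.
have tau0 : 0 <= tau * s by rewrite mulr_ge0 // ltW.
have nz1 : `|z1| <= s by move/andP: pa => [pa1 pa2]; rewrite ler_norml /z1; apply/andP; split; lra.
have nz2 : `|z2| <= s by move/andP: pc => [pc1 pc2]; rewrite ler_norml /z2; apply/andP; split; lra.
have ep1 : p.1 - q.1 = (j4 * z1 - j2 * z2) / J.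
  rewrite ez1 ez2 JE; field; by rewrite D0.
have ep2 : p.2 - q.2 = (j1 * z2 - j3 * z1) / J.
  rewrite ez1 ez2 JE; field; by rewrite D0.
have np : `|p - q| <= C * s.
  have b (x y u v : R) : `|u| <= s -> `|v| <= s -> `|x * u - y * v| <= (`|x| + `|y|) * s.
    move=> us vs; apply: (le_trans (ler_normB _ _)); rewrite !normrM mulrDl.
    by rewrite lerD // ler_wpM2l.
  rewrite /C mulrAC; apply: norm_pair_le => /=.
    rewrite ep1 normrM normfV [`|J|]gtr0_norm // ler_pM2r ?invr_gt0 //.
    apply: (le_trans (b _ _ _ _ nz1 nz2)); rewrite ler_wpM2r //.
    have := normr_ge0 j1; have := normr_ge0 j3; lra.
  rewrite ep2 normrM normfV [`|J|]gtr0_norm // ler_pM2r ?invr_gt0 //.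
  apply: (le_trans (b _ _ _ _ nz2 nz1)); rewrite ler_wpM2r //.
  have := normr_ge0 j2; have := normr_ge0 j4; lra.
have Cs : C * s <= (C + 1) * s by rewrite ler_wpM2r // lerDl.
have nd : `|p - q| < dm.
  apply: (le_lt_trans np); apply: (le_lt_trans Cs); by rewrite mulrC -ltr_pdivlMr.
move: (nd); rewrite !lt_min => /andP[/andP[n1 n2] /andP[n3 n4]].
have small : tau / (C + 1) * `|p - q| <= tau * s.
  rewrite mulrAC ler_pdivrMr // -mulrA ler_wpM2l ?(ltW t0) // mulrC.
  exact: le_trans np Cs.
have {}D1 := le_trans (D1 _ n3) small; have {}D2 := le_trans (D2 _ n4) small.
rewrite -ez1 /z1 in D1; rewrite -ez2 /z2 in D2.
split; [exact: HU| |exact: n2].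
move: D1 D2; rewrite !ler_norml => /andP[k1 k2] /andP[k3 k4].
clear -h1 h2 h3 h4 k1 k2 k3 k4.
apply/rectP; split; apply/andP; split; lra.
Qed.

(** One inequality suffices, as the inverse map will give the other. For it one only has to fit a
    set of the right area inside the preimage of a small square. *)
Lemma cov_le U V phi psi K f : diffeo2 U V phi psi -> compactly_in K V f -> (forall p, 0 <= f p) ->
  I2 f <= I2 (density_pull phi U f).
Proof.
move=> H Hf f0; have [oU oV UV VU [Cphi Cpsi J]] := H.
have Hg := density_pull_compactly H Hf; set g := density_pull phi U f in Hg *.
have [N cf] := compactly_in_cc Hf; have [N' cg] := compactly_in_cc Hg.
have [cK KV cnf fK] := Hf; have [_ _ cng _] := Hg; have [N0 _ fN] := cf.
have g0 p : 0 <= g p.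
  by rewrite /g /density_pull; case: asboolP => // Up; rewrite mulr_ge0 // ltW // J.
pose S a b c d := U `&` phi @^-1` rect a b c d.
have mS a b c d : meas (S a b c d) by exact: open_map_preimage_meas.
pose L := N + 1.
have L0 : 0 < L by rewrite ltr_wpDl.
have LL : - L <= L by lra.
pose A := (L - - L) * (L - - L).
have A0 : 0 <= A by rewrite /A mulr_ge0 // subr_ge0.
apply/ler_addgt0Pr => x x0.
have k0 : 0 < x / (A + 1) by rewrite divr_gt0 // ltr_wpDl.
set k := x / (A + 1) in k0.
suff M : I2on (rect (- L) L (- L) L) f <= I2on (S (- L) L (- L) L) g + k * ((L - - L) * (L - - L)).
  have -> : I2 f = I2on (rect (- L) L (- L) L) f.
    rewrite /I2on Rintegral_mkcond; apply: eq_Rintegral => p _; rewrite patchE.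
    case: ifPn => // pn; apply: fN; rewrite ltNge; apply: contra pn => pN.
    rewrite inE; apply/rectP; have := norm_fst_le p; have := norm_snd_le p.
    rewrite -/(cbox N p); move=> n2 n1.
    have {}n1 := le_trans n1 pN; have {}n2 := le_trans n2 pN.
    by move: n1 n2; rewrite !ler_norml /L => /andP[? ?] /andP[? ?]; split; apply/andP; split; lra.
  apply: (le_trans M); apply: lerD.
    by apply: I2on_sub cg g0 (mS _ _ _ _) measurableT _.
  rewrite -/A /k mulrAC ler_pdivrMr ?ltr_wpDl // ler_wpM2l ?(ltW x0) // lerDl //.
(* All three terms are additive under cutting, so bisection reduces the inequality, with its error k
   per unit of area, to small squares around one point. *)
pose P a b c d := I2on (rect a b c d) f <= I2on (S a b c d) g + k * ((b - a) * (d - c)).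
apply: (@rectangle_bisection R P) => //.
- move=> a m b c d /andP[am mb] cd P1 P2; rewrite /P.
  have -> : rect a b c d = rect a m c d `|` rect m b c d.
    apply/seteqP; split=> p.
      by move=> /rectP[/andP[? ?] /andP[? ?]]; have [?|?] := leP p.1 m; [left|right];
        apply/rectP; split; apply/andP; split => //.
    by move=> [] /rectP[/andP[? ?] /andP[? ?]]; apply/rectP; split; apply/andP; split => //; lra.
  have -> : S a b c d = S a m c d `|` S m b c d.
    apply/seteqP; split=> p.
      by move=> [Up /rectP[/andP[? ?] /andP[? ?]]]; have [?|?] := leP (phi p).1 m; [left|right];
        split => //; apply/rectP; split; apply/andP; split => //.
    by move=> [] [Up /rectP[/andP[? ?] /andP[? ?]]]; split => //; apply/rectP; split;
      apply/andP; split => //; lra.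
  have dj : rect a m c d `&` rect m b c d = set0.
    apply/seteqP; split=> p // [/rectP[/andP[? ?] _] /rectP[/andP[? ?] _]].
    by lra.
  rewrite (I2on_setU cf) ?(I2on_setU cg) //; try exact: rect_meas.
    by apply: (le_trans (lerD P1 P2)); rewrite le_eqVlt; apply/orP; left; apply/eqP; ring.
  apply/seteqP; split=> p // [[_ /rectP[/andP[? ?] _]] [_ /rectP[/andP[? ?] _]]].
  by lra.
- move=> a b c m d ab /andP[cm md] P1 P2; rewrite /P.
  have -> : rect a b c d = rect a b c m `|` rect a b m d.
    apply/seteqP; split=> p.
      by move=> /rectP[/andP[? ?] /andP[? ?]]; have [?|?] := leP p.2 m; [left|right];
        apply/rectP; split; apply/andP; split => //.
    by move=> [] /rectP[/andP[? ?] /andP[? ?]]; apply/rectP; split; apply/andP; split => //; lra.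
  have -> : S a b c d = S a b c m `|` S a b m d.
    apply/seteqP; split=> p.
      by move=> [Up /rectP[/andP[? ?] /andP[? ?]]]; have [?|?] := leP (phi p).2 m; [left|right];
        split => //; apply/rectP; split; apply/andP; split => //.
    by move=> [] [Up /rectP[/andP[? ?] /andP[? ?]]]; split => //; apply/rectP; split;
      apply/andP; split => //; lra.
  have dj : rect a b c m `&` rect a b m d = set0.
    apply/seteqP; split=> p // [/rectP[_ /andP[? ?]] /rectP[_ /andP[? ?]]].
    by lra.
  rewrite (I2on_setU cf) ?(I2on_setU cg) //; try exact: rect_meas.
    by apply: (le_trans (lerD P1 P2)); rewrite le_eqVlt; apply/orP; left; apply/eqP; ring.
  apply/seteqP; split=> p // [[_ /rectP[_ /andP[? ?]]] [_ /rectP[_ /andP[? ?]]]].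
  by lra.
move=> p pL1 pL2.
have [Kp|nKp] := pselect (K p); last first.
  have /near_normP[e e0 He] := off_compact_near cK nKp.
  exists e => // a b c d _ _ _ _ /andP[ap pb] /andP[cp pd] ba dc _; rewrite /P.
  apply: (@le_trans _ _ 0).
    have ab : a <= b by exact: le_trans pb.
    have cd : c <= d by exact: le_trans pd.
    have := @I2on_upper f N (rect a b c d) 0 _ cf (rect_meas _ _ _ _) (rect_leb ab cd).
    rewrite mul0r; apply=> q /rectP[/andP[H0 H1] /andP[H2 H3]].
    rewrite fK //; apply: He; clear -ap pb cp pd ba dc H0 H1 H2 H3.
    by apply: norm_pair_lt => /=; rewrite ltr_norml; apply/andP; split; lra.
  rewrite addr_ge0 //; first exact: I2on_ge0.
  by rewrite mulr_ge0 ?(ltW k0) // mulr_ge0 //; lra.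
have Vp := KV _ Kp; have [Uq pq] := VU _ Vp; set q := psi p in Uq pq.
have Jq := J _ Uq.
have gq : g q = f p * jdet phi q by rewrite /g /density_pull asboolT // pq.
pose F := f p; have F0 : 0 <= F by exact: f0.
have F1 : 0 < F + 1 by rewrite ltr_wpDl.
(* The relative loss of area is at most 4 tau. With 4 tau F <= k / 3, the oscillation of f and that
   of the pulled density take the other two thirds of k. *)
pose tau := Num.min (1 / 8) (k / (12 * (F + 1))).
have tau0 : 0 < tau.
  by rewrite lt_min; apply/andP; split; apply: divr_gt0 => //; exact: mulr_gt0.
have tau4 : tau < 1 / 4 by rewrite gt_min; apply/orP; left; lra.
have k30 : 0 < k / 3 by rewrite divr_gt0.
have /continuousP_eps /(_ _ k30)[d1 d10 Hd1] := cnf p.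
have kJ0 : 0 < k / 3 * jdet phi q by rewrite mulr_gt0.
have /continuousP_eps /(_ _ kJ0)[d2 d20 Hd2] := cng q.
have [e e0 He] := affine_inside oU Cphi Uq Jq tau0 tau4 d20.
exists (Num.min e d1); first by rewrite lt_min e0.
move=> a b c d _ _ _ _ ap cp; rewrite !lt_min => /andP[s1 s2] /andP[s3 s4] ratio.
have LLp : L - - L != 0 by rewrite gt_eqF //; lra.
(* The bisection starts from a square, so every rectangle it meets is a square. *)
have {}ratio : d - c = b - a by apply: (mulIf LLp); rewrite ratio.
pose s := b - a; have bE : b = a + s by rewrite /s addrC subrK.
have dE : d = c + s by rewrite /s -ratio addrC subrK.
have s0 : 0 <= s by move/andP: ap => [? ?]; rewrite /s; lra.
have ap' : a <= (phi q).1 <= a + s by rewrite pq -bE.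
have cp' : c <= (phi q).2 <= c + s by rewrite pq -dE.
have [E [mE lE HE]] := He a c s s0 s1 ap' cp'.
have ab : a <= b by rewrite bE lerDl.
have cd : c <= d by rewrite dE lerDl.
have up : I2on (rect a b c d) f <= (F + k / 3) * ((b - a) * (d - c)).
  apply: (I2on_upper cf (rect_meas _ _ _ _) (rect_leb ab cd)) => p' /rectP[/andP[h1 h2] /andP[h3 h4]].
  have : `|f p' - f p| < k / 3.
    apply: Hd1; move/andP: ap => [k1 k2]; move/andP: cp => [k3 k4].
    clear -h1 h2 h3 h4 k1 k2 k3 k4 s2 s4.
    by apply: norm_pair_lt => /=; rewrite ltr_norml; apply/andP; split; lra.
  by rewrite ltr_norml /F => /andP[_ h]; lra.
have low : (F * jdet phi q - k / 3 * jdet phi q) * (((1 - 2 * tau) * s) ^+ 2 / jdet phi q) <=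
    I2on (S a b c d) g.
  apply: (@le_trans _ _ (I2on E g)).
    apply: (I2on_lower cg mE lE) => p' /HE [_ _ n].
    by have := Hd2 _ n; rewrite gq -/F ltr_norml => /andP[h _]; lra.
  apply: (I2on_sub cg g0 mE (mS _ _ _ _)) => p' /HE [Up' rp' _].
  by split => //=; rewrite /preimage /= bE dE.
rewrite /P; apply: (le_trans up); apply: (@le_trans _ _ ((F * jdet phi q - k / 3 * jdet phi q) *
  (((1 - 2 * tau) * s) ^+ 2 / jdet phi q) + k * ((b - a) * (d - c)))); last by rewrite lerD2r.
have -> : (F * jdet phi q - k / 3 * jdet phi q) * (((1 - 2 * tau) * s) ^+ 2 / jdet phi q) =
  (F - k / 3) * (1 - 2 * tau) ^+ 2 * s ^+ 2 by field; rewrite gt_eqF.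
rewrite ratio -/s -expr2 -mulrDl ler_wpM2r ?exprn_ge0 //.
have tF : 4 * tau * F <= k / 3.
  have t2 : tau <= k / (12 * (F + 1)) by rewrite ge_min lexx orbT.
  apply: (@le_trans _ _ (4 * (k / (12 * (F + 1))) * (F + 1))).
    by apply: ler_pM => //; [rewrite mulr_ge0 // ltW|rewrite ler_wpM2l|rewrite lerDl].
  by rewrite le_eqVlt; apply/orP; left; apply/eqP; field; rewrite gt_eqF.
have q1 : (1 - 2 * tau) ^+ 2 <= 1.
  by rewrite expr_le1 //; clear -tau0 tau4; lra.
have q2 : 1 - 4 * tau <= (1 - 2 * tau) ^+ 2.
  have -> : (1 - 2 * tau) ^+ 2 = 1 - 4 * tau + (2 * tau) ^+ 2 by ring.
  by rewrite lerDl sqr_ge0.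
have a1 : F * (1 - 4 * tau) <= F * (1 - 2 * tau) ^+ 2 by rewrite ler_wpM2l.
have a2 : k / 3 * (1 - 2 * tau) ^+ 2 <= k / 3 by rewrite ler_piMr // ltW.
by clear -a1 a2 tF; rewrite mulrBl; lra.
Qed.

(** Pulling back by phi and then by psi returns f, since the Jacobians are inverse to each other; so
    [cov_le] for psi is the missing inequality. *)
Lemma cov_eq U V phi psi K f : diffeo2 U V phi psi -> compactly_in K V f -> (forall p, 0 <= f p) ->
  I2 f = I2 (density_pull phi U f).
Proof.
move=> H Hf f0; apply/eqP; rewrite eq_le (cov_le H Hf f0) /=.
have [oU oV UV VU [Cphi Cpsi J]] := H.
have H' := diffeo2_sym H.
have g0 p : 0 <= density_pull phi U f p.
  by rewrite /density_pull; case: asboolP => // Up; rewrite mulr_ge0 // ltW // J.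
have := cov_le H' (density_pull_compactly H Hf) g0.
suff -> : density_pull psi V (density_pull phi U f) = f by [].
apply/funext => q; rewrite /density_pull; case: asboolP => [Vq|nVq].
  have [Uq qq] := VU _ Vq; rewrite asboolT // qq -mulrA.
  have := diffeo2_jac H' Vq; rewrite [jdet phi _ * _]mulrC => E.
  by have := diffeo2_jac H Uq; rewrite qq mulrC => ->; rewrite mulr1.
by have [_ KV _ fK] := Hf; rewrite fK // => /KV.
Qed.

End ChangeOfVariables.

(** * Change of variables on open sets and their differences *)

Section ChangeOfVariablesBorel.
Variable R : realType.
Local Notation plane := (measurableTypeR R * measurableTypeR R)%type.
Local Notation meas A := (measurable (A : set plane)).
Local Notation mfun A f := (measurable_fun (A : set plane) (f : plane -> R)).
Implicit Types (U V O : set (R * R)) (phi psi : R * R -> R * R).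

(** The distance to the complement of O, truncated at 1; the extra element 1 also keeps the infimum
    meaningful when the complement is empty. *)
Definition depth O (p : R * R) : R := inf ([set 1] `|` [set `|p - q| | q in ~` O]).

Lemma depth_has_inf O p : has_inf ([set 1] `|` [set `|p - q| | q in ~` O]).
Proof.
split; first by exists 1; left.
by exists 0 => _ [->|[q _ <-]] //=.
Qed.

Lemma depth_ge0 O p : 0 <= depth O p.
Proof. by apply: lb_le_inf; [exists 1; left|move=> _ [->|[q _ <-]] //=]. Qed.

Lemma depth_out O p : ~ O p -> depth O p = 0.
Proof.
move=> nO; apply/eqP; rewrite eq_le depth_ge0 andbT.
apply: ge_inf; first by have [] := depth_has_inf O p.
by right; exists p => //; rewrite subrr normr0.
Qed.

Lemma depth_in O p : open O -> O p -> 0 < depth O p.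
Proof.
move=> oO Op; have /near_normP[d d0 H] := open_nbhs_nbhs (conj oO Op).
apply: (@lt_le_trans _ _ (Num.min 1 d)); first by rewrite lt_min ltr01.
apply: lb_le_inf; first by exists 1; left.
move=> _ [->|[q nq <-]] /=; first by rewrite ge_min lexx.
rewrite ge_min; apply/orP; right; rewrite leNgt; apply/negP => h; apply: nq; apply: H.
by rewrite distrC.
Qed.

Lemma depth_lipschitz O p q : depth O p <= depth O q + `|p - q|.
Proof.
rewrite -lerBlDr; apply: lb_le_inf; first by exists 1; left.
move=> _ [->|[z nz <-]] /=; rewrite lerBlDr.
  have : depth O p <= 1 by apply: ge_inf; [have [] := depth_has_inf O p|left].
  by move=> /le_trans; apply; rewrite lerDl.
have : depth O p <= `|p - z| by apply: ge_inf; [have [] := depth_has_inf O p|right; exists z].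
by move=> /le_trans; apply; rewrite [leRHS]addrC; exact: ler_distD.
Qed.

Lemma depth_continuous O : continuous (depth O).
Proof.
move=> p; apply/continuousP_eps => e e0; exists e => // q qp.
have := depth_lipschitz O p q; have := depth_lipschitz O q p; rewrite (distrC p q) ltr_norml.
by move=> h1 h2; apply/andP; split; lra.
Qed.

(** Zero where the depth is at most 1 / n and one where it is at least 2 / n: continuous functions
    increasing to the indicator of O. *)
Definition inner_cutoff O (n : nat) (p : R * R) : R := Num.min 1 (Num.max 0 (n%:R * depth O p - 1)).

Lemma inner_cutoff_continuous O n : continuous (inner_cutoff O n).
Proof.
move=> p; apply: (@continuous_min _ _ (cst 1) _ p); first exact: cst_continuous.
apply: (@continuous_max _ _ (cst 0) _ p); first exact: cst_continuous.
apply: (@continuous_add R (fun p => n%:R * depth O p) (fun=> -1)); last exact: cst_continuous.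
by apply: continuous_mul; [exact: cst_continuous|exact: depth_continuous].
Qed.

Lemma inner_cutoff_ge0 O n p : 0 <= inner_cutoff O n p.
Proof. by rewrite le_min ler01 le_max lexx. Qed.

Lemma inner_cutoff_mono O n m p : (n <= m)%N -> inner_cutoff O n p <= inner_cutoff O m p.
Proof.
move=> nm; rewrite /inner_cutoff le_min ge_min lexx /= ge_min; apply/orP; right.
rewrite ge_max le_max lexx /= le_max; apply/orP; right.
by rewrite lerD2r ler_wpM2r ?depth_ge0 // ler_nat.
Qed.

Lemma inner_cutoff_out O n p : ~ O p -> inner_cutoff O n p = 0.
Proof.
by move=> /depth_out E; rewrite /inner_cutoff E mulr0 sub0r (max_idPl _) ?lerN10 // (min_idPr _).
Qed.

Lemma inner_cutoff_cvg O p : open O -> O p -> \forall n \near \oo, inner_cutoff O n p = 1.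
Proof.
move=> oO Op; have d0 := depth_in oO Op.
exists (Num.truncn (2 / depth O p)).+1 => //= n nn.
have : 2 / depth O p < n%:R.
  by apply: (lt_le_trans (truncnS_gt _)); rewrite ler_nat.
rewrite ltr_pdivrMr // => h; rewrite /inner_cutoff; apply/min_idPl; rewrite le_max.
by apply/orP; right; move: h; lra.
Qed.

Lemma inner_cutoff_compactly O n f N : cc f N ->
  exists K, compactly_in K O (fun p => f p * inner_cutoff O n p).
Proof.
move=> [N0 cf f0]; exists (cbox N `&` [set p | 1 <= n%:R * depth O p]); split.
- apply: compact_closedI; first exact: cbox_compact.
  have -> : [set p | 1 <= n%:R * depth O p] = (fun p => n%:R * depth O p) @^-1` [set x | 1 <= x] by [].
  apply: closed_comp; last exact: closed_ge.
  move=> p _; apply: continuous_mul; [exact: cst_continuous|exact: depth_continuous].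
- move=> p [_ /= h]; apply: contrapT => /depth_out E; move: h; rewrite E mulr0.
  by rewrite leNgt ltr01.
- by move=> p; apply: continuous_mul; [exact: cf|exact: inner_cutoff_continuous].
move=> p nK; have [pN|pN] := ltP N `|p|; first by rewrite f0 // mul0r.
have h : n%:R * depth O p < 1 by rewrite ltNge; apply/negP => h; apply: nK.
rewrite /inner_cutoff (max_idPl _) ?(min_idPr _) ?mulr0 //.
by rewrite subr_le0 ltW.
Qed.

Lemma diffeo2_preimage_open U V phi psi O : diffeo2 U V phi psi -> open O -> open (U `&` phi @^-1` O).
Proof.
move=> [oU _ _ _ [C _ _]] oO; rewrite openE => p [Up Op]; apply: filterI.
  exact: open_nbhs_nbhs.
by apply: (C1map_continuous C Up); exact: open_nbhs_nbhs.
Qed.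

Lemma density_pull_measurable U V phi psi f : diffeo2 U V phi psi -> continuous f ->
  mfun U (density_pull phi U f).
Proof.
move=> [oU _ _ _ [C _ _]] cf; apply: (open_measurable_prod_fun oU) => p Up.
apply: (@near_continuous _ _ _ (fun p => f (phi p) * jdet phi p)).
  apply: filterS (open_nbhs_nbhs (conj oU Up)) => q Uq; rewrite /density_pull.
  by case: asboolP.
apply: continuous_mul (jdet_continuous C Up).
exact: continuous_at_comp (C1map_continuous C Up) (cf _).
Qed.

(** The cutoffs reduce to compact supports inside O, and both sides converge by monotone
    convergence. *)
Lemma cov_open U V phi psi O f N : diffeo2 U V phi psi -> open O -> O `<=` V -> cc f N ->
  (forall p, 0 <= f p) ->
  (\int[@leb2 R]_(p in O) (f p)%:E =
   \int[@leb2 R]_(p in U `&` phi @^-1` O) (density_pull phi U f p)%:E)%E.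
Proof.
move=> H oO OV cf f0; have [oU oV UV VU [Cphi Cpsi J]] := H.
have [N0 cnf fN] := cf.
have oP := diffeo2_preimage_open H oO; set P := U `&` phi @^-1` O in oP *.
have mO := open_prod_measurable oO; have mP := open_prod_measurable oP.
have mg : mfun P (density_pull phi U f).
  apply: (measurable_funS (open_prod_measurable oU)); last exact: density_pull_measurable H cnf.
  by move=> p [].
have g0 p : 0 <= density_pull phi U f p.
  by rewrite /density_pull; case: asboolP => // Up; rewrite mulr_ge0 // ltW // J.
pose a (n : nat) (p : R * R) := f p * inner_cutoff O n p.
pose b (n : nat) (p : R * R) := density_pull phi U f p * inner_cutoff O n (phi p).
have E n : (\int[@leb2 R]_(p in O) (a n p)%:E = \int[@leb2 R]_(p in P) (b n p)%:E)%E.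
  have [K HK] := inner_cutoff_compactly O n cf.
  have HK' : compactly_in K V (a n).
    by have [? ? ? ?] := HK; split=> // p Kp; apply: OV; auto.
  have a0 p : 0 <= a n p by rewrite mulr_ge0 // inner_cutoff_ge0.
  have eq := cov_eq H HK' a0.
  have [N1 c1] := compactly_in_cc HK'; have [N2 c2] := compactly_in_cc (density_pull_compactly H HK').
  have fin1 := integrable_fin_num measurableT (cc_integrable c1).
  have fin2 := integrable_fin_num measurableT (cc_integrable c2).
  have -> : (\int[@leb2 R]_(p in O) (a n p)%:E = \int[@leb2 R]_p (EFin \o a n) p)%E.
    rewrite integral_mkcond; apply: eq_integral => p _; rewrite patchE; case: ifPn => // /negP nO.
    by rewrite /= /a inner_cutoff_out ?mulr0 // => Op; apply: nO; rewrite inE.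
  have -> : (\int[@leb2 R]_(p in P) (b n p)%:E = \int[@leb2 R]_p (EFin \o density_pull phi U (a n)) p)%E.
    rewrite integral_mkcond; apply: eq_integral => p _; rewrite patchE; case: ifPn => [|/negP nP].
      rewrite inE => -[Up Op]; rewrite /= /b /density_pull asboolT // /a; congr EFin; ring.
    rewrite /= /density_pull; case: asboolP => // Up.
    rewrite /a inner_cutoff_out ?mulr0 ?mul0r // => Op; apply: nP; rewrite inE; split => //.
  by rewrite -(fineK fin1) -(fineK fin2); congr EFin.
have lim1 (D : set (R * R)) (g : R * R -> R) (F : R * R -> R * R) : meas D -> mfun D g ->
    (forall p, 0 <= g p) -> mfun D (fun p => inner_cutoff O 0 (F p)) ->
    (forall n, mfun D (fun p => inner_cutoff O n (F p))) -> (forall p, D p -> O (F p)) ->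
    ((\int[@leb2 R]_(p in D) (g p * inner_cutoff O n (F p))%:E)%E @[n --> \oo] -->
    (\int[@leb2 R]_(p in D) (g p)%:E)%E).
  move=> mD mg1 g10 _ mc DO.
  have -> : (\int[@leb2 R]_(p in D) (g p)%:E =
      \int[@leb2 R]_(p in D) limn (fun n => (g p * inner_cutoff O n (F p))%:E))%E.
    apply: eq_integral => p /set_mem Dp; apply/esym/cvg_lim => //.
    apply: cvg_near_cst; apply: filterS (inner_cutoff_cvg oO (DO _ Dp)) => n ->.
    by rewrite mulr1.
  apply: cvg_monotone_convergence => //.
  - by move=> n; apply/measurable_EFinP; apply: measurable_funM.
  - by move=> n p _; rewrite lee_fin mulr_ge0 // inner_cutoff_ge0.
  - by move=> p _ n m nm; rewrite lee_fin ler_wpM2l // inner_cutoff_mono.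
have mc n : mfun O (inner_cutoff O n).
  by apply: (open_measurable_prod_fun oO) => p _; exact: inner_cutoff_continuous.
have mc' n : mfun P (fun p => inner_cutoff O n (phi p)).
  apply: (open_measurable_prod_fun oP) => p [Up _].
  exact: continuous_at_comp (C1map_continuous Cphi Up) (@inner_cutoff_continuous O n _).
have mf : mfun O f by apply: (open_measurable_prod_fun oO) => p _; exact: cnf.
have L1 := lim1 O f id mO mf f0 (mc 0%N) mc (fun p Op => Op).
have L2 := lim1 P (density_pull phi U f) phi mP mg g0 (mc' 0%N) mc' (fun p Pp => Pp.2).
have E' : (fun n => (\int[@leb2 R]_(p in O) (f p * inner_cutoff O n (id p))%:E)%E) =
    (fun n => (\int[@leb2 R]_(p in P) (density_pull phi U f p * inner_cutoff O n (phi p))%:E)%E).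
  by apply/funext => n; exact: E.
by rewrite E' in L1; exact: cvg_unique L1 L2.
Qed.

Lemma adde_cancel (a x y : \bar R) : a \is a fin_num -> (a + x = a + y)%E -> x = y.
Proof.
move=> af /(congr1 (fun z => z - a)%E).
by rewrite addeAC subee // add0e addeAC subee // add0e.
Qed.

(* The shape, in a chart, of the pieces that the integral over the surface is cut into. *)
Lemma cov_locally_closed_ge0 U V phi psi O O2 f N : diffeo2 U V phi psi -> open O -> O `<=` V ->
  open O2 -> cc f N -> (forall p, 0 <= f p) ->
  (@leb2 R).-integrable (U `&` phi @^-1` (O `\` O2)) (EFin \o density_pull phi U f) /\
  I2on (U `&` phi @^-1` (O `\` O2)) (density_pull phi U f) = I2on (O `\` O2) f.
Proof.
move=> H oO OV oO2 cf f0; have [oU oV UV VU [Cphi Cpsi J]] := H.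
have cnf : continuous f by case: cf.
have g0 p : 0 <= density_pull phi U f p.
  by rewrite /density_pull; case: asboolP => // Up; rewrite mulr_ge0 // ltW // J.
pose O' := O `&` O2; have oO' : open O' by exact: openI.
have E1 := cov_open H oO OV cf f0.
have E2 : (\int[@leb2 R]_(p in O') (f p)%:E =
    \int[@leb2 R]_(p in U `&` phi @^-1` O') (density_pull phi U f p)%:E)%E.
  by apply: (cov_open H oO' _ cf f0) => p [/OV].
have -> : O `\` O2 = O `\` O' by rewrite /O' setDIr setDv set0U.
set P := U `&` phi @^-1` O in E1; set P' := U `&` phi @^-1` O' in E2.
have oP : open P := diffeo2_preimage_open H oO; have oP' : open P' := diffeo2_preimage_open H oO'.
have -> : U `&` phi @^-1` (O `\` O') = P `\` P'.
  apply/seteqP; split=> p; first by move=> [Up [Op nO]]; split => // -[_ /nO].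
  by move=> [[Up Op] nP]; split => //; split => // h; apply: nP.
have mO := open_prod_measurable oO; have mO' := open_prod_measurable oO'.
have mP := open_prod_measurable oP; have mP' := open_prod_measurable oP'.
have mg : mfun P (density_pull phi U f).
  apply: (measurable_funS (open_prod_measurable oU)); last exact: density_pull_measurable H cnf.
  by move=> p [].
have O'O : O' `<=` O by move=> p [].
have P'P : P' `<=` P by move=> p [Up [Op _]].
have S1 : (\int[@leb2 R]_(p in O) (f p)%:E = \int[@leb2 R]_(p in O') (f p)%:E +
    \int[@leb2 R]_(p in O `\` O') (f p)%:E)%E.
  rewrite -{1}(setDUK O'O) ge0_integral_setU //.
  - exact: measurableD.
  - apply/measurable_EFinP; apply: (@measurable_funTS _ _ plane); exact: continuous_measurable_prod_fun.
  - by move=> p _; rewrite lee_fin.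
  - by apply/disj_set2P; rewrite setDIK.
have S2 : (\int[@leb2 R]_(p in P) (density_pull phi U f p)%:E =
    \int[@leb2 R]_(p in P') (density_pull phi U f p)%:E +
    \int[@leb2 R]_(p in P `\` P') (density_pull phi U f p)%:E)%E.
  rewrite -{1}(setDUK P'P) ge0_integral_setU //.
  - exact: measurableD.
  - by apply/measurable_EFinP; rewrite setDUK.
  - by move=> p _; rewrite lee_fin.
  - by apply/disj_set2P; rewrite setDIK.
have fin (A : set (R * R)) : meas A -> (\int[@leb2 R]_(p in A) (f p)%:E \is a fin_num)%E.
  by move=> mA; exact: (integrable_fin_num mA (cc_integrable_on cf mA)).
(* Subtract the identity for the smaller open set from that for the larger one; the subtraction is
   licit as f has a finite integral. *)
have E3 : (\int[@leb2 R]_(p in P `\` P') (density_pull phi U f p)%:E =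
    \int[@leb2 R]_(p in O `\` O') (f p)%:E)%E.
  by have := S1; rewrite E1 S2 -E2 => /(adde_cancel (fin _ mO')).
split.
  apply/integrableP; split.
    by apply/measurable_EFinP; apply: measurable_funS mg => // p [].
  under eq_integral do rewrite /= ger0_norm //.
  by rewrite E3 ltey_eq (fin _ (measurableD mO mO')).
by rewrite /I2on /Rintegral; congr fine.
Qed.

(** Positive and negative parts of f, both continuous and of compact support, reduce this to the
    nonnegative case. *)
Lemma cov_locally_closed U V phi psi O O2 f N : diffeo2 U V phi psi -> open O -> O `<=` V ->
  open O2 -> cc f N ->
  (@leb2 R).-integrable (U `&` phi @^-1` (O `\` O2)) (EFin \o density_pull phi U f) /\
  I2on (U `&` phi @^-1` (O `\` O2)) (density_pull phi U f) = I2on (O `\` O2) f.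
Proof.
move=> H oO OV oO2 cf; have [oU oV UV VU [Cphi Cpsi J]] := H.
pose f1 p := 2^-1 * (`|f p| + f p); pose f2 p := 2^-1 * (`|f p| + - 1 * f p).
have c1 : cc f1 N := ccZ _ (ccD (cc_norm cf) cf).
have c2 : cc f2 N := ccZ _ (ccD (cc_norm cf) (ccZ _ cf)).
have p1 p : 0 <= f1 p.
  by rewrite /f1 mulr_ge0 // ?invr_ge0 //; have := ler_norm (- f p); rewrite normrN; lra.
have p2 p : 0 <= f2 p.
  by rewrite /f2 mulr_ge0 // ?invr_ge0 //; have := ler_norm (f p); lra.
have fE : f = fun p => f1 p - f2 p by apply/funext => p; rewrite /f1 /f2; field.
have mO := open_prod_measurable oO; have mO2 := open_prod_measurable oO2.
have mOD : meas (O `\` O2) by exact: measurableD.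
set P := U `&` _.
have mP : meas P.
  have o1 := diffeo2_preimage_open H oO; have o2 := diffeo2_preimage_open H oO2.
  have -> : P = (U `&` phi @^-1` O) `\` (U `&` phi @^-1` O2).
    apply/seteqP; split=> p; first by move=> [Up [Op nO]]; split => // -[_ /nO].
    by move=> [[Up Op] nP]; split => //; split => // h; apply: nP.
  by apply: measurableD; exact: open_prod_measurable.
have [i1 e1] := cov_locally_closed_ge0 H oO OV oO2 c1 p1.
have [i2 e2] := cov_locally_closed_ge0 H oO OV oO2 c2 p2.
have gE : density_pull phi U f = fun p => density_pull phi U f1 p - density_pull phi U f2 p.
  apply/funext => p; rewrite /density_pull; case: asboolP => _; last by rewrite subrr.
  by rewrite {1}fE mulrBl.
split.
  have -> : EFin \o density_pull phi U f =
      ((EFin \o density_pull phi U f1) \- (EFin \o density_pull phi U f2))%E.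
    by rewrite gE; apply/funext => p /=; rewrite EFinB.
  exact: integrableB.
rewrite /I2on gE RintegralB //; rewrite /I2on in e1 e2; rewrite e1 e2.
by rewrite [in RHS]fE RintegralB //; [exact: (cc_integrable_on c1 mOD)|exact: (cc_integrable_on c2 mOD)].
Qed.

End ChangeOfVariablesBorel.

(** * Integration on a compact surface *)

Section SurfaceCharts.
Variables (R : realType) (M : surface R).
Local Notation plane := (measurableTypeR R * measurableTypeR R)%type.
Local Notation meas A := (measurable (A : set plane)).
Implicit Types (i j : 'I_(nch M)) (m : M) (p q : R * R) (S : set M).

Lemma img_chart i S m : dom i m -> S m -> img i S (chart i m).
Proof. by move=> dm Sm; exists m. Qed.

Lemma imgP i S p : img i S p -> [/\ dom i (inv i p), S (inv i p) & chart i (inv i p) = p].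
Proof. by move=> [m [dm Sm] <-]; rewrite chartK. Qed.

Lemma img_setT i : img i setT = chart i @` dom i.
Proof. by rewrite /img setIT. Qed.

Lemma img_sub i S p : img i S p -> img i setT p.
Proof. by move=> [m [dm Sm] <-]; exact: img_chart. Qed.

Lemma img_setTE i S p : img i setT p -> S (inv i p) -> img i S p.
Proof. by move=> /imgP [d _ e] Sp; rewrite -e; exact: img_chart. Qed.

Lemma img_inv_cont i p : img i setT p -> {for p, continuous (inv i)}.
Proof. by rewrite img_setT => /inv_cont. Qed.

Lemma img_open i S : open S -> open (img i S).
Proof.
move=> oS; have oT : open (img i setT) by rewrite img_setT; exact: chart_open.
rewrite openE => p ip; have iT := img_sub ip.
have n1 := open_nbhs_nbhs (conj oT iT).
have n2 : \forall q \near p, S (inv i q).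
  by apply: (img_inv_cont iT); apply: open_nbhs_nbhs; split => //; case: (imgP ip).
by apply: filterS2 n1 n2 => q; exact: img_setTE.
Qed.

Lemma inv_image_open i (B : set (R * R)) : open B -> B `<=` img i setT -> open (inv i @` B).
Proof.
move=> oB BI; rewrite openE => _ [p Bp <-]; have [d _ e] := imgP (BI _ Bp).
have n1 : \forall m \near inv i p, B (chart i m).
  by apply: (chart_cont d); apply: open_nbhs_nbhs; rewrite e; split.
have n2 := open_nbhs_nbhs (conj (dom_open i) d).
by apply: filterS2 n1 n2 => m Bm dm; exists (chart i m) => //; rewrite chartK.
Qed.

Lemma transE i j m : dom i m -> trans i j (chart i m) = chart j m.
Proof. by move=> d; rewrite /trans /= chartK. Qed.

Lemma trans_C1map i j : C1map (img i (dom j)) (trans i j).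
Proof.
have [H1 H2] := trans_smooth i j 1.
by split; apply: class_nat1_C1on => //; exact: img_open (dom_open j).
Qed.

Lemma trans_diffeo i j : diffeo2 (img i (dom j)) (img j (dom i)) (trans i j) (trans j i).
Proof.
split; [exact: img_open (dom_open j)|exact: img_open (dom_open i)| | |split].
- by move=> _ [m [d1 d2] <-]; rewrite !transE //; split => //; exact: img_chart.
- by move=> _ [m [d1 d2] <-]; rewrite !transE //; split => //; exact: img_chart.
- exact: trans_C1map.
- exact: trans_C1map.
- by move=> _ [m [d1 d2] <-]; exact: trans_oriented.
Qed.

Definition rform1 := 'I_(nch M) -> M -> R * R.
Definition rform2 := 'I_(nch M) -> M -> R.

Definition cform2 (w : rform2) := [/\ forall i m, ~ dom i m -> w i m = 0,
  forall i j m, dom i m -> dom j m -> w i m = jdet (trans i j) (chart i m) * w j m &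
  forall i p, img i setT p -> {for p, continuous (fun q => w i (inv i q))}].

Definition rint (w : rform2) : R := \sum_(i < nch M) I2on (piece i) (fun p => w i (inv i p)).

Definition rgood (w : rform2) := forall i,
  (@leb2 R).-integrable (piece i) (EFin \o (fun p => w i (inv i p))).

Definition null_off (K : set M) (w : rform2) := forall i m, ~ K m -> w i m = 0.

Definition chart_fun i (w : rform2) (p : R * R) : R := if `[< img i setT p >] then w i (inv i p) else 0.

Lemma chart_fun_compactly i w (K : set M) : cform2 w -> compact K -> K `<=` dom i -> null_off K w ->
  compactly_in (chart i @` K) (img i setT) (chart_fun i w).
Proof.
move=> [w0 wlaw wc] cK Kd wK.
have ck : compact (chart i @` K).
  apply: continuous_compact cK; apply: continuous_in_subspaceT => m /set_mem /Kd.
  exact: chart_cont.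
have oI : open (img i setT) by apply: img_open; exact: openT.
split=> //.
- by move=> _ [m Km <-]; apply: img_chart => //; exact: Kd.
- move=> p; have [ip|nip] := pselect (img i setT p).
    apply: (@near_continuous _ _ _ (fun q => w i (inv i q))); last exact: wc.
    by apply: filterS (open_nbhs_nbhs (conj oI ip)) => q iq; rewrite /chart_fun asboolT.
  have nk : ~ (chart i @` K) p.
    by move=> [m Km mp]; apply: nip; rewrite -mp; apply: img_chart => //; exact: Kd.
  apply: (@near_continuous _ _ _ (fun=> 0)); last exact: cst_continuous.
  apply: filterS (off_compact_near ck nk) => q nq; rewrite /chart_fun.
  case: asboolP => // /imgP [d _ e]; rewrite wK // => Kq; apply: nq; by exists (inv i q).
- move=> p nk; rewrite /chart_fun; case: asboolP => // /imgP [d _ e].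
  by rewrite wK // => Kq; apply: nk; exists (inv i p).
Qed.

Definition dom_before (n : nat) : set M := \bigcup_(j in [set j : 'I_(nch M) | (j < n)%N]) dom j.

Lemma dom_before_open n : open (dom_before n).
Proof. by apply: bigcup_open => j _; exact: dom_open. Qed.

Lemma pieceE i : piece i = img i (~` dom_before i).
Proof. by []. Qed.

Lemma piece_meas i : meas (piece i).
Proof.
rewrite pieceE; have -> : img i (~` dom_before i) = img i setT `\` img i (dom_before i).
  apply/seteqP; split=> p.
    move=> ip; split; first exact: img_sub ip.
    by move=> iq; case: (imgP ip) => _ n _; case: (imgP iq) => _ /n.
  move=> [ip nq]; apply: (img_setTE ip) => h; apply: nq; exact: img_setTE.
apply: measurableD; apply: open_prod_measurable; apply: img_open; first exact: openT.
exact: dom_before_open.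
Qed.

(** A form supported in one chart domain can be integrated in that chart alone: each piece is
    carried to chart j by the transition map, where the pieces tile the image of the chart. *)
Lemma rint_chart j w (K : set M) : cform2 w -> compact K -> K `<=` dom j -> null_off K w ->
  rgood w /\ rint w = I2 (chart_fun j w).
Proof.
move=> Hw cK Kd wK; have [w0 wlaw wc] := Hw.
have [N cf] := compactly_in_cc (chart_fun_compactly Hw cK Kd wK).
set f := chart_fun j w in cf *.
pose O i := img j (dom i); pose O2 i := img j (dom_before i).
pose U i := img i (dom j).
have setE i : U i `&` trans i j @^-1` (O i `\` O2 i) = piece i `&` U i.
  apply/seteqP; split=> p.
    move=> [Up [Op nO]]; split => //; rewrite pieceE; apply: (img_setTE (img_sub Up)).
    move: Up Op nO => [m [d1 d2] <-]; rewrite transE // chartK // => _ nO dm; apply: nO.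
    exact: img_chart.
  rewrite pieceE => -[ip Up]; split => //; move: Up ip => [m [d1 d2] <-] /imgP [_ + _].
  rewrite chartK // => nd; rewrite /preimage /= transE //; split; first exact: img_chart.
  by move=> /imgP [_ + _]; rewrite chartK.
have wE i p : U i p -> w i (inv i p) = density_pull (trans i j) (U i) f p.
  move=> [m [d1 d2] <-]; rewrite /density_pull asboolT; last exact: img_chart.
  rewrite transE // /f /chart_fun asboolT; last exact: img_chart.
  by rewrite !chartK // mulrC; exact: wlaw.
have w0' i p : piece i p -> ~ U i p -> w i (inv i p) = 0.
  move=> ip nU; rewrite wK // => Kp; apply: nU; apply: (img_setTE (img_sub ip)); exact: Kd.
have mU i : meas (U i) by apply: open_prod_measurable; apply: img_open; exact: dom_open.
have each i : (@leb2 R).-integrable (piece i) (EFin \o (fun p => w i (inv i p))) /\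
    I2on (piece i) (fun p => w i (inv i p)) = I2on (O i `\` O2 i) f.
  have [] := @cov_locally_closed _ _ _ _ _ (O i) (O2 i) _ _ (trans_diffeo i j)
    (@img_open j _ (dom_open i)) (fun p h => h) (@img_open j _ (@dom_before_open i)) cf.
  rewrite setE => int eq; have mP := piece_meas i.
  have mPU : meas (piece i `&` U i) by exact: measurableI.
  have E : ((EFin \o (fun p => w i (inv i p))) \_ (piece i) =
      (EFin \o density_pull (trans i j) (U i) f) \_ (piece i `&` U i))%E.
    apply/funext => p; rewrite !patchE; case: ifPn => [/set_mem ip|/negP np].
      case: ifPn => [/set_mem [_ Up]|/negP nU]; first by rewrite /= wE.
      rewrite /= w0' // => Up; apply: nU; exact: mem_set.
    by case: ifPn => // /set_mem [ip _]; case: np; exact: mem_set.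
  split.
    apply: (integrable_mkcond _ mP).2; rewrite E.
    exact: (integrable_mkcond _ mPU).1.
  rewrite -eq /I2on /Rintegral; congr fine.
  by rewrite integral_mkcond [RHS]integral_mkcond E.
split; first by move=> i; case: (each i).
rewrite /rint (eq_bigr (fun i : 'I_(nch M) => I2on (O i `\` O2 i) f)); last by move=> i _; case: (each i).
(* Piece i is what chart i adds to the charts before it, so the sum over the pieces telescopes. *)
pose F n := I2on (img j (dom_before n)) f.
have mB n : meas (img j (dom_before n)).
  by apply: open_prod_measurable; apply: img_open; exact: dom_before_open.
have step i : I2on (O i `\` O2 i) f = F i.+1 - F i.
  apply/eqP; rewrite eq_sym subr_eq addrC; apply/eqP; rewrite /F.
  have -> : img j (dom_before i.+1) = O2 i `|` (O i `\` O2 i).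
    rewrite setUDr setDv setD0; apply/seteqP; split=> p.
      move=> ip; have [d [k /= ki dk] e] := imgP ip.
      rewrite ltnS leq_eqVlt in ki; case/orP: ki => [/eqP ki|ki].
        right; apply: (img_setTE (img_sub ip)); by have <- : k = i by exact: val_inj.
      by left; apply: (img_setTE (img_sub ip)); exists k.
    case=> ip; apply: (img_setTE (img_sub ip)); have [d h e] := imgP ip.
      by case: h => k /= ki dk; exists k => //=; exact: ltnW.
    by exists i => /=.
  apply: (I2on_setU cf) => //; last by rewrite setDIK.
    exact: mB.
  apply: measurableD; last exact: mB.
  by apply: open_prod_measurable; apply: img_open; exact: dom_open.
rewrite (eq_bigr (fun i : 'I_(nch M) => F i.+1 - F i)); last by move=> i _; exact: step.
rewrite -(big_mkord xpredT (fun n => F n.+1 - F n)) telescope_sumr //.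
have -> : F 0%N = 0.
  rewrite /F; have -> : img j (dom_before 0) = set0.
    by apply/seteqP; split=> p // /imgP [_ [k /=]]; rewrite ltn0.
  exact: Rintegral_set0.
rewrite subr0 /F; have -> : img j (dom_before (nch M)) = img j setT.
  apply/seteqP; split=> p ip; first exact: img_sub ip.
  by apply: (img_setTE ip); have [k dk] := dom_cover (inv j p); exists k => /=.
rewrite /I2on Rintegral_mkcond; apply: eq_Rintegral => p _; rewrite patchE.
case: ifPn => // /negP np; rewrite /f /chart_fun; case: asboolP => // ip.
by case: np; exact: mem_set.
Qed.

End SurfaceCharts.

(** * C^1 bump functions and localization on the surface *)

Section PartitionOfUnity.
Variables (R : realType) (M : surface R).
Implicit Types (i j : 'I_(nch M)) (m : M) (p q : R * R) (S : set M) (theta : M -> R).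

(** The sets whose complement in K satisfies Q form a filter. If Q failed for K the filter would be
    proper, and a cluster point would contradict the local hypothesis. *)
Lemma compact_union_ind (T : topologicalType) (K : set T) (Q : set T -> Prop) : compact K ->
  Q set0 -> (forall A B, A `<=` B -> Q B -> Q A) -> (forall A B, Q A -> Q B -> Q (A `|` B)) ->
  (forall x, K x -> exists2 U, open_nbhs x U & Q U) -> Q K.
Proof.
move=> cK Q0 Qs QU loc; apply: contrapT => nQ.
pose F : set_system T := fun A => Q (K `\` A).
have FF : ProperFilter F.
  split; first by rewrite /F setD0.
  split.
  - by rewrite /F setDT.
  - by move=> A B FA FB; rewrite /F setDIr; exact: QU.
  - by move=> A B AB; apply: Qs => x [Kx nB]; split => // /AB.
have FK : F K by rewrite /F setDv.
have [x [Kx clx]] := cK F FF FK.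
have [U [oU Ux] QUU] := loc x Kx.
have FU : F (~` U) by apply: Qs QUU => y [_ ny]; apply: contrapT => nU; exact: ny.
have [y [ny Uy]] := clx _ _ FU (open_nbhs_nbhs (conj oU Ux)).
exact: ny.
Qed.

Lemma C1on_comp1 (U : set (R * R)) (c c' : R -> R) (f : R * R -> R) : open U ->
  (forall t : R, is_derive t 1 c (c' t)) -> continuous c' -> C1on U f -> C1on U (fun p => c (f p)).
Proof.
move=> oU dc cc' Hf.
apply: (C1on_dif (a := fun p => c' (f p) * px f p) (b := fun p => c' (f p) * py f p)) => // p Up;
  have [d1 d2 d3] := Hf p Up; have cf := C1on_continuous Hf Up.
- have D : dif (fun q : R * R => c q.1) (f p, 0) (c' (f p)) 0 by exact: dif_of_derive.
  by apply: dif_eq (dif_comp D d1 (dif_cst 0 p)) _ _; ring.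
- by apply: continuous_mul d2; exact: (continuous_comp cf (cc' _)).
- by apply: continuous_mul d3; exact: (continuous_comp cf (cc' _)).
Qed.

Definition pos_sq (t : R) : R := if t <= 0 then 0 else t ^+ 2.
Definition pos_lin (t : R) : R := 2 * Num.max 0 t.

Lemma pos_sq_derive (t : R) : is_derive t 1 pos_sq (pos_lin t).
Proof.
apply/is_deriveP => e e0; exists e => // s se; rewrite /pos_sq /pos_lin.
have key : `|(s - t) ^+ 2| <= e * `|s - t| by rewrite normrX expr2 ler_wpM2r // ltW.
have le_sq (x : R) : 0 <= x -> x <= (s - t) ^+ 2 -> `|x| <= e * `|s - t|.
  by move=> x0 xs; rewrite ger0_norm //; apply: le_trans xs (le_trans (ler_norm _) key).
case: (leP s 0) => s0; case: (leP t 0) => t0.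
- by rewrite mulr0 mul0r !subrr normr0 mulr_ge0 // ltW.
- have -> : 0 - t ^+ 2 - 2 * t * (s - t) = t * (t - 2 * s) by ring.
  apply: le_sq; first by rewrite mulr_ge0 //; lra.
  have -> : (s - t) ^+ 2 = t * (t - 2 * s) + s ^+ 2 by ring.
  by rewrite lerDl sqr_ge0.
- rewrite mulr0 mul0r !subr0; apply: le_sq; first exact: sqr_ge0.
  have -> : (s - t) ^+ 2 = s ^+ 2 + (- t) * (2 * s - t) by ring.
  by rewrite lerDl mulr_ge0 //; lra.
- have -> : s ^+ 2 - t ^+ 2 - 2 * t * (s - t) = (s - t) ^+ 2 by ring.
  exact: key.
Qed.

Lemma pos_lin_continuous : continuous pos_lin.
Proof.
have c t : {for t, continuous (fun t : R => Num.max 0 t)}.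
  by apply: (@continuous_max _ _ (cst 0) _ t); [exact: cst_continuous|exact: cvg_id].
have -> : pos_lin = fun t => Num.max 0 t + Num.max 0 t.
  by apply/funext => t; rewrite /pos_lin; ring.
by move=> t; apply: continuousD; exact: c.
Qed.

(** A quadratic spline with knots 0, 1/2 and 1; the coefficients 2, -4, 2 make it constant to the
    right of 1. Class C^1 is all that the cutoffs need. *)
Definition smooth_step (t : R) : R := 2 * pos_sq t - 4 * pos_sq (t - 1 / 2) + 2 * pos_sq (t - 1).

Lemma smooth_step0 t : t <= 0 -> smooth_step t = 0.
Proof.
move=> t0; rewrite /smooth_step /pos_sq !ifT //; first by ring.
by lra.
by lra.
Qed.

Lemma smooth_step1 t : 1 <= t -> smooth_step t = 1.
Proof.
move=> t1; rewrite /smooth_step /pos_sq ifF; last by apply/negbTE; rewrite -ltNge; lra.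
rewrite ifF; last by apply/negbTE; rewrite -ltNge; lra.
case: (leP (t - 1) 0) => h; last by field.
have -> : t = 1 by lra.
by field.
Qed.

Lemma C1on_fst : C1on setT (fst : R * R -> R).
Proof.
apply: (C1on_dif (a := fun=> 1) (b := fun=> 0)); first exact: openT.
- by move=> p _; exact: dif_fst.
- by move=> p _; exact: cst_continuous.
- by move=> p _; exact: cst_continuous.
Qed.

Lemma C1on_snd : C1on setT (snd : R * R -> R).
Proof.
apply: (C1on_dif (a := fun=> 0) (b := fun=> 1)); first exact: openT.
- by move=> p _; exact: dif_snd.
- by move=> p _; exact: cst_continuous.
- by move=> p _; exact: cst_continuous.
Qed.

Lemma C1on_smooth_step (f : R * R -> R) : C1on setT f -> C1on setT (fun p => smooth_step (f p)).
Proof.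
move=> Hf; have oT := @openT (R * R)%type.
have S (a : R) : C1on setT (fun p => pos_sq (f p - a)).
  apply: (C1on_comp1 oT pos_sq_derive pos_lin_continuous).
  exact: C1onB oT Hf (C1on_cst _ oT).
have S0 : C1on setT (fun p => pos_sq (f p)) by exact: (C1on_comp1 oT pos_sq_derive pos_lin_continuous).
have c (a : R) f0 : C1on setT f0 -> C1on setT (fun p => a * f0 p) by exact: (C1onM oT (C1on_cst a oT)).
exact: (C1onD oT (C1onB oT (c _ _ S0) (c _ _ (S _))) (c _ _ (S _))).
Qed.

(** Equal to 1 on the square of radius r / 2 around c and to 0 outside that of radius r: in each
    variable, a step up times a step down. *)
Definition plane_bump (c : R * R) (r : R) (p : R * R) : R :=
  smooth_step (2 * (1 + (p.1 - c.1) / r)) * smooth_step (2 * (1 - (p.1 - c.1) / r)) *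
  (smooth_step (2 * (1 + (p.2 - c.2) / r)) * smooth_step (2 * (1 - (p.2 - c.2) / r))).

Lemma C1on_affine (f : R * R -> R) (a b : R) : C1on setT f -> C1on setT (fun p => a + b * f p).
Proof.
move=> Hf; have oT := @openT (R * R)%type.
exact: C1onD oT (C1on_cst _ oT) (C1onM oT (C1on_cst _ oT) Hf).
Qed.

Lemma plane_bump_C1 c r : C1on setT (plane_bump c r).
Proof.
have oT := @openT (R * R)%type.
have E (x a : R) : r * 0 = 0 -> 2 * (1 + (x - a) / r) = (2 - 2 * a / r) + (2 / r) * x.
  by move=> _; ring.
have E' (x a : R) : 2 * (1 - (x - a) / r) = (2 + 2 * a / r) + (- (2 / r)) * x by ring.
have -> : plane_bump c r = fun p =>
    smooth_step ((2 - 2 * c.1 / r) + (2 / r) * p.1) * smooth_step ((2 + 2 * c.1 / r) + (- (2 / r)) * p.1) *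
    (smooth_step ((2 - 2 * c.2 / r) + (2 / r) * p.2) * smooth_step ((2 + 2 * c.2 / r) + (- (2 / r)) * p.2)).
  by apply/funext => p; rewrite /plane_bump !E' !E ?mulr0.
have A1 a b := C1on_affine a b C1on_fst; have A2 a b := C1on_affine a b C1on_snd.
have m f1 f2 : C1on setT f1 -> C1on setT f2 -> C1on setT (fun p => f1 p * f2 p) by exact: (C1onM oT).
by apply: (m _ _ (m _ _ _ _) (m _ _ _ _)); exact: C1on_smooth_step.
Qed.

Lemma plane_bump_out c r p : 0 < r -> r <= `|p - c| -> plane_bump c r p = 0.
Proof.
move=> r0 pr.
have z (x a : R) : r <= `|x - a| ->
    smooth_step (2 * (1 + (x - a) / r)) * smooth_step (2 * (1 - (x - a) / r)) = 0.
  move=> xr; have [h|h] := leP 0 (x - a).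
    rewrite ger0_norm // in xr; rewrite [X in _ * X]smooth_step0 ?mulr0 //.
    have k : 1 <= (x - a) / r by rewrite ler_pdivlMr // mul1r.
    lra.
  rewrite ltr0_norm // in xr; rewrite smooth_step0 ?mul0r //.
  have k : (x - a) / r <= -1 by rewrite ler_pdivrMr //; lra.
  lra.
rewrite /plane_bump; move: pr; rewrite norm_pairE le_max /= => /orP[|] /z ->.
  by rewrite mul0r.
by rewrite mulr0.
Qed.

Lemma plane_bump_in c r p : 0 < r -> `|p - c| <= r / 2 -> plane_bump c r p = 1.
Proof.
move=> r0 pr.
have o (x a : R) : `|x - a| <= r / 2 ->
    smooth_step (2 * (1 + (x - a) / r)) * smooth_step (2 * (1 - (x - a) / r)) = 1.
  rewrite ler_norml => /andP[h1 h2].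
  have k1 : - (1 / 2) <= (x - a) / r by rewrite ler_pdivlMr //; lra.
  have k2 : (x - a) / r <= 1 / 2 by rewrite ler_pdivrMr //; lra.
  by rewrite !smooth_step1 ?mul1r //; lra.
by rewrite /plane_bump (o _ _ (le_trans (norm_fst_le (p - c)) pr))
  (o _ _ (le_trans (norm_snd_le (p - c)) pr)) mul1r.
Qed.

Definition C1M theta := forall i, C1on (img i setT) (theta \o inv i).

Definition lift_chart i (b : R * R -> R) m : R := if `[< dom i m >] then b (chart i m) else 0.

Lemma compact_closed_surface (K : set M) : compact K -> closed K.
Proof. by apply: compact_closed; exact: surface_hausdorff. Qed.

Lemma off_compact_near_surface (K : set M) m : compact K -> ~ K m -> \forall m' \near m, ~ K m'.
Proof.
move=> /compact_closed_surface/closed_openC oK nK.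
exact: (open_nbhs_nbhs (conj oK nK)).
Qed.

Lemma inv_image_compact i (k : set (R * R)) : compact k -> k `<=` img i setT -> compact (inv i @` k).
Proof.
move=> ck ki; apply: continuous_compact ck; apply: continuous_in_subspaceT => q /set_mem /ki.
exact: img_inv_cont.
Qed.

Lemma near_chart k p (A : set M) : img k setT p -> (\forall m \near inv k p, A m) ->
  \forall q \near p, img k setT q /\ A (inv k q).
Proof.
move=> ip nA; apply: filterI; last exact: (img_inv_cont ip nA).
by apply: open_nbhs_nbhs; split => //; apply: img_open; exact: openT.
Qed.

Lemma C1on_local (U : set (R * R)) f : (forall p, U p -> exists2 V, open_nbhs p V & C1on V f) -> C1on U f.
Proof. by move=> H p /H [V [_ Vp] /(_ p Vp)]. Qed.

Lemma lift_chart_C1 i b (k : set (R * R)) : C1on setT b -> compact k -> k `<=` img i setT ->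
  (forall p, ~ k p -> b p = 0) -> C1M (lift_chart i b).
Proof.
move=> Cb ck ki b0 l; apply: C1on_local => p ip; have [d _ e] := imgP ip.
have [di|ndi] := pselect (dom i (inv l p)).
  exists (img l (dom i)); first by split; [apply: img_open; exact: dom_open|exact: img_setTE].
  apply: (@C1on_near _ _ (b \o trans l i)); first by apply: img_open; exact: dom_open.
    by move=> _ [m [d1 d2] <-]; rewrite /lift_chart /trans /= chartK // asboolT.
  apply: (C1on_comp _ (@trans_C1map _ _ l i) (V := setT)) => //.
  by apply: img_open; exact: dom_open.
have nK : ~ (inv i @` k) (inv l p).
  by move=> [q kq qe]; apply: ndi; rewrite -qe; case: (imgP (ki _ kq)).
have := near_chart ip (off_compact_near_surface (inv_image_compact ck ki) nK).
move=> /near_normP[e1 e10 N].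
have oB := @ball_open_norm R p e1.
exists [set q | `|q - p| < e1]; first by split => //=; rewrite subrr normr0.
apply: (@C1on_near _ _ (fun=> 0)) => //; last exact: C1on_cst.
move=> q /N [iq nq]; rewrite /= /lift_chart; case: asboolP => // dq; rewrite b0 // => kq.
by apply: nq; exists (chart i (inv l q)) => //; rewrite chartK.
Qed.

Lemma open_chart_ball i (W : set M) m : open W -> W m -> dom i m -> exists2 r : R, 0 < r &
  forall p, `|p - chart i m| <= r -> img i W p.
Proof.
move=> oW Wm dm; have := open_nbhs_nbhs (conj (@img_open _ _ i _ oW) (img_chart dm Wm)).
move=> /near_normP[r r0 H]; exists (r / 2); first by rewrite divr_gt0.
move=> p pr; apply: H; apply: (le_lt_trans pr); lra.
Qed.

Lemma bump_at (W : set M) m : open W -> W m -> exists theta (V : set M) (K : set M),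
  [/\ C1M theta, open_nbhs m V, (forall m', V m' -> theta m' = 1) &
      [/\ compact K, K `<=` W & forall m', ~ K m' -> theta m' = 0]].
Proof.
move=> oW Wm; have [i dm] := dom_cover m.
have [r r0 H] := open_chart_ball oW Wm dm.
pose k := cball (chart i m) r.
have kW : k `<=` img i W by move=> p; exact: H.
have ki : k `<=` img i setT by move=> p /kW/img_sub.
have ck : compact k := @cball_compact _ (chart i m) r.
pose b := plane_bump (chart i m) r.
have b0 p : ~ k p -> b p = 0.
  by move=> nk; apply: plane_bump_out => //; rewrite leNgt; apply/negP => h; apply: nk; exact: ltW.
have r20 : 0 < r / 2 by rewrite divr_gt0.
pose B := [set p | `|p - chart i m| < r / 2].
have oB : open B := @ball_open_norm R (chart i m) (r / 2).
have Bk : B `<=` k by move=> p /= pB; apply: ltW; apply: lt_trans pB _; lra.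
exists (lift_chart i b), (inv i @` B), (inv i @` k); split.
- exact: lift_chart_C1 (@plane_bump_C1 _ _) ck ki b0.
- split; first by apply: inv_image_open => // p /Bk/ki.
  by exists (chart i m); [rewrite /B /= subrr normr0|rewrite chartK].
- move=> _ [p Bp <-]; have [d _ e] := imgP (ki _ (Bk _ Bp)).
  by rewrite /lift_chart asboolT // e /b plane_bump_in // ltW.
split; first exact: inv_image_compact.
  by move=> _ [p kp <-]; have [_ + _] := imgP (kW _ kp).
move=> m' nk; rewrite /lift_chart; case: asboolP => // d; apply: b0 => kp; apply: nk.
by exists (chart i m') => //; rewrite chartK.
Qed.

Lemma C1MD t1 t2 : C1M t1 -> C1M t2 -> C1M (fun m => t1 m + t2 m).
Proof. by move=> H1 H2 i; apply: C1onD (H1 i) (H2 i); apply: img_open; exact: openT. Qed.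

Lemma C1MM t1 t2 : C1M t1 -> C1M t2 -> C1M (fun m => t1 m * t2 m).
Proof. by move=> H1 H2 i; apply: C1onM (H1 i) (H2 i); apply: img_open; exact: openT. Qed.

Lemma C1M_cst c : C1M (fun=> c).
Proof. by move=> i; apply: C1on_cst; apply: img_open; exact: openT. Qed.

(* The partition of unity sum_i b_i prod_(j < i) (1 - b_j), one bump at a time. *)
Lemma glue (P : (M -> R) -> Prop) : P (fun=> 0) ->
  (forall t1 t2, C1M t1 -> C1M t2 -> P t1 -> P t2 -> P (fun m => t1 m + t2 m)) ->
  (forall m, exists2 W, open_nbhs m W & forall (K : set M) theta, compact K -> K `<=` W ->
     C1M theta -> (forall m', ~ K m' -> theta m' = 0) -> P theta) ->
  P (fun=> 1).
Proof.
move=> P0 PD loc.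
pose Q (V : set M) := exists chi, [/\ C1M chi, forall m, V m -> chi m = 1 &
  forall theta, C1M theta -> P (fun m => theta m * chi m)].
have QT : Q setT.
  apply: compact_union_ind (@surface_compact _ M) _ _ _ _.
  - exists (fun=> 0); split=> //; first exact: C1M_cst.
    move=> theta _; have -> : (fun m => theta m * 0) = (fun=> 0) by apply/funext => m; rewrite mulr0.
    exact: P0.
  - by move=> A B AB [chi [C1 c1 c2]]; exists chi; split=> // m /AB /c1.
  - move=> A B [c1 [C1 h1 k1]] [c2 [C2 h2 k2]].
    have Cn : C1M (fun m => 1 + -1 * c1 m) by apply: C1MD (C1M_cst _) (C1MM (C1M_cst _) C1).
    exists (fun m => c1 m + (1 + -1 * c1 m) * c2 m); split.
    + by apply: C1MD C1 _; exact: C1MM.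
    + by move=> m [/h1 ->|/h2 ->]; ring.
    + move=> theta Ct; have -> : (fun m => theta m * (c1 m + (1 + -1 * c1 m) * c2 m)) =
          (fun m => theta m * c1 m + (theta m * (1 + -1 * c1 m)) * c2 m).
        by apply/funext => m; ring.
      apply: PD; [exact: C1MM|by apply: C1MM C2; exact: C1MM|exact: k1|].
      by apply: k2; exact: C1MM.
  - move=> m _; have [W [oW Wm] H] := loc m.
    have [b [V [K [Cb nV bV [cK KW bK]]]]] := bump_at oW Wm.
    exists V; first by []. 
    exists b; split; [exact: Cb|exact: bV|move=> theta Ct]; apply: (H K); [exact: cK|exact: KW|exact: C1MM|].
    by move=> m' /bK ->; rewrite mulr0.
have [chi [_ c1 c2]] := QT; have := c2 _ (C1M_cst 1).
by have -> : (fun m => 1 * chi m) = (fun=> 1) by apply/funext => m; rewrite c1 // mul1r.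
Qed.

End PartitionOfUnity.

(** * Pulling back forms by diffeomorphisms off a finite set *)

Section SurfaceForms.
Variables (R : realType) (M : surface R).
Implicit Types (i j k : 'I_(nch M)) (m : M) (p q : R * R) (S K : set M) (theta : M -> R).
Implicit Types (a b : rform1 M) (w : rform2 M) (g : M -> M).

Definition rcovec_pull (F : R * R -> R * R) p (v : R * R) : R * R :=
  (v.1 * jac11 F p + v.2 * jac21 F p, v.1 * jac12 F p + v.2 * jac22 F p).

Definition cform1 S a :=
  (forall i j m, S m -> dom i m -> dom j m -> a i m = rcovec_pull (trans i j) (chart i m) (a j m)) /\
  (forall i p, img i S p -> {for p, continuous (fun q => (a i (inv i q)).1)} /\
                            {for p, continuous (fun q => (a i (inv i q)).2)}).

Lemma cform1_sub S S' (a : rform1 M) : S' `<=` S -> cform1 S a -> cform1 S' a.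
Proof.
move=> sub [la ca]; split=> [i j m /sub|i p /imgP [d /sub s e]]; first exact: la.
by apply: ca; rewrite -e; exact: img_chart.
Qed.

Definition null1_off K a := forall i m, ~ K m -> a i m = (0, 0).
Definition null1_out a := forall i m, ~ dom i m -> a i m = (0, 0).

Definition rwedge a b : rform2 M := fun i m => (a i m).1 * (b i m).2 - (a i m).2 * (b i m).1.

Lemma rwedge_cform2 S K a b : open S -> cform1 S a -> cform1 S b -> compact K -> K `<=` S ->
  null1_off K b -> null1_out b -> cform2 (rwedge a b) /\ null_off K (rwedge a b).
Proof.
move=> oS [la ca] [lb cb] cK KS bK b0; split; last first.
  by move=> i m nK; rewrite /rwedge bK //= !mulr0 subrr.
split.
- by move=> i m nd; rewrite /rwedge b0 //= !mulr0 subrr.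
- move=> i j m di dj; have [Km|nK] := pselect (K m); last first.
    by rewrite /rwedge !bK //= !mulr0 !subrr mulr0.
  by rewrite /rwedge (la i j m) ?(lb i j m) //; [rewrite /jdet /rcovec_pull /=; ring|exact: KS|exact: KS].
- move=> i p ip; have [Sp|nS] := pselect (S (inv i p)).
    have [a1 a2] := ca i p (img_setTE ip Sp); have [b1 b2] := cb i p (img_setTE ip Sp).
    by apply: continuous_add; [exact: continuous_mul|apply: continuousN; exact: continuous_mul].
  have nK : ~ K (inv i p) by move=> /KS.
  apply: (@near_continuous _ _ _ (fun=> 0)); last exact: cst_continuous.
  apply: filterS (near_chart ip (off_compact_near_surface cK nK)) => q [_ nq].
  by rewrite /rwedge bK //= !mulr0 subrr.
Qed.

Lemma rint_linear (c : R) (w1 w2 : rform2 M) : rgood w1 -> rgood w2 ->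
  rgood (fun i m => c * w1 i m + w2 i m) /\ rint (fun i m => c * w1 i m + w2 i m) = c * rint w1 + rint w2.
Proof.
move=> g1 g2; have mP i := piece_meas i.
have z i : (@leb2 R).-integrable (piece i) (fun p => (c%:E * (EFin \o (fun p => w1 i (inv i p))) p)%E).
  exact: integrableZl.
split.
  move=> i; have := integrableD (mP i) (z i) (g2 i).
  by apply: eq_integrable.
rewrite /rint mulr_sumr -big_split /=; apply: eq_bigr => i _.
have z' : (@leb2 R).-integrable (piece i) (EFin \o (fun p => c * w1 i (inv i p))).
  by apply: eq_integrable (z i).
by rewrite /I2on (RintegralD (mP i) z' (g2 i)) RintegralZl //; exact: mP.
Qed.

Lemma rgood0 : rgood (fun (_ : 'I_(nch M)) (_ : M) => 0 : R) /\ rint (fun (_ : 'I_(nch M)) (_ : M) => 0 : R) = 0.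
Proof.
split; first by move=> i; apply: integrable0.
by rewrite /rint big1 // => i _; rewrite /I2on Rintegral_cst ?mul0r //; exact: piece_meas.
Qed.

Definition scale2 theta w : rform2 M := fun i m => theta m * w i m.

Definition contM theta := continuous theta.

Lemma C1M_cont theta : C1M theta -> contM theta.
Proof.
move=> C m; have [i dm] := dom_cover m.
have ip : img i setT (chart i m) by exact: img_chart.
have c1 := C1on_continuous (C i) ip.
have c2 : {for m, continuous ((theta \o inv i) \o chart i)}.
  by apply: continuous_comp c1; exact: chart_cont.
move/cvgrPdist_lt: c2 => c2; apply/cvgrPdist_lt => e /c2 {}c2.
have nd := open_nbhs_nbhs (conj (dom_open i) dm).
by apply: filterS2 nd c2 => m' dm'; rewrite /= !chartK.
Qed.

Lemma scale2_cform2 theta w : contM theta -> cform2 w -> cform2 (scale2 theta w).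
Proof.
move=> ct [w0 wl wc]; split.
- by move=> i m nd; rewrite /scale2 w0 // mulr0.
- by move=> i j m di dj; rewrite /scale2 (wl i j m) // mulrCA.
- move=> i p ip; apply: continuous_mul; last exact: wc.
  exact: (continuous_comp (img_inv_cont ip) (ct _)).
Qed.

Lemma glue_forms (P : rform2 M -> Prop) w : P (fun _ _ => 0) ->
  (forall w1 w2, P w1 -> P w2 -> P (fun i m => w1 i m + w2 i m)) ->
  (forall m, exists2 W, open_nbhs m W & forall K theta, compact K -> K `<=` W ->
     C1M theta -> (forall m', ~ K m' -> theta m' = 0) -> P (scale2 theta w)) ->
  P w.
Proof.
move=> P0 PD loc.
have H : P (scale2 (fun=> 1) w).
  apply: (@glue R M (fun theta => P (scale2 theta w))).
  - have -> : scale2 (fun=> 0) w = fun _ _ => 0 by apply/funext => i; apply/funext => m; rewrite /scale2 mul0r.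
    exact: P0.
  - move=> t1 t2 _ _ P1 P2; have -> : scale2 (fun m => t1 m + t2 m) w =
      fun i m => scale2 t1 w i m + scale2 t2 w i m.
      by apply/funext => i; apply/funext => m; rewrite /scale2 mulrDl.
    exact: PD.
  - exact: loc.
suff <- : scale2 (fun=> 1) w = w by [].
by apply/funext => i; apply/funext => m; rewrite /scale2 mul1r.
Qed.

Lemma cform2_good w : cform2 w -> rgood w.
Proof.
move=> cw; apply: (@glue_forms (@rgood R M) w); first exact: rgood0.1.
  move=> w1 w2 g1 g2; have [h _] := rint_linear 1 g1 g2.
  have -> : (fun i m => w1 i m + w2 i m) = (fun i m => 1 * w1 i m + w2 i m).
    by apply/funext => i; apply/funext => m; rewrite mul1r.
  exact: h.
move=> m; have [i dm] := dom_cover m; exists (dom i); first by split; [exact: dom_open|].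
move=> K theta cK Kd Ct t0.
have [] // := rint_chart (scale2_cform2 (C1M_cont Ct) cw) cK Kd.
by move=> l m' nK; rewrite /scale2 t0 // mul0r.
Qed.

Lemma rint_add (w1 w2 : rform2 M) : rgood w1 -> rgood w2 -> rint (fun i m => w1 i m + w2 i m) = rint w1 + rint w2.
Proof.
move=> g1 g2; have [_] := rint_linear 1 g1 g2; rewrite mul1r => <-.
by congr rint; apply/funext => i; apply/funext => m; rewrite mul1r.
Qed.

(** The maps are defined on all of M but differentiable only on S, the complement of the
    singularities in the application. *)
Definition sdiffeo S (g g' : M -> M) := [/\ open S, (forall m, S m -> S (g m) /\ g' (g m) = m),
  (forall m, S m -> S (g' m) /\ g (g' m) = m), (forall m, S m -> {for m, continuous g}) /\
  (forall m, S m -> {for m, continuous g'}) &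
  forall i j, diffeo2 (img i (S `&` g @^-1` dom j)) (img j (S `&` g' @^-1` dom i))
    (chart j \o g \o inv i) (chart i \o g' \o inv j)].

Lemma sdiffeo_sym S (g g' : M -> M) : sdiffeo S g g' -> sdiffeo S g' g.
Proof. by move=> [oS h1 h2 [c1 c2] h3]; split=> // i j; exact: diffeo2_sym. Qed.

Definition loc (g : M -> M) i j : R * R -> R * R := chart j \o g \o inv i.

Lemma locE (g : M -> M) i j m : dom i m -> loc g i j (chart i m) = chart j (g m).
Proof. by move=> d; rewrite /loc /= chartK. Qed.

Definition pull2_rel S (g : M -> M) w (w' : rform2 M) := forall i j m, S m -> dom i m -> dom j (g m) ->
  w' i m = jdet (loc g i j) (chart i m) * w j (g m).

Lemma image_compact S (g : M -> M) K : compact K -> K `<=` S -> (forall m, S m -> {for m, continuous g}) ->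
  compact (g @` K).
Proof.
by move=> cK KS cg; apply: continuous_compact cK; apply: continuous_in_subspaceT => m /set_mem /KS /cg.
Qed.

(** Localize by cutoffs theta on the target side and theta o g on the source side. Each localized
    form then lives in one chart, and the planar change of variables between the two charts
    applies. *)
Lemma rint_invariant S (g g' : M -> M) K w (w' : rform2 M) : sdiffeo S g g' -> cform2 w -> cform2 w' -> compact K ->
  K `<=` S -> null_off K w -> null_off (g' @` K) w' -> pull2_rel S g w w' -> rint w' = rint w.
Proof.
move=> D cw cw' cK KS wK wK' rel; have [oS gS gS' [cg cg'] dg] := D.
(* Integrability is part of the glued property because integrals are added only for integrable
   forms. *)
pose P (theta : M -> R) := exists z z', [/\ z = scale2 theta w, z' = scale2 (theta \o g) w',
  rgood z, rgood z' & rint z' = rint z].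
suff : P (fun=> 1).
  move=> [z [z' [-> -> _ _]]].
  have E v : scale2 (fun=> 1) v = v by apply/funext => i; apply/funext => m; rewrite /scale2 mul1r.
  by rewrite E (_ : scale2 _ w' = w') // -[RHS]E.
apply: glue.
- exists (fun _ _ => 0), (fun _ _ => 0); split=> //; try exact: rgood0.1;
    by apply/funext => i; apply/funext => m; rewrite /scale2 /= mul0r.
- move=> t1 t2 _ _ [z1 [z1' [e1 e1' g1 g1' r1]]] [z2 [z2' [e2 e2' g2 g2' r2]]].
  have ad v v' (gv : rgood v) (gv' : rgood v') : rgood (fun i m => v i m + v' i m).
    have [h _] := rint_linear 1 gv gv'.
    have -> : (fun i m => v i m + v' i m) = (fun i m => 1 * v i m + v' i m).
      by apply/funext => i; apply/funext => m; rewrite mul1r.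
    exact: h.
  exists (fun i m => z1 i m + z2 i m), (fun i m => z1' i m + z2' i m); split.
  + by rewrite e1 e2; apply/funext => i; apply/funext => m; rewrite /scale2 mulrDl.
  + by rewrite e1' e2'; apply/funext => i; apply/funext => m; rewrite /scale2 /= mulrDl.
  + exact: ad.
  + exact: ad.
  + by rewrite !rint_add // r1 r2.
move=> m; have [Km|nK] := pselect (K m); last first.
  have oK : open (~` K) by apply: closed_openC; exact: compact_closed_surface.
  exists (~` K); first by split.
  move=> K1 theta cK1 K1K Ct t0; exists (fun _ _ => 0), (fun _ _ => 0); split=> //; try exact: rgood0.1.
    apply/funext => i; apply/funext => m'; rewrite /scale2.
    have [Km'|nKm'] := pselect (K m'); last by rewrite wK // mulr0.
    by rewrite t0 ?mul0r // => /K1K.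
  apply/funext => i; apply/funext => m'; rewrite /scale2.
  have [[x Kx xm]|nKm'] := pselect ((g' @` K) m'); last by rewrite wK' // mulr0.
  have [_ gx] := gS' _ (KS _ Kx); rewrite -xm /= gx t0 ?mul0r // => /K1K; exact.
have Sm := KS _ Km; have [Sg' gg'] := gS' _ Sm.
have [j dj] := dom_cover m; have [i di] := dom_cover (g' m).
pose W := inv j @` (img j (S `&` g' @^-1` dom i)).
have [oU oV UV VU _] := dg i j.
have WE x : W x <-> [/\ S x, dom j x & dom i (g' x)].
  split=> [[p /imgP [d [s k] _] <-] //|[s d k]].
  by exists (chart j x); [exact: img_chart|rewrite chartK].
exists W; first by split; [apply: inv_image_open => // p; exact: img_sub|apply/WE].
move=> K1 theta cK1 K1W Ct t0.
pose z := scale2 theta w; pose z' := scale2 (theta \o g) w'.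
have K1S : K1 `<=` S by move=> x /K1W/WE[].
have K1j : K1 `<=` dom j by move=> x /K1W/WE[].
have cKi := image_compact cK1 K1S cg'.
have Kii : g' @` K1 `<=` dom i by move=> _ [x /K1W/WE[_ _ d] <-].
have KiS : g' @` K1 `<=` S by move=> _ [x /K1S/gS' [] + _ <-].
have cz : cform2 z by exact: scale2_cform2 (C1M_cont Ct) cw.
have zK : null_off K1 z by move=> l x nx; rewrite /z /scale2 t0 // mul0r.
have zK' : null_off (g' @` K1) z'.
  move=> l x nx; rewrite /z' /scale2 /=.
  have [[y Ky yx]|nKx] := pselect ((g' @` K) x); last by rewrite wK' // mulr0.
  have [Sy gy] := gS' _ (KS _ Ky); rewrite t0 ?mul0r // => Kg; apply: nx.
  by exists (g x) => //; rewrite -yx gy.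
have cz' : cform2 z'.
  have [w0 wl wc] := cw'; split.
  - by move=> l x nd; rewrite /z' /scale2 w0 // mulr0.
  - by move=> l l' x d1 d2; rewrite /z' /scale2 (wl l l' x) // mulrCA.
  - move=> l p ip; have [Sp|nSp] := pselect (S (inv l p)).
      apply: continuous_mul; last exact: wc.
      apply: (continuous_comp (img_inv_cont ip)).
      by apply: (continuous_comp (cg _ Sp)); exact: (C1M_cont Ct).
    have nKi : ~ (g' @` K1) (inv l p) by move=> /KiS.
    apply: (@near_continuous _ _ _ (fun=> 0)); last exact: cst_continuous.
    apply: filterS (near_chart ip (off_compact_near_surface cKi nKi)) => q [_ nq].
    by rewrite (zK' l _ nq).
have [gz rz] := rint_chart cz cK1 K1j zK.
have [gz' rz'] := rint_chart cz' cKi Kii zK'.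
exists z, z'; split=> //; rewrite rz rz'.
set U := img i (S `&` g @^-1` dom j) in oU UV VU; set V := img j (S `&` g' @^-1` dom i) in oV UV VU.
have [N cf] := compactly_in_cc (chart_fun_compactly cz cK1 K1j zK).
have VW x : dom j x -> W x -> V (chart j x) by move=> d /WE[s _ k]; exact: img_chart.
have f0 p : ~ V p -> chart_fun j z p = 0.
  move=> nV; rewrite /chart_fun; case: asboolP => // ip; have [d _ e] := imgP ip.
  by rewrite zK // => Kp; apply: nV; rewrite -e; apply: VW d _; exact: K1W.
have U_of p : img i setT p -> (g' @` K1) (inv i p) -> U p.
  move=> ip [x Kx xp]; apply: (img_setTE ip); rewrite -xp; have /WE[s d k] := K1W _ Kx.
  have [s' e'] := gS' _ s; by split => //; rewrite /preimage /= e'.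
have [_] := @cov_locally_closed _ _ _ _ _ V set0 _ _ (dg i j) oV (fun p h => h) open0 cf.
rewrite setD0 -/U -/V -/(loc g i j).
have -> : U `&` loc g i j @^-1` V = U by apply: setIidl => p Up; case: (UV _ Up).
have <- : I2 (chart_fun i z') = I2on U (density_pull (loc g i j) U (chart_fun j z)).
  rewrite /I2on Rintegral_mkcond; apply: eq_Rintegral => p _; rewrite patchE.
  case: ifPn => [/set_mem Up|/negP nU].
    have ip := img_sub Up; have [d [Sp dgp] e] := imgP Up.
    rewrite /density_pull asboolT // /chart_fun asboolT //.
    rewrite -{2}e locE // asboolT; last exact: img_chart.
    by rewrite chartK // /z' /z /scale2 /= -[in LHS]e (rel i j) ?e //; ring.
  rewrite /chart_fun; case: asboolP => // ip; rewrite zK' // => Kp; apply: nU; apply: mem_set.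
  exact: U_of.
move=> ->; rewrite /I2on Rintegral_mkcond; apply: eq_Rintegral => p _; rewrite patchE.
by case: ifPn => // /negP nV; rewrite f0 // => Vp; apply: nV; exact: mem_set.
Qed.

Lemma jac_near (F G : R * R -> R * R) p : (\forall q \near p, F q = G q) ->
  (exists U, [/\ open U, U p & C1map U F]) ->
  [/\ jac11 F p = jac11 G p, jac12 F p = jac12 G p, jac21 F p = jac21 G p & jac22 F p = jac22 G p].
Proof.
move=> E [U [oU Up [C1 C2]]]; have [d1 _ _] := C1 p Up; have [d2 _ _] := C2 p Up.
have e1 : \forall q \near p, (F q).1 = (G q).1 by apply: filterS E => q ->.
have e2 : \forall q \near p, (F q).2 = (G q).2 by apply: filterS E => q ->.
have D1 := dif_near e1 d1; have D2 := dif_near e2 d2.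
have [_ h1] := dif_px D1; have [_ h2] := dif_py D1.
by have [_ h3] := dif_px D2; have [_ h4] := dif_py D2.
Qed.

Lemma rcovec_near (F G : R * R -> R * R) p v : (\forall q \near p, F q = G q) ->
  (exists U, [/\ open U, U p & C1map U F]) -> rcovec_pull F p v = rcovec_pull G p v.
Proof. by move=> E H; rewrite /rcovec_pull; have [-> -> -> ->] := jac_near E H. Qed.

Lemma rcovec_comp U V (F G : R * R -> R * R) p v : C1map U F -> U p -> C1map V G -> V (F p) ->
  rcovec_pull (G \o F) p v = rcovec_pull F p (rcovec_pull G (F p) v).
Proof.
move=> CF Up [G1 G2] Vp; have [g1 _ _] := G1 _ Vp; have [g2 _ _] := G2 _ Vp.
have D1 := dif_mapcomp CF Up g1; have D2 := dif_mapcomp CF Up g2.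
have [_ h1] := dif_px D1; have [_ h2] := dif_py D1.
have [_ h3] := dif_px D2; have [_ h4] := dif_py D2.
rewrite /rcovec_pull /=.
have -> : jac11 (G \o F) p = jac11 G (F p) * jac11 F p + jac12 G (F p) * jac21 F p by exact: h1.
have -> : jac12 (G \o F) p = jac11 G (F p) * jac12 F p + jac12 G (F p) * jac22 F p by exact: h2.
have -> : jac21 (G \o F) p = jac21 G (F p) * jac11 F p + jac22 G (F p) * jac21 F p by exact: h3.
have -> : jac22 (G \o F) p = jac21 G (F p) * jac12 F p + jac22 G (F p) * jac22 F p by exact: h4.
move: (jac11 F p) (jac12 F p) (jac21 F p) (jac22 F p) => x1 x2 x3 x4.
move: (jac11 G (F p)) (jac12 G (F p)) (jac21 G (F p)) (jac22 G (F p)) => y1 y2 y3 y4.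
by congr (_, _); ring.
Qed.

Lemma rcovec_id p v : rcovec_pull id p v = v.
Proof.
have [_ h1] := dif_px (dif_fst p); have [_ h2] := dif_py (dif_fst p).
have [_ h3] := dif_px (dif_snd p); have [_ h4] := dif_py (dif_snd p).
rewrite /rcovec_pull /jac11 /jac12 /jac21 /jac22.
rewrite (_ : (fun p => (id p).1) = fst) // (_ : (fun p => (id p).2) = snd) // h1 h2 h3 h4.
by case: v => x y /=; congr (_, _); ring.
Qed.

Definition rpull (g : M -> M) b : rform1 M := fun i m =>
  if `[< dom i m >] then
    if [pick j | `[< dom j (g m) >]] is Some j then rcovec_pull (loc g i j) (chart i m) (b j (g m))
    else (0, 0)
  else (0, 0).

Lemma rpull_out (g : M -> M) b : null1_out (rpull g b).
Proof. by move=> i m nd; rewrite /rpull; case: asboolP. Qed.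

Lemma rpull_zero (g : M -> M) b i m : (forall j, b j (g m) = (0, 0)) -> rpull g b i m = (0, 0).
Proof.
move=> b0; rewrite /rpull; case: asboolP => // _; case: pickP => // j _.
by rewrite b0 /rcovec_pull /= !mul0r addr0.
Qed.

Section Diffeo.
Variables (S : set M) (g g' : M -> M).
Hypothesis D : sdiffeo S g g'.

Lemma sdiffeo_open : open S. Proof. by case: D. Qed.
Lemma sdiffeo_in m : S m -> S (g m). Proof. by case: D => _ h _ _ _ /h []. Qed.
Lemma sdiffeoK m : S m -> g' (g m) = m. Proof. by case: D => _ h _ _ _ /h []. Qed.
Lemma sdiffeo_cont m : S m -> {for m, continuous g}. Proof. by case: D => _ _ _ [h _] _ /h. Qed.

Lemma loc_C1map i j : C1map (img i (S `&` g @^-1` dom j)) (loc g i j).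
Proof. by case: D => _ _ _ _ /(_ i j) [_ _ _ _ []]. Qed.

Lemma loc_open i j : open (img i (S `&` g @^-1` dom j)).
Proof. by case: D => _ _ _ _ /(_ i j) []. Qed.

Lemma loc_near i j m : S m -> dom i m -> dom j (g m) ->
  \forall q \near chart i m, [/\ S (inv i q), dom i (inv i q), dom j (g (inv i q)) & chart i (inv i q) = q].
Proof.
move=> Sm di dj; have := open_nbhs_nbhs (conj (@loc_open i j) (img_chart di (conj Sm dj))).
by apply: filterS => q /imgP [d [s k] e].
Qed.

(** The definition selects some chart around g m; the transformation law of b and the chain rule
    make any other chart give the same value. *)
Lemma rpullE b i j m : cform1 S b -> S m -> dom i m -> dom j (g m) ->
  rpull g b i m = rcovec_pull (loc g i j) (chart i m) (b j (g m)).
Proof.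
move=> [lb _] Sm di dj; rewrite /rpull asboolT //; case: pickP => [k /asboolP dk|/(_ j)]; last first.
  by rewrite asboolT.
have Sg := sdiffeo_in Sm.
rewrite (lb k j (g m)) // -(locE g k di).
rewrite -(rcovec_comp _ (@loc_C1map i k) _ (@trans_C1map _ _ k j)).
- apply/esym/rcovec_near; last by exists (img i (S `&` g @^-1` dom j)); split;
    [exact: loc_open|exact: img_chart|exact: loc_C1map].
  apply: filterS2 (loc_near Sm di dj) (loc_near Sm di dk) => q [s d k1 e] [_ _ k2 _].
  by rewrite -{1 2}e /= locE // locE // transE.
- exact: img_chart.
- by rewrite locE //; exact: img_chart.
Qed.

Lemma rpull_cform1 b : cform1 S b -> cform1 S (rpull g b).
Proof.
move=> Hb; have [lb cb] := Hb; split.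
  move=> i k m Sm di dk; have [j dj] := dom_cover (g m).
  rewrite (rpullE Hb Sm di dj) (rpullE Hb Sm dk dj) -(transE k di).
  rewrite -(rcovec_comp _ (@trans_C1map _ _ i k) _ (@loc_C1map k j)).
  - apply: rcovec_near; last by exists (img i (S `&` g @^-1` dom j)); split;
      [exact: loc_open|exact: img_chart|exact: loc_C1map].
    have nk := open_nbhs_nbhs (conj (@img_open _ _ i _ (dom_open k)) (img_chart di dk)).
    apply: filterS2 (loc_near Sm di dj) nk => q [s d k1 e] /imgP [_ d2 _].
    by rewrite -{1 2}e /= locE // transE // locE.
  - exact: img_chart.
  - by rewrite transE //; exact: img_chart.
move=> i p ip; have [d Sp e] := imgP ip; have [j dj] := dom_cover (g (inv i p)).
have Up : img i (S `&` g @^-1` dom j) p by rewrite -e; exact: img_chart.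
pose c q := b j (inv j (loc g i j q)).
have E : \forall q \near p, rcovec_pull (loc g i j) q (c q) = rpull g b i (inv i q).
  have := loc_near Sp d dj; rewrite e; apply: filterS => q [s dq dg eq].
  rewrite (rpullE Hb s dq dg) eq /c -{2}eq locE // chartK //.
have cl := C1map_continuous (@loc_C1map i j) Up.
have Vp : img j S (loc g i j p) by rewrite -e locE //; apply: img_chart => //; exact: sdiffeo_in.
have [c1 c2] := cb j _ Vp.
have C1 : {for p, continuous (fun q => (c q).1)} by exact: (continuous_at_comp cl c1).
have C2 : {for p, continuous (fun q => (c q).2)} by exact: (continuous_at_comp cl c2).
have [L1 L2] := @loc_C1map i j.
have [_ j11 j12] := L1 _ Up; have [_ j21 j22] := L2 _ Up.
split.
  apply: (@near_continuous _ _ _ (fun q => (rcovec_pull (loc g i j) q (c q)).1)).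
    by apply: filterS E => q ->.
  exact: (continuous_add (continuous_mul C1 j11) (continuous_mul C2 j21)).
apply: (@near_continuous _ _ _ (fun q => (rcovec_pull (loc g i j) q (c q)).2)).
  by apply: filterS E => q ->.
exact: (continuous_add (continuous_mul C1 j12) (continuous_mul C2 j22)).
Qed.

End Diffeo.

Lemma rpullK S (g g' : M -> M) a i m : sdiffeo S g g' -> cform1 S a -> S m -> dom i m ->
  rpull g (rpull g' a) i m = a i m.
Proof.
move=> D Ha Sm di; have D' := sdiffeo_sym D; have [j dj] := dom_cover (g m).
have Sg := sdiffeo_in D Sm; have gm := sdiffeoK D Sm.
have di' : dom i (g' (g m)) by rewrite gm.
rewrite (rpullE D (rpull_cform1 D' Ha) Sm di dj) (rpullE D' Ha Sg dj di') gm -(locE g j di).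
rewrite -(rcovec_comp _ (@loc_C1map _ _ _ D i j) _ (@loc_C1map _ _ _ D' j i)).
- rewrite -[RHS](rcovec_id (chart i m)); apply/esym/rcovec_near.
    apply: filterS (loc_near D Sm di dj) => q [s d k e].
    by rewrite -{2}e /= locE // locE // (sdiffeoK D s) e.
  by exists setT; split; [exact: openT| |split; [exact: C1on_fst|exact: C1on_snd]].
- exact: img_chart.
- by rewrite locE //; exact: img_chart.
Qed.

(** As no point outside S is mapped into S, the preimage of K is exactly its image by the inverse,
    still a compact subset of S. *)
Lemma rpull_null S (g g' : M -> M) K b : sdiffeo S g g' -> K `<=` S -> null1_off K b ->
  (forall m, ~ S m -> ~ S (g m)) -> null1_off (g' @` K) (rpull g b).
Proof.
move=> D KS bK nS i m nK; apply: rpull_zero => j; apply: bK => Kg; apply: nK.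
exists (g m) => //; have [Sm|nSm] := pselect (S m); first exact: (sdiffeoK D Sm).
by case: (nS _ nSm); exact: KS.
Qed.

(** Write a as the pull-back by g of its pull-back by g'; the left side is then the integral of the
    pull-back by g of the right-hand form. *)
Lemma rint_wedge_pull S (g g' : M -> M) K a b : sdiffeo S g g' -> (forall m, ~ S m -> ~ S (g m)) ->
  compact K -> K `<=` S -> cform1 S a -> cform1 S b -> null1_off K b -> null1_out b ->
  rint (rwedge a (rpull g b)) = rint (rwedge (rpull g' a) b).
Proof.
move=> D nS cK KS Ha Hb bK b0; have D' := sdiffeo_sym D; have oS := sdiffeo_open D.
have cgK := image_compact cK KS (@sdiffeo_cont _ _ _ D').
have gKS : g' @` K `<=` S by move=> _ [x /KS Sx <-]; exact: (sdiffeo_in D' Sx).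
have [cw wK] := rwedge_cform2 oS (rpull_cform1 D' Ha) Hb cK KS bK b0.
have [cw' wK'] := rwedge_cform2 oS Ha (rpull_cform1 D Hb) cgK gKS (rpull_null D KS bK nS)
  (@rpull_out g b).
apply: (rint_invariant D cw cw' cK KS wK wK') => i j m Sm di dj.
rewrite /rwedge -(rpullK D Ha Sm di) (rpullE D (rpull_cform1 D' Ha) Sm di dj) (rpullE D Hb Sm di dj).
by rewrite /rcovec_pull /jdet /=; ring.
Qed.

Lemma rpull_iter_cform1 S (g g' : M -> M) a n : sdiffeo S g g' -> cform1 S a -> cform1 S (iter n (rpull g) a).
Proof. move=> D Ha; elim: n => [|n IH]; [exact: Ha|rewrite iterS; exact (rpull_cform1 D IH)]. Qed.

Lemma rint_wedge_iter S (g g' : M -> M) K a b n : sdiffeo S g g' -> (forall m, ~ S m -> ~ S (g m)) ->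
  compact K -> K `<=` S -> cform1 S a -> cform1 S b -> null1_off K b -> null1_out b ->
  rint (rwedge a (iter n (rpull g) b)) = rint (rwedge (iter n (rpull g') a) b).
Proof.
move=> D nS; have D' := sdiffeo_sym D; elim: n K a b => // n IH K a b cK KS Ha Hb bK b0.
rewrite iterSr [in RHS]iterS.
have cgK := image_compact cK KS (@sdiffeo_cont _ _ _ D').
have gKS : g' @` K `<=` S by move=> _ [x /KS Sx <-]; exact: (sdiffeo_in D' Sx).
have Hn := rpull_iter_cform1 n D' Ha.
rewrite (IH _ _ _ cgK gKS Ha (rpull_cform1 D Hb) (rpull_null D KS bK nS) (@rpull_out g b)).
exact: (rint_wedge_pull D nS cK KS Hn Hb bK b0).
Qed.

End SurfaceForms.

(** * Local primitives of closed forms *)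

Section PlanarPrimitives.
Variable R : realType.
Implicit Types (f g G : R * R -> R) (p q : R * R) (E : set (R * R)).

Lemma dif0_const p0 (r : R) f : (forall p, `|p - p0| < r -> dif f p 0 0) ->
  forall p, `|p - p0| < r -> f p = f p0.
Proof.
move=> H [x y]; case: p0 H => x0 y0 H pr.
have rx := le_lt_trans (norm_fst_le _) pr; have ry := le_lt_trans (norm_snd_le _) pr; rewrite /= in rx ry.
have r0 : 0 < r := le_lt_trans (normr_ge0 _) pr.
transitivity (f (x, y0)).
  have h : f (x, y) - f (x, y0) = 0 - 0.
    apply: (@mvt_cst _ (fun s => f (x, s)) (fun=> 0) (fun=> 0)) => s /btw_dist sb.
    have d : dif f (x, s) 0 0 by apply: H; apply: norm_pair_lt => //=; exact: le_lt_trans sb _.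
    by have [d1 d2] := dif_py d; exact: slice_y_derive.
  by apply/subr0_eq; rewrite h subrr.
have h : f (x, y0) - f (x0, y0) = 0 - 0.
  apply: (@mvt_cst _ (fun s => f (s, y0)) (fun=> 0) (fun=> 0)) => s /btw_dist sb.
  have d : dif f (s, y0) 0 0.
    by apply: H; apply: norm_pair_lt => /=; [exact: le_lt_trans sb _|rewrite subrr normr0].
  by have [d1 d2] := dif_px d; exact: slice_x_derive.
by apply/subr0_eq; rewrite h subrr.
Qed.

Lemma prim_unique p0 (r : R) f g a1 a2 : (forall p, `|p - p0| < r -> dif f p (a1 p) (a2 p)) ->
  (forall p, `|p - p0| < r -> dif g p (a1 p) (a2 p)) ->
  forall p, `|p - p0| < r -> f p - g p = f p0 - g p0.
Proof.
move=> Hf Hg; apply: (@dif0_const p0 r (fun p => f p - g p)) => p pr.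
by apply: dif_eq (difB (Hf p pr) (Hg p pr)) _ _; rewrite subrr.
Qed.

Lemma min_lip (b s t : R) : `|Num.min b s - Num.min b t| <= `|s - t|.
Proof.
have e1 := ler_norm (s - t); have e2 := ler_norm (- (s - t)); rewrite normrN in e2.
by rewrite ler_norml !minEle; apply/andP; split; repeat case: ifPn; rewrite -?ltNge => *; lra.
Qed.

Lemma max_lip (b s t : R) : `|Num.max b s - Num.max b t| <= `|s - t|.
Proof.
have e1 := ler_norm (s - t); have e2 := ler_norm (- (s - t)); rewrite normrN in e2.
by rewrite ler_norml !maxEle; apply/andP; split; repeat case: ifPn; rewrite -?ltNge => *; lra.
Qed.

Definition clamp (a b t : R) := Num.max a (Num.min b t).

Lemma clamp_lip (a b s t : R) : `|clamp a b s - clamp a b t| <= `|s - t|.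
Proof. exact: le_trans (max_lip _ _ _) (min_lip _ _ _). Qed.

Lemma clamp_continuous (a b : R) : continuous (clamp a b).
Proof. by move=> t; apply/continuousP_eps => e e0; exists e => // s se; exact: le_lt_trans (clamp_lip _ _ _ _) se. Qed.

Lemma clamp_in (a b t : R) : a <= b -> a <= clamp a b t <= b.
Proof. by move=> ab; rewrite /clamp le_max lexx ge_max ab ge_min lexx. Qed.

Lemma clamp_id (a b t : R) : a <= t <= b -> clamp a b t = t.
Proof. by move=> /andP[h1 h2]; rewrite /clamp (min_r h2) max_r. Qed.

(** Clamping the variable to the segment gives a function on the whole line with derivative 0
    everywhere. *)
Lemma locally_constant_segment (c d : R) (h : R -> R) : c <= d ->
  (forall t, c <= t <= d -> exists2 e : R, 0 < e & forall s, c <= s <= d -> `|s - t| < e -> h s = h t) ->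
  h d = h c.
Proof.
move=> cd H; pose cl := clamp c d.
have cl_in t : c <= cl t <= d by exact: clamp_in.
have cl_lip (s t : R) : `|cl s - cl t| <= `|s - t| by exact: clamp_lip.
have h0 (t : R) : is_derive t 1 (h \o cl) 0.
  apply/is_deriveP => e e0; have [e1 e10 He] := H _ (cl_in t); exists e1 => // s st.
  rewrite /= (He (cl s)) ?cl_in //; last exact: le_lt_trans (cl_lip _ _) st.
  by rewrite subrr mul0r subr0 normr0 mulr_ge0 // ltW.
have : (h \o cl) d - (h \o cl) c = 0 - 0.
  by apply: (@mvt_cst _ (h \o cl) (fun=> 0) (fun=> 0)) => s _; exact: h0.
have -> : (h \o cl) d = h d by rewrite /= /cl clamp_id // cd lexx.
have -> : (h \o cl) c = h c by rewrite /= /cl clamp_id // cd lexx.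
by rewrite subrr => /subr0_eq.
Qed.

Section Gluing.
Variables a1 a2 : R * R -> R.

Let min_lel (x y : R) : Num.min x y <= x. Proof. by rewrite ge_min lexx. Qed.
Let min_ler (x y : R) : Num.min x y <= y. Proof. by rewrite ge_min lexx orbT. Qed.

Definition prim_near p (e : R) g := 0 < e /\ forall q, `|q - p| < e -> dif g q (a1 q) (a2 q).

(** On a closed set, G matches local primitives up to constants but need not be differentiable at
    the edges. Closed rectangles sharing an edge can thus be glued. *)
Definition relprim E G := forall p, E p -> exists e g, prim_near p e g /\
  forall q, E q -> `|q - p| < e -> G q - g q = G p - g p.

Lemma prim_near_min p e e' g : prim_near p e g -> 0 < e' -> e' <= e -> prim_near p e' g.
Proof. by move=> [_ H] e0 ee; split=> // q qe; apply: H; exact: lt_le_trans qe ee. Qed.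

(** The difference of the two primitives is locally constant on the intersection. The third
    hypothesis says that the intersection is connected in this sense, so a single constant corrects
    G2. *)
Lemma relprim_union E1 E2 G1 G2 : closed E1 -> closed E2 ->
  (forall h : R * R -> R, (forall p, (E1 `&` E2) p -> exists2 e : R, 0 < e &
     forall q, (E1 `&` E2) q -> `|q - p| < e -> h q = h p) -> exists k, forall p, (E1 `&` E2) p -> h p = k) ->
  relprim E1 G1 -> relprim E2 G2 -> exists G, relprim (E1 `|` E2) G.
Proof.
move=> c1 c2 conn P1 P2.
have away (E : set (R * R)) (p : R * R) : closed E -> ~ E p -> exists2 e : R, 0 < e & forall q : R * R, `|q - p| < e -> ~ E q.
  by move=> cE nE; apply/near_normP; apply: open_nbhs_nbhs; split=> //; exact: closed_openC.
have [] := conn (fun p => G1 p - G2 p).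
  move=> p [Ep1 Ep2]; have [e1 [g1 [n1 h1]]] := P1 p Ep1; have [e2 [g2 [n2 h2]]] := P2 p Ep2.
  have e0 : 0 < Num.min e1 e2 by rewrite lt_min n1.1 n2.1.
  exists (Num.min e1 e2) => // q [Eq1 Eq2] qe; move: (qe); rewrite lt_min => /andP[q1 q2].
  have [_ m1] := prim_near_min n1 e0 (min_lel _ _); have [_ m2] := prim_near_min n2 e0 (min_ler _ _).
  by have u := prim_unique m1 m2 qe; have := h1 q Eq1 q1; have := h2 q Eq2 q2; lra.
move=> k Hk; exists (fun p => if `[< E1 p >] then G1 p else G2 p + k) => p Ep.
have [Ep1|nE1] := pselect (E1 p); last first.
  have Ep2 : E2 p by case: Ep.
  have [e2 [g2 [n2 h2]]] := P2 p Ep2; have [e1 e10 aw] := away _ p c1 nE1.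
  have e0 : 0 < Num.min e1 e2 by rewrite lt_min e10 n2.1.
  exists (Num.min e1 e2), g2; split; first exact: prim_near_min n2 e0 (min_ler _ _).
  move=> q Eq; rewrite lt_min => /andP[/aw nq qe]; rewrite !asboolF //.
  by case: Eq => // Eq; have := h2 q Eq qe; lra.
have [e1 [g1 [n1 h1]]] := P1 p Ep1.
have [Ep2|nE2] := pselect (E2 p); last first.
  have [e2 e20 aw] := away _ p c2 nE2.
  have e0 : 0 < Num.min e1 e2 by rewrite lt_min n1.1 e20.
  exists (Num.min e1 e2), g1; split; first exact: prim_near_min n1 e0 (min_lel _ _).
  move=> q Eq; rewrite lt_min => /andP[qe /aw nq]; case: Eq => // Eq; rewrite !asboolT //; exact: h1.
have [e2 [g2 [n2 h2]]] := P2 p Ep2.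
have e0 : 0 < Num.min e1 e2 by rewrite lt_min n1.1 n2.1.
exists (Num.min e1 e2), g1; split; first exact: prim_near_min n1 e0 (min_lel _ _).
move=> q Eq qe; move: (qe); rewrite lt_min => /andP[q1 q2]; rewrite (asboolT Ep1).
case: asboolP => [Eq1|nq]; first exact: h1.
case: Eq => // Eq2.
have [_ m1] := prim_near_min n1 e0 (min_lel _ _); have [_ m2] := prim_near_min n2 e0 (min_ler _ _).
have u := prim_unique m1 m2 qe; have := h2 q Eq2 q2; have := Hk p (conj Ep1 Ep2); lra.
Qed.

Definition crect (a b c d : R) : set (R * R) := [set p | a <= p.1 <= b /\ c <= p.2 <= d].

Lemma crect_closed a b c d : closed (crect a b c d).
Proof.
have -> : crect a b c d = [set` `[a, b]] `*` [set` `[c, d]].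
  by apply/seteqP; split=> p /=; rewrite !in_itv.
by apply: compact_closed_plane; apply: compact_setX; exact: segment_compact.
Qed.

(** Local primitives on a square glue to one. This serves forms with merely continuous coefficients,
    such as pull-backs by C^1 maps, for which closedness cannot be stated by derivatives. *)
Lemma relprim_square p0 (r : R) : 0 < r ->
  (forall p, `|p - p0| <= r -> exists e g, prim_near p e g) ->
  exists G, forall p, `|p - p0| < r -> dif G p (a1 p) (a2 p).
Proof.
move=> r0 loc.
have [G HG] : exists G, relprim (crect (p0.1 - r) (p0.1 + r) (p0.2 - r) (p0.2 + r)) G.
  apply: (@rectangle_bisection _ (fun a b c d => exists G, relprim (crect a b c d) G)); try lra.
  - move=> a m b c d /andP[am mb] cd [G1 P1] [G2 P2].
    have -> : crect a b c d = crect a m c d `|` crect m b c d.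
      apply/seteqP; split=> p; rewrite /crect /=.
        by move=> [/andP[h1 h2] h3]; have [le|/ltW le] := lerP p.1 m; [left|right]; rewrite ?h1 ?h2 ?le.
      by move=> [[/andP[h1 h2] h3]|[/andP[h1 h2] h3]]; split=> //; rewrite ?h1 ?h2 ?(le_trans h2 mb) ?(le_trans am h1).
    apply: relprim_union P1 P2; try exact: crect_closed.
    have I p : (crect a m c d `&` crect m b c d) p <-> p.1 = m /\ c <= p.2 <= d.
      split=> [[[/andP[_ h] h2] [/andP[h' _] _]]|[e h]]; first by split=> //; apply/le_anti; rewrite h h'.
      by split; rewrite /crect /= e ?lexx ?am ?mb.
    move=> h lc; exists (h (m, c)) => p /I [p1 /andP[p2 p3]]; rewrite (surjective_pairing p) p1 /=.
    apply: (@locally_constant_segment _ _ (fun t => h (m, t)) p2) => t /andP[t1 t2].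
    have [|e e0 H] := lc (m, t); first by apply/I; rewrite /= t1 (le_trans t2 p3).
    exists e => // s /andP[s1 s2] st; apply: H; first by apply/I; rewrite /= s1 (le_trans s2 p3).
    by apply: norm_pair_lt => //=; rewrite subrr normr0.
  - move=> a b c m d ab /andP[cm md] [G1 P1] [G2 P2].
    have -> : crect a b c d = crect a b c m `|` crect a b m d.
      apply/seteqP; split=> p; rewrite /crect /=.
        by move=> [h3 /andP[h1 h2]]; have [le|/ltW le] := lerP p.2 m; [left|right]; rewrite ?h1 ?h2 ?le.
      by move=> [[h3 /andP[h1 h2]]|[h3 /andP[h1 h2]]]; split=> //; rewrite ?h1 ?h2 ?(le_trans h2 md) ?(le_trans cm h1).
    apply: relprim_union P1 P2; try exact: crect_closed.
    have I p : (crect a b c m `&` crect a b m d) p <-> p.2 = m /\ a <= p.1 <= b.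
      split=> [[[h2 /andP[_ h]] [_ /andP[h' _]]]|[e h]]; first by split=> //; apply/le_anti; rewrite h h'.
      by split; rewrite /crect /= e ?lexx ?cm ?md.
    move=> h lc; exists (h (a, m)) => p /I [p1 /andP[p2 p3]]; rewrite (surjective_pairing p) p1 /=.
    apply: (@locally_constant_segment _ _ (fun t => h (t, m)) p2) => t /andP[t1 t2].
    have [|e e0 H] := lc (t, m); first by apply/I; rewrite /= t1 (le_trans t2 p3).
    exists e => // s /andP[s1 s2] st; apply: H; first by apply/I; rewrite /= s1 (le_trans s2 p3).
    by apply: norm_pair_lt => //=; rewrite subrr normr0.
  - move=> p /andP[p1 p2] /andP[p3 p4].
    have [|e [g [e0 ng]]] := loc p.
      by apply: norm_pair_le => /=; rewrite ler_norml; lra.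
    exists e => // a b c d _ _ _ _ /andP[ap pb] /andP[cp pd] ba dc _; exists g => q [/andP[q1 q2] /andP[q3 q4]].
    have qe : `|q - p| < e by apply: norm_pair_lt => /=; rewrite ltr_norml; lra.
    exists (e - `|q - p|), g; split; last by move=> q' [/andP[? ?] /andP[? ?]] _; lra.
    split; first by rewrite subr_gt0.
    move=> q' q'e; apply: ng; have := ler_distD q q' p; lra.
exists G => p pr; have p1 := le_lt_trans (norm_fst_le _) pr; have p2 := le_lt_trans (norm_snd_le _) pr.
rewrite /= !ltr_norml in p1 p2.
have cr q : `|q - p| < r - `|p - p0| -> crect (p0.1 - r) (p0.1 + r) (p0.2 - r) (p0.2 + r) q.
  move=> qp; have qr : `|q - p0| < r by have := ler_distD p q p0; lra.
  have := le_lt_trans (norm_fst_le _) qr; have := le_lt_trans (norm_snd_le _) qr.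
  by rewrite /= !ltr_norml /crect /=; lra.
have d0 : 0 < r - `|p - p0| by rewrite subr_gt0.
have [|e [g [[e0 ng] hG]]] := HG p; first by apply: cr; rewrite subrr normr0.
have dg : dif (fun q => g q + (G p - g p)) p (a1 p) (a2 p).
  by apply: dif_eq (difD (ng p _) (dif_cst _ _)) _ _; rewrite ?addr0 // subrr normr0.
apply: dif_near dg; apply/near_normP; exists (Num.min e (r - `|p - p0|)); first by rewrite lt_min e0.
by move=> q; rewrite lt_min => /andP[qe qr]; rewrite -(hG q (cr _ qr) qe); lra.
Qed.

End Gluing.

Lemma slice2_continuous f (x y0 : R) (cl : R -> R) (t : R) : {for t, continuous cl} ->
  {for (x, cl t), continuous f} -> {for t, continuous (fun s => f (x, cl s))}.
Proof.
move=> ccl cf; apply/continuousP_eps => e e0.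
have [d d0 Hd] := (continuousP_eps _ _).1 cf e e0; have [d' d'0 Hd'] := (continuousP_eps _ _).1 ccl d d0.
exists d' => // s sd; apply: Hd; apply: norm_pair_lt => /=; last exact: Hd'.
by rewrite subrr normr0.
Qed.

(** The primitive integrates a1 along the horizontal line through p0, then a2 vertically; closedness
    enters in differentiating the second integral in x. *)
Lemma poincare_lemma p0 (r r' : R) a1 a2 : 0 < r' -> r' < r ->
  C1on [set p | `|p - p0| < r] a1 -> C1on [set p | `|p - p0| < r] a2 ->
  (forall p, `|p - p0| < r -> px a2 p = py a1 p) ->
  exists g, forall p, `|p - p0| < r' -> dif g p (a1 p) (a2 p).
Proof.
case: p0 => x0 y0 r'0 rr C1 C2 cl.
(* Clamping extends the coefficients to continuous functions on whole lines, as the existence of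
   primitives requires, and changes nothing within distance r'. *)
pose clp (z t : R) := clamp (z - r') (z + r') t.
have clp_in z t : `|clp z t - z| < r.
  apply: le_lt_trans rr; rewrite ler_distl; apply: clamp_in; lra.
have clp_c z t : {for t, continuous (clp z)} by exact: clamp_continuous.
have clp_id z t : `|t - z| < r' -> clp z t = t.
  by rewrite ltr_distl => /andP[/ltW h1 /ltW h2]; apply: clamp_id; rewrite h1.
have prim (c : R -> R) (z : R) : continuous c -> exists C : R -> R, (forall t : R, is_derive t 1 C (c t)) /\ C z = 0.
  move=> cc; have [C [dC C0]] := primitive_exists cc; exists (fun t => C t - C z); split; last by rewrite subrr.
  by move=> t; rewrite -[c t]subr0; apply: is_deriveB.
have inb (x y : R) : `|x - x0| < r -> `|y - y0| < r -> [set p | `|p - (x0, y0)| < r] (x, y).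
  by move=> hx hy; apply: norm_pair_lt.
have r0 : 0 < r := lt_trans r'0 rr.
have y00 : `|y0 - y0| < r by rewrite subrr normr0.
have [A [dA _]] : exists C : R -> R, (forall t : R, is_derive t 1 C (a1 (clp x0 t, y0))) /\ C x0 = 0.
  apply: prim => t; apply/continuousP_eps => e e0.
  have [d d0 Hd] := (continuousP_eps _ _).1 (C1on_continuous C1 (inb _ _ (clp_in x0 t) y00)) e e0.
  have [d' d'0 Hd'] := (continuousP_eps _ _).1 (clp_c x0 t) d d0; exists d' => // s sd; apply: Hd.
  by apply: norm_pair_lt => /=; [exact: Hd'|rewrite subrr normr0].
have /choice[F HF] : forall x : R, exists F : R -> R, `|x - x0| < r ->
    (forall t : R, is_derive t 1 F (a2 (x, clp y0 t))) /\ F y0 = 0.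
  move=> x; have [xr|nx] := ltP `|x - x0| r; last by exists (fun=> 0).
  have [|F HF] := prim (fun t => a2 (x, clp y0 t)) y0; last by exists F.
  move=> t; apply: (@slice2_continuous a2 x y0 (clp y0) t (clp_c _ _)).
  by apply: (C1on_continuous C2); apply: inb => //; exact: clp_in.
pose g (p : R * R) := A p.1 + F p.1 p.2.
have gy x y : `|x - x0| < r' -> `|y - y0| < r' -> is_derive y 1 (fun t => g (x, t)) (a2 (x, y)).
  move=> hx hy; have [dF _] := HF x (lt_trans hx rr); have := dF y; rewrite clp_id // => d.
  have h : is_derive y 1 (cst (A x) \+ F x) (0 + a2 (x, y)) by apply: is_deriveD.
  by rewrite add0r in h.
have gx x y : `|x - x0| < r' -> `|y - y0| < r' -> is_derive x 1 (fun t => g (t, y)) (a1 (x, y)).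
  move=> hx hy.
  have dF : is_derive x 1 (fun t => F t y) (a1 (x, y) - a1 (x, y0)).
    have Kin s : Num.min y0 y <= s <= Num.max y0 y -> `|s - y0| < r' by move=> /btw_dist h; exact: le_lt_trans h hy.
    have e00 : 0 < r' - `|x - x0| by rewrite subr_gt0.
    have xin x' : `|x' - x| < r' - `|x - x0| -> `|x' - x0| < r' by move=> h; have := ler_distD x x' x0; lra.
    apply: (@derive_under_primitive _ (fun u s => a2 (u, s)) (fun u s => px a2 (u, s)) F
      (fun u s => a1 (u, s) - a1 (u, y0)) x y0 y _ e00) => /=.
    - move=> x' s /xin hx' /Kin hs.
      have [d _ _] := C2 _ (inb _ _ (lt_trans hx' rr) (lt_trans hs rr)).
      by have [d1 d2] := dif_px d; exact: slice_x_derive.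
    - move=> s /Kin hs; have [_ d _] := C2 _ (inb _ _ (lt_trans hx rr) (lt_trans hs rr)).
      by have -> : (fun q : R * R => px a2 (q.1, q.2)) = px a2 by apply/funext => -[].
    - move=> x' s /xin hx' /Kin hs; have [dF _] := HF x' (lt_trans hx' rr).
      by have := dF s; rewrite clp_id.
    - by move=> x' /xin hx'; have [_] := HF x' (lt_trans hx' rr).
    - move=> s /Kin hs; have b := inb _ _ (lt_trans hx rr) (lt_trans hs rr); rewrite (cl _ b) -[py _ _]subr0.
      apply: is_deriveB; have [d _ _] := C1 _ b.
      by have [d1 d2] := dif_py d; exact: slice_y_derive.
    - by rewrite subrr.
  have := dA x; rewrite clp_id // => dA'.
  have -> : a1 (x, y) = a1 (x, y0) + (a1 (x, y) - a1 (x, y0)) by lra.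
  exact: is_deriveD.
have gp p : `|p - (x0, y0)| < r' -> [/\ derivable g p (1, 0), derivable g p (0, 1), px g p = a1 p & py g p = a2 p].
  move=> pr; have h1 := le_lt_trans (norm_fst_le _) pr; have h2 := le_lt_trans (norm_snd_le _) pr.
  rewrite /= in h1 h2; case: p pr h1 h2 => x y /= pr h1 h2.
  have E1 := gx x y h1 h2; have E2 := gy x y h1 h2.
  have D1 : is_derive (x, y) ((1, 0) : R * R) g (a1 (x, y)).
    apply/directional_derivativeP => e e0; have [d d0 Hd] := (is_deriveP _ _ _).1 E1 e e0; exists d => // h hd.
    have := Hd (h + x); rewrite addrK => /(_ hd); rewrite [_ * h]mulrC; congr (`|g _ - _ - _| <= _).
    have -> : h *: ((1, 0) : R * R) + (x, y) = (h * 1 + x, h * 0 + y) by [].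
    by rewrite mulr1 mulr0 add0r.
  have D2 : is_derive (x, y) ((0, 1) : R * R) g (a2 (x, y)).
    apply/directional_derivativeP => e e0; have [d d0 Hd] := (is_deriveP _ _ _).1 E2 e e0; exists d => // h hd.
    have := Hd (h + y); rewrite addrK => /(_ hd); rewrite [_ * h]mulrC; congr (`|g _ - _ - _| <= _).
    have -> : h *: ((0, 1) : R * R) + (x, y) = (h * 0 + x, h * 1 + y) by [].
    by rewrite mulr1 mulr0 add0r.
  by case: D1 => d1 e1; case: D2 => d2 e2; split; [exact: d1|exact: d2|exact: e1|exact: e2].
exists g => p pr; have [d1 d2 <- <-] := gp p pr.
have nr : \forall q \near p, `|q - (x0, y0)| < r'.
  by apply: open_nbhs_nbhs; split=> //; exact: (@ball_open_norm _ (x0, y0) r').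
apply: partials_dif.
- by apply: filterS nr => q /gp [].
- apply: (@near_continuous _ _ _ a1); first by apply: filterS nr => q /gp [].
  by apply: (C1on_continuous C1); exact: lt_trans pr rr.
- apply: (@near_continuous _ _ _ a2); first by apply: filterS nr => q /gp [].
  by apply: (C1on_continuous C2); exact: lt_trans pr rr.
Qed.

End PlanarPrimitives.

(** * Primitives of one-forms on the surface *)

Section SurfacePrimitives.
Variables (R : realType) (M : surface R).
Implicit Types (i j k : 'I_(nch M)) (m : M) (p q : R * R) (S K W : set M).
Implicit Types (a b : rform1 M) (f g : M -> R).

(** df = a at the point m, in all charts. This notion passes to pull-backs by C^1 maps without
    differentiating coefficients. *)
Definition prim_at a f m := forall i, dom i m -> dif (f \o inv i) (chart i m) (a i m).1 (a i m).2.

Lemma prim_at_chart S a f m i : cform1 S a -> S m -> dom i m ->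
  dif (f \o inv i) (chart i m) (a i m).1 (a i m).2 -> prim_at a f m.
Proof.
move=> [la _] Sm di D j dj; rewrite (la j i m) //.
have := @dif_mapcomp _ (f \o inv i) (trans j i) _ (chart j m) (a i m).1 (a i m).2
  (@trans_C1map _ _ j i) (img_chart dj di).
rewrite transE // => /(_ D); apply: dif_near.
have := open_nbhs_nbhs (conj (@img_open _ _ j _ (dom_open i)) (img_chart dj di)).
by apply: filterS => q /imgP [d k e]; rewrite /= /trans /= chartK.
Qed.

Lemma prim_at_pull S (n n' : M -> M) a f m : sdiffeo S n n' -> cform1 S a -> S m ->
  prim_at a f (n m) -> prim_at (rpull n a) (f \o n) m.
Proof.
move=> D Ha Sm P i di; have [j dj] := dom_cover (n m).
rewrite (rpullE D Ha Sm di dj).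
have := @dif_mapcomp _ (f \o inv j) (loc n i j) _ (chart i m) (a j (n m)).1 (a j (n m)).2
  (@loc_C1map _ _ _ _ _ D i j) (img_chart di (conj Sm dj)).
rewrite locE // => /(_ (P j dj)); apply: dif_near.
by apply: filterS (loc_near D Sm di dj) => q [s d k e]; rewrite /= /loc /= chartK.
Qed.

Lemma prim_at_iter S (n n' : M -> M) a f m (k : nat) : sdiffeo S n n' -> cform1 S a -> S m ->
  prim_at a f (iter k n m) -> prim_at (iter k (rpull n) a) (f \o iter k n) m.
Proof.
move=> D Ha; elim: k f m => [|k IH] f m Sm P; first exact: P.
rewrite iterS; have -> : f \o iter k.+1 n = (f \o iter k n) \o n.
  by apply/funext => x; rewrite /= -iterSr.
have Hk := rpull_iter_cform1 k D Ha.
apply: (prim_at_pull D Hk Sm); apply: IH; first exact: (sdiffeo_in D Sm).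
by rewrite -iterSr.
Qed.

Lemma prim_locally_unique a f g m : (\forall m' \near m, prim_at a f m') ->
  (\forall m' \near m, prim_at a g m') -> \forall m' \near m, f m' - g m' = f m - g m.
Proof.
move=> nf ng; have [i di] := dom_cover m.
have ip : img i setT (chart i m) by exact: img_chart.
have nfg : \forall m' \near inv i (chart i m), prim_at a f m' /\ prim_at a g m'.
  by rewrite chartK //; apply: filterS2 nf ng.
have /near_normP[d d0 Hd] := near_chart ip nfg.
have nm : \forall m' \near m, dom i m' /\ `|chart i m' - chart i m| < d.
  have n1 := open_nbhs_nbhs (conj (dom_open i) di).
  have /cvgrPdist_lt/(_ d d0) n2 := @chart_cont _ _ _ _ di.
  by apply: filterS2 n1 n2 => m' h1 h2; rewrite distrC.
apply: filterS nm => m' [di' dm'].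
have H (h : M -> R) : (forall q, `|q - chart i m| < d -> prim_at a h (inv i q)) ->
    forall q, `|q - chart i m| < d -> dif (h \o inv i) q (a i (inv i q)).1 (a i (inv i q)).2.
  move=> Hh q qd; have [/imgP [dq _ eq] _] := Hd q qd.
  by have := Hh q qd i dq; rewrite eq.
have := @prim_unique _ (chart i m) d (f \o inv i) (g \o inv i) (fun q => (a i (inv i q)).1) (fun q => (a i (inv i q)).2).
move=> /(_ (H f (fun q qd => (Hd q qd).2.1)) (H g (fun q qd => (Hd q qd).2.2)) _ dm').
by rewrite /= !chartK.
Qed.

Definition rclosed a := cform1 setT a /\ forall i,
  [/\ C1on (img i setT) (fun p => (a i (inv i p)).1), C1on (img i setT) (fun p => (a i (inv i p)).2) &
      forall p, img i setT p -> px (fun p => (a i (inv i p)).2) p = py (fun p => (a i (inv i p)).1) p].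

(** Here m may be a singularity, since a is closed on all of M. The primitive exists on radius r /
    2; on the closed ball of radius r / 3, which is compact, it is bounded. *)
Lemma local_primitive a m : rclosed a -> exists W f (C : R),
  [/\ open_nbhs m W, forall m', W m' -> prim_at a f m' & forall m', W m' -> `|f m'| <= C].
Proof.
move=> [Ha Ca]; have [i di] := dom_cover m; have [C1 C2 cl] := Ca i.
have [r r0 Hr] := @open_chart_ball _ _ i setT m openT I di.
have H1 : r / 2 < r by lra.
have H2 : 0 < r / 2 by lra.
have sub p : `|p - chart i m| < r -> img i setT p by move=> /ltW /Hr.
have [|G HG] := @poincare_lemma _ (chart i m) r (r / 2) _ _ H2 H1 (C1on_sub sub C1) (C1on_sub sub C2).
  by move=> p /sub; exact: cl.
pose B := [set p | `|p - chart i m| < r / 3].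
have [C HC] : exists C : R, forall p, cball (chart i m) (r / 3) p -> `|G p| <= C.
  have := @compact_bounded_fun _ _ (cball (chart i m) (r / 3)) G (@cball_compact _ _ _).
  case; last by move=> C _ H; exists C => p /H.
  move=> p pr; have p2 : `|p - chart i m| < r / 2 by apply: le_lt_trans pr _; lra.
  exact: dif_continuous (HG p p2).
exists (inv i @` B), (G \o chart i), C; split.
- split; first by apply: inv_image_open; [exact: ball_open_norm|move=> p pr; apply: sub; apply: lt_trans pr _; lra].
  by exists (chart i m); rewrite ?chartK // /B /= subrr normr0; lra.
- move=> _ [p pr <-]; have ip : img i setT p by apply: sub; apply: lt_trans pr _; lra.
  have [dp _ ep] := imgP ip.
  apply: (@prim_at_chart setT a _ _ i Ha) => //; rewrite ep.
  have p2 : `|p - chart i m| < r / 2 by apply: lt_trans pr _; lra.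
  apply: dif_near (HG p p2).
  have := open_nbhs_nbhs (conj (@img_open _ _ i _ openT) ip).
  by apply: filterS => q /imgP [_ _ e]; rewrite /= e.
- move=> _ [p pr <-]; have ip : img i setT p by apply: sub; apply: lt_trans pr _; lra.
  by have [_ _ ep] := imgP ip; rewrite /= ep; apply: HC; exact: ltW.
Qed.

End SurfacePrimitives.

(** * Short segments of leaves *)

Lemma shift_sub (V : zmodType) (x y a b : V) : x + b - y = (x + a - y) - (a - b).
Proof. by rewrite opprB [b - a]addrC addrA [x + a - y]addrAC addrK addrAC. Qed.

Section RealInduction.
Variable R : realType.

(** Continuous induction: the supremum of the initial segments on which P holds can neither fail P
    nor be less than 1. *)
Lemma interval_induction (P : R -> Prop) : P 0 ->
  (forall s, 0 <= s <= 1 -> P s -> exists2 d : R, 0 < d & forall t, 0 <= t <= 1 -> `|t - s| < d -> P t) ->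
  (forall s, 0 < s <= 1 -> (forall t, 0 <= t < s -> P t) -> P s) ->
  forall s, 0 <= s <= 1 -> P s.
Proof.
move=> P0 op cl s /andP[s0 s1].
pose B := [set t | 0 <= t <= 1 /\ forall u, 0 <= u <= t -> P u].
have B0 : B 0 by split; [rewrite lexx ler01|move=> u u0; rewrite (_ : u = 0) //; apply/le_anti; rewrite andbC].
have hs : has_sup B by split; [exists 0|exists 1 => t [/andP[]]].
have b0 : 0 <= sup B by apply: ub_le_sup => //; case: hs.
have b1 : sup B <= 1 by apply: ge_sup; [exists 0|move=> t [/andP[]]].
have below t : 0 <= t < sup B -> P t.
  move=> /andP[t0 tb]; have [u [_ Hu] tu] := sup_gt (ex_intro _ 0 B0) tb.
  by apply: Hu; rewrite t0 ltW.
have Pb : P (sup B).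
  have [e|n0] := eqVneq (sup B) 0; first by rewrite e.
  by apply: cl => //; rewrite b1 lt_neqAle eq_sym n0 b0.
suff e1 : sup B = 1.
  have [->|ns] := eqVneq s 1; first by rewrite -e1.
  by apply: below; rewrite s0 e1 lt_neqAle ns.
apply/le_anti; rewrite b1 /= leNgt; apply/negP => lt1.
have [|d d0 Hd] := op (sup B) _ Pb; first by rewrite b0.
pose t := Num.min 1 (sup B + d / 2).
have tb : sup B < t by rewrite lt_min lt1 /=; lra.
have t1 : t <= 1 by rewrite ge_min lexx.
have t2 : t <= sup B + d / 2 by rewrite ge_min lexx orbT.
suff Bt : B t by have := ub_le_sup hs.2 Bt; rewrite leNgt tb.
split; first by rewrite t1 (le_trans b0 (ltW tb)).
move=> u /andP[u0 ut]; have [ub|ub] := ltP u (sup B); first by apply: below; rewrite u0.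
by apply: Hd; rewrite ?u0 ?(le_trans ut) // ger0_norm; lra.
Qed.

End RealInduction.

Section Embeddings.
Variables (R : realType) (T : topologicalType).
Implicit Types (m : T) (p q : R * R) (U V W : set T).

Lemma emb_near U (f : T -> R * R) m V : embedding_on U f -> U m -> nbhs m V ->
  exists2 d : R, 0 < d & forall p : R * R, `|p - f m| < d -> exists m', [/\ U m', V m' & f m' = p].
Proof.
move=> [oU cf jf opf] Um; rewrite nbhsE => -[V' [oV' V'm] V'V].
have o : open (f @` (U `&` V')) by apply: opf; [exact: openI|move=> x []].
have : nbhs (f m) (f @` (U `&` V')) by apply: open_nbhs_nbhs; split=> //; exists m.
move=> /near_normP[d d0 Hd]; exists d => // p /Hd [m' [Um' Vm'] e]; exists m'; split=> //; exact: V'V.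
Qed.

Lemma emb_inj U (f : T -> R * R) m m' : embedding_on U f -> U m -> U m' -> f m = f m' -> m = m'.
Proof. by move=> [_ _ jf _] h1 h2; apply: jf; exact: mem_set. Qed.

(** A continuous right inverse over B; it is chosen pointwise, and its continuity comes from
    injectivity and openness of the embedding. *)
Lemma emb_inverse U (f : T -> R * R) (V : set T) (B : set (R * R)) m0 : embedding_on U f ->
  open B -> (forall p, B p -> exists m, [/\ U m, V m & f m = p]) ->
  exists s : R * R -> T, (forall p, B p -> [/\ U (s p), V (s p) & f (s p) = p]) /\
    forall p, B p -> {for p, continuous s}.
Proof.
move=> emb oB H.
have /choice[s Hs] : forall p, exists m, B p -> [/\ U m, V m & f m = p].
  by move=> p; have [Bp|nB] := pselect (B p); [have [m Hm] := H p Bp; exists m|exists m0].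
exists s; split=> // p Bp W nW; have [Up Vp fp] := Hs p Bp.
have [d d0 Hd] := emb_near emb Up nW.
have nB : nbhs p B by exact: open_nbhs_nbhs.
have nd : \forall q \near p, `|q - p| < d by apply/near_normP; exists d.
change (nbhs p (s @^-1` W)); apply: filterS2 nB nd => q Bq qd.
have [m [Um Wm fm]] := Hd q (eq_ind_r (fun x => `|q - x| < d) qd fp).
have [Uq _ fq] := Hs q Bq.
by rewrite /preimage /= (emb_inj emb Uq Um) // fq fm.
Qed.

Lemma plane_pow0 (p : R * R) : plane_pow 0 p = (1, 0).
Proof. by []. Qed.

Lemma plane_powS k (p : R * R) : plane_pow k.+1 p =
  (p.1 * (plane_pow k p).1 - p.2 * (plane_pow k p).2, p.1 * (plane_pow k p).2 + p.2 * (plane_pow k p).1).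
Proof.
rewrite /plane_pow exprS; case: (_ ^+ k) => x y /=.
by [].
Qed.

Lemma plane_pow1 (p : R * R) : plane_pow 1 p = p.
Proof. by rewrite plane_powS plane_pow0 /= !mulr1 !mulr0 subr0 add0r -surjective_pairing. Qed.

Lemma dotp_plane_pow k (p : R * R) : dotp (plane_pow k p) (plane_pow k p) = dotp p p ^+ k.
Proof.
elim: k => [|k IH]; first by rewrite plane_pow0 /dotp /= expr0; ring.
by rewrite exprS -IH plane_powS /dotp /=; ring.
Qed.

Lemma plane_pow_continuous k : continuous (@plane_pow R k).
Proof.
elim: k => [|k IH] p.
  have -> : @plane_pow R 0 = cst (1, 0) by apply/funext => q; rewrite plane_pow0.
  exact: cst_continuous.
have -> : @plane_pow R k.+1 = (fun q => (q.1 * (plane_pow k q).1 - q.2 * (plane_pow k q).2,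
  q.1 * (plane_pow k q).2 + q.2 * (plane_pow k q).1)) by apply/funext => q; rewrite plane_powS.
have c1 : {for p, continuous (fun q : R * R => q.1)} := dif_continuous (dif_fst p).
have c2 : {for p, continuous (fun q : R * R => q.2)} := dif_continuous (dif_snd p).
have d1 : {for p, continuous (fun q => (plane_pow k q).1)}.
  exact: (continuous_at_comp (IH p) (dif_continuous (dif_fst _))).
have d2 : {for p, continuous (fun q => (plane_pow k q).2)}.
  exact: (continuous_at_comp (IH p) (dif_continuous (dif_snd _))).
apply: continuous_pair => /=.
  by apply: (continuous_add (continuous_mul c1 d1)); apply: continuousN; exact: (continuous_mul c2 d2).
exact: (continuous_add (continuous_mul c1 d2) (continuous_mul c2 d1)).
Qed.

Lemma plane_pow_origin k : plane_pow k.+1 ((0, 0) : R * R) = (0, 0).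
Proof. by rewrite plane_powS /= !mul0r subr0 addr0. Qed.

Lemma dotp_continuous : continuous (fun p : R * R => dotp p p).
Proof.
move=> p; have c1 := dif_continuous (dif_fst p); have c2 := dif_continuous (dif_snd p).
exact: (continuous_add (continuous_mul c1 c1) (continuous_mul c2 c2)).
Qed.

End Embeddings.

Section FlatPaths.
Variables (R : realType) (T : topologicalType) (X : translation_structure R T).
Hypothesis hT : hausdorff_space T.
Implicit Types (m : T) (p q e : R * R) (U V W : set T) (eta : R -> T).

(* A path along the direction e, of signed length l, avoiding the singularities. *)
Definition hpath e (l : R) eta := forall s, 0 <= s <= 1 -> ~ sing X (eta s) /\
  forall k, tdom (t:=X) k (eta s) -> exists2 d : R, 0 < d & forall t, 0 <= t <= 1 -> `|t - s| < d ->
    tdom (t:=X) k (eta t) /\ tchart (t:=X) k (eta t) = tchart (t:=X) k (eta s) + ((t - s) * l) *: e.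

Lemma nonsing_tdom m : ~ sing X m -> exists k, tdom (t:=X) k m.
Proof. by move=> ns; have : (~` sing X) m by []; rewrite -tdom_cover => -[k _ h]; exists k. Qed.

Lemma tdom_open k : open (tdom (t:=X) k).
Proof. by case: (tchart_emb (t:=X) k). Qed.

(** Continuity of the path is no part of [hpath]; it follows because flat charts are embeddings in
    which the path is a straight segment. *)
Lemma hpath_continuous e l eta s V : hpath e l eta -> 0 <= s <= 1 -> nbhs (eta s) V ->
  exists2 d : R, 0 < d & forall t, 0 <= t <= 1 -> `|t - s| < d -> V (eta t).
Proof.
move=> H s01 nV; have [ns Hs] := H s s01; have [k dk] := nonsing_tdom ns.
have [d d0 Hd] := Hs k dk; have [d1 d10 Hd1] := emb_near (tchart_emb (t:=X) k) dk nV.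
pose d2 := d1 / (`|l *: e| + 1).
have d20 : 0 < d2 by rewrite divr_gt0 // ltr_wpDl.
exists (Num.min d d2); first by rewrite lt_min d0.
move=> t t01; rewrite lt_min => /andP[td td2]; have [dt et] := Hd t t01 td.
have [|m [dm Vm em]] := Hd1 (tchart (t:=X) k (eta t)).
  rewrite et addrAC subrr add0r -scalerA normrZ.
  apply: (@le_lt_trans _ _ (`|t - s| * (`|l *: e| + 1))); first by rewrite ler_wpM2l // lerDl.
  by rewrite -ltr_pdivlMr // ltr_wpDl.
by rewrite (emb_inj (tchart_emb (t:=X) k) dt dm).
Qed.

(** Treats singular and regular points alike: at a regular point k = 0 and z is a translated flat
    chart. *)
Definition cone_chart k U (z : T -> R * R) := embedding_on U z /\ forall l m, U m -> tdom (t:=X) l m ->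
  exists v, \forall m' \near m, tchart (t:=X) l m' = plane_pow k.+1 (z m') + v.

Lemma cone_chart_exists m : exists k U z, [/\ cone_chart k U z, U m & z m = (0, 0)].
Proof.
have [sm|/nonsing_tdom[k dk]] := pselect (sing X m).
  have [k [U [z [emb Us z0 H]]]] := tcone sm; exists k, U, z; split=> //.
  by have : [set m] m by []; rewrite -Us => -[].
have emb := tchart_emb (t:=X) k; have [oU cf jf opf] := emb.
exists 0%N, (tdom (t:=X) k), (fun m' => tchart (t:=X) k m' - tchart (t:=X) k m); split=> //; last by rewrite subrr.
split.
  split=> //.
  - by move=> x dx; apply: continuousB; [exact: cf|exact: cst_continuous].
  - by move=> x y dx dy /addIr; exact: jf.
  - move=> V oV Vd; have -> : (fun m' => tchart (t:=X) k m' - tchart (t:=X) k m) @` V =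
      (fun p => p + tchart (t:=X) k m) @^-1` (tchart (t:=X) k @` V).
      apply/seteqP; split=> p /= [x Vx e]; exists x => //; first by rewrite -e subrK.
      by rewrite e addrK.
    apply: open_comp; last exact: opf.
    move=> p _; apply/continuousP_eps => e e0; exists e => // q; congr (`|_| < _).
    by rewrite opprD addrACA subrr addr0.
move=> l m' dm' dl; have [v Hv] := ttrans dm' dl; exists (tchart (t:=X) k m + v).
by apply: filterS Hv => x ->; rewrite plane_pow1 addrA subrK.
Qed.

(** A short straight segment starting near m cannot leave V, even if m is a cone point. The power Z
    of the coordinate z is locally a flat coordinate, hence moves along a straight line, and a bound
    on |Z| is a bound on |z|. *)
Lemma cone_path m V : open V -> V m -> exists W (d : R), [/\ open_nbhs m W, 0 < d &
  forall e l eta, dotp e e <= 1 -> hpath e l eta -> `|l| <= d -> W (eta 0) ->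
    forall s, 0 <= s <= 1 -> V (eta s)].
Proof.
move=> oV Vm; have [k [U [z [[emb Hz] Um zm]]]] := cone_chart_exists m.
have [oU cz jz _] := emb.
have [e0 e00 He0] := emb_near emb Um (open_nbhs_nbhs (conj oV Vm)).
pose B := [set p : R * R | dotp p p < e0 ^+ 2].
have oB : open B by apply: (@open_comp _ _ (fun p : R * R => dotp p p) [set x | x < e0 ^+ 2]); [move=> p _; exact: dotp_continuous|exact: open_lt].
have [sg [Hsg csg]] : exists s : R * R -> T, (forall p, B p -> [/\ U (s p), V (s p) & z (s p) = p]) /\
    forall p, B p -> {for p, continuous s}.
  apply: (emb_inverse m emb oB) => p Bp; apply: He0; rewrite zm subr0.
  have h1 := le_lt_trans (dotp_ge_norm p) Bp.
  by rewrite -(ltr_pXn2r (ltn0Sn 1)) // ?nnegrE // ltW.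
pose r := e0 ^+ 2 / 2; have r0 : 0 < r by rewrite divr_gt0 // exprn_gt0.
have re : r < e0 ^+ 2 by rewrite /r ltr_pdivrMr // ltr_pMr ?exprn_gt0 // ltr1n.
(* The part of the cone chart where |z|^2 <= r. It is compact, hence closed in the Hausdorff space,
   so the path cannot escape from the chart in the limit. *)
pose K := sg @` [set p | dotp p p <= r].
have KB : [set p : R * R | dotp p p <= r] `<=` B by move=> p h; exact: le_lt_trans h re.
have cK : closed K.
  apply: compact_closed => //; apply: continuous_compact.
    by apply: continuous_in_subspaceT => p /set_mem /KB /csg.
  have -> : [set p : R * R | dotp p p <= r] = cball (0, 0) e0 `&` [set p | dotp p p <= r].
    apply/seteqP; split=> [p h|p []//]; split=> //.
    have h1 := le_lt_trans (dotp_ge_norm p) (KB p h).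
    have -> : cball (0, 0) e0 p = (`|p| <= e0) :> Prop by rewrite /cball /= (_ : p - (0, 0) = p) // subr0.
    by rewrite ltW // -(ltr_pXn2r (ltn0Sn 1)) // ?nnegrE // ltW.
  apply: compact_closedI; first exact: cball_compact.
  by apply: (@closed_comp _ _ (fun p : R * R => dotp p p) [set x | x <= r]); [move=> p _; exact: dotp_continuous|exact: closed_le].
have inK x : U x -> V x -> dotp (z x) (z x) <= r -> K x.
  move=> Ux Vx zx; exists (z x) => //; have [Us _ es] := Hsg _ (KB _ zx).
  exact: (emb_inj emb Us Ux).
have KUV x : K x -> [/\ U x, V x & dotp (z x) (z x) <= r].
  by move=> [p pr <-]; have [h1 h2 h3] := Hsg _ (KB _ pr); split=> //; rewrite h3.
pose Z x := plane_pow k.+1 (z x).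
have cZ x : U x -> {for x, continuous Z}.
  by move=> Ux; apply: continuous_comp; [exact: cz|exact: plane_pow_continuous].
pose rho := r ^+ k.+1; have rho0 : 0 < rho by exact: exprn_gt0.
(* With |Z|^2 < rho / 4 at the start and (s l)^2 <= rho / 4, the parallelogram identity keeps |Z|^2
   <= rho, that is |z|^2 <= r, along the path. *)
pose d := Num.min 1 (rho / 4); have d0 : 0 < d by rewrite lt_min ltr01 divr_gt0.
have nW : \forall x \near m, [/\ U x, V x & dotp (Z x) (Z x) < rho / 4].
  have n1 := open_nbhs_nbhs (conj oU Um); have n2 := open_nbhs_nbhs (conj oV Vm).
  have cd : {for m, continuous (fun x => dotp (Z x) (Z x))}.
    by apply: (@continuous_comp _ _ _ Z (fun p => dotp p p)); [exact: cZ|exact: dotp_continuous].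
  have n3 : \forall x \near m, dotp (Z x) (Z x) < rho / 4.
    apply: (cd [set x | x < rho / 4]); apply: open_nbhs_nbhs; split; first exact: open_lt.
    by rewrite /= /Z zm plane_pow_origin /dotp /= mulr0 addr0 divr_gt0.
  by apply: filterS3 n1 n2 n3.
have := nW : nbhs m [set x | [/\ U x, V x & dotp (Z x) (Z x) < rho / 4]].
rewrite nbhsE => -[W oW HW]; exists W, d; split=> // e l eta e1 Hp ld W0.
have [U0 V0 Z0] := HW _ W0.
pose P s := [/\ U (eta s), V (eta s) & Z (eta s) = Z (eta 0) + (s * l) *: e].
have PK s : 0 <= s <= 1 -> P s -> K (eta s).
  move=> /andP[s0 s1] [Us Vs Zs]; apply: inK => //.
  rewrite -(ler_pXn2r (ltn0Sn k)) ?nnegrE; [|by rewrite /dotp addr_ge0 // -expr2 sqr_ge0|exact: ltW].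
  rewrite -dotp_plane_pow -/(Z _) Zs; move: Z0; set p := Z (eta 0) => Z0.
  have l2 : (s * l) ^+ 2 <= rho / 4.
    have a1 : `|s * l| <= d by rewrite normrM ger0_norm //; apply: le_trans ld; rewrite ler_piMl.
    have d1 : d <= 1 by rewrite ge_min lexx.
    have d2 : d <= rho / 4 by rewrite ge_min lexx orbT.
    rewrite -real_normK ?num_real // expr2; apply: (le_trans _ d2); rewrite -[d in _ <= d]mulr1.
    by apply: ler_pM => //; exact: le_trans a1 d1.
  move: l2; set t := s * l => l2; rewrite -/rho.
  have h1 : 0 <= dotp (p - t *: e) (p - t *: e) by rewrite /dotp addr_ge0 // -expr2 sqr_ge0.
  have h2 : dotp (p - t *: e) (p - t *: e) + dotp (p + t *: e) (p + t *: e) = 2 * dotp p p + 2 * (t ^+ 2 * dotp e e).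
    by rewrite /dotp /= /GRing.scale /=; ring.
  have h3 : t ^+ 2 * dotp e e <= rho / 4 by apply: le_trans l2; rewrite ler_piMr // sqr_ge0.
  lra.
suff PP s : 0 <= s <= 1 -> P s by move=> s /PP [].
apply: interval_induction.
- by split=> //; rewrite mul0r scale0r addr0.
(* Openness: near [eta s] a flat chart differs from Z by a translation, so the straight motion
   continues. *)
- move=> {}s s01 [Us Vs Zs]; have [ns Hs] := Hp s s01; have [j dj] := nonsing_tdom ns.
  have [v Hv] := Hz j _ Us dj; have [d1 d10 Hd1] := Hs j dj.
  have nn : \forall x \near eta s, [/\ U x, V x & tchart (t:=X) j x = Z x + v].
    by apply: filterS3 (open_nbhs_nbhs (conj oU Us)) (open_nbhs_nbhs (conj oV Vs)) Hv.
  have [d2 d20 Hd2] := hpath_continuous Hp s01 nn.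
  exists (Num.min d1 d2); first by rewrite lt_min d10.
  move=> t t01; rewrite lt_min => /andP[t1 t2]; have [_ et] := Hd1 t t01 t1.
  have [Ut Vt Zt] := Hd2 t t01 t2; split=> //.
  have [_ _ Zs'] := nbhs_singleton nn.
  move: et; rewrite Zt Zs' Zs => et; apply: (@addIr _ v); rewrite et -!addrA; congr (_ + _).
  by rewrite [v + _]addrC addrA -scalerDl; congr (_ *: _ + _); ring.
(* Closedness: earlier points lie in K, so does the limit point, and there the formula for Z follows
   by continuity. *)
- move=> {}s /andP[s0 s1] Hb.
  have s01 : 0 <= s <= 1 by rewrite (ltW s0).
  have tst (d1 : R) : 0 < d1 -> exists t, [/\ 0 <= t < s, 0 <= t <= 1 & `|t - s| < d1].
    move=> d10; exists (Num.max 0 (s - d1 / 2)).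
    have a : 0 <= Num.max 0 (s - d1 / 2) by rewrite le_max lexx.
    have b : Num.max 0 (s - d1 / 2) < s by rewrite gt_max s0 /=; lra.
    have c : s - d1 / 2 <= Num.max 0 (s - d1 / 2) by rewrite le_max lexx orbT.
    split; rewrite ?a ?b //=; first by rewrite (le_trans (ltW b)).
    by rewrite ltr0_norm; lra.
  have Ks : K (eta s).
    apply: contrapT => nK; have nn : nbhs (eta s) (~` K) by apply: open_nbhs_nbhs; split=> //; exact: closed_openC.
    have [d1 d10 Hd1] := hpath_continuous Hp s01 nn; have [t [ts t01 td]] := tst d1 d10.
    by apply: (Hd1 t t01 td); apply: PK => //; exact: Hb.
  have [Us Vs _] := KUV _ Ks; split=> //.
  apply/subr0_eq/eqP; rewrite -normr_le0 leNgt; apply/negP => gap.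
  set g := `|_| in gap.
  have nn : nbhs (eta s) [set x | `|Z x - Z (eta s)| < g / 2].
    have g2 : 0 < g / 2 by rewrite divr_gt0.
    have /cvgrPdist_lt/(_ _ g2) := cZ _ Us; apply: filterS => x hx.
    by change (`|Z x - Z (eta s)| < g / 2); rewrite distrC; exact: hx.
  have [d1 d10 Hd1] := hpath_continuous Hp s01 nn.
  pose d2 := g / 2 / (`|l *: e| + 1).
  have n1 : 0 < `|l *: e| + 1 by rewrite ltr_wpDl.
  have d20 : 0 < d2 by rewrite !divr_gt0.
  have [|t [ts t01]] := tst (Num.min d1 d2); first by rewrite lt_min d10.
  rewrite lt_min => /andP[t1 t2]; have [_ _ Zt] := Hb t ts; have := Hd1 t t01 t1; rewrite /= Zt => h1.
  have h2 : `|(t * l) *: e - (s * l) *: e| < g / 2.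
    rewrite -scalerBl -mulrBl -scalerA normrZ.
    apply: (@le_lt_trans _ _ (`|t - s| * (`|l *: e| + 1))); first by rewrite ler_wpM2l // lerDl.
    by rewrite -ltr_pdivlMr.
  have : g <= `|Z (eta 0) + (t * l) *: e - Z (eta s)| + `|(t * l) *: e - (s * l) *: e|.
    by rewrite /g -normrN opprB (shift_sub _ _ ((t * l) *: e)); exact: ler_normB.
  lra.
Qed.

End FlatPaths.

Lemma iter_continuous (T : topologicalType) (n : T -> T) k : continuous n -> continuous (iter k n).
Proof.
move=> cn; elim: k => [|k IH] x; first by move=> A.
by apply: (@continuous_comp _ _ _ (iter k n) n); [exact: IH|exact: cn].
Qed.

Section FlatContractions.
Variables (R : realType) (T : topologicalType) (X : translation_structure R T).
Implicit Types (m : T) (p q e : R * R) (U V W : set T) (eta : R -> T).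

(** Compactness of the surface turns the neighbourhoods of [cone_path] into one length d and one
    constant C valid for all starting points. *)
Lemma hpath_uniform (P : R -> (R -> T) -> Prop) : hausdorff_space T -> compact [set: T] ->
  (forall C C' eta, C <= C' -> P C eta -> P C' eta) ->
  (forall m, exists V (C : R), open_nbhs m V /\ forall eta, (forall s, 0 <= s <= 1 -> V (eta s)) -> P C eta) ->
  exists d C : R, 0 < d /\ forall e l eta, dotp e e <= 1 -> hpath X e l eta -> `|l| <= d -> P C eta.
Proof.
move=> hT cT Pm H.
pose Q (A : set T) := exists d C : R, 0 < d /\ forall e l eta, dotp e e <= 1 -> hpath X e l eta ->
  `|l| <= d -> A (eta 0) -> P C eta.
suff [d [C [d0 HC]]] : Q setT by exists d, C; split=> // e l eta e1 hp ld; exact: (HC e l).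
apply: compact_union_ind cT _ _ _ _.
- by exists 1, 0.
- by move=> A B AB [d [C [d0 HC]]]; exists d, C; split=> // e l eta e1 hp ld /AB; exact: (HC e l).
- move=> A B [d [C [d0 HC]]] [d' [C' [d0' HC']]]; exists (Num.min d d'), (Num.max C C').
  split=> [|e l eta e1 hp]; first by rewrite lt_min d0.
  rewrite le_min => /andP[l1 l2] [Ae|Be].
    by apply: Pm (HC e l _ e1 hp l1 Ae); rewrite le_max lexx.
  by apply: Pm (HC' e l _ e1 hp l2 Be); rewrite le_max lexx orbT.
- move=> m _; have [V [C [[oV Vm] HV]]] := H m.
  have [W [d [oW d0 HW]]] := cone_path X hT oV Vm; exists W => //; exists d, C; split=> // e l eta e1 hp ld W0.
  by apply: HV => s s01; exact: (HW e l).
Qed.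

(** Only the behaviour along the direction e is recorded: in flat charts n multiplies displacements
    along e by c. *)
Definition contracts (n : T -> T) e (c : R) := [/\ continuous n, forall m, sing X (n m) -> sing X m &
  forall k l m, tdom (t:=X) k m -> tdom (t:=X) l (n m) -> \forall m' \near m, forall t : R,
    tchart (t:=X) k m' = tchart (t:=X) k m + t *: e ->
    tchart (t:=X) l (n m') = tchart (t:=X) l (n m) + (c * t) *: e].

Lemma hpath_contract (n : T -> T) e (c l : R) eta : contracts n e c -> hpath X e l eta ->
  hpath X e (c * l) (n \o eta).
Proof.
move=> [cn sn Hn] H s s01; have [ns Hs] := H s s01; split; first by move=> /sn.
move=> j dj; have [k dk] := nonsing_tdom ns; have [d d0 Hd] := Hs k dk.
have nn : \forall x \near eta s, tdom (t:=X) j (n x) /\ forall t : R,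
    tchart (t:=X) k x = tchart (t:=X) k (eta s) + t *: e ->
    tchart (t:=X) j (n x) = tchart (t:=X) j (n (eta s)) + (c * t) *: e.
  have n1 : \forall x \near eta s, tdom (t:=X) j (n x).
    by apply: (cn (eta s)); apply: open_nbhs_nbhs; split=> //; exact: tdom_open.
  by apply: filterS2 n1 (Hn k j _ dk dj).
have [d1 d10 Hd1] := hpath_continuous H s01 nn.
exists (Num.min d d1); first by rewrite lt_min d0.
move=> t t01; rewrite lt_min => /andP[td td1]; have [dt et] := Hd t t01 td.
have [djt E] := Hd1 t t01 td1; split=> //=.
by rewrite (E _ et) mulrCA.
Qed.

Lemma hpath_iter (n : T -> T) e (c l : R) eta k : contracts n e c -> hpath X e l eta ->
  hpath X e (c ^+ k * l) (iter k n \o eta).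
Proof.
move=> Hn H; elim: k => [|k IH]; first by rewrite expr0 mul1r.
by rewrite exprS -mulrA; exact: (hpath_contract Hn IH).
Qed.

End FlatContractions.

Section LeafOscillation.
Variables (R : realType) (M : surface R) (X : translation_structure R M).
Variables (n n' : M -> M) (e : R * R) (c : R) (a : rform1 M).
Hypotheses (D : sdiffeo (~` sing X) n n') (Hn : contracts X n e c) (c1 : `|c| < 1) (e1 : dotp e e <= 1).
Hypothesis ca : rclosed a.

(* n^k shrinks the paths, on which the primitives of its pull-backs therefore oscillate
   as little as local primitives of a. *)
Lemma leaf_oscillation (l0 : R) : exists (C : R) (k0 : nat), forall k l eta (G : M -> R), (k0 <= k)%N ->
  `|l| <= l0 -> hpath X e l eta ->
  (forall s, 0 <= s <= 1 -> \forall m \near eta s, prim_at (iter k (rpull n) a) G m) ->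
  `|G (eta 1) - G (eta 0)| <= C.
Proof.
have aS : cform1 (~` sing X) a by case: ca => h _; exact: (cform1_sub (@subsetT _ _) h).
pose P (C : R) (eta : R -> M) := exists V g, [/\ open V, forall s, 0 <= s <= 1 -> V (eta s),
  forall m, V m -> prim_at a g m & forall m, V m -> `|g m| <= C].
have [d [C [d0 HC]]] : exists d C : R, 0 < d /\ forall e l eta, dotp e e <= 1 -> hpath X e l eta ->
    `|l| <= d -> P C eta.
  apply: hpath_uniform.
  - exact: surface_hausdorff.
  - exact: surface_compact.
  - move=> C C' eta CC [V [g [h1 h2 h3 h4]]]; exists V, g; split=> // m Vm; exact: le_trans (h4 m Vm) CC.
  - move=> m; have [V [g [C [[oV Vm] h1 h2]]]] := local_primitive m ca.
    by exists V, C; split=> // eta h; exists V, g.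
(* From k0 on, paths of initial length at most l0 are shortened below the uniform length d. *)
have [k0 Hk0] : exists k0 : nat, forall k l, (k0 <= k)%N -> `|l| <= l0 -> `|c ^+ k * l| <= d.
  have l1 : 0 < `|l0| + 1 by rewrite ltr_wpDl.
  have := @cvg_expr R c c1 => /cvgrPdist_lt/(_ (d / (`|l0| + 1))).
  rewrite divr_gt0 // => /(_ isT) [k0 _ H]; exists k0 => k l kk ll.
  have := H k kk; rewrite /= sub0r normrN => h; rewrite normrM.
  apply: (@le_trans _ _ (d / (`|l0| + 1) * (`|l0| + 1))); last by rewrite divfK // gt_eqF.
  apply: ler_pM => //; first exact: ltW.
  by apply: (le_trans ll); apply: (le_trans (ler_norm _)); rewrite lerDl.
exists (2 * C), k0 => k l eta G kk ll Hp HG.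
(* The shrunk path lies in a set carrying a primitive g with |g| <= C. Along the original path G and
   g o n^k are primitives of the same form, so their difference is constant and G oscillates by at
   most 2 C. *)
have Hp' := hpath_iter k Hn Hp.
have [V [g [oV Vs Pg bg]]] := HC _ _ _ e1 Hp' (Hk0 k l kk ll).
have s0 : 0 <= (0 : R) <= 1 by rewrite lexx ler01.
have s1 : 0 <= (1 : R) <= 1 by rewrite lexx ler01.
have E : G (eta 1) - g (iter k n (eta 1)) = G (eta 0) - g (iter k n (eta 0)).
  apply: (@locally_constant_segment _ 0 1 (fun s => G (eta s) - g (iter k n (eta s)))) => // s s01.
  have [ns _] := Hp s s01.
  have cnk := iter_continuous (k := k) (let: And3 cn _ _ := Hn in cn).
  have npg : \forall m \near eta s, prim_at (iter k (rpull n) a) (g \o iter k n) m.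
    have n1 : \forall m \near eta s, V (iter k n m).
      by apply: (cnk (eta s)); apply: open_nbhs_nbhs; split=> //; exact: Vs.
    have n2 : \forall m \near eta s, (~` sing X) m by apply: open_nbhs_nbhs; split=> //; exact: (sdiffeo_open D).
    apply: filterS2 n1 n2 => m Vm Sm; exact: (prim_at_iter D aS Sm (Pg _ Vm)).
  have nn := prim_locally_unique (HG s s01) npg.
  have [d1 d10 Hd1] := hpath_continuous Hp s01 nn; by exists d1.
have b1 := bg _ (Vs 1 s1); have b0 := bg _ (Vs 0 s0); rewrite /= in b1 b0.
have -> : G (eta 1) - G (eta 0) = g (iter k n (eta 1)) - g (iter k n (eta 0)) by lra.
by apply: le_trans (ler_normB _ _) _; lra.
Qed.

End LeafOscillation.

(** * Uniform bounds along the leaves *)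

Section Axes.
Variable R : realType.
Implicit Types (b : bool) (p q : R * R).

Definition axis b : R * R := if b then (1, 0) else (0, 1).
Definition along b p : R := if b then p.1 else p.2.
Definition across b p : R := if b then p.2 else p.1.

Lemma axis_dotp b : dotp (axis b) (axis b) <= 1.
Proof. by case: b; rewrite /dotp /=; lra. Qed.

Lemma acrossD b p q : across b (p + q) = across b p + across b q.
Proof. by case: b. Qed.

(** Projects p along the leaf direction to the transversal through p0. *)
Definition flatten_to b p0 p : R * R := if b then (p0.1, p.2) else (p.1, p0.2).

Lemma flatten_across b p0 p q : across b p = across b q -> flatten_to b p0 p = flatten_to b p0 q.
Proof. by case: b => /= ->. Qed.

Lemma flatten_end b p0 p : flatten_to b p0 p + (1 * along b (p - p0)) *: axis b = p.
Proof.
rewrite mul1r; case: p p0 => x y [x0 y0]; case: b => /=.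
  by transitivity (x0 + (x - x0) * 1, y + (x - x0) * 0) => //; congr (_, _); ring.
by transitivity (x + (y - y0) * 0, y0 + (y - y0) * 1) => //; congr (_, _); ring.
Qed.

Lemma flatten_near b p0 p (s : R) : 0 <= s <= 1 ->
  `|flatten_to b p0 p + (s * along b (p - p0)) *: axis b - p0| <= `|p - p0|.
Proof.
move=> /andP[s0 s1]; have f1 := norm_fst_le (p - p0); have f2 := norm_snd_le (p - p0).
have h z : `|z| <= `|p - p0| -> `|s * z| <= `|p - p0|.
  by move=> hz; rewrite normrM ger0_norm //; apply: le_trans hz; rewrite ler_piMl.
move: h f1 f2; set N := `|p - p0|; case: p p0 @N => x y [x0 y0] N h f1 f2; apply: norm_pair_le; case: b => /=.
- rewrite (_ : _ - x0 = s * (x - x0)); first exact: h.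
  by transitivity (x0 + (s * (x - x0)) * 1 - x0) => //; ring.
- rewrite (_ : _ - x0 = x - x0) //.
  by transitivity (x + (s * (y - y0)) * 0 - x0) => //; ring.
- rewrite (_ : _ - y0 = y - y0) //.
  by transitivity (y + (s * (x - x0)) * 0 - y0) => //; ring.
- rewrite (_ : _ - y0 = s * (y - y0)); first exact: h.
  by transitivity (y0 + (s * (y - y0)) * 1 - y0) => //; ring.
Qed.

Lemma along_le b p : `|along b p| <= `|p|.
Proof. by case: b; [exact: norm_fst_le|exact: norm_snd_le]. Qed.

Lemma flatten_continuous b p0 : continuous (flatten_to b p0).
Proof.
move=> p; case: b => /=; apply: continuous_pair => /=; try exact: cst_continuous.
  exact: dif_continuous (dif_snd p).
exact: dif_continuous (dif_fst p).
Qed.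

Lemma is_derive_pair (f : R -> R * R) (t : R) (v : R * R) : is_derive t 1 f v ->
  is_derive t 1 (fun s => (f s).1) v.1 /\ is_derive t 1 (fun s => (f s).2) v.2.
Proof.
move=> [d <-]; have c : (fun h : R => h^-1 *: (f (h *: 1 + t) - f t)) @ 0^' --> 'D_1 f t := d.
have c1 : (fun h : R => h^-1 *: ((f (h *: 1 + t)).1 - (f t).1)) @ 0^' --> ('D_1 f t).1.
  exact: (@cvg_comp _ _ _ _ fst _ _ _ c (@cvg_fst _ _ _ _ _)).
have c2 : (fun h : R => h^-1 *: ((f (h *: 1 + t)).2 - (f t).2)) @ 0^' --> ('D_1 f t).2.
  exact: (@cvg_comp _ _ _ _ snd _ _ _ c (@cvg_snd _ _ _ _ _)).
split; split.
- by apply/cvg_ex; exists ('D_1 f t).1.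
- exact: cvg_lim c1.
- by apply/cvg_ex; exists ('D_1 f t).2.
- exact: cvg_lim c2.
Qed.

Lemma C1on_lipschitz (U : set (R * R)) (f : R * R -> R) p0 (r : R) : C1on U f -> cball p0 r `<=` U ->
  exists2 L : R, 0 <= L & forall p q, cball p0 r p -> cball p0 r q -> `|f p - f q| <= L * `|p - q|.
Proof.
move=> C BU.
have [L1 L10 H1] := compact_bounded_fun (@cball_compact _ p0 r) (fun p h => let: And3 _ c _ := C p (BU p h) in c).
have [L2 L20 H2] := compact_bounded_fun (@cball_compact _ p0 r) (fun p h => let: And3 _ _ c := C p (BU p h) in c).
exists (L1 + L2); first exact: addr_ge0.
move=> [x y] [x' y']; rewrite /cball /= => h h'.
have [h1 h2] := (norm_fst_le ((x, y) - p0), norm_snd_le ((x, y) - p0)).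
have [h1' h2'] := (norm_fst_le ((x', y') - p0), norm_snd_le ((x', y') - p0)).
have btw (u v s z : R) : `|u - z| <= r -> `|v - z| <= r -> Num.min u v <= s <= Num.max u v -> `|s - z| <= r.
  rewrite !ler_distl => /andP[a1 a2] /andP[b1 b2]; rewrite ge_min le_max => /andP[/orP[] c1 /orP[] c2]; apply/andP; split; lra.
have e1 : `|f (x, y) - f (x', y) - 0 * (x - x')| <= L1 * `|x - x'|.
  apply: (@mvt_le _ (fun s => f (s, y)) (fun s => px f (s, y))) => s sb.
    have b : cball p0 r (s, y) by apply: norm_pair_le; [exact: btw (le_trans h1' h') (le_trans h1 h) sb|exact: le_trans h2 h].
    by have [d _ _] := C _ (BU _ b); have [d1 _] := dif_px d; exact: slice_x_derive.
  rewrite subr0; apply: H1; apply: norm_pair_le; [exact: btw (le_trans h1' h') (le_trans h1 h) sb|exact: le_trans h2 h].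
have e2 : `|f (x', y) - f (x', y') - 0 * (y - y')| <= L2 * `|y - y'|.
  apply: (@mvt_le _ (fun s => f (x', s)) (fun s => py f (x', s))) => s sb.
    have b : cball p0 r (x', s) by apply: norm_pair_le; [exact: le_trans h1' h'|exact: btw (le_trans h2' h') (le_trans h2 h) sb].
    by have [d _ _] := C _ (BU _ b); have [d1 _] := dif_py d; exact: slice_y_derive.
  rewrite subr0; apply: H2; apply: norm_pair_le; [exact: le_trans h1' h'|exact: btw (le_trans h2' h') (le_trans h2 h) sb].
rewrite !mul0r !subr0 in e1 e2.
have g1 := norm_fst_le ((x, y) - (x', y')); have g2 := norm_snd_le ((x, y) - (x', y')); rewrite /= in g1 g2.
have k1 := ler_wpM2l L10 g1; have k2 := ler_wpM2l L20 g2; rewrite mulrDl.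
have := ler_distD (f (x', y)) (f (x, y)) (f (x', y')); lra.
Qed.

End Axes.

Section ChartEstimate.
Variables (R : realType) (M : surface R) (X : translation_structure R M).
Variables (n n' : M -> M) (b : bool) (c : R) (a : rform1 M).
Local Notation S := (~` sing X).
Hypotheses (D : sdiffeo S n n') (Hn : contracts X n (axis R b) c) (c1 : `|c| < 1).
Hypothesis ca : rclosed a.

Definition rcontract (Y : vfield M) (w : rform2 M) : rform1 M := fun i m =>
  if `[< S m >] then (- (w i m * (Y i m).2), w i m * (Y i m).1) else (0, 0).

Definition flat_foliation : foliation M :=
  @Foliation R M (tidx X) (fun k => tdom (t:=X) k) (fun k m => across b (tchart (t:=X) k m)).

Variables (Y : vfield M) (w : rform2 M).
Hypotheses (HY : is_vfield_on 1 S Y) (TY : tangent_to flat_foliation S Y).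
Hypotheses (cw : cform2 w) (Cw : forall i, C1on (img i setT) (w i \o inv i)).

Lemma closed_cform1 : cform1 S a.
Proof. by case: ca => h _; exact: (cform1_sub (@subsetT _ S) h). Qed.

Lemma vfield_C1 i : C1map (img i S) (fun q => Y i (inv i q)).
Proof.
have [_ /(_ i) [y1 y2]] := HY; have oS := sdiffeo_open D.
by split; apply: class_nat1_C1on => //; exact: img_open.
Qed.

Lemma rcontract_cform1 : cform1 S (rcontract Y w).
Proof.
have [w0 wl wc] := cw; split.
  move=> i j m Sm di dj; have [yl _] := HY; rewrite /rcontract !asboolT //.
  rewrite (yl i j m) // (wl i j m) // /rcovec_pull /vec_push /jdet /=.
  by congr (_, _); ring.
move=> i p ip; have [y1 y2] := vfield_C1 i.
have cwp := wc i p (img_sub ip); have c_1 := C1on_continuous y1 ip; have c_2 := C1on_continuous y2 ip.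
have nS : \forall q \near p, S (inv i q).
  have := open_nbhs_nbhs (conj (@img_open _ _ i _ (sdiffeo_open D)) ip).
  by apply: filterS => q /imgP[].
split.
  apply: (@near_continuous _ _ _ (fun q => - (w i (inv i q) * (Y i (inv i q)).2))).
    by apply: filterS nS => q Sq; rewrite /rcontract asboolT.
  by apply: continuousN; exact: (continuous_mul cwp c_2).
apply: (@near_continuous _ _ _ (fun q => w i (inv i q) * (Y i (inv i q)).1)).
  by apply: filterS nS => q Sq; rewrite /rcontract asboolT.
exact: (continuous_mul cwp c_1).
Qed.

Variables (K0 : set M).
Hypotheses (cK0 : compact K0) (K0S : K0 `<=` S) (wK0 : null_off K0 w).

Lemma rcontract_null : null1_off K0 (rcontract Y w).
Proof. by move=> i m nK; rewrite /rcontract wK0 // !mul0r oppr0; case: ifP. Qed.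

Lemma rcontract_out : null1_out (rcontract Y w).
Proof. by move=> i m nd; have [w0 _ _] := cw; rewrite /rcontract w0 // !mul0r oppr0; case: ifP. Qed.

Definition pulled k := iter k (rpull n) a.

Lemma pulled_cform1 k : cform1 S (pulled k).
Proof. exact: (rpull_iter_cform1 k D closed_cform1). Qed.

Lemma pulled_wedge k : cform2 (rwedge (pulled k) (rcontract Y w)) /\ null_off K0 (rwedge (pulled k) (rcontract Y w)).
Proof.
exact: (rwedge_cform2 (sdiffeo_open D) (pulled_cform1 k) rcontract_cform1 cK0 K0S rcontract_null rcontract_out).
Qed.

Lemma pulled_local_primitive k m : S m -> exists g, \forall m' \near m, prim_at (pulled k) g m'.
Proof.
move=> Sm; have [V [g [C [[oV Vm] Pg _]]]] := local_primitive (iter k n m) ca.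
exists (g \o iter k n); have [cn _ _] := Hn.
have n1 : \forall m' \near m, V (iter k n m').
  by apply: (iter_continuous (k := k) cn (x := m)); apply: open_nbhs_nbhs.
have n2 : \forall m' \near m, S m' by apply: open_nbhs_nbhs; split=> //; exact: (sdiffeo_open D).
apply: filterS2 n1 n2 => m' Vm' Sm'; exact: (prim_at_iter D closed_cform1 Sm' (Pg _ Vm')).
Qed.

(** The pulled-back form is only continuous; its local primitives are compositions of those of a
    with n^k, and they are glued over the square. *)
Lemma pulled_chart_primitive k i p0 (r : R) : 0 < r -> cball p0 r `<=` img i S ->
  exists G, forall p, `|p - p0| < r -> dif G p (pulled k i (inv i p)).1 (pulled k i (inv i p)).2.
Proof.
move=> r0 BS; apply: (@relprim_square _ (fun p => (pulled k i (inv i p)).1) (fun p => (pulled k i (inv i p)).2) p0 r r0).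
move=> p /BS ip; have [dp Sp ep] := imgP ip.
have [g Hg] := pulled_local_primitive k Sp.
have /near_normP[d d0 Hd] := near_chart (img_sub ip) Hg.
exists d, (g \o inv i); split=> // q /Hd [/imgP[dq _ eq] Pq].
by have := Pq i dq; rewrite eq.
Qed.

(** Around m0 a smooth chart, carrying G and the integrals, is compared with a flat chart, carrying
    the transversal. The bound C times the integral of |Dv| depends on theta, w and Y but not on
    k. *)
Lemma chart_estimate m0 : S m0 -> exists2 W, open_nbhs m0 W & forall K theta, compact K -> K `<=` W ->
  C1M theta -> (forall m, ~ K m -> theta m = 0) ->
  exists C k0, forall k, (k0 <= k)%N -> `|rint (scale2 theta (rwedge (pulled k) (rcontract Y w)))| <= C.
Proof.
move=> Sm0; have oS := sdiffeo_open D; have [i di] := dom_cover m0.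
set p0 := chart i m0.
have [R0 R00 HR0] := @open_chart_ball _ _ i S m0 oS Sm0 di.
have BS : cball p0 R0 `<=` img i S by move=> p; exact: HR0.
have BS' p : `|p - p0| < R0 -> img i S p by move=> /ltW /HR0.
pose V := inv i @` [set p | `|p - p0| < R0].
have oV : open V by apply: inv_image_open; [exact: ball_open_norm|move=> p /BS' /img_sub].
have Vm0 : V m0 by exists p0; [rewrite /= subrr normr0|exact: chartK].
have VP m : V m -> [/\ dom i m, S m & `|chart i m - p0| < R0].
  by move=> [p pr <-]; have [d s e] := imgP (BS' _ pr); rewrite e.
have [kf dkf] := nonsing_tdom Sm0.
have emb := tchart_emb (t:=X) kf; have [oU cU _ _] := emb.
pose tc := tchart (t:=X) kf; set t0 := tc m0.
have [d d0 Hd] := emb_near emb dkf (open_nbhs_nbhs (conj oV Vm0)).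
pose B := [set p : R * R | `|p - t0| < d].
have oB : open B by exact: ball_open_norm.
have [sg [Hsg csg]] : exists s : R * R -> M, (forall p, B p -> [/\ tdom (t:=X) kf (s p), V (s p) & tc (s p) = p]) /\
    forall p, B p -> {for p, continuous s} by exact: (emb_inverse m0 emb oB).
(* r1 is so small that the ball lies in the flat chart and that projecting its points to the
   transversal stays in the domain of G. *)
have [r1 r10 Hr1] : exists2 r1 : R, 0 < r1 & forall q, cball p0 r1 q ->
    [/\ tdom (t:=X) kf (inv i q), B (tc (inv i q)) & `|q - p0| < R0].
  have ip : img i setT p0 by exact: img_chart.
  have nn : \forall m \near inv i p0, tdom (t:=X) kf m /\ B (tc m).
    rewrite chartK //; have n1 := open_nbhs_nbhs (conj oU dkf).
    have n2 : \forall m \near m0, B (tc m).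
      by apply: (cU m0 dkf); apply: open_nbhs_nbhs; split=> //; rewrite /B /= subrr normr0.
    exact: filterS2 n1 n2.
  have /near_normP[r2 r20 Hr2] := near_chart ip nn.
  have e0 : 0 < Num.min r2 R0 by rewrite lt_min r20.
  exists (Num.min r2 R0 / 2); first by rewrite divr_gt0.
  move=> q qr; have : `|q - p0| < Num.min r2 R0 by apply: (le_lt_trans qr); lra.
  by rewrite lt_min => /andP[/Hr2 [_ [h1 h2]] h3].
pose r := r1 / 2; have r0 : 0 < r by rewrite divr_gt0.
have rr : r < r1 by rewrite /r; lra.
have r1R p : `|p - p0| < r1 -> `|p - p0| < R0 by move=> /ltW /Hr1 [].
have Bm p : `|p - p0| < r1 -> img i S p by move=> /r1R; exact: BS'.
pose W := inv i @` [set p | `|p - p0| < r].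
exists W.
  split; last by exists p0; [rewrite /= subrr normr0|exact: chartK].
  apply: inv_image_open; first exact: ball_open_norm.
  by move=> p /= pr; apply: img_sub; apply: Bm; exact: lt_trans pr rr.
move=> K theta cK KW Ct t0K.
have Kdom : K `<=` dom i by move=> m /KW [p pr <-]; have [] := imgP (Bm p (lt_trans pr rr)).
have csw : cform2 (scale2 theta w) by exact: (scale2_cform2 (C1M_cont Ct) cw).
have nsw : null_off K (scale2 theta w) by move=> j m nK; rewrite /scale2 t0K // mul0r.
pose rho := chart_fun i (scale2 theta w).
have rho0 p : r <= `|p - p0| -> rho p = 0.
  move=> pr; rewrite /rho /chart_fun; case: asboolP => // ip; rewrite nsw // => /KW [q qr e].
  have [_ _ e1] := imgP (Bm _ (lt_trans qr rr)); have [_ _ e2] := imgP ip.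
  by move: pr; rewrite -e2 -e e1 leNgt qr.
have [N ccr] := compactly_in_cc (chart_fun_compactly csw cK Kdom nsw).
have [Mr _ rhoM] := cc_bounded ccr.
have Crho : C1on [set p | `|p - p0| < r1] rho.
  apply: (@C1on_near _ _ (fun q => (theta \o inv i) q * (w i \o inv i) q)); first exact: ball_open_norm.
    by move=> p /Bm ip; rewrite /rho /chart_fun asboolT //; exact: img_sub ip.
  apply: C1onM; first exact: ball_open_norm.
    by apply: C1on_sub (Ct i) => p /Bm /img_sub.
  exact: (C1on_sub (fun p h => img_sub (Bm p h)) (@Cw i)).
pose Yc q := Y i (inv i q).
have [y1 y2] := vfield_C1 i.
have cB : cball p0 r1 `<=` img i S by move=> p /Hr1 [_ _ /BS'].
have [L1 L10 HL1] := C1on_lipschitz y1 cB; have [L2 L20 HL2] := C1on_lipschitz y2 cB.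
have L0 : 0 <= L1 + L2 by exact: addr_ge0.
have LY p q : cball p0 r1 p -> cball p0 r1 q -> `|Yc p - Yc q| <= (L1 + L2) * `|p - q|.
  move=> hp hq; have a1 := HL1 p q hp hq; have a2 := HL2 p q hp hq.
  have n1 : 0 <= L1 * `|p - q| by rewrite mulr_ge0.
  have n2 : 0 <= L2 * `|p - q| by rewrite mulr_ge0.
  by rewrite mulrDl; apply: norm_pair_le => /=; lra.
have CV1 : C1on [set p | `|p - p0| < r1] (fun p => rho p * (Yc p).1).
  by apply: C1onM; [exact: ball_open_norm|exact: Crho|apply: C1on_sub y1 => p /Bm].
have CV2 : C1on [set p | `|p - p0| < r1] (fun p => rho p * (Yc p).2).
  by apply: C1onM; [exact: ball_open_norm|exact: Crho|apply: C1on_sub y2 => p /Bm].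
have [C [k0 Hosc]] := leaf_oscillation D Hn c1 (axis_dotp R b) ca d.
pose Dv p := px (fun p => rho p * (Yc p).1) p + py (fun p => rho p * (Yc p).2) p.
exists (C * I2 (fun p => `|Dv p|)), k0 => k kk.
have [G HG] := pulled_chart_primitive k R00 BS.
have CG : C1on [set p | `|p - p0| < R0] G.
  have [_ cc] := pulled_cform1 k.
  apply: (C1on_dif (a := fun p => (pulled k i (inv i p)).1) (b := fun p => (pulled k i (inv i p)).2)).
  - exact: ball_open_norm.
  - by move=> p; exact: HG.
  - by move=> p /BS' ip; case: (cc i p ip).
  - by move=> p /BS' ip; case: (cc i p ip).
have PG m : V m -> prim_at (pulled k) (G \o chart i) m.
  move=> /VP [dm Sm mr]; apply: (prim_at_chart (pulled_cform1 k) Sm dm).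
  have dG := HG _ mr; rewrite chartK // in dG; apply: dif_near dG.
  have := open_nbhs_nbhs (conj (@img_open _ _ i _ openT) (img_chart dm I)).
  by apply: filterS => q /imgP[_ _ e]; rewrite /= e.
pose fl := flatten_to b t0.
have flB q : B q -> B (fl q).
  move=> Bq; have := @flatten_near _ b t0 q 0; rewrite lexx ler01 => /(_ isT).
  by rewrite mul0r scale0r addr0 => h; exact: le_lt_trans h Bq.
(* The value of G at the point where the plaque of q meets the transversal; it is only continuous,
   as the flat chart is. *)
pose Q q := G (chart i (sg (fl (tc (inv i q))))).
have cQ p : cball p0 r1 p -> {for p, continuous Q}.
  move=> pr; have [h1 h2 h3] := Hr1 p pr; have [h4 h5 h6] := Hsg _ (flB _ h2).
  have [h7 _ h8] := VP _ h5; have ip := img_sub (BS' _ h3).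
  have k1 : {for p, continuous (fun q => tc (inv i q))} by exact: (continuous_comp (img_inv_cont ip) (cU _ h1)).
  have k2 : {for p, continuous (fun q => fl (tc (inv i q)))} by exact: (continuous_comp k1 (@flatten_continuous _ b t0 _)).
  have k3 : {for p, continuous (fun q => sg (fl (tc (inv i q))))} by exact: (continuous_comp k2 (csg _ (flB _ h2))).
  have k4 : {for p, continuous (fun q => chart i (sg (fl (tc (inv i q)))))} by exact: (continuous_comp k3 (chart_cont h7)).
  exact: (continuous_comp k4 (C1on_continuous CG h8)).
have GQ p : cball p0 r p -> `|G p - Q p| <= C.
  move=> pr; have pr1 : cball p0 r1 p by apply: le_trans pr _; exact: ltW.
  have [h1 h2 h3] := Hr1 p pr1; set t := tc (inv i p) in h2.
  have [dp Sp ep] := imgP (BS' _ h3).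
  (* The leaf segment from the transversal to p, of length less than d; its endpoints give Q and
     G. *)
  pose l := along b (t - t0); pose st s := fl t + (s * l) *: axis R b.
  have Bst s : 0 <= s <= 1 -> B (st s) by move=> /(@flatten_near _ b t0 t) h; exact: le_lt_trans h h2.
  have e1 : sg (st 1) = inv i p.
    rewrite /st flatten_end; have [h4 _ h5] := Hsg _ h2; exact: (emb_inj emb h4 h1 h5).
  have e0 : st 0 = fl t by rewrite /st mul0r scale0r addr0.
  have -> : G p = (G \o chart i) (sg (st 1)) by rewrite /= e1 ep.
  have -> : Q p = (G \o chart i) (sg (st 0)) by rewrite /= e0.
  have stc s : {for s, continuous st}.
    apply/continuousP_eps => e e0'; have n1 : 0 < `|l *: axis R b| + 1 by rewrite ltr_wpDl.
    exists (e / (`|l *: axis R b| + 1)) => [|s' hs']; first by rewrite divr_gt0.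
    rewrite /st opprD addrACA subrr add0r -scalerBl -mulrBl -scalerA normrZ.
    apply: (@le_lt_trans _ _ (`|s' - s| * (`|l *: axis R b| + 1))); first by rewrite ler_wpM2l // lerDl.
    by rewrite -ltr_pdivlMr.
  apply: (Hosc k l (sg \o st) (G \o chart i) kk).
  - exact: le_trans (along_le b _) (ltW h2).
  - move=> s s01; have [h4 h5 h6] := Hsg _ (Bst s s01); have [_ h8 _] := VP _ h5; split; first exact: h8.
    move=> k' dk'; have [v Hv] := ttrans h4 dk'.
    have nn : \forall m \near sg (st s), tdom (t:=X) k' m /\ tchart (t:=X) k' m = tc m + v.
      by apply: filterS2 (open_nbhs_nbhs (conj (tdom_open k') dk')) Hv.
    have cs : {for s, continuous (sg \o st)} by exact: (continuous_comp (stc s) (csg _ (Bst s s01))).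
    have /near_normP[d' d'0 Hd'] := cs _ nn; exists d' => // s' s'01 /Hd' [h9 h10]; split=> //.
    rewrite /= in h10 *; have [_ h11] := nbhs_singleton nn; rewrite h10 h11.
    have [_ _ ->] := Hsg _ (Bst s' s'01); rewrite h6 /st -!addrA; congr (_ + _).
    by rewrite [v + _]addrC addrA -scalerDl; congr (_ *: _ + _); ring.
  - move=> s s01; have [_ h5 _] := Hsg _ (Bst s s01).
    by apply: filterS (open_nbhs_nbhs (conj oV h5)) => m; exact: PG.
(* The curve given by tangency stays in a plaque of a possibly different flat chart k'. Transitions
   are translations, so its transverse coordinate is constant in the chart kf as well, and hence so
   is Q. *)
have curves q : `|q - p0| < r1 -> exists c1 c2 : R -> R, exists d : R,
  [/\ 0 < d, is_derive (0 : R) (1 : R) c1 (Yc q).1, is_derive (0 : R) (1 : R) c2 (Yc q).2,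
      (c1 0, c2 0) = q &
      forall t, `|t| < d -> cball p0 r1 (c1 t, c2 t) -> Q (c1 t, c2 t) = Q q].
  move=> qr; have [dq Sq eq] := imgP (Bm q qr); have [h1 h2 h3] := Hr1 q (ltW qr).
  have [k' [cv [e [e0 cv0 Hcv dcv]]]] := TY Sq.
  have [d1 d2] := is_derive_pair (dcv i dq).
  have zero0 : `|0 : R| < e by rewrite normr0.
  have [ccv dk' _] := Hcv 0 zero0; rewrite cv0 in dk'.
  have [v Hv] := ttrans dk' h1.
  have nn : \forall m \near cv 0, dom i m /\ tc m = tchart (t:=X) k' m + v.
    by rewrite cv0; apply: filterS2 (open_nbhs_nbhs (conj (dom_open i) dq)) Hv.
  have /near_normP[d' d'0 Hd'] := ccv _ nn.
  exists (fun s => (chart i (cv s)).1), (fun s => (chart i (cv s)).2), (Num.min e d'); split=> //.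
  - by rewrite lt_min e0.
  - by rewrite -surjective_pairing cv0.
  move=> t; rewrite lt_min => /andP[te td] _; rewrite -surjective_pairing.
  have [|dt et] := Hd' t; first by rewrite subr0.
  have [_ dkt ft] := Hcv t te.
  rewrite /Q chartK //; congr (G (chart i (sg _))); apply: flatten_across.
  have [_ e0'] := nbhs_singleton nn; rewrite cv0 in e0'.
  by rewrite et e0' !acrossD; congr (_ + _); exact: ft.
have := @transport_bound _ p0 r r1 (L1 + L2) Mr Yc rho Q r0 rr L0 LY cQ curves rhoM rho0 CV1 CV2 G C
  (C1on_sub (fun p (h : `|p - p0| < r1) => r1R p h) CG) GQ.
have [cwk _] := pulled_wedge k.
have cz := scale2_cform2 (C1M_cont Ct) cwk.
have nz : null_off K (scale2 theta (rwedge (pulled k) (rcontract Y w))).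
  by move=> j m nK; rewrite /scale2 t0K // mul0r.
have [_ ->] := rint_chart cz cK Kdom nz.
suff -> : chart_fun i (scale2 theta (rwedge (pulled k) (rcontract Y w))) =
  (fun p => rho p * (Yc p).1 * px G p + rho p * (Yc p).2 * py G p) by [].
apply/funext => p; have [pr|pr] := ltP `|p - p0| r.
  have ip := Bm p (lt_trans pr rr); have [dp Sp ep] := imgP ip.
  have dG := HG p (r1R _ (lt_trans pr rr)); have [_ ->] := dif_px dG; have [_ ->] := dif_py dG.
  rewrite /rho /chart_fun !asboolT; try exact: img_sub ip.
  by rewrite /scale2 /rwedge /rcontract asboolT //= /Yc; ring.
rewrite rho0 // !mul0r addr0 /chart_fun; case: asboolP => // ip.
apply: nz => /KW [q qr e]; have [_ _ e1] := imgP (Bm _ (lt_trans qr rr)); have [_ _ e2] := imgP ip.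
by move: pr; rewrite -e2 -e e1 leNgt qr.
Qed.

Lemma pulled_bound : exists C, forall k, `|rint (rwedge (pulled k) (rcontract Y w))| <= C.
Proof.
pose om k := rwedge (pulled k) (rcontract Y w).
have com k : cform2 (om k) by case: (pulled_wedge k).
have nom k : null_off K0 (om k) by case: (pulled_wedge k).
have [C [k0 HC]] : exists C k0, forall k, (k0 <= k)%N -> `|rint (scale2 (fun=> 1) (om k))| <= C.
  apply: (@glue R M (fun theta => exists C k0, forall k, (k0 <= k)%N -> `|rint (scale2 theta (om k))| <= C)).
  - exists 0, 0%N => k _; have -> : scale2 (fun=> 0) (om k) = fun _ _ => 0.
      by apply/funext => i; apply/funext => m; rewrite /scale2 mul0r.
    by have [_ ->] := @rgood0 R M; rewrite normr0.
  - move=> t1 t2 C1 C2 [A1 [k1 H1]] [A2 [k2 H2]]; exists (A1 + A2), (maxn k1 k2) => k; rewrite geq_max => /andP[l1 l2].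
    have -> : scale2 (fun m => t1 m + t2 m) (om k) = fun i m => scale2 t1 (om k) i m + scale2 t2 (om k) i m.
      by apply/funext => i; apply/funext => m; rewrite /scale2 mulrDl.
    rewrite rint_add; try (apply: cform2_good; apply: scale2_cform2; [exact: C1M_cont|exact: com]).
    by apply: (le_trans (ler_normD _ _)); apply: lerD; [exact: H1|exact: H2].
  - move=> m; have [Km|nK] := pselect (K0 m); first exact: (chart_estimate (K0S Km)).
    have oK : open (~` K0) by apply: closed_openC; exact: compact_closed_surface.
    exists (~` K0); first by split.
    move=> K theta cK KK _ t0; exists 0, 0%N => k _; have -> : scale2 theta (om k) = fun _ _ => 0.
      apply/funext => i; apply/funext => x; rewrite /scale2; have [Kx|nKx] := pselect (K0 x).
        by rewrite t0 ?mul0r // => /KK.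
      by rewrite nom // mulr0.
    by have [_ ->] := @rgood0 R M; rewrite normr0.
have E k : scale2 (fun=> 1) (om k) = om k by apply/funext => i; apply/funext => m; rewrite /scale2 mul1r.
(* The local bounds hold only from some k0 on; the sum takes care of the finitely many earlier
   iterates. *)
exists (Num.max C (\sum_(k < k0) `|rint (om k)|)) => k; rewrite le_max.
have [kk|kk] := leqP k0 k; first by have := HC k kk; rewrite E => ->.
apply/orP; right; rewrite (bigD1 (Ordinal kk)) //= lerDl; exact: sumr_ge0.
Qed.

(** Invariance of the integral moves the iterates of n' from the test form to iterates of the
    leaf-contracting map n on a. *)
Lemma wedge_contract_bound : (forall m, ~ S m -> ~ S (n' m)) ->
  exists C, forall k, `|rint (rwedge a (iter k (rpull n') (rcontract Y w)))| <= C.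
Proof.
move=> nS; have [C HC] := pulled_bound; exists C => k.
rewrite (rint_wedge_iter k (sdiffeo_sym D) nS cK0 K0S closed_cform1 rcontract_cform1 rcontract_null rcontract_out).
exact: HC.
Qed.

End ChartEstimate.

(** * Exact forms *)

Section ExactForms.
Variables (R : realType) (M : surface R).
Implicit Types (i j k : 'I_(nch M)) (m : M) (p q : R * R) (S K W : set M).
Implicit Types (a b : rform1 M) (F : M -> R).

Definition rd0 F : rform1 M := fun i m =>
  if `[< dom i m >] then (px (F \o inv i) (chart i m), py (F \o inv i) (chart i m)) else (0, 0).

Lemma rd0E F i m : dom i m -> rd0 F i m = (px (F \o inv i) (chart i m), py (F \o inv i) (chart i m)).
Proof. by move=> d; rewrite /rd0 asboolT. Qed.

Lemma rd0_out F : null1_out (rd0 F).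
Proof. by move=> i m nd; rewrite /rd0 asboolF. Qed.

Lemma C1M_prim F m : C1M F -> prim_at (rd0 F) F m.
Proof.
move=> C i di; rewrite rd0E //; have [d _ _] := C i _ (img_chart di I); exact: d.
Qed.

Lemma prim_at_unique a b F m i : prim_at a F m -> prim_at b F m -> dom i m -> a i m = b i m.
Proof.
move=> Pa Pb di; have da := Pa i di; have db := Pb i di.
have [_ a1] := dif_px da; have [_ a2] := dif_py da; have [_ b1] := dif_px db; have [_ b2] := dif_py db.
by rewrite (surjective_pairing (a i m)) (surjective_pairing (b i m)) -a1 -a2 b1 b2.
Qed.

Lemma rd0_null K F : compact K -> (forall m, ~ K m -> F m = 0) -> null1_off K (rd0 F).
Proof.
move=> cK F0 i m nK; have [di|nd] := pselect (dom i m); last exact: rd0_out.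
rewrite rd0E //; have ip : img i setT (chart i m) by exact: img_chart.
have nn : \forall q \near chart i m, cst 0 q = (F \o inv i) q.
  have := near_chart ip (_ : \forall x \near inv i (chart i m), ~ K x).
  rewrite chartK // => /(_ (off_compact_near_surface cK nK)).
  by apply: filterS => q [_ nq]; rewrite /= F0.
have d := dif_near nn (dif_cst 0 _).
by have [_ ->] := dif_px d; have [_ ->] := dif_py d.
Qed.

Lemma rd0_cform1 S F : C1M F -> cform1 S (rd0 F).
Proof.
move=> C; split.
  move=> i j m _ di dj; rewrite !rd0E //.
  have [d _ _] := C j _ (img_chart dj I).
  have := @dif_mapcomp _ (F \o inv j) (trans i j) _ (chart i m) _ _ (@trans_C1map _ _ i j) (img_chart di dj).
  rewrite transE // => /(_ _ _ d) d'.
  have nn : \forall q \near chart i m, ((F \o inv j) \o trans i j) q = (F \o inv i) q.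
    have := open_nbhs_nbhs (conj (@img_open _ _ i _ (dom_open j)) (img_chart di dj)).
    by apply: filterS => q /imgP [dq k e]; rewrite /= /trans /= chartK.
  have d2 := dif_near nn d'.
  by have [_ ->] := dif_px d2; have [_ ->] := dif_py d2.
move=> i p /img_sub ip; have [d c1 c2] := C i p ip.
have nn := open_nbhs_nbhs (conj (@img_open _ _ i _ openT) ip).
split.
  apply: (near_continuous _ c1); apply: filterS nn => q /imgP [dq _ e].
  by rewrite rd0E // e.
apply: (near_continuous _ c2); apply: filterS nn => q /imgP [dq _ e].
by rewrite rd0E // e.
Qed.

Lemma rd0D F1 F2 : C1M F1 -> C1M F2 ->
  rd0 (fun m => F1 m + F2 m) = fun i m => ((rd0 F1 i m).1 + (rd0 F2 i m).1, (rd0 F1 i m).2 + (rd0 F2 i m).2).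
Proof.
move=> C1 C2; apply/funext => i; apply/funext => m; have [di|nd] := pselect (dom i m); last first.
  by rewrite !rd0_out //= addr0.
rewrite !rd0E //; have [d1 _ _] := C1 i _ (img_chart di I); have [d2 _ _] := C2 i _ (img_chart di I).
have d := difD d1 d2.
by have [_ e1] := dif_px d; have [_ e2] := dif_py d; rewrite -e1 -e2.
Qed.

Definition radd a b : rform1 M := fun i m => ((a i m).1 + (b i m).1, (a i m).2 + (b i m).2).

Lemma rwedge_addr a b1 b2 : rwedge a (radd b1 b2) = fun i m => rwedge a b1 i m + rwedge a b2 i m.
Proof. by apply/funext => i; apply/funext => m; rewrite /rwedge /radd /=; ring. Qed.

Lemma wedge_d_cform2 a F : cform1 setT a -> C1M F -> cform2 (rwedge a (rd0 F)).
Proof.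
move=> ca CF; have cK := @surface_compact R M.
have nb : null1_off setT (rd0 F) by move=> i m; case.
by have [] := rwedge_cform2 openT ca (rd0_cform1 setT CF) cK (fun _ _ => I) nb (@rd0_out F).
Qed.

(** The cutoffs multiply F rather than the form, so that each localized term is again a wedged with
    an exact form. *)
Lemma stokes a F : rclosed a -> C1M F -> rint (rwedge a (rd0 F)) = 0.
Proof.
move=> [Ha Ca] CF.
have E : rint (rwedge a (rd0 (fun m => 1 * F m))) = 0.
  have C1 : C1M (fun _ : M => 1 : R) by exact: C1M_cst.
  move: C1; apply: (@glue R M (fun theta => C1M theta -> rint (rwedge a (rd0 (fun m => theta m * F m))) = 0)).
  - move=> _; have z : C1M (fun _ : M => 0 : R) by exact: C1M_cst.
    have -> : (fun m => 0 * F m) = fun _ : M => 0 by apply/funext => m; rewrite mul0r.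
    have -> : rwedge a (rd0 (fun=> 0)) = fun _ _ => 0; last by case: (@rgood0 R M).
    apply/funext => i; apply/funext => m; rewrite /rwedge.
    by rewrite (@rd0_null set0) ?mulr0 ?subrr //; exact: compact0.
  - move=> t1 t2 C1 C2 H1 H2 _.
    have -> : (fun m => (t1 m + t2 m) * F m) = fun m => t1 m * F m + t2 m * F m.
      by apply/funext => m; rewrite mulrDl.
    have D1 := C1MM C1 CF; have D2 := C1MM C2 CF.
    rewrite rd0D // -/(radd _ _) rwedge_addr rint_add; try (apply: cform2_good; exact: wedge_d_cform2).
    by rewrite H1 // H2 // addr0.
  - move=> m; have [i di] := dom_cover m; exists (dom i); first by split; [exact: dom_open|].
    move=> K theta cK Kd _ t0 Ct; set f := fun m => theta m * F m.
    have Cf : C1M f by exact: C1MM.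
    have f0 x : ~ K x -> f x = 0 by move=> nK; rewrite /f t0 // mul0r.
    have cw := wedge_d_cform2 Ha Cf.
    have nw : null_off K (rwedge a (rd0 f)).
      by move=> j x nK; rewrite /rwedge (rd0_null cK f0) //= !mulr0 subrr.
    have [_ ->] := rint_chart cw cK Kd nw.
    have [A1 A2 cl] := Ca i.
    (* Coefficient times f, extended by zero from the chart image. As a is closed, a wedge df is the
       y-derivative of [ext] of the first coefficient minus the x-derivative of [ext] of the second,
       and both integrate to 0. *)
    pose ext (g : R * R -> R) p := if `[< img i setT p >] then g p * f (inv i p) else 0.
    have cik : compact (chart i @` K).
      apply: continuous_compact cK; apply: continuous_in_subspaceT => x /set_mem /Kd dx; exact: chart_cont.
    have [N0 N00 HN0] := compact_bounded_plane cik.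
    have ext0 g p : ~ (chart i @` K) p -> ext g p = 0.
      move=> nK; rewrite /ext; case: asboolP => // ip; rewrite f0 ?mulr0 // => Kp; apply: nK.
      by exists (inv i p) => //; have [] := imgP ip.
    have ext_near g p : img i setT p -> \forall q \near p, g q * (f \o inv i) q = ext g q.
      move=> ip; apply: filterS (open_nbhs_nbhs (conj (@img_open _ _ i _ openT) ip)) => q iq.
      by rewrite /ext asboolT.
    have extC g : C1on (img i setT) g -> C1cc (ext g) (N0 + 1).
      move=> Cg; split; last first.
        split; first by rewrite ltr_wpDl.
        by move=> p pN; apply: ext0 => /HN0 h; move: pN; rewrite leNgt (le_lt_trans h) // ltrDl.
      apply: C1on_local => p _; have [ip|nip] := pselect (img i setT p).
        exists (img i setT); first by split; [exact: (@img_open _ _ i _ openT)|].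
        apply: (@C1on_near _ _ (fun q => g q * (f \o inv i) q)).
        - exact: (@img_open _ _ i _ openT).
        - by move=> q iq; rewrite /ext asboolT.
        - by apply: C1onM; [exact: (@img_open _ _ i _ openT)|exact: Cg|exact: Cf].
      exists (~` (chart i @` K)).
        split; first by apply: closed_openC; exact: compact_closed_plane.
        by move=> [x Kx e]; apply: nip; rewrite -e; apply: img_chart => //; exact: Kd.
      apply: (@C1on_near _ _ (fun=> 0)).
      - by apply: closed_openC; exact: compact_closed_plane.
      - by move=> q nq; rewrite ext0.
      - by apply: C1on_cst; apply: closed_openC; exact: compact_closed_plane.
    have E1 := extC _ A1; have E2 := extC _ A2.
    have [G1 G1'] := C1cc_grad E1; have [G2 G2'] := C1cc_grad E2.
    suff -> : chart_fun i (rwedge a (rd0 f)) =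
        (fun p => py (ext (fun q => (a i (inv i q)).1)) p - px (ext (fun q => (a i (inv i q)).2)) p).
      by rewrite (I2B G1' G2) (I2_py E1) (I2_px E2) subrr.
    apply/funext => p; rewrite /chart_fun; case: asboolP => [ip|nip].
      have [dp _ ep] := imgP ip; have [df _ _] := Cf i p ip.
      have [d1 _ _] := A1 p ip; have [d2 _ _] := A2 p ip.
      have [_ ->] := dif_py (dif_near (ext_near _ _ ip) (difM d1 df)).
      have [_ ->] := dif_px (dif_near (ext_near _ _ ip) (difM d2 df)).
      by rewrite (cl p ip) /rwedge rd0E // ep /=; ring.
    have z g : (forall q, ~ (chart i @` K) q -> g q = 0) -> px g p = 0 /\ py g p = 0.
      move=> g0; have nn : \forall q \near p, cst 0 q = g q.
        have : \forall q \near p, ~ (chart i @` K) q.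
          apply: off_compact_near cik _ => -[x Kx e]; apply: nip; rewrite -e; apply: img_chart => //; exact: Kd.
        by apply: filterS => q nq; rewrite g0.
      have d := dif_near nn (dif_cst 0 p).
      by have [_ ->] := dif_px d; have [_ ->] := dif_py d.
    by have [_ ->] := z _ (ext0 (fun q => (a i (inv i q)).1)); have [-> _] := z _ (ext0 (fun q => (a i (inv i q)).2)); rewrite subrr.
by move: E; have -> : (fun m => 1 * F m) = F by apply/funext => m; rewrite mul1r.
Qed.

Section PullExact.
Variables (S : set M) (g g' : M -> M).
Hypotheses (D : sdiffeo S g g') (nS : forall m, ~ S m -> ~ S (g m)).

(** Although g need not be differentiable at the singularities, F o g is C^1 on all of M: it
    vanishes near them. *)
Lemma comp_C1M K F : C1M F -> compact K -> K `<=` S -> (forall m, ~ K m -> F m = 0) ->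
  [/\ C1M (F \o g), compact (g' @` K), g' @` K `<=` S & forall m, ~ (g' @` K) m -> (F \o g) m = 0].
Proof.
move=> CF cK KS F0; have D' := sdiffeo_sym D.
have cgK := image_compact cK KS (@sdiffeo_cont _ _ _ _ _ D').
have gKS : g' @` K `<=` S by move=> _ [x /KS Sx <-]; exact: (sdiffeo_in D' Sx).
have Fg0 m : ~ (g' @` K) m -> (F \o g) m = 0.
  move=> nK; apply: F0 => Kg; apply: nK; exists (g m) => //.
  have [Sm|nSm] := pselect (S m); first exact: (sdiffeoK D Sm).
  by case: (nS nSm); exact: KS.
split=> // i; apply: C1on_local => p ip; have [dp _ ep] := imgP ip.
have [Sp|nSp] := pselect (S (inv i p)); last first.
  have nK : ~ (g' @` K) (inv i p) by move=> /gKS.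
  have oV := @img_open _ _ i _ (closed_openC (compact_closed_surface cgK)).
  exists (img i (~` (g' @` K))); first by split; [exact: oV|exact: img_setTE].
  apply: (@C1on_near _ _ (fun=> 0)) => //; last exact: C1on_cst.
  by move=> q /imgP [_ nq _]; rewrite [RHS]Fg0.
have [j dj] := dom_cover (g (inv i p)).
have oU := @loc_open _ _ _ _ _ D i j.
have Up : img i (S `&` g @^-1` dom j) p by exact: img_setTE.
exists (img i (S `&` g @^-1` dom j)); first by split.
apply: (@C1on_near _ _ ((F \o inv j) \o loc g i j)) => //.
  by move=> q /imgP [dq [_ k] _]; rewrite /loc /= chartK.
apply: (@C1on_comp _ _ (img j setT)) (@CF j) => //; first exact: (@loc_C1map _ _ _ _ _ D i j).
by move=> q /imgP [dq [_ k] _]; rewrite /loc /=; exact: img_chart.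
Qed.

Lemma rpull_rd0 K F : C1M F -> compact K -> K `<=` S -> (forall m, ~ K m -> F m = 0) ->
  rpull g (rd0 F) = rd0 (F \o g).
Proof.
move=> CF cK KS F0; have [CFg cgK gKS Fg0] := comp_C1M CF cK KS F0.
apply/funext => i; apply/funext => m; have [di|nd] := pselect (dom i m); last by rewrite rpull_out // rd0_out.
have [Sm|nSm] := pselect (S m); last first.
  rewrite rpull_zero; last by move=> j; apply: (rd0_null cK F0) => /KS; exact: nS.
  by rewrite (rd0_null cgK Fg0) // => /gKS.
apply: (@prim_at_unique _ _ (F \o g) m i _ (@C1M_prim _ m CFg) di).
exact: (prim_at_pull D (rd0_cform1 S CF) Sm (@C1M_prim _ (g m) CF)).
Qed.

(** Each pull-back replaces F by F o g, again C^1 with compact support in S, until [stokes]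
    applies. *)
Lemma wedge_exact_zero a K F n : rclosed a -> C1M F -> compact K -> K `<=` S -> (forall m, ~ K m -> F m = 0) ->
  rint (rwedge a (iter n (rpull g) (rd0 F))) = 0.
Proof.
move=> ca; elim: n K F => [|n IH] K F CF cK KS F0; first exact: stokes.
have [CFg cgK gKS Fg0] := comp_C1M CF cK KS F0.
by rewrite iterSr (rpull_rd0 CF cK KS F0); exact: IH cgK gKS Fg0.
Qed.

End PullExact.

End ExactForms.

(** * Symmetry of second derivatives *)

Section Schwarz.
Variable R : realType.

(** The second difference over a square of side h, divided by h^2, tends to the y-derivative of
    [px f]; differentiability of [px f] at p alone is used. *)
Lemma mixed_difference (f : R * R -> R) (p : R * R) (c u e : R) : 0 < e ->
  (\forall q \near p, derivable f q (1, 0)) -> dif (px f) p u c ->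
  exists2 d : R, 0 < d & forall h : R, 0 < h -> h < d ->
    `|f (p.1 + h, p.2 + h) - f (p.1 + h, p.2) - (f (p.1, p.2 + h) - f p) - c * h * h| <= 2 * e * h * h.
Proof.
move=> e0 /near_normP[d1 d10 Hd1] Dp; have [d2 d20 Hd2] := Dp e e0.
exists (Num.min d1 d2); first by rewrite lt_min d10.
move=> h h0; rewrite lt_min => /andP[hd1 hd2].
have in0 s t : p.1 <= s <= p.1 + h -> p.2 <= t <= p.2 + h -> `|(s, t) - p| <= h.
  by move=> /andP[s1 s2] /andP[t1 t2]; apply: norm_pair_le => /=; rewrite ger0_norm; lra.
have hp : Num.min p.1 (p.1 + h) = p.1 by apply: min_l; lra.
have hp' : Num.max p.1 (p.1 + h) = p.1 + h by apply: max_r; lra.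
have t0 : p.2 <= p.2 <= p.2 + h by rewrite lexx; lra.
have t1 : p.2 <= p.2 + h <= p.2 + h by rewrite lexx; lra.
have der s t : p.1 <= s <= p.1 + h -> p.2 <= t <= p.2 + h -> is_derive s 1 (fun z => f (z, t)) (px f (s, t)).
  move=> hs ht; apply: slice_x_derive => //; apply: Hd1; exact: le_lt_trans (in0 _ _ hs ht) hd1.
have bd s t : p.1 <= s <= p.1 + h -> p.2 <= t <= p.2 + h ->
    `|px f (s, t) - px f p - (u * (s - p.1) + c * (t - p.2))| <= e * h.
  move=> hs ht; apply: (le_trans (Hd2 (s, t) (le_lt_trans (in0 _ _ hs ht) hd2))).
  by rewrite ler_pM2l //; exact: in0.
have := @mvt_le _ (fun s => f (s, p.2 + h) - f (s, p.2)) (fun s => px f (s, p.2 + h) - px f (s, p.2))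
  p.1 (p.1 + h) (c * h) (2 * (e * h)).
rewrite hp hp' => mv.
have A1 s : p.1 <= s <= p.1 + h ->
    is_derive s 1 (fun z => f (z, p.2 + h) - f (z, p.2)) (px f (s, p.2 + h) - px f (s, p.2)).
  by move=> hs; apply: is_deriveB; exact: der.
have A2 s : p.1 <= s <= p.1 + h -> `|px f (s, p.2 + h) - px f (s, p.2) - c * h| <= 2 * (e * h).
  move=> hs; have b1 := bd s _ hs t1; have b0 := bd s _ hs t0.
  have -> : px f (s, p.2 + h) - px f (s, p.2) - c * h =
    (px f (s, p.2 + h) - px f p - (u * (s - p.1) + c * (p.2 + h - p.2))) -
    (px f (s, p.2) - px f p - (u * (s - p.1) + c * (p.2 - p.2))) by ring.
  by apply: (le_trans (ler_normB _ _)); lra.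
have := mv A1 A2; rewrite [p.1 + h - p.1]addrAC subrr add0r (gtr0_norm h0) -(surjective_pairing p).
by have -> : 2 * (e * h) * h = 2 * e * h * h by ring.
Qed.

Lemma schwarz (U : set (R * R)) (f : R * R -> R) p : open U -> C1on U f -> C1on U (px f) -> C1on U (py f) -> U p ->
  py (px f) p = px (py f) p.
Proof.
move=> oU Cf C1 C2 Up; pose sw (q : R * R) := (q.2, q.1).
have nU := open_nbhs_nbhs (conj oU Up).
have [d1 _ _] := C1 p Up; have [d2 _ _] := C2 p Up.
have nx : \forall q \near p, derivable f q (1, 0) by apply: filterS nU => q /Cf [/dif_px[]].
(* The second difference is symmetric in the two variables, so the same lemma for f with swapped
   variables gives the other mixed derivative. *)
pose F := f \o sw.
have dF q : U (sw q) -> dif F q (py f (sw q)) (px f (sw q)).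
  move=> Uq; have [d _ _] := Cf _ Uq.
  have := @dif_comp _ f snd fst q _ _ 0 1 1 0 d (dif_snd q) (dif_fst q).
  by move=> h; apply: dif_eq h _ _; ring.
have csw q : {for q, continuous sw}.
  by apply: continuous_pair => /=; [exact: (dif_continuous (dif_snd q))|exact: (dif_continuous (dif_fst q))].
have nV : \forall q \near sw p, U (sw q).
  by apply: (csw (sw p)); rewrite /sw /= -surjective_pairing.
have nF : \forall q \near sw p, derivable F q (1, 0) by apply: filterS nV => q /dF/dif_px[].
have D2 : dif (px F) (sw p) (py (py f) p) (px (py f) p).
  have d2' : dif (py f) ((sw p).2, (sw p).1) (px (py f) p) (py (py f) p) by rewrite /= -surjective_pairing.
  have := @dif_comp _ (py f) snd fst (sw p) _ _ 0 1 1 0 d2' (dif_snd _) (dif_fst _).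
  move=> h; have h' : dif (fun q => py f (q.2, q.1)) (sw p) (py (py f) p) (px (py f) p) by apply: dif_eq h _ _; ring.
  by apply: dif_near h'; apply: filterS nV => q /dF/dif_px[].
apply/eqP; rewrite -subr_eq0 -normr_le0; apply/ler_addgt0Pl => e e0; rewrite addr0.
have e4 : 0 < e / 4 by rewrite divr_gt0.
have [r1 r10 H1] := mixed_difference e4 nx d1; have [r2 r20 H2] := mixed_difference e4 nF D2.
pose h := Num.min r1 r2 / 2; have m0 : 0 < Num.min r1 r2 by rewrite lt_min r10.
have h0 : 0 < h by rewrite divr_gt0.
have hm : h < Num.min r1 r2 by rewrite /h; lra.
move: hm; rewrite lt_min => /andP[h1 h2].
have := H1 h h0 h1; have := H2 h h0 h2; rewrite /F /sw /= -(surjective_pairing p).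
set A := f (p.1 + h, p.2 + h); set B := f (p.1 + h, p.2); set C := f (p.1, p.2 + h) => k2 k1.
have hh : 0 < h * h by rewrite mulr_gt0.
rewrite -(ler_pM2r hh) -[X in _ * X <= _](gtr0_norm hh) -normrM.
have -> : (py (px f) p - px (py f) p) * (h * h) =
  (A - C - (B - f p) - px (py f) p * h * h) - (A - B - (C - f p) - py (px f) p * h * h) by ring.
apply: (le_trans (ler_normB _ _)); have -> : e * (h * h) = 2 * (e / 4) * h * h + 2 * (e / 4) * h * h by field.
exact: (lerD k2 k1).
Qed.

End Schwarz.

(** * The flat structure transported by the conjugacy *)

Section PulledStructure.
Variables (R : realType) (T T' : topologicalType) (h : T -> T') (h' : T' -> T).
Hypothesis Hh : homeo h h'.
Variable X : translation_structure R T'.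

Lemma homeo_near (P : T' -> Prop) m : (\forall y \near h m, P y) -> \forall x \near m, P (h x).
Proof. by case: Hh => _ _ ch _ H; exact: (ch m _ H). Qed.

Lemma homeo_embedding U (f : T' -> R * R) : embedding_on U f -> embedding_on (h @^-1` U) (f \o h).
Proof.
case: Hh => hK h'K ch ch' [oU cf jf opf]; split.
- by apply: open_comp oU => x _; exact: ch.
- by move=> x Ux; apply: continuous_comp; [exact: ch|exact: cf].
- move=> x y /set_mem Ux /set_mem Uy /= e; rewrite -(hK x) -(hK y); congr h'.
  by apply: jf => //; exact: mem_set.
- move=> V oV VU; have -> : (f \o h) @` V = f @` (h' @^-1` V).
    apply/seteqP; split=> [p [x Vx <-]|p [y Vy <-]].
      by exists (h x) => //; rewrite /preimage /= hK.
    by exists (h' y) => //=; rewrite h'K.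
  apply: opf; first by apply: open_comp oV => x _; exact: ch'.
  by move=> y /VU; rewrite /preimage /= h'K.
Qed.

Let sing' := h @^-1` sing X.

Lemma pulled_sing_finite : finite_set sing'.
Proof.
have -> : sing' = h' @` sing X; last by apply: finite_image; exact: sing_finite.
case: Hh => hK h'K _ _; apply/seteqP; split=> [x sx|x [y sy <-]]; first by exists (h x).
by rewrite /sing' /preimage /= h'K.
Qed.

Lemma pulled_cover : \bigcup_(k in setT) (h @^-1` tdom (t:=X) k) = ~` sing'.
Proof.
rewrite -preimage_bigcup; apply/seteqP; split=> x.
  by rewrite /preimage /= tdom_cover.
by rewrite /preimage /= tdom_cover.
Qed.

Lemma pulled_trans k l m : (h @^-1` tdom (t:=X) k) m -> (h @^-1` tdom (t:=X) l) m ->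
  exists v, \forall m' \near m, (tchart (t:=X) l \o h) m' = (tchart (t:=X) k \o h) m' + v.
Proof. by move=> d1 d2; have [v Hv] := ttrans d1 d2; exists v; exact: homeo_near Hv. Qed.

Lemma pulled_cone p : sing' p -> exists (k : nat) (U : set T) (z : T -> R * R),
  [/\ embedding_on U z, U `&` sing' = [set p], z p = (0, 0) &
      forall l m, U m -> (h @^-1` tdom (t:=X) l) m -> exists v, \forall m' \near m,
        (tchart (t:=X) l \o h) m' = plane_pow k.+1 (z m') + v].
Proof.
move=> sp; have [k [U [z [emb Us z0 H]]]] := tcone sp; exists k, (h @^-1` U), (z \o h); split=> //.
- exact: homeo_embedding.
- rewrite -preimage_setI Us; case: Hh => hK _ _ _; apply/seteqP; split=> x /=; last by move=> ->.
  by move=> e; rewrite -(hK x) e hK.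
- by move=> l m Um dm; have [v Hv] := H l (h m) Um dm; exists v; apply: homeo_near Hv.
Qed.

Definition pulled_structure : translation_structure R T :=
  @TranslationStructure R T sing' (tidx X) (fun k => h @^-1` tdom (t:=X) k) (fun k => tchart (t:=X) k \o h)
    pulled_sing_finite pulled_cover (fun k => homeo_embedding (tchart_emb (t:=X) k)) pulled_trans pulled_cone.

Variables (L L' : T' -> T') (A A' : T -> T).
Hypotheses (HA : homeo A A') (HL : linear_pA X L L') (hA : forall m, h (A m) = L (h m)).

(** The factor is nu^-1 in both cases: A contracts vertical lines and its inverse contracts
    horizontal ones. As nu may be negative, only |c| < 1 is claimed. *)
Lemma linear_contraction : exists2 c : R, `|c| < 1 &
  ((forall m, sing' (A m) -> sing' m) -> contracts pulled_structure A (axis R false) c) /\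
  ((forall m, sing' (A' m) -> sing' m) -> contracts pulled_structure A' (axis R true) c).
Proof.
have [_ _ [nu [nu1 H]]] := HL; have [AK A'K cA cA'] := HA.
have nu0 : nu != 0 by rewrite -normr_gt0; exact: lt_trans ltr01 nu1.
exists nu^-1; first by rewrite normfV invf_lt1 // normr_gt0.
split=> sA; split=> // k l m dk dl.
  have dl' : tdom (t:=X) l (L (h m)) by rewrite -hA.
  have [v Hv] := H k l (h m) dk dl'; have Hm := nbhs_singleton Hv.
  apply: filterS (homeo_near Hv) => x Hx t /= e; rewrite hA Hx e hA Hm.
  case: (tchart (t:=X) k (h m)) => x0 y0; case: v {Hv Hm Hx} => v1 v2 /=.
  transitivity (nu * (x0 + t * 0) + v1, nu^-1 * (y0 + t * 1) + v2) => //.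
  transitivity (nu * x0 + v1 + nu^-1 * t * 0, nu^-1 * y0 + v2 + nu^-1 * t * 1) => //.
  by congr (_, _); ring.
have E x : L (h (A' x)) = h x by rewrite -hA A'K.
have dk' : tdom (t:=X) k (L (h (A' m))) by rewrite E.
have [v Hv] := H l k (h (A' m)) dl dk'; have Hm := nbhs_singleton Hv.
have Hv' : \forall x \near m, tchart (t:=X) k (L (h (A' x))) =
    (nu * (tchart (t:=X) l (h (A' x))).1, nu^-1 * (tchart (t:=X) l (h (A' x))).2) + v := cA' m _ (homeo_near Hv).
apply: filterS Hv' => x Hx t /= e; move: Hm Hx e; rewrite !E.
case: (tchart (t:=X) k (h m)) => x0 y0; case: (tchart (t:=X) k (h x)) => x1 y1.
case: (tchart (t:=X) l (h (A' m))) => x2 y2; case: (tchart (t:=X) l (h (A' x))) => x3 y3; case: v {Hv} => v1 v2 /=.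
move=> e1 e2 e3.
have f1 : x0 = nu * x2 + v1 by case: e1.
have f2 : y0 = nu^-1 * y2 + v2 by case: e1.
have f3 : x1 = nu * x3 + v1 by case: e2.
have f4 : y1 = nu^-1 * y3 + v2 by case: e2.
have f5 : x1 = x0 + t * 1 by case: e3.
have f6 : y1 = y0 + t * 0 by case: e3.
transitivity (x2 + (nu^-1 * t) * 1, y2 + (nu^-1 * t) * 0) => //; congr (_, _).
  apply: (mulfI nu0); have -> : nu * (x2 + nu^-1 * t * 1) = nu * x2 + t by field.
  by move: f1 f3 f5; lra.
by apply: (mulfI (invr_neq0 nu0)); move: f2 f4 f6; rewrite !mulr0 !addr0; lra.
Qed.

End PulledStructure.

(** r > 1 gives an integer part of at least 1; the Hoelder exponent can be forgotten. *)
Lemma class_real_C1on (R : realType) (r : R) (U : set (R * R)) (f : R * R -> R) : 1 < r -> open U ->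
  class_real r U f -> C1on U f.
Proof.
move=> r1 oU; rewrite /class_real; move: (r - _) => th.
have : (0 < Num.truncn r)%N by rewrite truncn_gt0 ltW.
case: (Num.truncn r) => // k _ [cf df cx cy].
have cont (j : nat) g : class_holder j th U g -> forall p, U p -> {for p, continuous g}.
  by case: j => [[]//|j] [].
by apply: C1on_partials => //; [exact: (cont k)|exact: (cont k)].
Qed.

Section PADiffeo.
Variables (R : realType) (M : surface R) (r : R) (Sig : set M) (A : pA_diffeo r Sig).
Hypothesis r1 : 1 < r.
Local Notation S := (~` Sig).

Lemma pA_invK m : pA_inv A (A m) = m. Proof. by case: (pA_homeo A). Qed.
Lemma pA_mapK m : A (pA_inv A m) = m. Proof. by case: (pA_homeo A) => _ h. Qed.

(** A m is fixed, so A (A m) = A m, and injectivity of A gives A m = m. *)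
Lemma pA_map_Sig m : Sig (A m) -> Sig m.
Proof. by move=> s; have := pA_fix A s; move=> /(congr1 (pA_inv A)); rewrite !pA_invK => <-. Qed.

Lemma pA_inv_Sig m : Sig (pA_inv A m) -> Sig m.
Proof. by move=> s; have := pA_fix A s; rewrite pA_mapK => ->. Qed.

Lemma pA_map_off m : S m -> S (A m). Proof. by move=> ns /pA_map_Sig. Qed.
Lemma pA_inv_off m : S m -> S (pA_inv A m). Proof. by move=> ns /pA_inv_Sig. Qed.

Lemma finite_open_compl : finite_set Sig -> open S.
Proof. by move=> fS; apply: closed_openC; apply: compact_closed_surface; exact: finite_compact. Qed.

Lemma class_off_C1map (B : M -> M) i j : class_off r Sig B -> open (img i (S `&` B @^-1` dom j)) ->
  C1map (img i (S `&` B @^-1` dom j)) (chart j \o B \o inv i).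
Proof.
move=> [CB _] o; have [c1 c2] := CB i j.
have E : img i (B @^-1` dom j `\` Sig) = img i (S `&` B @^-1` dom j) by rewrite setDE setIC.
by rewrite E in c1 c2; split; [exact: (class_real_C1on r1 o c1)|exact: (class_real_C1on r1 o c2)].
Qed.

Lemma pA_sdiffeo : finite_set Sig -> sdiffeo S A (pA_inv A).
Proof.
move=> fS; have oS := finite_open_compl fS; have [AK A'K cA cA'] := pA_homeo A.
split=> //.
- by move=> m Sm; split; [exact: pA_map_off|exact: pA_invK].
- by move=> m Sm; split; [exact: pA_inv_off|exact: pA_mapK].
- by split=> m _; [exact: cA|exact: cA'].
move=> i j.
have oU : open (img i (S `&` A @^-1` dom j)).
  by apply: img_open; apply: openI => //; apply: open_comp (dom_open j) => x _; exact: cA.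
have oV : open (img j (S `&` pA_inv A @^-1` dom i)).
  by apply: img_open; apply: openI => //; apply: open_comp (dom_open i) => x _; exact: cA'.
split=> //.
- move=> p /imgP [dp [Sp dA] ep]; rewrite /= chartK // pA_invK ep; split=> //.
  by apply: img_chart => //; split; [exact: pA_map_off|rewrite /preimage /= pA_invK].
- move=> p /imgP [dp [Sp dA] ep]; rewrite /= chartK // pA_mapK ep; split=> //.
  by apply: img_chart => //; split; [exact: pA_inv_off|rewrite /preimage /= pA_mapK].
split; [exact: (class_off_C1map (pA_class A))|exact: (class_off_C1map (pA_inv_class A))|].
by move=> p /imgP [dp [Sp dA] ep]; rewrite -ep; exact: pA_orient.
Qed.

(** Transporting the flat structure to M by the conjugacy makes [flat_foliation] unfold to the
    unstable and stable foliations of A, so that the conjugacy disappears from the estimates. *)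
Definition pA_structure : translation_structure R M := pulled_structure (pA_conj_homeo A) (pA_flat A).

Lemma pA_structure_sing : sing pA_structure = Sig.
Proof.
have [hK h'K _ _] := pA_conj_homeo A; rewrite /pA_structure /= -(pA_conj_sing A); apply/seteqP; split=> x.
  by move=> [y Sy e]; rewrite -(hK x) -e hK.
by move=> Sx; exists x.
Qed.

Lemma pA_contraction : exists2 c : R, `|c| < 1 &
  contracts pA_structure A (axis R false) c /\ contracts pA_structure (pA_inv A) (axis R true) c.
Proof.
have [c c1 [H1 H2]] := linear_contraction (pA_conj_homeo A) (pA_homeo A) (pA_lin_pA A) (pA_conjE A).
have E : pA_conj A @^-1` sing (pA_flat A) = Sig := pA_structure_sing.
by exists c => //; rewrite E in H1 H2; split; [apply: H1|apply: H2] => m; [exact: pA_map_Sig|exact: pA_inv_Sig].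
Qed.

End PADiffeo.

(** * Complex forms and test forms *)

Section ComplexForms.
Variables (R : realType) (M : surface R).
Implicit Types (i j : 'I_(nch M)) (m : M) (S K : set M) (g : M -> M).

Lemma complex_ext (z z' : R[i]) : cRe z = cRe z' -> cIm z = cIm z' -> z = z'.
Proof. by case: z z' => x y [x' y'] /= -> ->. Qed.

Definition re1 (a : form1 M) : rform1 M := fun i m => (cRe (a i m).1, cRe (a i m).2).
Definition im1 (a : form1 M) : rform1 M := fun i m => (cIm (a i m).1, cIm (a i m).2).
Definition re2 (w : form2 M) : rform2 M := fun i m => cRe (w i m).
Definition im2 (w : form2 M) : rform2 M := fun i m => cIm (w i m).

Lemma integral2E (w : form2 M) : integral2 w = rint (re2 w) +i* rint (im2 w).
Proof.
rewrite /integral2 /rint /I2on; elim/big_rec3: _ => [|i x y z _ ->]; first by [].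
by [].
Qed.

Lemma wedge_re (a b : form1 M) : re2 (wedge a b) = fun i m => -1 * rwedge (im1 a) (im1 b) i m + rwedge (re1 a) (re1 b) i m.
Proof.
apply/funext => i; apply/funext => m; rewrite /re2 /wedge /rwedge /re1 /im1.
by case: (a i m) => -[x1 x2] [y1 y2]; case: (b i m) => -[z1 z2] [t1 t2] /=; ring.
Qed.

Lemma wedge_im (a b : form1 M) : im2 (wedge a b) = fun i m => 1 * rwedge (im1 a) (re1 b) i m + rwedge (re1 a) (im1 b) i m.
Proof.
apply/funext => i; apply/funext => m; rewrite /im2 /wedge /rwedge /re1 /im1.
by case: (a i m) => -[x1 x2] [y1 y2]; case: (b i m) => -[z1 z2] [t1 t2] /=; ring.
Qed.

Lemma pull_re g (b : form1 M) : re1 (pull1 g b) = rpull g (re1 b).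
Proof.
apply/funext => i; apply/funext => m; rewrite /re1 /pull1 /rpull; case: asboolP => // _.
case: pickP => // j _; rewrite /covec_pull /rcovec_pull /loc.
by case: (b j (g m)) => -[x1 x2] [y1 y2] /=; congr (_, _); ring.
Qed.

Lemma pull_im g (b : form1 M) : im1 (pull1 g b) = rpull g (im1 b).
Proof.
apply/funext => i; apply/funext => m; rewrite /im1 /pull1 /rpull; case: asboolP => // _.
case: pickP => // j _; rewrite /covec_pull /rcovec_pull /loc.
by case: (b j (g m)) => -[x1 x2] [y1 y2] /=; congr (_, _); ring.
Qed.

Lemma pull_iter_re g n (b : form1 M) : re1 (iter n (pull1 g) b) = iter n (rpull g) (re1 b).
Proof. by elim: n => //= n IH; rewrite pull_re IH. Qed.

Lemma pull_iter_im g n (b : form1 M) : im1 (iter n (pull1 g) b) = iter n (rpull g) (im1 b).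
Proof. by elim: n => //= n IH; rewrite pull_im IH. Qed.

Lemma push_iter g n (B : current M) b : iter n (push g) B b = B (iter n (pull1 g) b).
Proof. by elim: n b => //= n IH b; rewrite /push IH -iterSr. Qed.

Lemma closed_form_real (a : form1 M) : closed_form a -> rclosed (re1 a) /\ rclosed (im1 a).
Proof.
move=> [[[_ la] Ca] da].
have oT i : open (img i [set: M]) by apply: img_open; exact: openT.
have law (f : R[i] -> R) : (forall z z' x x', f (z * x%:C + z' * x'%:C) = f z * x + f z' * x') ->
    forall i j m, [set: M] m -> dom i m -> dom j m ->
    (f (a i m).1, f (a i m).2) = rcovec_pull (trans i j) (chart i m) (f (a j m).1, f (a j m).2).
  move=> fl i j m _ di dj; rewrite (la i j m di dj); congr (_, _); exact: fl.
have dz i p : img i [set: M] p -> cpx (fun p => (a i (inv i p)).2) p = cpy (fun p => (a i (inv i p)).1) p.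
  move=> ip; have [dp _ ep] := imgP ip; have := da i (inv i p); rewrite /d1 asboolT // ep.
  by move/eqP; rewrite subr_eq0 => /eqP.
split; split.
- split; first by apply: law => -[x y] [x' y'] u u' /=; ring.
  move=> i p ip; have [[c1 _] [c2 _]] := Ca i.
  by split; [exact: (C1on_continuous (class_nat1_C1on (oT i) c1) ip)|exact: (C1on_continuous (class_nat1_C1on (oT i) c2) ip)].
- move=> i; have [[c1 _] [c2 _]] := Ca i; split; try exact: class_nat1_C1on.
  by move=> p /dz [].
- split; first by apply: law => -[x y] [x' y'] u u' /=; ring.
  move=> i p ip; have [[_ c1] [_ c2]] := Ca i.
  by split; [exact: (C1on_continuous (class_nat1_C1on (oT i) c1) ip)|exact: (C1on_continuous (class_nat1_C1on (oT i) c2) ip)].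
- move=> i; have [[_ c1] [_ c2]] := Ca i; split; try exact: class_nat1_C1on.
  by move=> p /dz [].
Qed.

Definition cgood (w : form2 M) := rgood (re2 w) /\ rgood (im2 w).

Lemma integral2_linear (c : R[i]) (w w' : form2 M) : cgood w -> cgood w' ->
  integral2 (fun i m => c * w i m + w' i m) = c * integral2 w + integral2 w'.
Proof.
case: c => x y [g1 g2] [h1 h2]; rewrite !integral2E.
have [k1 e1] := rint_linear (- y) g2 h1; have [_ e2] := rint_linear x g1 k1.
have [k3 e3] := rint_linear y g1 h2; have [_ e4] := rint_linear x g2 k3.
apply: complex_ext => /=.
  rewrite (_ : re2 _ = fun i m => x * re2 w i m + (- y * im2 w i m + re2 w' i m)).
    by rewrite e2 e1; ring.
  apply/funext => i; apply/funext => m; rewrite /re2 /im2.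
  by case: (w i m) => u v; case: (w' i m) => u' v' /=; ring.
rewrite (_ : im2 _ = fun i m => x * im2 w i m + (y * re2 w i m + im2 w' i m)).
  by rewrite e4 e3; ring.
apply/funext => i; apply/funext => m; rewrite /re2 /im2.
by case: (w i m) => u v; case: (w' i m) => u' v' /=; ring.
Qed.

(** The class of test forms on which the currents are shown to vanish: pairings of iterates with
    every closed real form exist and are bounded. It isolates all the geometry from the linear
    algebra. *)
Definition rtest g (b : rform1 M) := forall a, rclosed a ->
  (forall n, rgood (rwedge a (iter n (rpull g) b))) /\
  exists C, forall n, `|rint (rwedge a (iter n (rpull g) b))| <= C.

Lemma rpull_add g (b1 b2 : rform1 M) : rpull g (radd b1 b2) = radd (rpull g b1) (rpull g b2).
Proof.
apply/funext => i; apply/funext => m; rewrite /rpull /radd; case: asboolP => _; last by rewrite /= addr0.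
by case: pickP => [j _|_]; rewrite /rcovec_pull /=; [congr (_, _); ring|rewrite addr0].
Qed.

Lemma rtest_add g b1 b2 : rtest g b1 -> rtest g b2 -> rtest g (radd b1 b2).
Proof.
move=> H1 H2 a ca; have [g1 [C1 B1]] := H1 a ca; have [g2 [C2 B2]] := H2 a ca.
have E n : rwedge a (iter n (rpull g) (radd b1 b2)) =
    fun i m => 1 * rwedge a (iter n (rpull g) b1) i m + rwedge a (iter n (rpull g) b2) i m.
  have -> : iter n (rpull g) (radd b1 b2) = radd (iter n (rpull g) b1) (iter n (rpull g) b2).
    by elim: n => //= n ->; rewrite rpull_add.
  by rewrite rwedge_addr; apply/funext => i; apply/funext => m; rewrite mul1r.
split; first by move=> n; rewrite E; have [] := rint_linear 1 (g1 n) (g2 n).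
exists (C1 + C2) => n; rewrite E; have [_ ->] := rint_linear 1 (g1 n) (g2 n); rewrite mul1r.
by apply: (le_trans (ler_normD _ _)); exact: lerD.
Qed.

Lemma supported_good S g g' K (a b : rform1 M) n : sdiffeo S g g' -> (forall m, ~ S m -> ~ S (g m)) ->
  compact K -> K `<=` S -> cform1 S b -> null1_off K b -> null1_out b -> rclosed a ->
  rgood (rwedge a (iter n (rpull g) b)).
Proof.
move=> D nS cK KS cb bK b0 [ca _]; have D' := sdiffeo_sym D.
have [K' [cK' KS' bK' b0']] : exists K', [/\ compact K', K' `<=` S, null1_off K' (iter n (rpull g) b) &
    null1_out (iter n (rpull g) b)].
  elim: n => [|n [K' [cK' KS' bK' b0']]]; first by exists K.
  exists (g' @` K'); split.
  - exact: (image_compact cK' KS' (@sdiffeo_cont _ _ _ _ _ D')).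
  - by move=> _ [x /KS' Sx <-]; exact: (sdiffeo_in D' Sx).
  - exact: (rpull_null D KS' bK' nS).
  - exact: rpull_out.
have [cw _] := rwedge_cform2 (sdiffeo_open D) (cform1_sub (@subsetT _ S) ca) (rpull_iter_cform1 n D cb) cK' KS' bK' b0'.
exact: cform2_good.
Qed.

Definition ctest g (b : form1 M) := rtest g (re1 b) /\ rtest g (im1 b).

Lemma ctest_good g (a b : form1 M) n : ctest g b -> closed_form a -> cgood (wedge a (iter n (pull1 g) b)).
Proof.
move=> [Hr Hi] /closed_form_real [ar ai].
have [r1 _] := Hr _ ar; have [r2 _] := Hr _ ai; have [i1 _] := Hi _ ar; have [i2 _] := Hi _ ai.
rewrite /cgood wedge_re wedge_im pull_iter_re pull_iter_im; split.
  by have [] := rint_linear (-1) (i2 n) (r1 n).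
by have [] := rint_linear 1 (r2 n) (i1 n).
Qed.

Lemma ctest_bound g (a b : form1 M) : ctest g b -> closed_form a ->
  exists C : R, forall n, Normc.normc (integral2 (wedge a (iter n (pull1 g) b))) <= C.
Proof.
move=> [Hr Hi] /closed_form_real [ar ai].
have [r1 [C1 B1]] := Hr _ ar; have [r2 [C2 B2]] := Hr _ ai.
have [i1 [C3 B3]] := Hi _ ar; have [i2 [C4 B4]] := Hi _ ai.
exists (C4 + C1 + (C2 + C3)) => n; rewrite integral2E.
have le (x y : R) : Normc.normc (x +i* y) <= `|x| + `|y|.
  rewrite /Normc.normc -(ler_pXn2r (ltn0Sn 1)) ?nnegrE ?sqrtr_ge0 ?addr_ge0 // sqr_sqrtr ?addr_ge0 ?sqr_ge0 //.
  rewrite sqrrD !real_normK ?num_real // [_ + _ *+ 2]addrC -addrA lerDr mulrn_wge0 // mulr_ge0 //.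
apply: (le_trans (le _ _)); rewrite wedge_re wedge_im pull_iter_re pull_iter_im.
have [_ ->] := rint_linear (-1) (i2 n) (r1 n); have [_ ->] := rint_linear 1 (r2 n) (i1 n).
rewrite mulN1r mul1r; apply: lerD; apply: (le_trans (ler_normD _ _)); rewrite ?normrN; apply: lerD => //.
Qed.

Lemma ctest_linear g (b a a' : form1 M) (c : R[i]) n : ctest g b -> closed_form a -> closed_form a' ->
  integral2 (wedge (add1 (scale1 c a) a') (iter n (pull1 g) b)) =
  c * integral2 (wedge a (iter n (pull1 g) b)) + integral2 (wedge a' (iter n (pull1 g) b)).
Proof.
move=> Hb ca ca'; rewrite -(integral2_linear c (ctest_good n Hb ca) (ctest_good n Hb ca')); congr integral2.
by apply/funext => i; apply/funext => m; rewrite /wedge /add1 /scale1 /=; ring.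
Qed.

End ComplexForms.

Section Limits.
Variable R : realType.

Lemma normc_Re (z : R[i]) : `|cRe z| <= Normc.normc z.
Proof. by case: z => x y /=; rewrite -sqrtr_sqr ler_wsqrtr // lerDl sqr_ge0. Qed.

Lemma normc_Im (z : R[i]) : `|cIm z| <= Normc.normc z.
Proof. by case: z => x y /=; rewrite -sqrtr_sqr ler_wsqrtr // lerDr sqr_ge0. Qed.

Lemma geometric_lim0 (u : nat -> R) (C th : R) : 0 <= th -> th < 1 -> (forall n, `|u n| <= C * th ^+ n) ->
  lim (u @ \oo) = 0.
Proof.
move=> t0 t1 H; apply: cvg_lim => //; apply/norm_cvg0P.
apply: (@squeeze_cvgr _ _ _ _ (fun=> 0) (fun n => C * th ^+ n)).
- by near=> n; rewrite normr_ge0 H.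
- exact: cvg_cst.
- rewrite -[0](mulr0 C); apply: cvgMr; apply: cvg_expr; by rewrite ger0_norm.
Unshelve. all: by end_near. Qed.

Lemma geometric_limC0 (u : nat -> R[i]) (C th : R) : 0 <= th -> th < 1 ->
  (forall n, Normc.normc (u n) <= C * th ^+ n) -> limC u = 0.
Proof.
move=> t0 t1 H; rewrite /limC.
have -> : lim ((fun n => cRe (u n)) @ \oo) = 0.
  by apply: (geometric_lim0 t0 t1) => n; exact: le_trans (normc_Re _) (H n).
have -> : lim ((fun n => cIm (u n)) @ \oo) = 0.
  by apply: (geometric_lim0 t0 t1) => n; exact: le_trans (normc_Im _) (H n).
by [].
Qed.

End Limits.

(** * Decay of bounded functionals along Jordan chains *)

Section JordanDecay.
Variables (R : realType) (V : lmodType R[i]) (f : V -> V) (U : nat -> V -> R[i]) (th : R).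
Hypothesis lf : forall c x y, f (c *: x + y) = c *: f x + f y.
Hypothesis lU : forall n c x y, U n (c *: x + y) = c * U n x + U n y.
Hypothesis bU : forall x, exists C : R, forall n, Normc.normc (U n x) <= C.
Hypothesis th0 : 0 < th.

(** The constant serves all n and m at once; the limit defining the currents is later taken along n
    = m. *)
Definition decays x := exists C : R, forall n m, Normc.normc (U n (iter m f x)) <= C * th ^+ m.

Lemma iter_linear m c x y : iter m f (c *: x + y) = c *: iter m f x + iter m f y.
Proof. by elim: m => //= m ->; rewrite lf. Qed.

Lemma decays_image x : decays x -> decays (f x).
Proof.
move=> [C H]; exists (C * th) => n m; have := H n m.+1; by rewrite exprS mulrA iterSr.
Qed.

Lemma normcD_le (z z' : R[i]) : Normc.normc (z + z') <= Normc.normc z + Normc.normc z'.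
Proof. exact: le_normcD. Qed.

Lemma decays0 : decays 0.
Proof.
have U0 n : U n 0 = 0 by have := lU n (-1) 0 0; rewrite scaler0 addr0 mulN1r addNr.
have f0 m : iter m f 0 = 0.
  by have := iter_linear m (-1) 0 0; rewrite scaler0 addr0 scaleN1r addNr.
by exists 0 => n m; rewrite f0 U0 Normc.normc0 mul0r.
Qed.

Lemma decays_scale c x : decays x -> decays (c *: x).
Proof.
move=> [C H]; have [C0 H0] := decays0; exists (Normc.normc c * C + C0) => n m.
rewrite -[c *: x]addr0 iter_linear lU; apply: (le_trans (normcD_le _ _)); rewrite Normc.normcM mulrDl -mulrA.
apply: lerD; last exact: H0.
by apply: ler_wpM2l; [case: (c) => a b; exact: sqrtr_ge0|exact: H].
Qed.

(** Induction on m: if E >= C / (th - k), then k E + C <= th E, so the bound E th^m propagates. The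
    strict gap between |c| and th absorbs the polynomial growth due to Jordan blocks. *)
Lemma decays_step x y c : Normc.normc c < th -> f x = c *: x + y -> decays y -> decays x.
Proof.
move=> cth e [C H]; have [C0 H0] := bU x; set k := Normc.normc c in cth *.
have k0 : 0 <= k by rewrite /k; case: (c) => a b; exact: sqrtr_ge0.
pose E := Num.max C0 (C / (th - k)); exists E => n.
have d0 : 0 < th - k by rewrite subr_gt0.
elim=> [|m IH]; first by rewrite expr0 mulr1 le_max H0.
rewrite iterSr e iter_linear lU; apply: (le_trans (normcD_le _ _)); rewrite Normc.normcM -/k.
have tm : 0 <= th ^+ m by rewrite exprn_ge0 // ltW.
have E1 : C <= E * (th - k) by rewrite -ler_pdivrMr // le_max lexx orbT.
apply: (@le_trans _ _ (k * (E * th ^+ m) + C * th ^+ m)).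
  by apply: lerD; [exact: ler_wpM2l|exact: H].
have := ler_wpM2r tm E1; rewrite exprS; lra.
Qed.

End JordanDecay.

Section TestForms.
Variables (R : realType) (M : surface R).
Implicit Types (i j : 'I_(nch M)) (m : M) (p q : R * R) (K : set M).

Lemma class_holder_cont k th (U : set (R * R)) f : class_holder k th U f -> forall p, U p -> {for p, continuous f}.
Proof. by case: k => [[]//|k] []. Qed.

Lemma class_holder_C1on k th (U : set (R * R)) f : open U -> class_holder k.+1 th U f -> C1on U f.
Proof.
move=> oU [cf df cx cy].
by apply: C1on_partials => //; [exact: (class_holder_cont cx)|exact: (class_holder_cont cy)].
Qed.

Definition C2on (U : set (R * R)) f := [/\ C1on U f, C1on U (px f) & C1on U (py f)].

Lemma class_nat2_C2on (U : set (R * R)) f : open U -> class_nat 2 U f -> C2on U f.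
Proof.
move=> oU H; have [_ _ cx cy] := H.
by split; [exact: (@class_holder_C1on 1 0 U f oU H)|exact: (@class_holder_C1on 0 0 U _ oU cx)|exact: (@class_holder_C1on 0 0 U _ oU cy)].
Qed.

(** The exterior derivative of a pulled-back form. The mixed second derivatives s and t of the two
    components of the transition map cancel. *)
Lemma pull_d1_identity (u v u1 u2 v1 v2 f11 f12 f21 f22 s t : R) :
  (u1 * f11 + u2 * f21) * f12 + u * s + ((v1 * f11 + v2 * f21) * f22 + v * t) -
  ((u1 * f12 + u2 * f22) * f11 + u * s + ((v1 * f12 + v2 * f22) * f21 + v * t)) =
  (f11 * f22 - f12 * f21) * (v1 - u2).
Proof. by ring. Qed.

Definition rd1 (a : rform1 M) : rform2 M := fun i m =>
  if `[< dom i m >] then px (fun p => (a i (inv i p)).2) (chart i m) - py (fun p => (a i (inv i p)).1) (chart i m)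
  else 0.

Variable a : rform1 M.
Hypothesis law : forall i j m, dom i m -> dom j m -> a i m = rcovec_pull (trans i j) (chart i m) (a j m).
Hypothesis C2a : forall i, C2on (img i setT) (fun p => (a i (inv i p)).1) /\ C2on (img i setT) (fun p => (a i (inv i p)).2).

(** The exterior derivative computed in a chart transforms as a 2-form. Both mixed derivatives of
    the transition map occur, and [schwarz] identifies them. *)
Lemma rd1_law i j m : dom i m -> dom j m -> rd1 a i m = jdet (trans i j) (chart i m) * rd1 a j m.
Proof.
move=> di dj; rewrite /rd1 !asboolT //; set p := chart i m; set F := trans i j.
have oU : open (img i (dom j)) by apply: img_open; exact: dom_open.
have Up : img i (dom j) p by exact: img_chart.
have [t1 t2] := trans_smooth i j 2.
have [A1 A1x A1y] := class_nat2_C2on oU t1; have [A2 A2x A2y] := class_nat2_C2on oU t2.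
have Fp : F p = chart j m by rewrite /F transE.
have CF : C1map (img i (dom j)) F by split; [exact: A1|exact: A2].
pose u q := (a j (inv j q)).1; pose v q := (a j (inv j q)).2.
have jp : img j setT (chart j m) by exact: img_chart.
have [[Cu _ _] [Cv _ _]] := C2a j.
have [du _ _] := Cu _ jp; have [dv _ _] := Cv _ jp; rewrite -Fp in du dv.
have du' := dif_mapcomp CF Up du; have dv' := dif_mapcomp CF Up dv.
have [d11 _ _] := A1x p Up; have [d12 _ _] := A1y p Up; have [d21 _ _] := A2x p Up; have [d22 _ _] := A2y p Up.
have nn : \forall q \near p, a i (inv i q) = rcovec_pull F q (u (F q), v (F q)).
  apply: filterS (open_nbhs_nbhs (conj oU Up)) => q /imgP [dq dq' eq].
  by rewrite (law dq dq') eq /u /v /F /trans /= chartK // -surjective_pairing.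
have n1 : \forall q \near p, (u \o F) q * jac11 F q + (v \o F) q * jac21 F q = (a i (inv i q)).1.
  by apply: filterS nn => q ->.
have n2 : \forall q \near p, (u \o F) q * jac12 F q + (v \o F) q * jac22 F q = (a i (inv i q)).2.
  by apply: filterS nn => q ->.
have D1 := dif_near n1 (difD (difM du' d11) (difM dv' d21)).
have D2 := dif_near n2 (difD (difM du' d12) (difM dv' d22)).
have [_ ->] := dif_py D1; have [_ ->] := dif_px D2.
have s1 := schwarz oU A1 A1x A1y Up; have s2 := schwarz oU A2 A2x A2y Up.
rewrite -[px (py _) p]s1 -[px (py _) p]s2 -Fp /jdet.
exact: pull_d1_identity.
Qed.

Lemma rd1_C1 i : C1on (img i setT) (rd1 a i \o inv i).
Proof.
have oT : open (img i [set: M]) by apply: img_open; exact: openT.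
have [[_ _ c1] [_ c2 _]] := C2a i.
apply: (@C1on_near _ _ (fun p => px (fun p => (a i (inv i p)).2) p - py (fun p => (a i (inv i p)).1) p)); first exact: oT.
  by move=> p /imgP [dp _ ep]; rewrite /= /rd1 asboolT // ep.
exact: (C1onB oT c2 c1).
Qed.

Lemma rd1_cform2 : cform2 (rd1 a).
Proof.
split; [by move=> i m nd; rewrite /rd1 asboolF|exact: rd1_law|].
by move=> i p ip; exact: (C1on_continuous (@rd1_C1 i) ip).
Qed.

Lemma rd1_null K : compact K -> null1_off K a -> null_off K (rd1 a).
Proof.
move=> cK aK i m nK; rewrite /rd1; case: asboolP => // di.
have ip : img i setT (chart i m) by exact: img_chart.
have nn : \forall q \near chart i m, a i (inv i q) = (0, 0).
  have := near_chart ip (_ : \forall x \near inv i (chart i m), ~ K x).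
  rewrite chartK // => /(_ (off_compact_near_surface cK nK)).
  by apply: filterS => q [_ nq]; rewrite aK.
have n1 : \forall q \near chart i m, cst 0 q = (a i (inv i q)).1 by apply: filterS nn => q ->.
have n2 : \forall q \near chart i m, cst 0 q = (a i (inv i q)).2 by apply: filterS nn => q ->.
have [_ ->] := dif_px (dif_near n2 (dif_cst 0 _)); have [_ ->] := dif_py (dif_near n1 (dif_cst 0 _)).
by rewrite subrr.
Qed.

End TestForms.

Section BasicCurrents.
Variables (R : realType) (M : surface R) (X : translation_structure R M).
Variables (n n' : M -> M) (b : bool) (c : R).
Local Notation S := (~` sing X).
Hypotheses (D : sdiffeo S n n') (Hn : contracts X n (axis R b) c) (c1 : `|c| < 1).
Hypothesis nS : forall m, ~ S m -> ~ S (n' m).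
Implicit Types (i j : 'I_(nch M)) (m : M) (p q : R * R) (K : set M) (Y : vfield M).

Let oS : open S := sdiffeo_open D.

Lemma rtest_exact K (F : M -> R) : C1M F -> compact K -> K `<=` S -> (forall m, ~ K m -> F m = 0) ->
  rtest n' (rd0 F).
Proof.
move=> CF cK KS F0 a ca; have D' := sdiffeo_sym D; split=> [k|].
  exact: (supported_good k D' nS cK KS (rd0_cform1 S CF) (rd0_null cK F0) (@rd0_out _ _ F) ca).
by exists 0 => k; rewrite (wedge_exact_zero D' nS k ca CF cK KS F0) normr0.
Qed.

Lemma rtest_contract Y K (w : rform2 M) : is_vfield_on 1 S Y -> tangent_to (flat_foliation X b) S Y ->
  cform2 w -> (forall i, C1on (img i setT) (w i \o inv i)) -> compact K -> K `<=` S -> null_off K w ->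
  rtest n' (rcontract X Y w).
Proof.
move=> HY TY cw Cw cK KS wK a ca; have D' := sdiffeo_sym D; split=> [k|].
  exact: (supported_good k D' nS cK KS (rcontract_cform1 D HY cw) (@rcontract_null _ _ X Y _ _ wK) (@rcontract_out _ _ X Y _ cw) ca).
exact: (wedge_contract_bound D Hn c1 ca HY TY cw Cw cK KS wK nS).
Qed.

Lemma contract1_E Y (a : form1 M) i m : is_form1 a -> is_vfield_on 1 S Y -> S m -> dom i m ->
  contract1 S Y a m = (a i m).1 * ((Y i m).1)%:C + (a i m).2 * ((Y i m).2)%:C.
Proof.
move=> [_ la] [yl _] Sm di; rewrite /contract1; case: pickP => [j /asboolP [_ dj]|/(_ i)]; last by rewrite asboolT.
rewrite (la i j m) // (yl i j m) // /covec_pull /vec_push /=.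
case: (a j m) => -[x1 x2] [y1 y2] /=; apply: complex_ext => /=; ring.
Qed.

(** [re] stands for the real or the imaginary part. The contraction is only as regular as Y, that is
    C^1, which is enough for Stokes' theorem. *)
Lemma contract1_C1 Y K (a : form1 M) (re : R[i] -> R) : 
  (forall z z' x x', re (z * x%:C + z' * x'%:C) = re z * x + re z' * x') ->
  is_form1 a -> is_vfield_on 1 S Y -> compact K -> K `<=` S -> (forall m, ~ K m -> forall i, a i m = (0, 0)) ->
  (forall i, C1on (img i setT) (fun p => re (a i (inv i p)).1) /\ C1on (img i setT) (fun p => re (a i (inv i p)).2)) ->
  C1M (fun m => re (contract1 S Y a m)) /\ forall m, ~ K m -> re (contract1 S Y a m) = 0.
Proof.
move=> rl fa HY cK KS aK Ca.
have re0 : re 0 = 0 by have := rl 0 0 0 0; rewrite !mul0r addr0 !mulr0 addr0.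
have z m : ~ K m -> re (contract1 S Y a m) = 0.
  move=> nK; rewrite /contract1; case: pickP => [j _|_] //.
  by rewrite rl aK //= re0 !mul0r addr0.
split=> // i; apply: C1on_local => p ip; have [Sp|nSp] := pselect (S (inv i p)); last first.
  have oV := @img_open _ _ i _ (closed_openC (compact_closed_surface cK)).
  exists (img i (~` K)); first by split; [exact: oV|apply: img_setTE => // /KS].
  apply: (@C1on_near _ _ (fun=> 0)) => //; last exact: C1on_cst.
  by move=> q /imgP [_ nq _]; rewrite /= z.
have oU := @img_open _ _ i _ oS.
exists (img i S); first by split=> //; exact: img_setTE.
have [y1 y2] := vfield_C1 D HY i; have [a1 a2] := Ca i.
have sub : img i S `<=` img i setT by move=> q; exact: img_sub.
apply: (@C1on_near _ _ (fun q => re (a i (inv i q)).1 * (Y i (inv i q)).1 + re (a i (inv i q)).2 * (Y i (inv i q)).2)); first exact: oU.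
  by move=> q /imgP [dq Sq _]; rewrite /= (contract1_E fa HY Sq dq) rl.
exact: (C1onD oU (C1onM oU (C1on_sub sub a1) y1) (C1onM oU (C1on_sub sub a2) y2)).
Qed.

Lemma cRe_bilinear (z z' : R[i]) (x x' : R) : cRe (z * x%:C + z' * x'%:C) = cRe z * x + cRe z' * x'.
Proof. by case: z z' => u v [u' v'] /=; ring. Qed.

Lemma cIm_bilinear (z z' : R[i]) (x x' : R) : cIm (z * x%:C + z' * x'%:C) = cIm z * x + cIm z' * x'.
Proof. by case: z z' => u v [u' v'] /=; ring. Qed.

Lemma contract2_re Y (w : form2 M) : re1 (contract2 S Y w) = rcontract X Y (re2 w).
Proof.
apply/funext => i; apply/funext => m; rewrite /re1 /contract2 /rcontract /re2; case: asboolP => // _.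
by case: (w i m) => x y /=; congr (_, _); ring.
Qed.

Lemma contract2_im Y (w : form2 M) : im1 (contract2 S Y w) = rcontract X Y (im2 w).
Proof.
apply/funext => i; apply/funext => m; rewrite /im1 /contract2 /rcontract /im2; case: asboolP => // _.
by case: (w i m) => x y /=; congr (_, _); ring.
Qed.

Lemma d0_re (f : M -> R[i]) : re1 (d0 f) = rd0 (fun m => cRe (f m)).
Proof. by apply/funext => i; apply/funext => m; rewrite /re1 /d0 /rd0; case: asboolP. Qed.

Lemma d0_im (f : M -> R[i]) : im1 (d0 f) = rd0 (fun m => cIm (f m)).
Proof. by apply/funext => i; apply/funext => m; rewrite /im1 /d0 /rd0; case: asboolP. Qed.

Lemma d1_re (a : form1 M) : re2 (d1 a) = rd1 (re1 a).
Proof. by apply/funext => i; apply/funext => m; rewrite /re2 /d1 /rd1; case: asboolP. Qed.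

Lemma d1_im (a : form1 M) : im2 (d1 a) = rd1 (im1 a).
Proof. by apply/funext => i; apply/funext => m; rewrite /im2 /d1 /rd1; case: asboolP. Qed.

Lemma add1_re (a a' : form1 M) : re1 (add1 a a') = radd (re1 a) (re1 a').
Proof. by apply/funext => i; apply/funext => m; rewrite /re1 /add1 /radd /=; case: (a i m) => -[? ?] [? ?]; case: (a' i m) => -[? ?] [? ?]. Qed.

Lemma add1_im (a a' : form1 M) : im1 (add1 a a') = radd (im1 a) (im1 a').
Proof. by apply/funext => i; apply/funext => m; rewrite /im1 /add1 /radd /=; case: (a i m) => -[? ?] [? ?]; case: (a' i m) => -[? ?] [? ?]. Qed.

Lemma form_law (re : R[i] -> R) (a : form1 M) :
  (forall z z' x x', re (z * x%:C + z' * x'%:C) = re z * x + re z' * x') -> is_form1 a ->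
  forall i j m, dom i m -> dom j m ->
    (re (a i m).1, re (a i m).2) = rcovec_pull (trans i j) (chart i m) (re (a j m).1, re (a j m).2).
Proof. move=> rl [_ la] i j m di dj; rewrite (la i j m di dj); congr (_, _); exact: rl. Qed.

Lemma ctest_d0 K (f : M -> R[i]) : class_fun 2 f -> compact K -> K `<=` S -> (forall m, ~ K m -> f m = 0) ->
  ctest n' (d0 f).
Proof.
move=> Cf cK KS f0; have oT i : open (img i [set: M]) by apply: img_open; exact: openT.
split.
  rewrite d0_re; apply: (rtest_exact _ cK KS) => [i|m nK]; last by rewrite f0.
  by have [h _] := Cf i; exact: (@class_holder_C1on _ 1 0 _ _ (oT i) h).
rewrite d0_im; apply: (rtest_exact _ cK KS) => [i|m nK]; last by rewrite f0.
by have [_ h] := Cf i; exact: (@class_holder_C1on _ 1 0 _ _ (oT i) h).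
Qed.

Lemma ctest_contract Y K (w : form2 M) : is_vfield_on 1 S Y -> tangent_to (flat_foliation X b) S Y ->
  form2_class 1 w -> compact K -> K `<=` S -> (forall m, ~ K m -> forall i, w i m = 0) ->
  ctest n' (contract2 S Y w).
Proof.
move=> HY TY [[w0 wl] Cw] cK KS wK; have oT i : open (img i [set: M]) by apply: img_open; exact: openT.
have real (x : R) (z : R[i]) : cRe (x%:C * z) = x * cRe z /\ cIm (x%:C * z) = x * cIm z.
  by case: z => u v /=; split; ring.
have C1 i := class_nat1_C1on (oT i) (Cw i).1; have C2 i := class_nat1_C1on (oT i) (Cw i).2.
split.
  rewrite contract2_re; apply: (rtest_contract HY TY _ C1 cK KS).
    split; [by move=> i m nd; rewrite /re2 w0|by move=> i j m di dj; rewrite /re2 (wl i j m) // (real _ _).1|].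
    by move=> i p ip; exact: (C1on_continuous (C1 i) ip).
  by move=> i m nK; rewrite /re2 wK.
rewrite contract2_im; apply: (rtest_contract HY TY _ C2 cK KS).
  split; [by move=> i m nd; rewrite /im2 w0|by move=> i j m di dj; rewrite /im2 (wl i j m) // (real _ _).2|].
  by move=> i p ip; exact: (C1on_continuous (C2 i) ip).
by move=> i m nK; rewrite /im2 wK.
Qed.

(** By Cartan's formula the Lie derivative is an exact form plus a contraction of da, and both kinds
    of test forms are already treated. *)
Lemma ctest_lie Y K (a : form1 M) : is_vfield_on 1 S Y -> tangent_to (flat_foliation X b) S Y ->
  form1_class 2 a -> compact K -> K `<=` S -> (forall m, ~ K m -> forall i, a i m = (0, 0)) ->
  ctest n' (lie1 S Y a).
Proof.
move=> HY TY [fa Ca] cK KS aK; have oT i : open (img i [set: M]) by apply: img_open; exact: openT.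
have C2r i := (class_nat2_C2on (oT i) (Ca i).1.1, class_nat2_C2on (oT i) (Ca i).2.1).
have C2i i := (class_nat2_C2on (oT i) (Ca i).1.2, class_nat2_C2on (oT i) (Ca i).2.2).
split.
  rewrite /lie1 add1_re d0_re contract2_re d1_re; apply: rtest_add.
    have [|C F0] := contract1_C1 cRe_bilinear fa HY cK KS aK; last exact: (rtest_exact C cK KS F0).
    by move=> i; have [[h _ _] [h' _ _]] := C2r i.
  have H i : C2on (img i setT) (fun p => (re1 a i (inv i p)).1) /\ C2on (img i setT) (fun p => (re1 a i (inv i p)).2).
    exact: (conj (C2r i).1 (C2r i).2).
  apply: (rtest_contract HY TY _ _ cK KS).
  - exact: (rd1_cform2 (form_law cRe_bilinear fa) H).
  - by move=> i; exact: (rd1_C1 H).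
  - by apply: (rd1_null cK) => i m nK; rewrite /re1 aK.
rewrite /lie1 add1_im d0_im contract2_im d1_im; apply: rtest_add.
  have [|C F0] := contract1_C1 cIm_bilinear fa HY cK KS aK; last exact: (rtest_exact C cK KS F0).
  by move=> i; have [[h _ _] [h' _ _]] := C2i i.
have H i : C2on (img i setT) (fun p => (im1 a i (inv i p)).1) /\ C2on (img i setT) (fun p => (im1 a i (inv i p)).2).
  exact: (conj (C2i i).1 (C2i i).2).
apply: (rtest_contract HY TY _ _ cK KS).
- exact: (rd1_cform2 (form_law cIm_bilinear fa) H).
- by move=> i; exact: (rd1_C1 H).
- by apply: (rd1_null cK) => i m nK; rewrite /im1 aK.
Qed.

Lemma basic_of_contraction (B : current M) : (forall t, ctest n' t -> B t = 0) ->
  basic_current (flat_foliation X b) S B.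
Proof.
move=> B0; split; first by move=> f Cf [K [cK KS f0]]; apply: B0; exact: (ctest_d0 Cf cK KS).
move=> Y HY TY; split.
  by move=> w Cw [K [cK KS w0]]; apply: B0; exact: (ctest_contract HY TY Cw cK KS).
by move=> a Ca [K [cK KS a0]]; apply: B0; exact: (ctest_lie HY TY Ca cK KS).
Qed.

End BasicCurrents.

Section InvariantCurrentLimits.
Variables (R : realType) (M : surface R) (H : deRham M) (al : H -> form1 M).
Hypothesis Hal : linear_section al.
Variables (g : M -> M) (t : form1 M).
Hypothesis Ht : ctest g t.

Definition pairing (n : nat) (x : H) : R[i] := integral2 (wedge (al x) (iter n (pull1 g) t)).

Lemma pairing_linear n c x y : pairing n (c *: x + y) = c * pairing n x + pairing n y.
Proof. by case: Hal => la ca _; rewrite /pairing la (ctest_linear c n Ht (ca x) (ca y)). Qed.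

Lemma pairing_bound x : exists C : R, forall n, Normc.normc (pairing n x) <= C.
Proof. by case: Hal => _ ca _; exact: (ctest_bound Ht (ca x)). Qed.

(** The n-th term of the limit is the n-th pairing evaluated at f^n x, so the uniform decay is used
    on the diagonal. *)
Lemma current_limit_decay (f : 'End(H)) (th : R) x : 0 <= th -> th < 1 -> decays f pairing th x ->
  current_limit g f al x t = 0.
Proof.
move=> t0 t1 [C HC]; apply: (geometric_limC0 t0 t1) => n.
by rewrite push_iter; exact: (HC n n).
Qed.

(* v is a Jordan chain of f, up to replacing its vectors by multiples of their images. *)
Lemma jordan_chain_zero (f : 'End(H)) (J : nat) (v : nat -> H) (k s : R[i]) (e : bool) : Normc.normc k < 1 ->
  (forall j, (1 <= j <= J)%N -> f (v j) = k *: v j + (if j == 1%N then 0 else s *: (if e then f (v j.-1) else v j.-1))) ->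
  forall j, (1 <= j <= J)%N -> current_limit g f al (v j) t = 0.
Proof.
move=> k1 Hv j jJ; have k0 : 0 <= Normc.normc k by case: (k) => a b; exact: sqrtr_ge0.
pose th := (1 + Normc.normc k) / 2.
have th0 : 0 < th by rewrite /th; lra.
have th1 : th < 1 by rewrite /th; lra.
have kth : Normc.normc k < th by rewrite /th; lra.
have lf c x y : f (c *: x + y) = c *: f x + f y by rewrite linearP.
apply: (current_limit_decay (ltW th0) th1).
case/andP: jJ; elim: j => // j IH _ jJ; have := Hv j.+1; rewrite jJ => /(_ isT) E.
apply: (decays_step lf pairing_linear pairing_bound th0 kth E).
case: j IH jJ {E} => [|j] IH jJ /=; first exact: (decays0 _ lf pairing_linear).
have dj := IH isT (ltnW jJ).
apply: (decays_scale lf pairing_linear); case: (e) => //; exact: decays_image.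
Qed.

End InvariantCurrentLimits.

Lemma normc_norm (R : realType) (z : R[i]) : `|z| = (Normc.normc z)%:C.
Proof. by case: z. Qed.

Lemma basic_off_sing (R : realType) (M : surface R) (X : translation_structure R M) (Sig : set M)
    (n n' : M -> M) (b : bool) (c : R) (B : current M) : sing X = Sig ->
  sdiffeo (~` Sig) n n' -> contracts X n (axis R b) c -> `|c| < 1 ->
  (forall m, ~ (~` Sig) m -> ~ (~` Sig) (n' m)) ->
  (forall t, ctest n' t -> B t = 0) -> basic_current (flat_foliation X b) (~` Sig) B.
Proof. by move=> <- D Hn c1 nS B0; exact: (basic_of_contraction D Hn c1 nS B0). Qed.

Theorem mainTheorem2 (R : realType) (M : surface R) (Sig : set M) (r : R)
    (A : pA_diffeo r Sig) (H : deRham M) (As : 'End(H)) (al : H -> form1 M)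
    (k : nat) (mu : nat -> R[i]) (J : nat -> nat) (Cp Cm : nat -> nat -> H) :
  finite_set Sig ->
  1 < r ->
  cohomology_action A As ->
  linear_section al ->
  expanding_data A k mu J ->
  jordan_basis (@modulus_gt1 R) As k mu J Cp ->
  jordan_basis (@modulus_lt1 R) As k (fun i => (mu i)^-1) J Cm ->
  forall i j : nat, (1 <= i <= k)%N -> (1 <= j <= J i)%N ->
    basic_current (unstable_foliation A) (~` Sig)
      (current_plus A As al (Cp i j)) /\
    basic_current (stable_foliation A) (~` Sig)
      (current_minus A As al (Cm i j)).
Proof.
move=> fS r1 [kerAs _] Hal [_ _ _ _ mu_gt] [jp _ _] [jm _ _] i j ik jJ.
have D := pA_sdiffeo A r1 fS; have [c c1 [c_s c_u]] := pA_contraction A.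
have [mu1 _] := mu_gt i ik.
have mu1' : 1 < Normc.normc (mu i) by move: mu1; rewrite normc_norm ltcR.
have mu0 : mu i != 0 by apply: contraTneq mu1' => ->; rewrite Normc.normc0 -leNgt ler01.
have k1 : Normc.normc (mu i)^-1 < 1 by rewrite Normc.normcV invf_lt1 // (lt_trans ltr01).
have fixS m : ~ (~` Sig) m -> Sig m by move=> h; apply: contrapT.
have fA m : ~ (~` Sig) m -> ~ (~` Sig) (A m) by move=> /fixS s; rewrite (pA_fix A s) => /(_ s).
have fA' m : ~ (~` Sig) m -> ~ (~` Sig) (pA_inv A m).
  by move=> /fixS s; rewrite -{1}(pA_fix A s) pA_invK => /(_ s).
split.
  apply: (@basic_off_sing _ _ (pA_structure A) Sig (pA_inv A) A true c) => //.
  - exact: pA_structure_sing.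
  - exact: (sdiffeo_sym D).
  (* Here f is the inverse of [As]. Applying it to As v_j = mu v_j + v_(j-1) gives f v_j = mu^-1 v_j
     - mu^-1 f v_(j-1), whence the multiple - mu^-1 of an image. *)
  move=> t Ht; apply: (@jordan_chain_zero _ _ _ _ Hal _ _ Ht _ (J i) (Cp i) (mu i)^-1 (- (mu i)^-1) true k1) => // j' jj'.
  have := jp i j' ik jj' => /(congr1 (As^-1)%VF); rewrite lker0_lfunK ?kerAs // linearD linearZ /=.
  case: (j' == 1%N) => e.
    by rewrite {2}e linear0 !addr0 scalerA mulVf // scale1r.
  by rewrite {2}e scalerDr scalerA mulVf // scale1r scaleNr addrK.
apply: (@basic_off_sing _ _ (pA_structure A) Sig A (pA_inv A) false c) => //.
- exact: pA_structure_sing.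
(* On the contracting side f is [As] itself, and the given basis is a genuine Jordan chain with
   eigenvalue mu^-1. *)
move=> t Ht; apply: (@jordan_chain_zero _ _ _ _ Hal _ _ Ht _ (J i) (Cm i) (mu i)^-1 1 false k1) => // j' jj'.
by rewrite (jm i j' ik jj') scale1r.
Qed.
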